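(* Let $\Delta\subset\mathbb{C}$ be the open unit disc, $\Delta^*=\Delta\setminus\{0\}$, and let $\tilde\Delta^*$ be the universal covering of $\Delta^*$. (1) If $E$ is a smooth Bryant end, parametrized on $\Delta^*$ with the end at $0$, then the corresponding holomorphic null immersion $F\colon\tilde\Delta^*\to \mathrm{SL}(2,\mathbb{C})$ (its Bryant representation) is well defined on $\Delta^*$, has a pole at zero, and $F'F^{-1}$ has a pole of order $2$ at zero. (2) Conversely, if $F\colon\Delta^*\to \mathrm{SL}(2,\mathbb{C})$ is a holomorphic null immersion with a pole at zero such that $F'F^{-1}$ has a pole of order $2$ at zero, then the Bryant surface corresponding to $F$ is a smooth Bryant end.
   Context: Let $\mathbf{B}^3=\{x\in\mathbb{R}^3: |x|<1\}$ with the metric $\frac{4|dx|^2}{(1-|x|^2)^2}$ (Poincaré ball model of hyperbolic space). A Bryant surface is a conformal immersion $f\colon M\to\mathbf{B}^3$ of a Riemann surface $M$ with constant mean curvature $1$ (with respect to the unit normal determined by the orientation of $M$, with conventions such that the following representation holds). A holomorphic map $F$ into $\mathrm{SL}(2,\mathbb{C})$ is null if $\det F'=0$ (derivative with respect to a local holomorphic coordinate). Bryant representation: a conformal immersion $f\colon M\to \mathbf{B}^3$ is a Bryant surface if and only if there is a holomorphic null immersion $F\colon\tilde M\to \mathrm{SL}(2,\mathbb{C})$ on the universal covering $\tilde M$ of $M$ such that $$f=\frac{(x_1,x_2,x_3)}{x_0+1},\qquad \begin{pmatrix}x_0+x_3&x_1+x_2 i\\ x_1-x_2 i&x_0-x_3\end{pmatrix}=F\bar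 F^{t}.$$ $F$ is unique up to right multiplication by a constant matrix in $\mathrm{SU}(2)$; $f$ is called the Bryant surface corresponding to $F$. A smooth Bryant end is a Bryant surface $E\subset\mathbf{B}^3$ for which there is a point $p_\infty\in\partial\mathbf{B}^3$ such that $E\cup\{p_\infty\}$ is a conformally immersed open disc in $\mathbb{R}^3$; that is, there is a (smooth) conformal immersion $f\colon\Delta\to\mathbb{R}^3$ with $f(0)=p_\infty$ such that $f|_{\Delta^*}$ takes values in $\mathbf{B}^3$ and parametrizes $E$. The pole order of a matrix valued meromorphic function is the maximum of the pole orders of its entries. *)

(* Defs.v *)
(* Stdlib real numbers with Coquelicot; [C] is Coquelicot's [R * R]. *)
From Stdlib Require Import Reals Lia Lra.
From Coquelicot Require Import Coquelicot.
Open Scope R_scope.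

Definition disc (z : C) : Prop := Cmod z < 1.
Definition punctured_disc (z : C) : Prop := 0 < Cmod z < 1.

(* The universal covering of the punctured disc is modelled by the covering
   map [Cexp : left_half_plane -> punctured_disc]. *)
Definition left_half_plane (w : C) : Prop := Re w < 0.
Definition Cexp (w : C) : C := (exp (Re w) * cos (Im w), exp (Re w) * sin (Im w)).

(* Only used for open [U]. *)
Definition holomorphic_on (U : C -> Prop) (g : C -> C) : Prop :=
  forall z, U z -> @ex_derive C_AbsRing C_NormedModule g z.

Definition M2C : Type := @matrix C 2 2.

Definition entry (A : M2C) (i j : nat) : C := coeff_mat (RtoC 0) A i j.

Definition mat2 (a b c d : C) : M2C :=
  mk_matrix 2 2 (fun i j => match i, j with
                            | O, O => a | O, _ => b | _, O => c | _, _ => d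
                            end).

Definition det2 (A : M2C) : C :=
  (entry A 0 0 * entry A 1 1 - entry A 0 1 * entry A 1 0)%C.

Definition inv2 (A : M2C) : M2C :=
  mat2 (entry A 1 1 / det2 A) (- entry A 0 1 / det2 A)
       (- entry A 1 0 / det2 A) (entry A 0 0 / det2 A).

Definition conj_transpose (A : M2C) : M2C :=
  mk_matrix 2 2 (fun i j => Cconj (entry A j i)).

Definition mul2 (A B : M2C) : M2C := @Mmult C_Ring 2 2 2 A B.

(* [C_derive] is total: it is the complex derivative only where the entries
   are holomorphic. *)
Definition mderive (F : C -> M2C) (z : C) : M2C :=
  mk_matrix 2 2 (fun i j => C_derive (fun w => entry (F w) i j) z).

Definition mholomorphic_on (U : C -> Prop) (F : C -> M2C) : Prop :=
  forall i j, (i < 2)%nat -> (j < 2)%nat ->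
  holomorphic_on U (fun z => entry (F z) i j).

Definition holomorphic_null_immersion_SL2 (U : C -> Prop) (F : C -> M2C) : Prop :=
  mholomorphic_on U F /\
  forall z, U z ->
    det2 (F z) = 1 /\
    det2 (mderive F z) = 0 /\
    mderive F z <> mat2 0 0 0 0.

(* The isolated singularity of [g] at [0] is a pole of order [n]; order [0]
   means that the singularity is removable. *)
Definition pole_order_at_0 (g : C -> C) (n : nat) : Prop :=
  exists (r : R) (h : C -> C),
    0 < r /\
    holomorphic_on (fun z => Cmod z < r) h /\
    (forall z : C, 0 < Cmod z < r -> g z = (h z / z ^ n)%C) /\
    ((0 < n)%nat -> h 0 <> 0).

Definition mpole_order_at_0 (F : C -> M2C) (n : nat) : Prop :=
  exists m : nat -> nat -> nat,
    (forall i j, (i < 2)%nat -> (j < 2)%nat ->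
       pole_order_at_0 (fun z => entry (F z) i j) (m i j)) /\
    (n = Nat.max (Nat.max (m 0 0) (m 0 1)) (Nat.max (m 1 0) (m 1 1)))%nat.

Definition has_pole_at_0 (F : C -> M2C) : Prop :=
  exists n, (0 < n)%nat /\ mpole_order_at_0 F n.

Definition R3 : Type := (R * R * R)%type.

Definition c1 (p : R3) : R := fst (fst p).
Definition c2 (p : R3) : R := snd (fst p).
Definition c3 (p : R3) : R := snd p.

Definition lincomb (a : R) (u : R3) (b : R) (v : R3) : R3 :=
  (a * c1 u + b * c1 v, a * c2 u + b * c2 v, a * c3 u + b * c3 v).

Definition dot (u v : R3) : R := c1 u * c1 v + c2 u * c2 v + c3 u * c3 v.

Definition cross (u v : R3) : R3 :=
  (c2 u * c3 v - c3 u * c2 v,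
   c3 u * c1 v - c1 u * c3 v,
   c1 u * c2 v - c2 u * c1 v).

Definition smooth_on (U : C -> Prop) (f : C -> R3) : Prop :=
  forall (z : C) (n : nat), U z ->
    ex_diff_n (fun x y => c1 (f (x, y))) n (Re z) (Im z) /\
    ex_diff_n (fun x y => c2 (f (x, y))) n (Re z) (Im z) /\
    ex_diff_n (fun x y => c3 (f (x, y))) n (Re z) (Im z).

Definition dx (f : C -> R3) (z : C) : R3 :=
  (Derive (fun t => c1 (f (t, Im z))) (Re z),
   Derive (fun t => c2 (f (t, Im z))) (Re z),
   Derive (fun t => c3 (f (t, Im z))) (Re z)).
Definition dy (f : C -> R3) (z : C) : R3 :=
  (Derive (fun t => c1 (f (Re z, t))) (Im z),
   Derive (fun t => c2 (f (Re z, t))) (Im z),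
   Derive (fun t => c3 (f (Re z, t))) (Im z)).

(* [g p u v] is the inner product of the tangent vectors [u] and [v] at [p]. *)
Definition metric : Type := R3 -> R3 -> R3 -> R.

Definition euclidean : metric := fun _ u v => dot u v.
Definition hyperbolic : metric :=
  fun p u v => 4 / (1 - dot p p) ^ 2 * dot u v.

Definition conformal_immersion (g : metric) (U : C -> Prop) (f : C -> R3) : Prop :=
  smooth_on U f /\
  forall z, U z ->
    (forall a b, lincomb a (dx f z) b (dy f z) = (0, 0, 0) -> a = 0 /\ b = 0) /\
    g (f z) (dx f z) (dx f z) = g (f z) (dy f z) (dy f z) /\
    g (f z) (dx f z) (dy f z) = 0.

(* For constant vector fields the Koszul formula gives the inner product of
   the Levi-Civita covariant derivative of [v] along [u] with [w]. *)
Definition metric_derive (g : metric) (p u v w : R3) : R :=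
  Derive (fun t => g (lincomb 1 p t u) v w) 0.
Definition koszul (g : metric) (p u v w : R3) : R :=
  (metric_derive g p u v w + metric_derive g p v u w - metric_derive g p w u v) / 2.

(* The hyperbolic metric is pointwise a multiple of the Euclidean one, so the
   cross product of [dx f] and [dy f] is normal for it as well; the order of the
   factors is the orientation of the surface. *)
Definition hyp_normal (f : C -> R3) (z : C) : R3 :=
  let n := cross (dx f z) (dy f z) in
  lincomb (/ sqrt (hyperbolic (f z) n n)) n 0 n.

(* [f_uv] is the Euclidean second derivative of [f] in the coordinate directions
   whose first derivatives are [f_u] and [f_v]; the sum is the inner product of
   the covariant derivative with the unit normal. *)
Definition hyp_second_form (f : C -> R3) (z : C) (f_uv f_u f_v : R3) : R :=
  hyperbolic (f z) f_uv (hyp_normal f z)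
  + koszul hyperbolic (f z) f_u f_v (hyp_normal f z).

(* Half the trace of the second with respect to the first fundamental form;
   horospheres have mean curvature 1 for the normal pointing into the horoball. *)
Definition hyp_mean_curvature (f : C -> R3) (z : C) : R :=
  let E := hyperbolic (f z) (dx f z) (dx f z) in
  let F := hyperbolic (f z) (dx f z) (dy f z) in
  let G := hyperbolic (f z) (dy f z) (dy f z) in
  let L := hyp_second_form f z (dx (dx f) z) (dx f z) (dx f z) in
  let M := hyp_second_form f z (dx (dy f) z) (dx f z) (dy f z) in
  let N := hyp_second_form f z (dy (dy f) z) (dy f z) (dy f z) in
  (E * N - 2 * F * M + G * L) / (2 * (E * G - F ^ 2)).

Definition bryant_surface (U : C -> Prop) (f : C -> R3) : Prop :=
  (forall z, U z -> dot (f z) (f z) < 1) /\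
  conformal_immersion hyperbolic U f /\
  (forall z, U z -> hyp_mean_curvature f z = 1).

(* The surface is parametrized on the punctured disc with the end at [0], so the
   immersed disc [fbar] is an extension of the same parametrization. *)
Definition smooth_bryant_end (f : C -> R3) : Prop :=
  bryant_surface punctured_disc f /\
  exists (p : R3) (fbar : C -> R3),
    dot p p = 1 /\
    conformal_immersion euclidean disc fbar /\
    fbar 0 = p /\
    (forall z, punctured_disc z -> fbar z = f z).

Definition hermitian_matrix (x0 x1 x2 x3 : R) : M2C :=
  mat2 (x0 + x3, 0) (x1, x2) (x1, - x2) (x0 - x3, 0).

(* The coordinates [x0, x1, x2, x3] of a Hermitian matrix; see
   [hermitian_coords]. *)
Definition hx0 (X : M2C) : R := (Re (entry X 0 0) + Re (entry X 1 1)) / 2.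
Definition hx1 (X : M2C) : R := Re (entry X 0 1).
Definition hx2 (X : M2C) : R := Im (entry X 0 1).
Definition hx3 (X : M2C) : R := (Re (entry X 0 0) - Re (entry X 1 1)) / 2.

Definition bryant_point (A : M2C) : R3 :=
  let X := mul2 A (conj_transpose A) in
  (hx1 X / (hx0 X + 1), hx2 X / (hx0 X + 1), hx3 X / (hx0 X + 1)).

Lemma hermitian_coords (A : M2C) :
  let X := mul2 A (conj_transpose A) in
  X = hermitian_matrix (hx0 X) (hx1 X) (hx2 X) (hx3 X).
Proof.
destruct A as [[[a1 a2] [[b1 b2] []]] [[[d1 d2] [[e1 e2] []]] []]].
cbv zeta; unfold hx0, hx1, hx2, hx3, mul2, Mmult; simpl pred.
unfold hermitian_matrix, mat2; apply mk_matrix_ext; intros i j Hi Hj.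
destruct i as [|[|i]]; [| |exfalso; lia];
  (destruct j as [|[|j]]; [| |exfalso; lia]);
  rewrite sum_Sn, sum_O; apply injective_projections; cbn; field.
Qed.

(* Main.v *)
Require Import Defs.
From Stdlib Require Import ZArith Reals Lra Lia Classical ClassicalEpsilon FunctionalExtensionality.
From Coquelicot Require Import Coquelicot.
Import Defs.
Open Scope R_scope.

(** Write [^H] for the conjugate transpose and [rho = 1 - |f|^2]. For the surface of [F] one has
    [rho = 2 / (x_0 + 1)] and [2 x_0 = |F|^2], the squared norm of the matrix, so the distance to
    the boundary sphere and the growth of [F] determine each other. Both directions rest on this
    and on one pointwise identity. Since [F] is null, [A = F' F^{-1}] is traceless and nilpotent,
    hence [A = e w v] with a column [w] and the row [v] that annihilates it; expressing the
    derivatives of [f] by [e] and [w] gives conformality, mean curvature one and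
    [|f_x|^2 |A|^2 (x_0 + 1)^2 = |F'|^4] ([point_null], [null_surface]).

    From a pole to a smooth end. If [F = H / z^n] with [H] holomorphic and [H(0) <> 0], numerator
    and denominator of [f], multiplied by [|z|^(2 n)], are smooth across the puncture and the
    denominator [|H|^2 / 2 + |z|^(2 n)] does not vanish ([near_puncture]). The identity above,
    cleared of its poles ([pole_metric_identity]), tends at the puncture to
    [|f_x|^2 |A_0|^2 |H(0)|^4 / 4 = n^4 |H(0)|^4], where [A_0] is the coefficient of [z^{-2}] in
    [A]; so the extension is immersed when the pole of [A] has order two ([pole_smooth_end]).

    From a smooth end to a pole. Let [f] now denote the smooth extension; [rho] is smooth,
    positive on the punctured disc and zero at the puncture. Mean curvature one becomes
    [rho Delta rho - |grad rho|^2 = - rho^2 |Delta f|^2 / (4 |f_x|^2)] ([sq_dist_pde]): the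
    Laplacian of [ln rho] is bounded. Therefore the circle means of [ln rho] decrease at most
    linearly as the logarithm of the radius tends to minus infinity, and [rho] does not vanish to
    infinite order ([not_flat]); its leading homogeneous part [q] solves [q Delta q = |grad q|^2],
    so [ln q] is affine in the angle on the unit circle, hence constant, and [rho] behaves like
    [c |z|^(2 n)] ([leading_power]).

    On the half plane, [F(w + 2 pi i) = F(w) U] with [U] unitary of determinant one. The entries of
    [U] are holomorphic, and so are their conjugates, which are entries of [U] up to sign: [U] is
    constant. The norm of [H = e^{n w} F] converges as [Re w] tends to minus infinity; comparing
    its mean square over circles with its value at the centre shows that [H'] tends to [0], hence
    also [H(w + 2 pi i) - H(w) = H (U - I)]. As [|H (U - I)|^2 = (2 - tr U) |H|^2] with [|H|]
    bounded below, [U = I] ([monodromy_trivial]). Thus [F] descends to a map [G] of the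
    punctured disc ([descended_null]); [z^n G] is bounded with nonzero limit, which is the pole
    ([end_pole_factor]), and the metric identity, read for [A] in terms of the nonzero [f_x(0)],
    shows that [z^2 G' G^{-1}] extends with a nonzero value ([end_log_derivative_order]).

    The complex analysis that this needs - Goursat's theorem, Cauchy's formula, removable
    singularities, the mean square inequality - is developed first, followed by the calculus of
    smooth functions of two real variables. *)

Lemma function_choice {A B : Type} {R : A -> B -> Prop} :
  (forall x, exists y, R x y) -> exists g : A -> B, forall x, R x (g x).
Proof.
  intros H; exists (fun x => proj1_sig (constructive_indefinite_description _ (H x))).
  intros x; exact (proj2_sig (constructive_indefinite_description _ (H x))).
Qed.

(** * Continuity and differentiability of complex functions *)

Lemma Cmod_le_abs (z : C) : Cmod z <= Rabs (Re z) + Rabs (Im z).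
Proof.
  assert (H1 := Rabs_pos (Re z)); assert (H2 := Rabs_pos (Im z)).
  unfold Cmod; rewrite <- (sqrt_Rsqr (Rabs (Re z) + Rabs (Im z))) by lra.
  apply sqrt_le_1_alt; unfold Rsqr.
  rewrite <- (pow2_abs (fst z)), <- (pow2_abs (snd z)); unfold Re, Im in *; nra.
Qed.

Lemma im_le_Cmod (z : C) : Rabs (Im z) <= Cmod z.
Proof. apply Rle_trans with (2 := Rmax_Cmod z), Rmax_r. Qed.

Lemma Cmod_sqr (z : C) : Cmod z ^ 2 = Re z ^ 2 + Im z ^ 2.
Proof. unfold Cmod, Re, Im; rewrite pow2_sqrt; [reflexivity|nra]. Qed.

Section Continuity.
Context {T : UniformSpace}.

Lemma continuous_pairC (f g : T -> R) (t : T) :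
  continuous f t -> continuous g t ->
  @continuous T C_UniformSpace (fun s => (f s, g s) : C) t.
Proof.
  intros Hf Hg; apply filterlim_locally; intros eps.
  generalize (proj1 (filterlim_locally _ _) Hf eps)
    (proj1 (filterlim_locally _ _) Hg eps).
  intros A B; generalize (filter_and _ _ A B); apply filter_imp.
  intros s [H1 H2]; split; assumption.
Qed.

Lemma continuous_Re (f : T -> C) (t : T) :
  @continuous T C_UniformSpace f t -> continuous (fun s => Re (f s)) t.
Proof. intros H; exact (continuous_comp f fst t H (continuous_fst _ _)). Qed.

Lemma continuous_Im (f : T -> C) (t : T) :
  @continuous T C_UniformSpace f t -> continuous (fun s => Im (f s)) t.
Proof. intros H; exact (continuous_comp f snd t H (continuous_snd _ _)). Qed.

Lemma continuous_Cconst (c : C) (t : T) :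
  @continuous T C_UniformSpace (fun _ => c) t.
Proof. apply continuous_const. Qed.

Lemma continuous_Cplus (f g : T -> C) (t : T) :
  @continuous T C_UniformSpace f t -> @continuous T C_UniformSpace g t ->
  @continuous T C_UniformSpace (fun s => (f s + g s)%C) t.
Proof.
  intros Hf Hg; apply continuous_pairC.
  - exact (continuous_plus _ _ t (continuous_Re f t Hf) (continuous_Re g t Hg)).
  - exact (continuous_plus _ _ t (continuous_Im f t Hf) (continuous_Im g t Hg)).
Qed.

Lemma continuous_Copp (f : T -> C) (t : T) :
  @continuous T C_UniformSpace f t ->
  @continuous T C_UniformSpace (fun s => (- f s)%C) t.
Proof.
  intros Hf; apply continuous_pairC.
  - exact (continuous_opp _ t (continuous_Re f t Hf)).
  - exact (continuous_opp _ t (continuous_Im f t Hf)).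
Qed.

Lemma continuous_Cminus (f g : T -> C) (t : T) :
  @continuous T C_UniformSpace f t -> @continuous T C_UniformSpace g t ->
  @continuous T C_UniformSpace (fun s => (f s - g s)%C) t.
Proof. intros Hf Hg; apply continuous_Cplus; [|apply continuous_Copp]; assumption. Qed.

Lemma continuous_Rmult (f g : T -> R) (t : T) :
  continuous f t -> continuous g t -> continuous (fun s => f s * g s) t.
Proof. exact (continuous_mult (K := R_AbsRing) f g t). Qed.

Lemma continuous_Rplus (f g : T -> R) (t : T) :
  continuous f t -> continuous g t -> continuous (fun s => f s + g s) t.
Proof. exact (continuous_plus (K := R_AbsRing) (V := R_NormedModule) f g t). Qed.

Lemma continuous_Rminus (f g : T -> R) (t : T) :
  continuous f t -> continuous g t -> continuous (fun s => f s - g s) t.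
Proof. exact (continuous_minus (K := R_AbsRing) (V := R_NormedModule) f g t). Qed.

Lemma continuous_Rinv (f : T -> R) (t : T) :
  continuous f t -> f t <> 0 -> continuous (fun s => / f s) t.
Proof.
  intros Hf Hn; apply (continuous_comp f Rinv); [assumption|].
  apply continuous_Rinv_comp; [apply continuous_id|assumption].
Qed.

Lemma continuous_Cmult (f g : T -> C) (t : T) :
  @continuous T C_UniformSpace f t -> @continuous T C_UniformSpace g t ->
  @continuous T C_UniformSpace (fun s => (f s * g s)%C) t.
Proof.
  intros Hf Hg.
  generalize (continuous_Re f t Hf) (continuous_Re g t Hg)
    (continuous_Im f t Hf) (continuous_Im g t Hg); intros.
  apply continuous_pairC.
  - apply continuous_Rminus; apply continuous_Rmult; assumption.
  - apply continuous_Rplus; apply continuous_Rmult; assumption.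
Qed.

Lemma continuous_Cinv (f : T -> C) (t : T) :
  @continuous T C_UniformSpace f t -> f t <> 0%C ->
  @continuous T C_UniformSpace (fun s => (/ f s)%C) t.
Proof.
  intros Hf Hn.
  generalize (continuous_Re f t Hf) (continuous_Im f t Hf); intros H1 H2.
  assert (Hd : continuous (fun s => / (Re (f s) ^ 2 + Im (f s) ^ 2)) t).
  { apply continuous_Rinv.
    - apply continuous_Rplus;
        (apply continuous_Rmult; [assumption|]);
        (apply continuous_Rmult; [assumption|apply continuous_const]).
    - rewrite <- Cmod_sqr; apply pow_nonzero; intros E; apply Hn, Cmod_eq_0, E. }
  apply continuous_pairC; apply continuous_Rmult; try assumption.
  exact (continuous_opp _ t H2).
Qed.

Lemma continuous_RtoC (f : T -> R) (t : T) :
  continuous f t -> @continuous T C_UniformSpace (fun s => RtoC (f s)) t.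
Proof. intros H; apply continuous_pairC; [exact H|apply continuous_const]. Qed.

Lemma continuous_Cpow (f : T -> C) (n : nat) (t : T) :
  @continuous T C_UniformSpace f t ->
  @continuous T C_UniformSpace (fun s => (f s ^ n)%C) t.
Proof.
  intros H; induction n as [|n IH]; simpl; [apply continuous_Cconst|].
  now apply continuous_Cmult.
Qed.

End Continuity.

Definition ccont (f : C -> C) (z : C) : Prop :=
  @continuous C_UniformSpace C_UniformSpace f z.

Lemma locally_C (z : C) (P : C -> Prop) :
  @locally C_UniformSpace z P <->
  exists d, 0 < d /\ forall w, Cmod (w - z) < d -> P w.
Proof.
  split.
  - intros [eps He]; exists eps; split; [apply cond_pos|].
    intros w Hw; apply He.
    assert (A := Rmax_Cmod (w - z)%C).
    assert (B1 := Rmax_l (Rabs (fst (w - z)%C)) (Rabs (snd (w - z)%C))).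
    assert (B2 := Rmax_r (Rabs (fst (w - z)%C)) (Rabs (snd (w - z)%C))).
    split; apply Rle_lt_trans with (2 := Hw).
    + apply Rle_trans with (2 := A), B1.
    + apply Rle_trans with (2 := A), B2.
  - intros (d & Hd & H).
    assert (Hd2 : 0 < d / 2) by lra.
    exists (mkposreal _ Hd2); intros w [H1 H2]; apply H.
    apply Rle_lt_trans with (1 := Cmod_le_abs _).
    unfold ball in H1, H2; simpl in H1, H2; unfold AbsRing_ball, abs, minus in H1, H2;
      simpl in H1, H2; unfold plus, opp in H1, H2; simpl in H1, H2.
    change (Rabs (Re (w - z)) < d / 2) in H1; change (Rabs (Im (w - z)) < d / 2) in H2.
    lra.
Qed.

Lemma ccont_eps (f : C -> C) (z : C) :
  ccont f z <-> forall eps, 0 < eps -> exists d, 0 < d /\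
    forall w, Cmod (w - z) < d -> Cmod (f w - f z) < eps.
Proof.
  split.
  - intros H eps He.
    assert (L : @locally C_UniformSpace (f z) (fun y => Cmod (y - f z) < eps)).
    { apply locally_C; exists eps; split; [exact He|auto]. }
    exact (proj1 (locally_C _ _) (H _ L)).
  - intros H P HP; apply locally_C in HP; destruct HP as (e & He & HP).
    destruct (H e He) as (d & Hd & Hw).
    apply locally_C; exists d; split; [exact Hd|]; intros w Hd'; apply HP, Hw, Hd'.
Qed.

Definition cderiv (f : C -> C) (z l : C) : Prop :=
  forall eps, 0 < eps -> exists d, 0 < d /\
    forall w, Cmod (w - z) < d ->
      Cmod (f w - f z - l * (w - z)) <= eps * Cmod (w - z).

Lemma cderiv_is_derive (f : C -> C) (z l : C) :
  cderiv f z l <-> @is_derive C_AbsRing C_NormedModule f z l.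
Proof.
  split.
  - intros H; split; [exact (is_linear_scal_l (K := C_AbsRing) (V := C_NormedModule) l)|].
    intros x Hx.
    assert (E := is_filter_lim_locally_unique (K := C_AbsRing) (V := AbsRing_NormedModule C_AbsRing) z x Hx); subst x.
    intros eps; destruct (H eps (cond_pos eps)) as (d & Hd & Hw).
    exists (mkposreal d Hd); intros y Hy.
    change (Cmod (f y - f z - (y - z) * l) <= eps * Cmod (y - z)).
    rewrite (Cmult_comm (y - z)); apply Hw, Hy.
  - intros [_ H] eps He.
    destruct (H z (fun P HP => HP) (mkposreal eps He)) as [d Hd].
    exists d; split; [apply cond_pos|]; intros w Hw.
    specialize (Hd w Hw).
    change (Cmod (f w - f z - (w - z) * l) <= eps * Cmod (w - z)) in Hd.
    now rewrite (Cmult_comm (w - z)) in Hd.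
Qed.

Lemma cderiv_unique (f : C -> C) (z l : C) : cderiv f z l -> C_derive f z = l.
Proof. intros H; apply is_C_derive_unique, cderiv_is_derive, H. Qed.

Lemma holomorphic_cderiv (U : C -> Prop) (f : C -> C) :
  holomorphic_on U f <-> forall z, U z -> cderiv f z (C_derive f z).
Proof.
  split.
  - intros H z Hz; apply cderiv_is_derive, C_derive_correct; [exact z|exact (H z Hz)].
  - intros H z Hz; exists (C_derive f z); apply cderiv_is_derive, H, Hz.
Qed.

Lemma holomorphic_intro (U : C -> Prop) (f f' : C -> C) :
  (forall z, U z -> cderiv f z (f' z)) -> holomorphic_on U f.
Proof. intros H z Hz; exists (f' z); apply cderiv_is_derive, H, Hz. Qed.

Lemma cderiv_ccont (f : C -> C) (z l : C) : cderiv f z l -> ccont f z.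
Proof.
  intros H; apply ccont_eps; intros eps He.
  destruct (H 1 Rlt_0_1) as (d & Hd & Hw).
  assert (Hl := Cmod_ge_0 l).
  assert (Hp : 0 < eps / (1 + Cmod l)) by (apply Rdiv_lt_0_compat; lra).
  exists (Rmin d (eps / (1 + Cmod l))); split; [apply Rmin_pos; assumption|].
  intros w Hw'.
  assert (H1 : Cmod (w - z) < d) by (apply Rlt_le_trans with (1 := Hw'), Rmin_l).
  assert (H2 : Cmod (w - z) < eps / (1 + Cmod l)) by (apply Rlt_le_trans with (1 := Hw'), Rmin_r).
  specialize (Hw w H1).
  replace (f w - f z)%C with ((f w - f z - l * (w - z)) + l * (w - z))%C by ring.
  apply Rle_lt_trans with (1 := Cmod_triangle _ _); rewrite Cmod_mult.
  apply Rmult_lt_compat_l with (r := 1 + Cmod l) in H2; [|lra].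
  replace ((1 + Cmod l) * (eps / (1 + Cmod l))) with eps in H2 by (field; lra).
  lra.
Qed.

Lemma cderiv_ext_loc (f g : C -> C) (z l : C) :
  (exists d, 0 < d /\ forall w, Cmod (w - z) < d -> f w = g w) ->
  cderiv f z l -> cderiv g z l.
Proof.
  intros (d & Hd & E) H eps He; destruct (H eps He) as (d' & Hd' & Hw).
  exists (Rmin d d'); split; [apply Rmin_pos; assumption|]; intros w Hm.
  rewrite <- !E.
  - apply Hw, Rlt_le_trans with (1 := Hm), Rmin_r.
  - replace (z - z)%C with (RtoC 0) by ring; now rewrite Cmod_0.
  - apply Rlt_le_trans with (1 := Hm), Rmin_l.
Qed.

Lemma cderiv_const (c z : C) : cderiv (fun _ => c) z 0%C.
Proof.
  intros eps He; exists 1; split; [lra|]; intros w _.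
  replace (c - c - 0 * (w - z))%C with (RtoC 0) by ring; rewrite Cmod_0.
  apply Rmult_le_pos; [lra|apply Cmod_ge_0].
Qed.

Lemma cderiv_id (z : C) : cderiv (fun w => w) z 1%C.
Proof.
  intros eps He; exists 1; split; [lra|]; intros w _.
  replace (w - z - 1 * (w - z))%C with (RtoC 0) by ring; rewrite Cmod_0.
  apply Rmult_le_pos; [lra|apply Cmod_ge_0].
Qed.

Lemma cderiv_plus (f g : C -> C) (z l m : C) :
  cderiv f z l -> cderiv g z m -> cderiv (fun w => f w + g w)%C z (l + m)%C.
Proof.
  intros Hf Hg eps He.
  destruct (Hf (eps / 2)) as (d & Hd & Hw); [lra|].
  destruct (Hg (eps / 2)) as (d' & Hd' & Hw'); [lra|].
  exists (Rmin d d'); split; [apply Rmin_pos; assumption|]; intros w Hm.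
  specialize (Hw w (Rlt_le_trans _ _ _ Hm (Rmin_l _ _))).
  specialize (Hw' w (Rlt_le_trans _ _ _ Hm (Rmin_r _ _))).
  replace (f w + g w - (f z + g z) - (l + m) * (w - z))%C
    with ((f w - f z - l * (w - z)) + (g w - g z - m * (w - z)))%C by ring.
  apply Rle_trans with (1 := Cmod_triangle _ _); lra.
Qed.

Lemma cderiv_comp (f g : C -> C) (z l m : C) :
  cderiv f (g z) l -> cderiv g z m -> cderiv (fun w => f (g w)) z (l * m)%C.
Proof.
  intros Hf Hg eps He.
  assert (Hl := Cmod_ge_0 l); assert (Hm := Cmod_ge_0 m).
  set (e2 := Rmin 1 (eps / (2 * (1 + Cmod l)))).
  assert (He2 : 0 < e2).
  { apply Rmin_pos; [lra|apply Rdiv_lt_0_compat; lra]. }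
  assert (He2' : e2 * Cmod l <= eps / 2).
  { assert (e2 <= eps / (2 * (1 + Cmod l))) by apply Rmin_r.
    apply Rle_trans with (eps / (2 * (1 + Cmod l)) * (1 + Cmod l)).
    - apply Rmult_le_compat; lra.
    - apply Req_le; field; lra. }
  assert (He21 : e2 <= 1) by apply Rmin_l.
  set (e1 := eps / (2 * (1 + Cmod m))).
  assert (He1 : 0 < e1) by (apply Rdiv_lt_0_compat; lra).
  assert (He1' : e1 * (1 + Cmod m) = eps / 2) by (unfold e1; field; lra).
  destruct (Hf e1 He1) as (d1 & Hd1 & H1).
  destruct (proj1 (ccont_eps _ _) (cderiv_ccont _ _ _ Hg) d1 Hd1) as (d2 & Hd2 & H2).
  destruct (Hg e2 He2) as (d3 & Hd3 & H3).
  exists (Rmin d2 d3); split; [apply Rmin_pos; assumption|]; intros w Hw.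
  specialize (H2 w (Rlt_le_trans _ _ _ Hw (Rmin_l _ _))).
  specialize (H3 w (Rlt_le_trans _ _ _ Hw (Rmin_r _ _))).
  specialize (H1 _ H2).
  assert (Hgw : Cmod (g w - g z) <= (1 + Cmod m) * Cmod (w - z)).
  { replace (g w - g z)%C with ((g w - g z - m * (w - z)) + m * (w - z))%C by ring.
    apply Rle_trans with (1 := Cmod_triangle _ _); rewrite Cmod_mult.
    assert (Hp := Cmod_ge_0 (w - z)); nra. }
  replace (f (g w) - f (g z) - l * m * (w - z))%C with
    ((f (g w) - f (g z) - l * (g w - g z)) + l * (g w - g z - m * (w - z)))%C by ring.
  apply Rle_trans with (1 := Cmod_triangle _ _); rewrite Cmod_mult.
  assert (Hp := Cmod_ge_0 (w - z)).
  apply Rle_trans with (e1 * ((1 + Cmod m) * Cmod (w - z)) + Cmod l * (e2 * Cmod (w - z))).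
  - apply Rplus_le_compat.
    + apply Rle_trans with (1 := H1); apply Rmult_le_compat_l; lra.
    + apply Rmult_le_compat_l; lra.
  - nra.
Qed.

Lemma cderiv_sqr (z : C) : cderiv (fun w => w * w)%C z (2 * z)%C.
Proof.
  intros eps He; exists eps; split; [exact He|]; intros w Hw.
  replace (w * w - z * z - 2 * z * (w - z))%C with ((w - z) * (w - z))%C by ring.
  rewrite Cmod_mult; assert (Hp := Cmod_ge_0 (w - z)); nra.
Qed.

Lemma cderiv_scal (c : C) (f : C -> C) (z l : C) :
  cderiv f z l -> cderiv (fun w => c * f w)%C z (c * l)%C.
Proof.
  intros H; apply (cderiv_comp (fun w => c * w)%C f z c l); [|exact H].
  intros eps He; exists 1; split; [lra|]; intros w _.
  replace (c * w - c * f z - c * (w - f z))%C with (RtoC 0) by ring; rewrite Cmod_0.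
  apply Rmult_le_pos; [lra|apply Cmod_ge_0].
Qed.

Lemma cderiv_eq (f : C -> C) (z l m : C) : l = m -> cderiv f z l -> cderiv f z m.
Proof. now intros ->. Qed.

(** The product rule follows from the chain rule for squares by polarization. *)
Lemma cderiv_mult (f g : C -> C) (z l m : C) :
  cderiv f z l -> cderiv g z m ->
  cderiv (fun w => f w * g w)%C z (l * g z + f z * m)%C.
Proof.
  intros Hf Hg.
  assert (Hs := cderiv_comp _ _ z _ _ (cderiv_sqr _) (cderiv_plus _ _ z _ _ Hf Hg)).
  assert (Hd := cderiv_comp _ _ z _ _ (cderiv_sqr _)
    (cderiv_plus _ _ z _ _ Hf (cderiv_scal (Copp 1) _ z _ Hg))).
  assert (H := cderiv_scal (/ 4)%C _ z _
    (cderiv_plus _ _ z _ _ Hs (cderiv_scal (Copp 1) _ z _ Hd))).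
  assert (N4 : (4 : C) <> 0%C).
  { intros E; apply RtoC_inj in E; lra. }
  eapply cderiv_ext_loc; [|eapply cderiv_eq; [|exact H]].
  - exists 1; split; [lra|]; intros w _; simpl.
    field; exact N4.
  - simpl; field; exact N4.
Qed.

Lemma cderiv_opp (f : C -> C) (z l : C) :
  cderiv f z l -> cderiv (fun w => - f w)%C z (- l)%C.
Proof.
  intros H; eapply cderiv_ext_loc; [|eapply cderiv_eq; [|exact (cderiv_scal (Copp 1) _ _ _ H)]].
  - exists 1; split; [lra|]; intros; simpl; ring.
  - simpl; ring.
Qed.

Lemma cderiv_minus (f g : C -> C) (z l m : C) :
  cderiv f z l -> cderiv g z m -> cderiv (fun w => f w - g w)%C z (l - m)%C.
Proof. intros; apply cderiv_plus; [|apply cderiv_opp]; assumption. Qed.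

Lemma Cinv_lip (z w : C) : z <> 0%C -> Cmod (w - z) < Cmod z / 2 ->
  w <> 0%C /\ Cmod z / 2 <= Cmod w.
Proof.
  intros Hz H.
  assert (Hp : 0 < Cmod z) by (apply Cmod_gt_0; exact Hz).
  assert (T := Cmod_triangle w (z - w)).
  replace (w + (z - w))%C with z in T by ring.
  rewrite <- Cmod_opp in H; replace (- (w - z))%C with (z - w)%C in H by ring.
  split; [|lra].
  intros ->; rewrite Cmod_0 in T; lra.
Qed.

Lemma cderiv_Cinv (z : C) : z <> 0%C -> cderiv (fun w => / w)%C z (- / (z * z))%C.
Proof.
  intros Hz eps He.
  assert (Hp : 0 < Cmod z) by (apply Cmod_gt_0; exact Hz).
  assert (Hc : 0 < Cmod z ^ 3) by (apply pow_lt; exact Hp).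
  set (d := Rmin (Cmod z / 2) (eps * Cmod z ^ 3 / 2)).
  assert (Hd : 0 < d) by (apply Rmin_pos; [lra|apply Rdiv_lt_0_compat; [apply Rmult_lt_0_compat|]; lra]).
  exists d; split; [exact Hd|]; intros w Hw.
  assert (H1 : Cmod (w - z) < Cmod z / 2) by (apply Rlt_le_trans with (1 := Hw), Rmin_l).
  assert (H2 : Cmod (w - z) <= eps * Cmod z ^ 3 / 2)
    by (apply Rlt_le, Rlt_le_trans with (1 := Hw), Rmin_r).
  destruct (Cinv_lip z w Hz H1) as [Hwn Hwm].
  replace (/ w - / z - - / (z * z) * (w - z))%C
    with ((w - z) * (w - z) / (w * z * z))%C by (field; split; assumption).
  rewrite Cmod_div by (repeat apply Cmult_neq_0; assumption).
  rewrite !Cmod_mult.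
  assert (Hq := Cmod_ge_0 (w - z)).
  apply Rle_div_l.
  - repeat apply Rmult_gt_0_compat; lra.
  - assert (Hk : Cmod z ^ 3 / 2 <= Cmod w * Cmod z * Cmod z) by (simpl; nra).
    assert (eps * (Cmod z ^ 3 / 2) <= eps * (Cmod w * Cmod z * Cmod z))
      by (apply Rmult_le_compat_l; lra).
    nra.
Qed.

Lemma cderiv_inv (f : C -> C) (z l : C) :
  cderiv f z l -> f z <> 0%C -> cderiv (fun w => / f w)%C z (- l / (f z * f z))%C.
Proof.
  intros H Hn; eapply cderiv_eq; [|exact (cderiv_comp _ _ z _ _ (cderiv_Cinv _ Hn) H)].
  field; exact Hn.
Qed.

Lemma cderiv_pow (n : nat) (z : C) :
  cderiv (fun w => w ^ n)%C z (RtoC (INR n) * z ^ (pred n))%C.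
Proof.
  induction n as [|n IH].
  - simpl; eapply cderiv_eq; [|apply cderiv_const]; ring.
  - simpl; eapply cderiv_eq; [|exact (cderiv_mult _ _ z _ _ (cderiv_id z) IH)].
    change (match n with 0%nat => 1 | S _ => INR n + 1 end) with (INR (S n)).
    rewrite S_INR, RtoC_plus; destruct n as [|n]; simpl; ring.
Qed.

(** * Integrals of complex functions of a real variable *)

Definition CInt (g : R -> C) (a b : R) : C :=
  (RInt (fun t => Re (g t)) a b, RInt (fun t => Im (g t)) a b).

Definition ccontR (g : R -> C) (t : R) : Prop := @continuous R_UniformSpace C_UniformSpace g t.

Definition ccont_on (g : R -> C) (a b : R) : Prop :=
  forall t, Rmin a b <= t <= Rmax a b -> ccontR g t.

Lemma ex_CInt (g : R -> C) (a b : R) : ccont_on g a b ->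
  ex_RInt (fun t => Re (g t)) a b /\ ex_RInt (fun t => Im (g t)) a b.
Proof.
  intros H; split; apply (ex_RInt_continuous (V := R_CompleteNormedModule)); intros z Hz.
  - apply continuous_Re, H, Hz.
  - apply continuous_Im, H, Hz.
Qed.

Lemma CInt_ext (f g : R -> C) (a b : R) :
  (forall t, Rmin a b < t < Rmax a b -> f t = g t) -> CInt f a b = CInt g a b.
Proof.
  intros H; unfold CInt; f_equal; apply RInt_ext; intros t Ht; now rewrite H.
Qed.

Lemma CInt_plus (f g : R -> C) (a b : R) :
  ccont_on f a b -> ccont_on g a b ->
  CInt (fun t => f t + g t)%C a b = (CInt f a b + CInt g a b)%C.
Proof.
  intros Hf Hg; destruct (ex_CInt f a b Hf), (ex_CInt g a b Hg).
  apply injective_projections; simpl.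
  - exact (RInt_plus (V := R_CompleteNormedModule) _ _ a b H H1).
  - exact (RInt_plus (V := R_CompleteNormedModule) _ _ a b H0 H2).
Qed.

Lemma CInt_scal (c : C) (g : R -> C) (a b : R) : ccont_on g a b ->
  CInt (fun t => c * g t)%C a b = (c * CInt g a b)%C.
Proof.
  intros Hg; destruct (ex_CInt g a b Hg) as [H1 H2].
  assert (S1 : forall k, ex_RInt (fun t => k * Re (g t)) a b)
    by (intros k; exact (ex_RInt_scal (V := R_NormedModule) _ a b k H1)).
  assert (S2 : forall k, ex_RInt (fun t => k * Im (g t)) a b)
    by (intros k; exact (ex_RInt_scal (V := R_NormedModule) _ a b k H2)).
  assert (E1 : forall k, RInt (fun t => k * Re (g t)) a b = k * RInt (fun t => Re (g t)) a b)
    by (intros k; exact (RInt_scal (V := R_CompleteNormedModule) _ a b k H1)).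
  assert (E2 : forall k, RInt (fun t => k * Im (g t)) a b = k * RInt (fun t => Im (g t)) a b)
    by (intros k; exact (RInt_scal (V := R_CompleteNormedModule) _ a b k H2)).
  apply injective_projections; simpl; unfold Re, Im in *.
  - rewrite <- E1, <- E2.
    exact (RInt_minus (V := R_CompleteNormedModule) _ _ a b (S1 _) (S2 _)).
  - rewrite <- E1, <- E2.
    exact (RInt_plus (V := R_CompleteNormedModule) _ _ a b (S2 _) (S1 _)).
Qed.

Lemma CInt_minus (f g : R -> C) (a b : R) :
  ccont_on f a b -> ccont_on g a b ->
  CInt (fun t => f t - g t)%C a b = (CInt f a b - CInt g a b)%C.
Proof.
  intros Hf Hg.
  rewrite (CInt_ext _ (fun t => f t + Copp 1 * g t)%C) by (intros; ring).
  rewrite CInt_plus, CInt_scal; try assumption; [ring|].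
  intros t Ht; apply continuous_Cmult; [apply continuous_Cconst|apply Hg, Ht].
Qed.

Lemma CInt_const (c : C) (a b : R) : CInt (fun _ => c) a b = (RtoC (b - a) * c)%C.
Proof.
  unfold CInt; apply injective_projections; simpl; rewrite RInt_const;
    unfold scal; simpl; unfold mult; simpl; unfold Re, Im; ring.
Qed.

(** The factor [2] comes from bounding the real and the imaginary part separately. *)
Lemma CInt_bound (g : R -> C) (a b M : R) : a <= b -> ccont_on g a b ->
  (forall t, a <= t <= b -> Cmod (g t) <= M) -> Cmod (CInt g a b) <= 2 * M * (b - a).
Proof.
  intros Hab Hg HM; destruct (ex_CInt g a b Hg) as [H1 H2].
  apply Rle_trans with (1 := Cmod_le_abs _); simpl.
  assert (B1 : Rabs (RInt (fun t => Re (g t)) a b) <= (b - a) * M).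
  { apply abs_RInt_le_const; try assumption; intros t Ht.
    apply Rle_trans with (1 := re_le_Cmod _), HM, Ht. }
  assert (B2 : Rabs (RInt (fun t => Im (g t)) a b) <= (b - a) * M).
  { apply abs_RInt_le_const; try assumption; intros t Ht.
    apply Rle_trans with (1 := im_le_Cmod _), HM, Ht. }
  lra.
Qed.

Lemma CInt_Chasles (g : R -> C) (a b c : R) : ccont_on g a b -> ccont_on g b c ->
  (CInt g a b + CInt g b c)%C = CInt g a c.
Proof.
  intros Hab Hbc; destruct (ex_CInt g a b Hab), (ex_CInt g b c Hbc).
  apply injective_projections; simpl;
    apply (RInt_Chasles (V := R_CompleteNormedModule)); assumption.
Qed.

Lemma CInt_swap (g : R -> C) (a b : R) : ccont_on g a b ->
  CInt g b a = (- CInt g a b)%C.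
Proof.
  intros Hg; destruct (ex_CInt g a b Hg).
  apply injective_projections; simpl; symmetry;
    apply (opp_RInt_swap (V := R_CompleteNormedModule)); assumption.
Qed.

Lemma CInt_comp_lin (g : R -> C) (u v a b : R) :
  ccont_on g (u * a + v) (u * b + v) -> ccont_on (fun t => g (u * t + v)%R) a b ->
  (RtoC u * CInt (fun t => g (u * t + v)%R) a b)%C = CInt g (u * a + v) (u * b + v).
Proof.
  intros Hg Hg'.
  rewrite <- CInt_scal by exact Hg'.
  destruct (ex_CInt g (u * a + v) (u * b + v) Hg) as [H1 H2].
  unfold CInt; f_equal.
  - rewrite <- (RInt_comp_lin (V := R_CompleteNormedModule)) by exact H1.
    apply RInt_ext; intros t _; unfold scal; simpl; unfold mult; simpl; unfold Re; ring.
  - rewrite <- (RInt_comp_lin (V := R_CompleteNormedModule)) by exact H2.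
    apply RInt_ext; intros t _; unfold scal; simpl; unfold mult; simpl; unfold Im; ring.
Qed.

(** * Goursat's theorem and primitives on discs *)

Definition seg_path (a b : C) (t : R) : C := (a + RtoC t * (b - a))%C.

Definition seg (f : C -> C) (a b : C) : C :=
  ((b - a) * CInt (fun t => f (seg_path a b t)) 0 1)%C.

Lemma seg_path_ball (c a b : C) (r t : R) : Cmod (a - c) <= r -> Cmod (b - c) <= r ->
  0 <= t <= 1 -> Cmod (seg_path a b t - c) <= r.
Proof.
  intros Ha Hb Ht; unfold seg_path.
  replace (a + t * (b - a) - c)%C with (RtoC (1 - t) * (a - c) + RtoC t * (b - c))%C
    by (rewrite RtoC_minus; ring).
  apply Rle_trans with (1 := Cmod_triangle _ _); rewrite !Cmod_mult, !Cmod_R.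
  rewrite !Rabs_pos_eq by lra; nra.
Qed.

Lemma seg_path_cont (a b : C) (t : R) : ccontR (seg_path a b) t.
Proof.
  apply continuous_Cplus; [apply continuous_Cconst|].
  apply continuous_Cmult; [|apply continuous_Cconst].
  apply continuous_RtoC, continuous_id.
Qed.

Definition ccont_ball (f : C -> C) (c : C) (r : R) : Prop :=
  forall z, Cmod (z - c) <= r -> ccont f z.

Lemma seg_cont (f : C -> C) (c a b : C) (r s t : R) :
  ccont_ball f c r -> Cmod (a - c) <= r -> Cmod (b - c) <= r ->
  0 <= s <= 1 -> 0 <= t <= 1 -> ccont_on (fun t => f (seg_path a b t)) s t.
Proof.
  intros Hf Ha Hb Hs Ht u Hu.
  apply (continuous_comp (seg_path a b) f); [apply seg_path_cont|].
  apply Hf, seg_path_ball; try assumption.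
  unfold Rmin, Rmax in Hu; destruct (Rle_dec s t); lra.
Qed.

Lemma half_bounds : 0 <= 1 / 2 <= 1. Proof. lra. Qed.
Lemma zero_bounds : 0 <= 0 <= 1. Proof. lra. Qed.
Lemma one_bounds : 0 <= 1 <= 1. Proof. lra. Qed.

Lemma RtoC_m1 : RtoC (-1) = (- (1))%C.
Proof. apply injective_projections; simpl; ring. Qed.

Definition mid (a b : C) : C := (RtoC (1 / 2) * (a + b))%C.

Lemma C2_neq0 : (RtoC 2) <> 0%C.
Proof. intros E; apply RtoC_inj in E; lra. Qed.

Lemma mid_ball (c a b : C) (r : R) : Cmod (a - c) <= r -> Cmod (b - c) <= r ->
  Cmod (mid a b - c) <= r.
Proof.
  intros Ha Hb; replace (mid a b) with (seg_path a b (1 / 2));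
    [apply seg_path_ball; auto using half_bounds|].
  unfold mid, seg_path; rewrite RtoC_div by lra; field; exact C2_neq0.
Qed.

Lemma ccont_on_lin (g : R -> C) (u v a b : R) :
  (forall t, Rmin a b <= t <= Rmax a b -> ccontR g (u * t + v)) ->
  ccont_on (fun t => g (u * t + v)) a b.
Proof.
  intros H t Ht; apply (continuous_comp (fun t => u * t + v) g); [|apply H, Ht].
  apply continuous_Rplus; [apply continuous_Rmult|];
    first [apply continuous_id|apply continuous_const].
Qed.

Ltac mm01 := unfold Rmin, Rmax; destruct (Rle_dec _ _); try lra.

Section Segments.
Context (f : C -> C) (c : C) (r : R) (Hf : ccont_ball f c r).

Lemma seg_swap (a b : C) : Cmod (a - c) <= r -> Cmod (b - c) <= r ->
  seg f b a = (- seg f a b)%C.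
Proof.
  intros Ha Hb; unfold seg.
  set (g := fun t => f (seg_path a b t)).
  assert (Hg : ccont_on g 0 1) by (apply (seg_cont f c a b r); auto using zero_bounds, one_bounds).
  assert (E := CInt_comp_lin g (-1) 1 0 1).
  replace (-1 * 0 + 1) with 1 in E by ring; replace (-1 * 1 + 1) with 0 in E by ring.
  assert (H10 : ccont_on g 1 0).
  { intros t Ht; apply Hg; revert Ht; unfold Rmin, Rmax.
    destruct (Rle_dec 1 0), (Rle_dec 0 1); lra. }
  specialize (E H10).
  rewrite (CInt_swap g 0 1 Hg) in E.
  rewrite (CInt_ext (fun t => f (seg_path b a t)) (fun t => g (-1 * t + 1))).
  - assert (E' : CInt (fun t => g (-1 * t + 1)) 0 1 = CInt g 0 1).
    { rewrite RtoC_m1 in E.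
      transitivity (- (- (1) * CInt (fun t => g (-1 * t + 1)%R) 0 1))%C; [ring|].
      rewrite E; [ring|].
      apply ccont_on_lin; intros t Ht; apply Hg; revert Ht; mm01. }
    rewrite E'; ring.
  - intros t _; unfold g; f_equal; unfold seg_path.
    rewrite RtoC_plus, RtoC_mult, RtoC_m1; ring.
Qed.

Lemma seg_mid (a b : C) : Cmod (a - c) <= r -> Cmod (b - c) <= r ->
  seg f a b = (seg f a (mid a b) + seg f (mid a b) b)%C.
Proof.
  intros Ha Hb; unfold seg.
  set (g := fun t => f (seg_path a b t)).
  assert (Hg : forall s t, 0 <= s <= 1 -> 0 <= t <= 1 -> ccont_on g s t)
    by (intros; apply (seg_cont f c a b r); auto).
  assert (Hp : forall u v t, Rmin 0 1 <= t <= Rmax 0 1 -> 0 <= v -> 0 <= u -> u + v <= 1 ->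
    ccontR g (u * t + v)).
  { intros u v t Ht Hv Hu Huv; apply (Hg 0 1 zero_bounds one_bounds).
    unfold Rmin, Rmax in *; destruct (Rle_dec 0 1); [|lra]; nra. }
  assert (E1 := CInt_comp_lin g (1 / 2) 0 0 1).
  assert (E2 := CInt_comp_lin g (1 / 2) (1 / 2) 0 1).
  replace (1 / 2 * 0 + 0) with 0 in E1 by ring; replace (1 / 2 * 1 + 0) with (1 / 2) in E1 by ring.
  replace (1 / 2 * 0 + 1 / 2) with (1 / 2) in E2 by ring.
  replace (1 / 2 * 1 + 1 / 2) with 1 in E2 by field.
  specialize (E1 (Hg _ _ zero_bounds half_bounds)).
  specialize (E2 (Hg _ _ half_bounds one_bounds)).
  rewrite <- (CInt_Chasles g 0 (1 / 2) 1); [|apply Hg; auto using zero_bounds, half_bounds, one_bounds..].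
  rewrite <- E1, <- E2 by (apply ccont_on_lin; intros; apply Hp; auto; lra).
  rewrite (CInt_ext (fun t => f (seg_path a (mid a b) t)) (fun t => g (1 / 2 * t + 0))).
  rewrite (CInt_ext (fun t => f (seg_path (mid a b) b t)) (fun t => g (1 / 2 * t + 1 / 2))).
  - unfold mid; rewrite RtoC_div by lra; field; exact C2_neq0.
  - intros t _; unfold g; f_equal; unfold seg_path, mid.
    rewrite RtoC_plus, RtoC_mult, !RtoC_div by lra; field; exact C2_neq0.
  - intros t _; unfold g; f_equal; unfold seg_path, mid.
    rewrite RtoC_plus, RtoC_mult, !RtoC_div by lra; field; exact C2_neq0.
Qed.

Lemma seg_bound (a b : C) (M : R) : Cmod (a - c) <= r -> Cmod (b - c) <= r ->
  (forall t, 0 <= t <= 1 -> Cmod (f (seg_path a b t)) <= M) ->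
  Cmod (seg f a b) <= 2 * M * Cmod (b - a).
Proof.
  intros Ha Hb HM; unfold seg; rewrite Cmod_mult.
  assert (B := CInt_bound (fun t => f (seg_path a b t)) 0 1 M Rle_0_1
    (seg_cont f c a b r 0 1 Hf Ha Hb zero_bounds one_bounds) HM).
  assert (P := Cmod_ge_0 (b - a)); nra.
Qed.

End Segments.

Lemma CInt_id : CInt RtoC 0 1 = RtoC (1 / 2).
Proof.
  unfold CInt; apply injective_projections; simpl.
  - assert (H : is_RInt (fun t : R => t) 0 1 (minus ((fun t => t ^ 2 / 2) 1) ((fun t => t ^ 2 / 2) 0))).
    { apply (is_RInt_derive (V := R_CompleteNormedModule) (fun t => t ^ 2 / 2) (fun t => t)).
      - intros x _; auto_derive; [auto|field].
      - intros x _; apply continuous_id. }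
    apply (is_RInt_unique (V := R_CompleteNormedModule)) in H; etransitivity; [exact H|].
    unfold minus, plus, opp; simpl; field.
  - rewrite RInt_const; unfold scal; simpl; unfold mult; simpl; ring.
Qed.

Lemma seg_affine (u v a b : C) :
  seg (fun w => u + v * w)%C a b = (u * (b - a) + v * (RtoC (1 / 2) * (b * b - a * a)))%C.
Proof.
  unfold seg.
  assert (Hc : ccont_on RtoC 0 1)
    by (intros t _; apply continuous_RtoC, continuous_id).
  rewrite (CInt_ext _ (fun t => (u + v * a) + (v * (b - a)) * RtoC t)%C)
    by (intros; unfold seg_path; ring).
  rewrite (CInt_plus (fun _ => u + v * a)%C (fun t => v * (b - a) * RtoC t)%C).
  - rewrite CInt_const, (CInt_scal _ RtoC), CInt_id by exact Hc.
    rewrite RtoC_div, RtoC_minus by lra; field; exact C2_neq0.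
  - intros t _; apply continuous_Cconst.
  - intros t Ht; apply continuous_Cmult; [apply continuous_Cconst|apply Hc, Ht].
Qed.

Definition tri (f : C -> C) (a b p : C) : C := (seg f a b + seg f b p + seg f p a)%C.

Lemma tri_split (f : C -> C) (c : C) (r : R) (a b p : C) : ccont_ball f c r ->
  Cmod (a - c) <= r -> Cmod (b - c) <= r -> Cmod (p - c) <= r ->
  tri f a b p = (tri f a (mid a b) (mid p a) + tri f (mid a b) b (mid b p)
    + tri f (mid p a) (mid b p) p + tri f (mid a b) (mid b p) (mid p a))%C.
Proof.
  intros Hf Ha Hb Hp; unfold tri.
  assert (H1 := mid_ball c a b r Ha Hb); assert (H2 := mid_ball c b p r Hb Hp).
  assert (H3 := mid_ball c p a r Hp Ha).
  rewrite (seg_mid f c r Hf a b Ha Hb), (seg_mid f c r Hf b p Hb Hp), (seg_mid f c r Hf p a Hp Ha).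
  rewrite (seg_swap f c r Hf (mid a b) (mid p a)), (seg_swap f c r Hf (mid a b) (mid b p)),
    (seg_swap f c r Hf (mid b p) (mid p a)); auto; ring.
Qed.

Definition perim (a b p : C) : R := Cmod (b - a) + Cmod (p - b) + Cmod (a - p).

Record triangle := Tri { ta : C; tb : C; tp : C }.

Definition subtri (S : triangle) (i : nat) : triangle :=
  let (a, b, p) := S in
  match i with
  | 0%nat => Tri a (mid a b) (mid p a)
  | 1%nat => Tri (mid a b) b (mid b p)
  | 2%nat => Tri (mid p a) (mid b p) p
  | _ => Tri (mid a b) (mid b p) (mid p a)
  end.

Definition triS f (S : triangle) : C := tri f (ta S) (tb S) (tp S).
Definition perimS (S : triangle) : R := perim (ta S) (tb S) (tp S).

Lemma Cmod_half (z : C) : Cmod (RtoC (1 / 2) * z) = Cmod z / 2.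
Proof. rewrite Cmod_mult, Cmod_R, Rabs_pos_eq by lra; field. Qed.

Lemma subtri_perim (S : triangle) (i : nat) : perimS (subtri S i) = perimS S / 2.
Proof.
  assert (E : forall x y z : C, (x - y)%C = (RtoC (1 / 2) * z)%C -> Cmod (x - y) = Cmod z / 2)
    by (intros x y z ->; apply Cmod_half).
  assert (N := C2_neq0).
  assert (Sy : forall x y : C, Cmod (x - y) = Cmod (y - x)).
  { intros x y; rewrite <- Cmod_opp; f_equal; ring. }
  destruct S as [a b p]; unfold perimS, perim.
  destruct i as [|[|[|i]]]; simpl; unfold mid.
  all: repeat match goal with
    | |- context [Cmod (?x - ?y)] =>
        first [ rewrite (E x y (b - a)%C) by (rewrite RtoC_div by lra; field; exact N)
              | rewrite (E x y (a - b)%C) by (rewrite RtoC_div by lra; field; exact N)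
              | rewrite (E x y (p - b)%C) by (rewrite RtoC_div by lra; field; exact N)
              | rewrite (E x y (b - p)%C) by (rewrite RtoC_div by lra; field; exact N)
              | rewrite (E x y (p - a)%C) by (rewrite RtoC_div by lra; field; exact N)
              | rewrite (E x y (a - p)%C) by (rewrite RtoC_div by lra; field; exact N)]
    end.
  all: rewrite ?(Sy a b), ?(Sy b p), ?(Sy p a); field.
Qed.

Definition inball (c : C) (r : R) (S : triangle) : Prop :=
  Cmod (ta S - c) <= r /\ Cmod (tb S - c) <= r /\ Cmod (tp S - c) <= r.

Lemma subtri_inball (c : C) (r : R) (S : triangle) (i : nat) :
  inball c r S -> inball c r (subtri S i).
Proof.
  destruct S as [a b p]; intros (Ha & Hb & Hp); simpl in *.
  destruct i as [|[|[|i]]]; unfold inball; simpl; auto using mid_ball.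
Qed.

Lemma subtri_ta (S : triangle) (i : nat) : Cmod (ta (subtri S i) - ta S) <= perimS S.
Proof.
  destruct S as [a b p].
  assert (N := C2_neq0).
  assert (Q1 := Cmod_ge_0 (b - a)); assert (Q2 := Cmod_ge_0 (p - b)); assert (Q3 := Cmod_ge_0 (a - p)).
  unfold perimS, perim; simpl.
  destruct i as [|[|[|i]]]; simpl; unfold mid.
  - replace (a - a)%C with (RtoC 0) by ring; rewrite Cmod_0; lra.
  - replace (RtoC (1 / 2) * (a + b) - a)%C with (RtoC (1 / 2) * (b - a))%C
      by (rewrite RtoC_div by lra; field; exact N).
    rewrite Cmod_half; lra.
  - replace (RtoC (1 / 2) * (p + a) - a)%C with (- (RtoC (1 / 2) * (a - p)))%C
      by (rewrite RtoC_div by lra; field; exact N).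
    rewrite Cmod_opp, Cmod_half; lra.
  - replace (RtoC (1 / 2) * (a + b) - a)%C with (RtoC (1 / 2) * (b - a))%C
      by (rewrite RtoC_div by lra; field; exact N).
    rewrite Cmod_half; lra.
Qed.

Lemma subtri_big (f : C -> C) (c : C) (r : R) (S : triangle) : ccont_ball f c r ->
  inball c r S -> exists i, Cmod (triS f S) <= 4 * Cmod (triS f (subtri S i)).
Proof.
  intros Hf HS; apply NNPP; intros Hn.
  assert (H : forall i, 4 * Cmod (triS f (subtri S i)) < Cmod (triS f S)).
  { intros i; apply Rnot_le_lt; intros Hi; apply Hn; now exists i. }
  destruct S as [a b p]; destruct HS as (Ha & Hb & Hp).
  assert (E := tri_split f c r a b p Hf Ha Hb Hp).
  assert (H0 := H 0%nat); assert (H1 := H 1%nat); assert (H2 := H 2%nat); assert (H3 := H 3%nat).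
  unfold triS in *; simpl in *.
  set (T0 := tri f a (mid a b) (mid p a)) in *.
  set (T1 := tri f (mid a b) b (mid b p)) in *.
  set (T2 := tri f (mid p a) (mid b p) p) in *.
  set (T3 := tri f (mid a b) (mid b p) (mid p a)) in *.
  assert (B1 := Cmod_triangle T0 T1); assert (B2 := Cmod_triangle (T0 + T1) T2).
  assert (B3 := Cmod_triangle (T0 + T1 + T2) T3); rewrite <- E in B3; lra.
Qed.

(** Completeness in the quantitative form that locates the limit of the nested triangles. *)
Lemma geometric_limit (u : nat -> R) (K : R) :
  (forall n, Rabs (u (S n) - u n) <= K / 2 ^ n) ->
  exists l, forall n, Rabs (l - u n) <= 2 * K / 2 ^ n.
Proof.
  intros H.
  assert (Hp : forall n, 0 < 2 ^ n) by (intros; apply pow_lt; lra).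
  assert (HK : 0 <= K).
  { specialize (H 0%nat); simpl in H; assert (P := Rabs_pos (u 1%nat - u 0%nat)); lra. }
  assert (Hd : forall n k, Rabs (u (n + k)%nat - u n) <= 2 * K / 2 ^ n - 2 * K / 2 ^ (n + k)).
  { intros n; induction k as [|k IH].
    - rewrite Nat.add_0_r, Rminus_diag, Rabs_R0; lra.
    - replace (u (n + S k)%nat - u n) with ((u (S (n + k)) - u (n + k)%nat) + (u (n + k)%nat - u n))
        by (rewrite Nat.add_succ_r; ring).
      apply Rle_trans with (1 := Rabs_triang _ _); specialize (H (n + k)%nat).
      replace (2 * K / 2 ^ (n + S k)) with (2 * K / 2 ^ (n + k) - K / 2 ^ (n + k)).
      + lra.
      + rewrite Nat.add_succ_r; simpl; field; generalize (Hp (n + k)%nat); lra. }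
  assert (Hd' : forall n k, Rabs (u (n + k)%nat - u n) <= 2 * K / 2 ^ n).
  { intros n k; specialize (Hd n k).
    assert (0 <= 2 * K / 2 ^ (n + k)) by (apply Rle_div_r; [apply Hp|lra]); lra. }
  assert (Hs : forall eps, 0 < eps -> exists N, 2 * K / 2 ^ N < eps).
  { intros eps He.
    assert (A : Rabs (/ 2) < 1) by (rewrite Rabs_pos_eq; lra).
    destruct (pow_lt_1_zero (/ 2) A (eps / (2 * K + 1))) as [N HN].
    { apply Rdiv_lt_0_compat; lra. }
    exists N; specialize (HN N (Nat.le_refl _)); rewrite pow_inv in HN.
    rewrite Rabs_pos_eq in HN by (apply Rlt_le, Rinv_0_lt_compat, Hp).
    apply Rle_lt_trans with ((2 * K + 1) * / 2 ^ N).
    - unfold Rdiv; apply Rmult_le_compat_r; [apply Rlt_le, Rinv_0_lt_compat, Hp|lra].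
    - apply Rmult_lt_compat_l with (r := 2 * K + 1) in HN; [|lra].
      replace ((2 * K + 1) * (eps / (2 * K + 1))) with eps in HN by (field; lra); exact HN. }
  assert (Hc : Cauchy_crit u).
  { intros eps He; destruct (Hs (eps / 2)) as [N HN]; [lra|].
    exists N; intros n m Hn Hm.
    replace n with (N + (n - N))%nat by lia; replace m with (N + (m - N))%nat by lia.
    unfold Rdist.
    replace (u (N + (n - N))%nat - u (N + (m - N))%nat)
      with ((u (N + (n - N))%nat - u N) + - (u (N + (m - N))%nat - u N)) by ring.
    apply Rle_lt_trans with (1 := Rabs_triang _ _); rewrite Rabs_Ropp.
    assert (A := Hd' N (n - N)%nat); assert (B := Hd' N (m - N)%nat); lra. }
  destruct (Stdlib.Reals.Rcomplete.R_complete u Hc) as [l Hl]; exists l; intros n.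
  apply Rle_plus_epsilon; intros eps He.
  destruct (Hl eps He) as [N HN].
  specialize (HN (n + N)%nat ltac:(lia)); unfold Rdist in HN.
  replace (l - u n) with (- (u (n + N)%nat - l) + (u (n + N)%nat - u n)) by ring.
  apply Rle_trans with (1 := Rabs_triang _ _); rewrite Rabs_Ropp.
  specialize (Hd' n N); lra.
Qed.

Lemma geometric_limit_C (u : nat -> C) (K : R) :
  (forall n, Cmod (u (S n) - u n) <= K / 2 ^ n) ->
  exists l, forall n, Cmod (l - u n) <= 4 * K / 2 ^ n.
Proof.
  intros H.
  destruct (geometric_limit (fun n => Re (u n)) K) as [l1 H1].
  { intros n; apply Rle_trans with (2 := H n), (re_le_Cmod (u (S n) - u n)%C). }
  destruct (geometric_limit (fun n => Im (u n)) K) as [l2 H2].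
  { intros n; apply Rle_trans with (2 := H n), (im_le_Cmod (u (S n) - u n)%C). }
  exists (l1, l2); intros n; apply Rle_trans with (1 := Cmod_le_abs _); simpl.
  specialize (H1 n); specialize (H2 n); unfold Re, Im, Rminus, Rdiv in *; simpl in *; lra.
Qed.

Lemma cont_affine (u v z : C) : ccont (fun w => u + v * w)%C z.
Proof.
  apply continuous_Cplus; [apply continuous_Cconst|apply continuous_Cmult;
    [apply continuous_Cconst|apply continuous_id]].
Qed.

Lemma seg_minus (f g : C -> C) (c : C) (r : R) (a b : C) : ccont_ball f c r -> ccont_ball g c r ->
  Cmod (a - c) <= r -> Cmod (b - c) <= r ->
  seg (fun w => f w - g w)%C a b = (seg f a b - seg g a b)%C.
Proof.
  intros Hf Hg Ha Hb; unfold seg; rewrite CInt_minus; [ring|..];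
    apply (seg_cont _ c a b r); auto using zero_bounds, one_bounds.
Qed.

Lemma seg_path_near (a b z : C) (d t : R) : Cmod (a - z) <= d -> Cmod (b - z) <= d ->
  0 <= t <= 1 -> Cmod (seg_path a b t - z) <= d.
Proof. apply seg_path_ball. Qed.

Lemma tri_small (f : C -> C) (c : C) (r : R) (z l : C) : ccont_ball f c r -> cderiv f z l ->
  forall eps, 0 < eps -> exists d, 0 < d /\ forall S k, inball c r S ->
    0 <= k < d -> inball z k S -> Cmod (triS f S) <= 2 * eps * k * perimS S.
Proof.
  intros Hf Hl eps He; destruct (Hl eps He) as (d & Hd & Hw).
  exists d; split; [exact Hd|]; intros [a b p] k (Ha & Hb & Hp) Hk (Ka & Kb & Kp); simpl in *.
  set (g := fun w => ((f z - l * z) + l * w)%C).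
  assert (Hg : ccont_ball g c r) by (intros w _; apply cont_affine).
  assert (Z : tri g a b p = 0%C) by (unfold tri, g; rewrite !seg_affine; ring).
  assert (Hfg : ccont_ball (fun w => f w - g w)%C c r)
    by (intros w Hw'; apply continuous_Cminus; [apply Hf|apply Hg]; exact Hw').
  assert (B : forall x y, Cmod (x - c) <= r -> Cmod (y - c) <= r -> Cmod (x - z) <= k -> Cmod (y - z) <= k ->
    Cmod (seg (fun w => f w - g w)%C x y) <= 2 * (eps * k) * Cmod (y - x)).
  { intros x y Hx Hy Kx Ky; apply (seg_bound _ c r Hfg); auto.
    intros t Ht; assert (A := seg_path_near x y z k t Kx Ky Ht).
    unfold g; match goal with |- Cmod ?e <= _ =>
      replace e with (f (seg_path x y t) - f z - l * (seg_path x y t - z))%C by ring end.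
    apply Rle_trans with (1 := Hw _ (Rle_lt_trans _ _ _ A (proj2 Hk))).
    apply Rmult_le_compat_l; [lra|exact A]. }
  replace (triS f (Tri a b p)) with (tri (fun w => f w - g w)%C a b p).
  - unfold tri, perimS, perim; simpl.
    assert (B1 := B a b Ha Hb Ka Kb); assert (B2 := B b p Hb Hp Kb Kp); assert (B3 := B p a Hp Ha Kp Ka).
    apply Rle_trans with (1 := Cmod_triangle _ _).
    apply Rle_trans with (1 := Rplus_le_compat_r _ _ _ (Cmod_triangle _ _)); lra.
  - unfold triS; simpl; rewrite <- (Cplus_0_r (tri f a b p)), <- (Copp_0), <- Z.
    unfold tri; rewrite !(seg_minus f g c r) by assumption; ring.
Qed.

Lemma inball_near (z : C) (S : triangle) (e : R) : Cmod (z - ta S) <= e ->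
  inball z (e + perimS S) S.
Proof.
  destruct S as [a b p]; intros H; unfold inball, perimS, perim in *; simpl in *.
  rewrite <- Cmod_opp in H; replace (- (z - a))%C with (a - z)%C in H by ring.
  assert (Q1 := Cmod_ge_0 (b - a)); assert (Q2 := Cmod_ge_0 (p - b)); assert (Q3 := Cmod_ge_0 (a - p)).
  split; [lra|split].
  - replace (b - z)%C with ((b - a) + (a - z))%C by ring.
    apply Rle_trans with (1 := Cmod_triangle _ _); lra.
  - replace (p - z)%C with (- (a - p) + (a - z))%C by ring.
    apply Rle_trans with (1 := Cmod_triangle _ _); rewrite Cmod_opp; lra.
Qed.

(** Goursat's bisection: a triangle with nonzero boundary integral would shrink to a point at
    which the function is not differentiable. *)
Theorem Goursat (f : C -> C) (c : C) (r : R) (a b p : C) :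
  (forall z, Cmod (z - c) <= r -> exists l, cderiv f z l) ->
  Cmod (a - c) <= r -> Cmod (b - c) <= r -> Cmod (p - c) <= r -> tri f a b p = 0%C.
Proof.
  intros Hd Ha Hb Hp.
  assert (Hf : ccont_ball f c r).
  { intros z Hz; destruct (Hd z Hz) as [l Hl]; exact (cderiv_ccont _ _ _ Hl). }
  assert (Hch : forall S, exists i, inball c r S -> Cmod (triS f S) <= 4 * Cmod (triS f (subtri S i))).
  { intros S; destruct (classic (inball c r S)) as [H|H].
    - destruct (subtri_big f c r S Hf H) as [i Hi]; now exists i.
    - exists 0%nat; tauto. }
  destruct (function_choice Hch) as [i Hi].
  set (T := fix T n := match n with O => Tri a b p | S m => subtri (T m) (i (T m)) end).
  set (P0 := perim a b p).
  assert (HP : forall n, 0 < 2 ^ n) by (intros; apply pow_lt; lra).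
  assert (HT : forall n, inball c r (T n)).
  { induction n as [|n IH]; [repeat split; assumption|simpl; apply subtri_inball, IH]. }
  assert (Hper : forall n, perimS (T n) = P0 / 2 ^ n).
  { induction n as [|n IH]; [unfold P0, perimS; simpl; field|].
    change (T (S n)) with (subtri (T n) (i (T n))); rewrite subtri_perim, IH; simpl.
    field; generalize (HP n); lra. }
  assert (Hbig : forall n, Cmod (tri f a b p) <= 4 ^ n * Cmod (triS f (T n))).
  { induction n as [|n IH]; [unfold triS; simpl; lra|].
    apply Rle_trans with (1 := IH); simpl.
    assert (0 < 4 ^ n) by (apply pow_lt; lra).
    specialize (Hi (T n) (HT n)).
    change (T (S n)) with (subtri (T n) (i (T n))).
    apply Rmult_le_compat_l with (r := 4 ^ n) in Hi; lra. }
  destruct (geometric_limit_C (fun n => ta (T n)) P0) as [z Hz].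
  { intros n; rewrite <- Hper; change (T (S n)) with (subtri (T n) (i (T n))); apply subtri_ta. }
  assert (Hs : forall e, 0 < e -> exists n, P0 / 2 ^ n < e).
  { assert (HP0 : 0 <= P0).
    { unfold P0, perim; assert (Q1 := Cmod_ge_0 (b - a)); assert (Q2 := Cmod_ge_0 (p - b));
        assert (Q3 := Cmod_ge_0 (a - p)); lra. }
    intros e He; assert (A : Rabs (/ 2) < 1) by (rewrite Rabs_pos_eq; lra).
    destruct (pow_lt_1_zero (/ 2) A (e / (P0 + 1))) as [N HN].
    { apply Rdiv_lt_0_compat; lra. }
    exists N; specialize (HN N (Nat.le_refl _)); rewrite pow_inv in HN.
    rewrite Rabs_pos_eq in HN by (apply Rlt_le, Rinv_0_lt_compat, HP).
    apply Rle_lt_trans with ((P0 + 1) * / 2 ^ N).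
    - unfold Rdiv; apply Rmult_le_compat_r; [apply Rlt_le, Rinv_0_lt_compat, HP|lra].
    - apply Rmult_lt_compat_l with (r := P0 + 1) in HN; [|lra].
      replace ((P0 + 1) * (e / (P0 + 1))) with e in HN by (field; lra); exact HN. }
  assert (Hzc : Cmod (z - c) <= r).
  { apply Rle_plus_epsilon; intros e He; destruct (Hs (e / 4)) as [n Hn]; [lra|].
    specialize (Hz n); destruct (HT n) as [H1 _].
    replace (z - c)%C with ((ta (T n) - c) + (z - ta (T n)))%C by ring.
    apply Rle_trans with (1 := Cmod_triangle _ _).
    unfold Rdiv in *; lra. }
  destruct (Hd z Hzc) as [l Hl].
  apply Cmod_eq_0, Rle_antisym; [|apply Cmod_ge_0].
  apply Rle_plus_epsilon; intros e He; rewrite Rplus_0_l.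
  assert (HP2 : 0 <= P0 ^ 2) by apply pow2_ge_0.
  set (eps := e / (10 * (P0 ^ 2 + 1))).
  assert (Heps : 0 < eps) by (apply Rdiv_lt_0_compat; lra).
  destruct (tri_small f c r z l Hf Hl eps Heps) as (d & Hdp & Hsm).
  destruct (Hs (d / 5)) as [n Hn]; [lra|].
  assert (Hk : 0 <= P0 / 2 ^ n).
  { rewrite <- Hper; unfold perimS, perim; assert (Q1 := Cmod_ge_0 (tb (T n) - ta (T n)));
     assert (Q2 := Cmod_ge_0 (tp (T n) - tb (T n)));
        assert (Q3 := Cmod_ge_0 (ta (T n) - tp (T n))); lra. }
  assert (Hin : inball z (5 * (P0 / 2 ^ n)) (T n)).
  { replace (5 * (P0 / 2 ^ n)) with (4 * P0 / 2 ^ n + perimS (T n)).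
    - apply inball_near, Hz.
    - rewrite Hper; field; generalize (HP n); lra. }
  specialize (Hsm (T n) (5 * (P0 / 2 ^ n)) (HT n) ltac:(lra) Hin); rewrite Hper in Hsm.
  apply Rle_trans with (1 := Hbig n).
  apply Rle_trans with (4 ^ n * (2 * eps * (5 * (P0 / 2 ^ n)) * (P0 / 2 ^ n))).
  - apply Rmult_le_compat_l; [apply pow_le; lra|exact Hsm].
  - replace 4 with (2 * 2) by ring; rewrite Rpow_mult_distr.
    replace (2 ^ n * 2 ^ n * (2 * eps * (5 * (P0 / 2 ^ n)) * (P0 / 2 ^ n))) with (10 * eps * P0 ^ 2)
      by (field; generalize (HP n); lra).
    assert (E : 10 * eps * (P0 ^ 2 + 1) = e) by (unfold eps; field; lra); nra.
Qed.

(** By Goursat's theorem on the triangle [c, z, w], the integrals along two radii differ by the integral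
    from [z] to [w]. *)
Lemma primitive_on_disc (f : C -> C) (c : C) (r0 : R) :
  (forall z, Cmod (z - c) < r0 -> exists l, cderiv f z l) ->
  forall z, Cmod (z - c) < r0 -> cderiv (fun w => seg f c w) z (f z).
Proof.
  intros Hd z Hz eps He.
  set (r := (r0 + Cmod (z - c)) / 2).
  assert (Hr : Cmod (z - c) < r < r0) by (unfold r; lra).
  assert (H0 := Cmod_ge_0 (z - c)).
  assert (Hd' : forall w, Cmod (w - c) <= r -> exists l, cderiv f w l) by (intros; apply Hd; lra).
  assert (Hf : ccont_ball f c r).
  { intros w Hw; destruct (Hd' w Hw) as [l Hl]; exact (cderiv_ccont _ _ _ Hl). }
  assert (Hfz : ccont f z) by (apply Hf; lra).
  destruct (proj1 (ccont_eps _ _) Hfz (eps / 2)) as (d & Hdp & Hw); [lra|].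
  exists (Rmin d (r - Cmod (z - c))); split; [apply Rmin_pos; lra|]; intros w Hm.
  assert (M1 := Rlt_le_trans _ _ _ Hm (Rmin_l _ _)).
  assert (M2 := Rlt_le_trans _ _ _ Hm (Rmin_r _ _)).
  assert (Hwc : Cmod (w - c) <= r).
  { replace (w - c)%C with ((w - z) + (z - c))%C by ring.
    apply Rle_trans with (1 := Cmod_triangle _ _); lra. }
  assert (Hcc : Cmod (c - c) <= r).
  { replace (c - c)%C with (RtoC 0) by ring; rewrite Cmod_0; lra. }
  assert (Hzc : Cmod (z - c) <= r) by lra.
  assert (T := Goursat f c r c z w Hd' Hcc Hzc Hwc); unfold tri in T.
  rewrite (seg_swap f c r Hf c w Hcc Hwc) in T.
  assert (E : (seg f c w - seg f c z - f z * (w - z) = seg (fun u => f u - f z) z w)%C).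
  { rewrite (seg_minus f (fun _ => f z) c r); auto.
    - assert (E2 := seg_affine (f z) 0 z w).
      assert (E3 : seg (fun _ => f z) z w = (f z * (w - z))%C).
      { transitivity (seg (fun w0 => f z + 0 * w0)%C z w); [|rewrite E2; ring].
        unfold seg; f_equal; apply CInt_ext; intros; ring. }
      rewrite E3.
      transitivity (seg f z w - f z * (w - z)
        - (seg f c z + seg f z w + - seg f c w))%C; [ring|rewrite T; ring].
    - intros u _; apply continuous_Cconst. }
  rewrite E.
  apply Rle_trans with (2 * (eps / 2) * Cmod (w - z)); [|apply Req_le; field].
  apply (seg_bound _ c r); auto.
  - intros u Hu; apply continuous_Cminus; [apply Hf, Hu|apply continuous_Cconst].
  - intros t Ht; apply Rlt_le, Hw, Rle_lt_trans with (2 := M1), seg_path_near; auto.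
    + replace (z - z)%C with (RtoC 0) by ring; rewrite Cmod_0; apply Cmod_ge_0.
    + apply Rle_refl.
Qed.

(** * Derivatives along real curves *)

Lemma is_derive_eps (f : R -> R) (x l : R) :
  is_derive f x l <-> forall eps, 0 < eps -> exists d, 0 < d /\
    forall y, Rabs (y - x) < d -> Rabs (f y - f x - l * (y - x)) <= eps * Rabs (y - x).
Proof.
  split.
  - intros [_ H] eps He.
    destruct (H x (fun P HP => HP) (mkposreal eps He)) as [d Hd].
    exists d; split; [apply cond_pos|]; intros y Hy.
    specialize (Hd y Hy).
    change (Rabs (f y - f x - (y - x) * l) <= eps * Rabs (y - x)) in Hd.
    now rewrite (Rmult_comm (y - x)) in Hd.
  - intros H; split; [exact (is_linear_scal_l (K := R_AbsRing) (V := R_NormedModule) l)|].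
    intros y Hy.
    assert (E := is_filter_lim_locally_unique (K := R_AbsRing) (V := AbsRing_NormedModule R_AbsRing) x y Hy); subst y.
    intros eps; destruct (H eps (cond_pos eps)) as (d & Hd & Hw).
    exists (mkposreal d Hd); intros y Hy'.
    change (Rabs (f y - f x - (y - x) * l) <= eps * Rabs (y - x)).
    rewrite (Rmult_comm (y - x)); apply Hw, Hy'.
Qed.

Definition rcderiv (g : R -> C) (t : R) (l : C) : Prop :=
  forall eps, 0 < eps -> exists d, 0 < d /\ forall s, Rabs (s - t) < d ->
    Cmod (g s - g t - RtoC (s - t) * l) <= eps * Rabs (s - t).

Lemma rcderiv_Re (g : R -> C) (t : R) (l : C) :
  rcderiv g t l -> is_derive (fun s => Re (g s)) t (Re l).
Proof.
  intros H; apply is_derive_eps; intros eps He; destruct (H eps He) as (d & Hd & Hs).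
  exists d; split; [exact Hd|]; intros y Hy.
  apply Rle_trans with (2 := Hs y Hy).
  apply Rle_trans with (2 := re_le_Cmod _); apply Req_le; f_equal.
  simpl; unfold Re, Im; ring.
Qed.

Lemma rcderiv_Im (g : R -> C) (t : R) (l : C) :
  rcderiv g t l -> is_derive (fun s => Im (g s)) t (Im l).
Proof.
  intros H; apply is_derive_eps; intros eps He; destruct (H eps He) as (d & Hd & Hs).
  exists d; split; [exact Hd|]; intros y Hy.
  apply Rle_trans with (2 := Hs y Hy).
  apply Rle_trans with (2 := im_le_Cmod _); apply Req_le; f_equal.
  simpl; unfold Re, Im; ring.
Qed.

Lemma rcderiv_pair (g : R -> C) (t : R) (l : C) :
  is_derive (fun s => Re (g s)) t (Re l) -> is_derive (fun s => Im (g s)) t (Im l) ->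
  rcderiv g t l.
Proof.
  intros H1 H2 eps He.
  destruct (proj1 (is_derive_eps _ _ _) H1 (eps / 2)) as (d & Hd & A); [lra|].
  destruct (proj1 (is_derive_eps _ _ _) H2 (eps / 2)) as (d' & Hd' & B); [lra|].
  exists (Rmin d d'); split; [apply Rmin_pos; assumption|]; intros s Hs.
  specialize (A s (Rlt_le_trans _ _ _ Hs (Rmin_l _ _))).
  specialize (B s (Rlt_le_trans _ _ _ Hs (Rmin_r _ _))).
  apply Rle_trans with (1 := Cmod_le_abs _).
  replace (Re (g s - g t - RtoC (s - t) * l)) with (Re (g s) - Re (g t) - Re l * (s - t))
    by (simpl; unfold Re, Im; ring).
  replace (Im (g s - g t - RtoC (s - t) * l)) with (Im (g s) - Im (g t) - Im l * (s - t))
    by (simpl; unfold Re, Im; ring).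
  lra.
Qed.

Lemma rcderiv_comp (f : C -> C) (p : R -> C) (t : R) (l v : C) :
  cderiv f (p t) l -> rcderiv p t v -> rcderiv (fun s => f (p s)) t (l * v)%C.
Proof.
  intros Hf Hp eps He.
  assert (Hl := Cmod_ge_0 l); assert (Hm := Cmod_ge_0 v).
  set (e2 := Rmin 1 (eps / (2 * (1 + Cmod l)))).
  assert (He2 : 0 < e2).
  { apply Rmin_pos; [lra|apply Rdiv_lt_0_compat; lra]. }
  assert (He2' : e2 * Cmod l <= eps / 2).
  { assert (e2 <= eps / (2 * (1 + Cmod l))) by apply Rmin_r.
    apply Rle_trans with (eps / (2 * (1 + Cmod l)) * (1 + Cmod l)).
    - apply Rmult_le_compat; lra.
    - apply Req_le; field; lra. }
  assert (He21 : e2 <= 1) by apply Rmin_l.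
  set (e1 := eps / (2 * (1 + Cmod v))).
  assert (He1 : 0 < e1) by (apply Rdiv_lt_0_compat; lra).
  assert (He1' : e1 * (1 + Cmod v) = eps / 2) by (unfold e1; field; lra).
  destruct (Hf e1 He1) as (d1 & Hd1 & H1).
  destruct (Hp e2 He2) as (d3 & Hd3 & H3).
  assert (Hq : 0 < d1 / (1 + Cmod v)) by (apply Rdiv_lt_0_compat; lra).
  exists (Rmin (d1 / (1 + Cmod v)) d3); split; [apply Rmin_pos; assumption|]; intros w Hw.
  assert (H2 := Rlt_le_trans _ _ _ Hw (Rmin_l _ _)).
  specialize (H3 w (Rlt_le_trans _ _ _ Hw (Rmin_r _ _))).
  assert (P := Rabs_pos (w - t)).
  assert (Hgw : Cmod (p w - p t) <= (1 + Cmod v) * Rabs (w - t)).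
  { replace (p w - p t)%C with ((p w - p t - RtoC (w - t) * v) + RtoC (w - t) * v)%C by ring.
    apply Rle_trans with (1 := Cmod_triangle _ _); rewrite Cmod_mult, Cmod_R; nra. }
  assert (H4 : Cmod (p w - p t) < d1).
  { apply Rle_lt_trans with (1 := Hgw).
    apply Rmult_lt_compat_l with (r := 1 + Cmod v) in H2; [|lra].
    replace ((1 + Cmod v) * (d1 / (1 + Cmod v))) with d1 in H2 by (field; lra); exact H2. }
  specialize (H1 _ H4).
  replace (f (p w) - f (p t) - RtoC (w - t) * (l * v))%C with
    ((f (p w) - f (p t) - l * (p w - p t)) + l * (p w - p t - RtoC (w - t) * v))%C by ring.
  apply Rle_trans with (1 := Cmod_triangle _ _); rewrite Cmod_mult.
  apply Rle_trans with (e1 * ((1 + Cmod v) * Rabs (w - t)) + Cmod l * (e2 * Rabs (w - t))).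
  - apply Rplus_le_compat.
    + apply Rle_trans with (1 := H1); apply Rmult_le_compat_l; lra.
    + apply Rmult_le_compat_l; lra.
  - nra.
Qed.

Lemma rcderiv_affine (a b : C) (t : R) : rcderiv (fun s => (a + RtoC s * b)%C) t b.
Proof.
  intros eps He; exists 1; split; [lra|]; intros s _.
  replace (a + s * b - (a + t * b) - RtoC (s - t) * b)%C with (RtoC 0)
    by (rewrite RtoC_minus; ring).
  rewrite Cmod_0; apply Rmult_le_pos; [lra|apply Rabs_pos].
Qed.

Lemma rcderiv_eq (g : R -> C) (t : R) (l m : C) : l = m -> rcderiv g t l -> rcderiv g t m.
Proof. now intros ->. Qed.

Lemma rcderiv_ext (g h : R -> C) (t : R) (l : C) :
  (forall s, g s = h s) -> rcderiv g t l -> rcderiv h t l.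
Proof.
  intros E H eps He; destruct (H eps He) as (d & Hd & Hs).
  exists d; split; [exact Hd|]; intros s Hs'; rewrite <- !E; auto.
Qed.

Lemma rcderiv_ccontR (g : R -> C) (t : R) (l : C) : rcderiv g t l -> ccontR g t.
Proof.
  intros H.
  apply (continuous_ext (T := R_UniformSpace) (U := C_UniformSpace) (fun s => (Re (g s), Im (g s)) : C)).
  - intros s; symmetry; apply surjective_pairing.
  - apply continuous_pairC; apply (ex_derive_continuous (V := R_NormedModule)).
    + exists (Re l); apply rcderiv_Re, H.
    + exists (Im l); apply rcderiv_Im, H.
Qed.

Lemma CInt_derive (g g' : R -> C) (a b : R) :
  (forall t, rcderiv g t (g' t)) -> (forall t, ccontR g' t) ->
  CInt g' a b = (g b - g a)%C.
Proof.
  intros H Hc; apply injective_projections; simpl.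
  - apply (is_RInt_unique (V := R_CompleteNormedModule)).
    apply (is_RInt_derive (V := R_CompleteNormedModule) (fun t => Re (g t))).
    + intros t _; apply rcderiv_Re, H.
    + intros t _; apply continuous_Re, Hc.
  - apply (is_RInt_unique (V := R_CompleteNormedModule)).
    apply (is_RInt_derive (V := R_CompleteNormedModule) (fun t => Im (g t))).
    + intros t _; apply rcderiv_Im, H.
    + intros t _; apply continuous_Im, Hc.
Qed.

Lemma cderiv0_const (f : C -> C) (c : C) (r : R) :
  (forall z, Cmod (z - c) < r -> cderiv f z 0%C) ->
  forall z, Cmod (z - c) < r -> f z = f c.
Proof.
  intros H z Hz.
  assert (Hp : forall t, 0 <= t <= 1 -> rcderiv (fun s => f (c + RtoC s * (z - c))%C) t 0%C).
  { intros t Ht; eapply rcderiv_eq; [|apply rcderiv_comp; [apply H|apply rcderiv_affine]]; [ring|].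
    replace (c + t * (z - c) - c)%C with (RtoC t * (z - c))%C by ring.
    rewrite Cmod_mult, Cmod_R, Rabs_pos_eq by lra.
    assert (P := Cmod_ge_0 (z - c)); nra. }
  assert (E1 := eq_is_derive (V := R_NormedModule) (fun s => Re (f (c + RtoC s * (z - c))%C)) 0 1
    (fun t Ht => rcderiv_Re _ _ _ (Hp t Ht)) Rlt_0_1).
  assert (E2 := eq_is_derive (V := R_NormedModule) (fun s => Im (f (c + RtoC s * (z - c))%C)) 0 1
    (fun t Ht => rcderiv_Im _ _ _ (Hp t Ht)) Rlt_0_1).
  simpl in E1, E2.
  replace (c + 0 * (z - c))%C with c in E1, E2 by ring.
  replace (c + 1 * (z - c))%C with z in E1, E2 by ring.
  apply injective_projections; [exact (eq_sym E1)|exact (eq_sym E2)].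
Qed.

(** * Cauchy-type integrals over circles around the origin *)

Definition eI (t : R) : C := (cos t, sin t).
Definition circ (r t : R) : C := (RtoC r * eI t)%C.

Lemma Cmod_eI (t : R) : Cmod (eI t) = 1.
Proof.
  unfold Cmod, eI; simpl; transitivity (sqrt 1); [f_equal|apply sqrt_1].
  generalize (sin2_cos2 t); unfold Rsqr; lra.
Qed.

Lemma Cmod_circ (r t : R) : 0 <= r -> Cmod (circ r t) = r.
Proof. intros H; unfold circ; rewrite Cmod_mult, Cmod_R, Cmod_eI, Rabs_pos_eq; lra. Qed.

Lemma rcderiv_eI (t : R) : rcderiv eI t (Ci * eI t)%C.
Proof.
  apply rcderiv_pair; unfold eI, Re, Im; simpl.
  - replace (0 * cos t - 1 * sin t) with (- sin t) by ring; apply is_derive_cos.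
  - replace (0 * sin t + 1 * cos t) with (cos t) by ring; apply is_derive_sin.
Qed.

Lemma rcderiv_scal (c : C) (g : R -> C) (t : R) (l : C) :
  rcderiv g t l -> rcderiv (fun s => c * g s)%C t (c * l)%C.
Proof.
  intros H; apply (rcderiv_comp (fun w => c * w)%C); [|exact H].
  eapply cderiv_eq; [|apply cderiv_scal, cderiv_id]; ring.
Qed.

Lemma rcderiv_circ (r t : R) : rcderiv (circ r) t (Ci * circ r t)%C.
Proof.
  eapply rcderiv_eq; [|apply rcderiv_scal, rcderiv_eI]; unfold circ; ring.
Qed.

Lemma ccontR_circ (r t : R) : ccontR (circ r) t.
Proof. exact (rcderiv_ccontR _ _ _ (rcderiv_circ r t)). Qed.

Lemma eI_2PI : eI (2 * PI) = eI 0.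
Proof. unfold eI; now rewrite cos_2PI, sin_2PI, cos_0, sin_0. Qed.

Lemma circ_2PI (r : R) : circ r (2 * PI) = circ r 0.
Proof. unfold circ; now rewrite eI_2PI. Qed.

Definition cauchy_int (r : R) (phi : R -> C) (n : nat) (z : C) : C :=
  CInt (fun t => phi t * (/ (circ r t - z)) ^ n)%C 0 (2 * PI).

Lemma circ_minus_bound (r t : R) (z : C) : 0 <= r -> r - Cmod z <= Cmod (circ r t - z).
Proof.
  intros Hr; assert (T := Cmod_triangle (circ r t - z) z).
  replace (circ r t - z + z)%C with (circ r t) in T by ring.
  rewrite Cmod_circ in T by exact Hr; lra.
Qed.

Lemma circ_minus_neq0 (r t : R) (z : C) : 0 <= r -> Cmod z < r -> (circ r t - z)%C <> 0%C.
Proof.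
  intros Hr Hz E; assert (B := circ_minus_bound r t z Hr); rewrite E, Cmod_0 in B; lra.
Qed.

Lemma kernel_taylor (A : R) (n : nat) : 0 <= A -> exists K, 0 <= K /\
  forall a b h : C, Cmod a <= A -> Cmod b <= A -> (b - a)%C = (h * a * b)%C ->
    Cmod (b ^ n - a ^ n - RtoC (INR n) * h * a ^ S n) <= K * Cmod h ^ 2.
Proof.
  intros HA; induction n as [|n (K & HK & IH)].
  - exists 0; split; [lra|]; intros a b h _ _ _; simpl.
    replace (1 - 1 - 0 * h * (a * 1))%C with (RtoC 0) by ring; rewrite Cmod_0; lra.
  - exists (A * K + INR (S n) * A ^ S (S (S n))); split.
    { assert (P := pos_INR (S n)); assert (P' := pow_le A (S (S (S n))) HA); nra. }
    intros a b h Ha Hb E.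
    replace (b ^ S n - a ^ S n - RtoC (INR (S n)) * h * a ^ S (S n))%C with
      (b * (b ^ n - a ^ n - RtoC (INR n) * h * a ^ S n)
        + RtoC (INR (S n)) * (h * h) * (a ^ S (S n) * b))%C.
    + apply Rle_trans with (1 := Cmod_triangle _ _); rewrite !Cmod_mult, Cmod_R, Cmod_pow.
      rewrite Rabs_pos_eq by apply pos_INR.
      specialize (IH a b h Ha Hb E).
      assert (P1 := Cmod_ge_0 a); assert (P2 := Cmod_ge_0 b); assert (P3 := Cmod_ge_0 h).
      assert (Q1 : Cmod b * Cmod (b ^ n - a ^ n - RtoC (INR n) * h * a ^ S n) <= A * (K * Cmod h ^ 2)).
      { apply Rmult_le_compat; auto; apply Cmod_ge_0. }
      assert (Q2 : Cmod a ^ S (S n) * Cmod b <= A ^ S (S n) * A).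
      { apply Rmult_le_compat; auto; [apply pow_le; auto|apply pow_incr; auto]. }
      assert (Q3 : INR (S n) * (Cmod h * Cmod h) * (Cmod a ^ S (S n) * Cmod b)
         <= INR (S n) * (Cmod h * Cmod h) * (A ^ S (S n) * A)).
      { apply Rmult_le_compat_l; auto; apply Rmult_le_pos; [apply pos_INR|nra]. }
      replace (A ^ S (S (S n))) with (A ^ S (S n) * A) by (simpl; ring).
      replace (Cmod h ^ 2) with (Cmod h * Cmod h) in * by ring.
      nra.
    + rewrite S_INR, RtoC_plus.
      transitivity (b ^ S n - a ^ S n - (RtoC (INR n) + 1) * h * a ^ S (S n)
        - a ^ n * ((b - a) - h * a * b)
        + (RtoC (INR n) + 1) * h * a ^ S n * (h * a * b - (b - a)))%C.
      * simpl; ring.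
      * rewrite E; ring.
Qed.

Lemma ccontR_bounded (g : R -> C) (a b : R) : a <= b -> ccont_on g a b ->
  exists M, 0 <= M /\ forall t, a <= t <= b -> Cmod (g t) <= M.
Proof.
  intros Hab Hg.
  assert (H : forall k : R -> R, (forall t, a <= t <= b -> continuous k t) ->
    exists M, forall t, a <= t <= b -> Rabs (k t) <= M).
  { intros k Hk; destruct (continuity_ab_maj (fun t => Rabs (k t)) a b Hab) as (m & Hm & _).
    - intros t Ht; apply continuity_pt_filterlim.
      apply (continuous_comp k Rabs); [apply Hk, Ht|apply continuous_Rabs].
    - exists (Rabs (k m)); exact Hm. }
  assert (Hg' : forall t, a <= t <= b -> ccontR g t).
  { intros t Ht; apply Hg; rewrite Rmin_left, Rmax_right; lra. }
  destruct (H (fun t => Re (g t))) as [M1 H1].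
  { intros t Ht; apply continuous_Re, Hg', Ht. }
  destruct (H (fun t => Im (g t))) as [M2 H2].
  { intros t Ht; apply continuous_Im, Hg', Ht. }
  exists (M1 + M2); split.
  - specialize (H1 a ltac:(lra)); specialize (H2 a ltac:(lra)).
    assert (P1 := Rabs_pos (Re (g a))); assert (P2 := Rabs_pos (Im (g a))); lra.
  - intros t Ht; apply Rle_trans with (1 := Cmod_le_abs _); specialize (H1 t Ht); specialize (H2 t Ht); lra.
Qed.

Lemma two_PI_pos : 0 <= 2 * PI.
Proof. generalize PI_RGT_0; lra. Qed.

Lemma cauchy_integrand_cont (r : R) (phi : R -> C) (n : nat) (z : C) : 0 <= r -> Cmod z < r ->
  ccont_on phi 0 (2 * PI) ->
  ccont_on (fun t => phi t * (/ (circ r t - z)) ^ n)%C 0 (2 * PI).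
Proof.
  intros Hr Hz Hp t Ht; apply continuous_Cmult; [apply Hp, Ht|].
  apply continuous_Cpow, continuous_Cinv; [|apply circ_minus_neq0; assumption].
  apply continuous_Cminus; [apply ccontR_circ|apply continuous_Cconst].
Qed.

(** Differentiation under the integral sign, by a second-order estimate of the kernel. *)
Lemma cauchy_int_deriv (r : R) (phi : R -> C) (n : nat) (z : C) : 0 <= r -> Cmod z < r ->
  ccont_on phi 0 (2 * PI) ->
  cderiv (cauchy_int r phi n) z (RtoC (INR n) * cauchy_int r phi (S n) z)%C.
Proof.
  intros Hr Hz Hp.
  assert (H2pi := two_PI_pos).
  destruct (ccontR_bounded phi 0 (2 * PI) H2pi Hp) as (M & HM0 & HM).
  set (d := (r - Cmod z) / 2); assert (Hd : 0 < d) by (unfold d; lra).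
  assert (HA : 0 <= / d) by (apply Rlt_le, Rinv_0_lt_compat, Hd).
  destruct (kernel_taylor (/ d) n HA) as (K & HK & HT).
  intros eps He.
  set (Q := 2 * (M * K) * (2 * PI)).
  assert (HQ : 0 <= Q) by (unfold Q; assert (0 <= M * K) by nra; nra).
  exists (Rmin d (eps / (1 + Q))); split.
  { apply Rmin_pos; [exact Hd|apply Rdiv_lt_0_compat; lra]. }
  intros w Hw.
  assert (W1 := Rlt_le_trans _ _ _ Hw (Rmin_l _ _)).
  assert (W2 := Rlt_le_trans _ _ _ Hw (Rmin_r _ _)).
  assert (Hwz : Cmod w < Cmod z + d).
  { replace w with ((w - z) + z)%C at 1 by ring; apply Rle_lt_trans with (1 := Cmod_triangle _ _); lra. }
  assert (Hwr : Cmod w < r) by (unfold d in *; lra).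
  unfold cauchy_int.
  assert (C1 := cauchy_integrand_cont r phi n w Hr Hwr Hp).
  assert (C2 := cauchy_integrand_cont r phi n z Hr Hz Hp).
  assert (C3 := cauchy_integrand_cont r phi (S n) z Hr Hz Hp).
  assert (C3' : ccont_on (fun t => RtoC (INR n) * (w - z) * (phi t * (/ (circ r t - z)) ^ S n))%C 0 (2 * PI)).
  { intros t Ht; apply continuous_Cmult; [apply continuous_Cconst|apply C3, Ht]. }
  assert (C12 : ccont_on (fun t => phi t * (/ (circ r t - w)) ^ n - phi t * (/ (circ r t - z)) ^ n)%C 0 (2 * PI)).
  { intros t Ht; apply continuous_Cminus; [apply C1, Ht|apply C2, Ht]. }
  replace (RtoC (INR n) * CInt (fun t : R => phi t * (/ (circ r t - z)) ^ S n) 0 (2 * PI) * (w - z))%C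
    with (RtoC (INR n) * (w - z) * CInt (fun t : R => phi t * (/ (circ r t - z)) ^ S n) 0 (2 * PI))%C by ring.
  rewrite <- CInt_scal by exact C3.
  rewrite <- CInt_minus by assumption.
  rewrite <- CInt_minus by assumption.
  apply Rle_trans with (2 * (M * (K * Cmod (w - z) ^ 2)) * (2 * PI - 0)).
  - apply CInt_bound; [exact H2pi|..].
    + intros t Ht; apply continuous_Cminus; [apply C12, Ht|apply C3', Ht].
    + intros t Ht.
      set (a := (/ (circ r t - z))%C); set (b := (/ (circ r t - w))%C).
      assert (Na := circ_minus_neq0 r t z Hr Hz); assert (Nb := circ_minus_neq0 r t w Hr Hwr).
      replace (phi t * b ^ n - phi t * a ^ n - RtoC (INR n) * (w - z) * (phi t * a ^ S n))%C
        with (phi t * (b ^ n - a ^ n - RtoC (INR n) * (w - z) * a ^ S n))%C by ring.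
      rewrite Cmod_mult; apply Rmult_le_compat; [apply Cmod_ge_0|apply Cmod_ge_0|apply HM, Ht|].
      apply HT.
      * unfold a; rewrite Cmod_inv by exact Na; apply Rinv_le_contravar; [exact Hd|].
        apply Rle_trans with (2 := circ_minus_bound r t z Hr); unfold d; lra.
      * unfold b; rewrite Cmod_inv by exact Nb; apply Rinv_le_contravar; [exact Hd|].
        apply Rle_trans with (2 := circ_minus_bound r t w Hr); unfold d in *; lra.
      * unfold a, b; field; split; assumption.
  - assert (P := Cmod_ge_0 (w - z)).
    replace (2 * (M * (K * Cmod (w - z) ^ 2)) * (2 * PI - 0)) with (Q * Cmod (w - z) * Cmod (w - z))
      by (unfold Q; ring).
    apply Rmult_le_compat_r; [exact P|].
    apply Rmult_lt_compat_l with (r := 1 + Q) in W2; [|lra].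
    replace ((1 + Q) * (eps / (1 + Q))) with eps in W2 by (field; lra); nra.
Qed.

(** * Cauchy's formula and derivatives of holomorphic functions *)

Lemma RInt_param_derive (F dF : R -> R -> R) (a b lo hi t : R) :
  (forall s x, lo < s < hi -> is_derive (fun u => F u x) s (dF s x)) ->
  (forall s x, lo < s < hi -> continuity_2d_pt dF s x) ->
  (forall s x, lo < s < hi -> continuous (F s) x) ->
  lo < t < hi ->
  is_derive (fun s => RInt (F s) a b) t (RInt (dF t) a b).
Proof.
  intros Hd Hc HF Ht.
  assert (He : 0 < Rmin (t - lo) (hi - t)) by (apply Rmin_pos; lra).
  assert (HL : forall P : R -> Prop, (forall s, lo < s < hi -> P s) -> locally t P).
  { intros P HP; exists (mkposreal _ He); intros s Hs; apply HP.
    assert (A := Rmin_l (t - lo) (hi - t)); assert (B := Rmin_r (t - lo) (hi - t)).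
    apply Rabs_lt_between in Hs; unfold minus, plus, opp in Hs; simpl in Hs; lra. }
  replace (RInt (dF t) a b) with (RInt (fun x => Derive (fun u => F u x) t) a b).
  - apply is_derive_RInt_param.
    + apply HL; intros s Hs x _; exists (dF s x); apply Hd, Hs.
    + intros x _; apply continuity_2d_pt_ext_loc with dF; [|apply Hc, Ht].
      exists (mkposreal _ He); intros u v Hu _; symmetry; apply is_derive_unique, Hd.
      assert (A := Rmin_l (t - lo) (hi - t)); assert (B := Rmin_r (t - lo) (hi - t)).
      apply Rabs_lt_between in Hu; simpl in Hu; lra.
    + apply HL; intros s Hs; apply (ex_RInt_continuous (V := R_CompleteNormedModule)).
      intros x _; apply HF, Hs.
  - apply RInt_ext; intros x _; apply is_derive_unique, Hd, Ht.
Qed.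

Lemma continuity_2d_Re (G : R -> R -> C) (x y : R) :
  @continuous (prod_UniformSpace R_UniformSpace R_UniformSpace) C_UniformSpace
    (fun p => G (fst p) (snd p)) (x, y) ->
  continuity_2d_pt (fun u v => Re (G u v)) x y.
Proof. intros H; apply continuity_2d_pt_filterlim; exact (continuous_Re _ _ H). Qed.

Lemma continuity_2d_Im (G : R -> R -> C) (x y : R) :
  @continuous (prod_UniformSpace R_UniformSpace R_UniformSpace) C_UniformSpace
    (fun p => G (fst p) (snd p)) (x, y) ->
  continuity_2d_pt (fun u v => Im (G u v)) x y.
Proof. intros H; apply continuity_2d_pt_filterlim; exact (continuous_Im _ _ H). Qed.

Lemma CInt_param_const (F dF : R -> R -> C) (a b d : R) : 0 < d ->
  (forall s x, - d < s < 1 + d -> rcderiv (fun u => F u x) s (dF s x)) ->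
  (forall s x, - d < s < 1 + d ->
    @continuous (prod_UniformSpace R_UniformSpace R_UniformSpace) C_UniformSpace
      (fun p => dF (fst p) (snd p)) (s, x)) ->
  (forall s x, - d < s < 1 + d -> ccontR (F s) x) ->
  (forall s, 0 <= s <= 1 -> CInt (dF s) a b = 0%C) ->
  CInt (F 1) a b = CInt (F 0) a b.
Proof.
  intros Hd HF HdF Hc H0.
  assert (D1 : forall t, 0 <= t <= 1 -> is_derive (fun s => RInt (fun x => Re (F s x)) a b) t zero).
  { intros t Ht.
    change (is_derive (fun s => RInt (fun x => Re (F s x)) a b) t (Re (RtoC 0))); rewrite <- (H0 t Ht).
    apply (RInt_param_derive (fun s x => Re (F s x)) (fun s x => Re (dF s x)) a b (- d) (1 + d)); [..|lra].
    - intros s x Hs; apply (rcderiv_Re (fun u => F u x)), HF, Hs.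
    - intros s x Hs; apply continuity_2d_Re, HdF, Hs.
    - intros s x Hs; apply (continuous_Re (T := R_UniformSpace)), Hc, Hs.
  }
  assert (D2 : forall t, 0 <= t <= 1 -> is_derive (fun s => RInt (fun x => Im (F s x)) a b) t zero).
  { intros t Ht.
    change (is_derive (fun s => RInt (fun x => Im (F s x)) a b) t (Im (RtoC 0))); rewrite <- (H0 t Ht).
    apply (RInt_param_derive (fun s x => Im (F s x)) (fun s x => Im (dF s x)) a b (- d) (1 + d)); [..|lra].
    - intros s x Hs; apply (rcderiv_Im (fun u => F u x)), HF, Hs.
    - intros s x Hs; apply continuity_2d_Im, HdF, Hs.
    - intros s x Hs; apply (continuous_Im (T := R_UniformSpace)), Hc, Hs.
  }
  assert (E1 := eq_is_derive (V := R_NormedModule) _ 0 1 D1 Rlt_0_1).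
  assert (E2 := eq_is_derive (V := R_NormedModule) _ 0 1 D2 Rlt_0_1).
  unfold CInt; f_equal; symmetry; [exact E1|exact E2].
Qed.

Lemma Ci_neq0 : Ci <> 0%C.
Proof. intros E; apply (f_equal snd) in E; simpl in E; lra. Qed.

Lemma RtoC_neq0 (x : R) : x <> 0 -> RtoC x <> 0%C.
Proof. intros H E; apply RtoC_inj in E; contradiction. Qed.

Lemma cauchy_int_one (r : R) (z : C) : 0 < r -> Cmod z < r ->
  cauchy_int r (circ r) 1 z = RtoC (2 * PI).
Proof.
  intros Hr Hz.
  assert (Hc : ccont_on (circ r) 0 (2 * PI)) by (intros t _; apply ccontR_circ).
  rewrite (cderiv0_const (cauchy_int r (circ r) 1) 0 r).
  - unfold cauchy_int; rewrite (CInt_ext _ (fun _ => 1%C)).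
    + rewrite CInt_const, Rminus_0_r; ring.
    + intros t _; assert (N : circ r t <> 0%C).
      { intros E; assert (E' := Cmod_circ r t ltac:(lra)); rewrite E, Cmod_0 in E'; lra. }
      simpl; field; exact N.
  - intros w Hw; replace (w - 0)%C with w in Hw by ring.
    eapply cderiv_eq; [|apply cauchy_int_deriv; [lra|exact Hw|exact Hc]].
    assert (D : forall t, rcderiv (fun t => (- / Ci) * / (circ r t - w))%C t (circ r t * (/ (circ r t - w)) ^ 2)%C).
    { intros t; assert (N := circ_minus_neq0 r t w ltac:(lra) Hw).
      eapply rcderiv_eq; [|apply rcderiv_scal, (rcderiv_comp (fun u => / (u - w))%C (circ r))].
      2: { apply cderiv_inv; [|exact N]. apply cderiv_minus; [apply cderiv_id|apply cderiv_const]. }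
      2: apply rcderiv_circ.
      simpl; field; split; [exact N|exact Ci_neq0]. }
    assert (E : cauchy_int r (circ r) 2 w = 0%C).
    { unfold cauchy_int; etransitivity.
      - exact (CInt_derive _ _ 0 (2 * PI) D (fun t =>
          continuous_Cmult _ _ t (ccontR_circ r t)
           (continuous_Cpow _ 2 t (continuous_Cinv _ t (continuous_Cminus _ _ t (ccontR_circ r t)
             (continuous_Cconst w t)) (circ_minus_neq0 r t w ltac:(lra) Hw))))).
      - cbv beta; rewrite circ_2PI; ring. }
    rewrite E; ring.
  - replace (z - 0)%C with z by ring; exact Hz.
Qed.

Section CauchyC1.
Context (f f' : C -> C) (R0 : R).
Context (Hf : forall z, Cmod z < R0 -> cderiv f z (f' z)).
Context (Hf' : forall z, Cmod z < R0 -> ccont f' z).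

(** Contracting the circle to the point [z]: the derivative of the integral in the contraction
    parameter is the integral of an exact form. *)
Lemma cauchy_C1 (r : R) (z : C) : 0 < r < R0 -> Cmod z < r ->
  cauchy_int r (fun t => f (circ r t) * circ r t)%C 1 z = (RtoC (2 * PI) * f z)%C.
Proof.
  intros Hr Hz.
  set (d := (R0 - r) / (4 * r)).
  assert (Hd : 0 < d) by (apply Rdiv_lt_0_compat; lra).
  assert (Hdr : (1 + 2 * d) * r < R0).
  { replace ((1 + 2 * d) * r) with (r + (R0 - r) / 2) by (unfold d; field; lra); lra. }
  set (p := fun s t => (z + RtoC s * (circ r t - z))%C).
  assert (Hp : forall s t, - d < s < 1 + d -> Cmod (p s t) < R0).
  { intros s t Hs; unfold p.
    replace (z + s * (circ r t - z))%C with (RtoC (1 - s) * z + RtoC s * circ r t)%C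
      by (rewrite RtoC_minus; ring).
    apply Rle_lt_trans with (1 := Cmod_triangle _ _).
    rewrite !Cmod_mult, !Cmod_R, Cmod_circ by lra.
    assert (P := Cmod_ge_0 z).
    assert (Rabs (1 - s) + Rabs s <= 1 + 2 * d).
    { unfold Rabs; destruct (Rcase_abs (1 - s)), (Rcase_abs s); lra. }
    assert (P1 := Rabs_pos (1 - s)); assert (P2 := Rabs_pos s); nra. }
  assert (HN : forall t, (circ r t - z)%C <> 0%C) by (intros t; apply circ_minus_neq0; lra).
  set (F := fun s t => (f (p s t) * (circ r t * / (circ r t - z)))%C).
  set (dF := fun s t => (f' (p s t) * circ r t)%C).
  assert (E : CInt (F 1) 0 (2 * PI) = CInt (F 0) 0 (2 * PI)).
  { apply (CInt_param_const F dF 0 (2 * PI) d Hd).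
    - intros s t Hs; unfold F, dF.
      apply (rcderiv_ext (fun u => (circ r t * / (circ r t - z)) * f (p u t))%C); [intros; ring|].
      eapply rcderiv_eq; [|apply rcderiv_scal, rcderiv_comp; [apply Hf, Hp, Hs|apply rcderiv_affine]].
      field; apply HN.
    - intros s t Hs; unfold dF.
      assert (Cc : @continuous (prod_UniformSpace R_UniformSpace R_UniformSpace) C_UniformSpace
        (fun q => circ r (snd q)) (s, t)).
      { apply (continuous_comp snd (circ r)); [apply continuous_snd|apply ccontR_circ]. }
      apply continuous_Cmult; [|exact Cc].
      apply (continuous_comp (fun q => p (fst q) (snd q)) f').
      + unfold p; apply continuous_Cplus; [apply continuous_Cconst|].
        apply continuous_Cmult; [apply continuous_RtoC, continuous_fst|].
        apply continuous_Cminus; [exact Cc|apply continuous_Cconst].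
      + apply Hf', Hp, Hs.
    - intros s t Hs; unfold F; apply continuous_Cmult.
      + apply (continuous_comp (p s) f).
        * unfold p; apply continuous_Cplus; [apply continuous_Cconst|].
          apply continuous_Cmult; [apply continuous_Cconst|].
          apply continuous_Cminus; [apply ccontR_circ|apply continuous_Cconst].
        * eapply cderiv_ccont, Hf, Hp, Hs.
      + apply continuous_Cmult; [apply ccontR_circ|].
        apply continuous_Cinv; [|apply HN].
        apply continuous_Cminus; [apply ccontR_circ|apply continuous_Cconst].
    - intros s Hs; unfold dF.
      assert (Hcont : forall t, ccontR (fun t => f' (p s t) * circ r t)%C t).
      { intros t; apply continuous_Cmult; [|apply ccontR_circ].
        apply (continuous_comp (p s) f').
        - unfold p; apply continuous_Cplus; [apply continuous_Cconst|].
          apply continuous_Cmult; [apply continuous_Cconst|].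
          apply continuous_Cminus; [apply ccontR_circ|apply continuous_Cconst].
        - apply Hf', Hp; lra. }
      destruct (Req_dec s 0) as [->|Hs0].
      + assert (Ep : forall t, p 0 t = z) by (intros t; unfold p; ring).
        rewrite (CInt_derive (fun t => (f' z * / Ci) * circ r t)%C).
        * rewrite circ_2PI; ring.
        * intros t; eapply rcderiv_eq; [|apply rcderiv_scal, rcderiv_circ].
          rewrite Ep; field; exact Ci_neq0.
        * exact Hcont.
      + rewrite (CInt_derive (fun t => / (Ci * RtoC s) * f (p s t))%C).
        * unfold p; rewrite circ_2PI; ring.
        * intros t; eapply rcderiv_eq; [|apply rcderiv_scal, (rcderiv_comp f (p s) t (f' (p s t)) (RtoC s * (Ci * circ r t))%C)].
          { field; split; [apply RtoC_neq0, Hs0|exact Ci_neq0]. }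
          { apply Hf, Hp; lra. }
          { unfold p; apply (rcderiv_comp (fun u => z + RtoC s * (u - z))%C (circ r)); [|apply rcderiv_circ].
            eapply cderiv_eq; [|apply cderiv_plus; [apply cderiv_const|apply cderiv_scal, cderiv_minus;
              [apply cderiv_id|apply cderiv_const]]]; ring. }
        * exact Hcont. }
  unfold cauchy_int.
  rewrite (CInt_ext _ (F 1)).
  - rewrite E, (CInt_ext (F 0) (fun t => f z * (circ r t * (/ (circ r t - z)) ^ 1))%C).
    + rewrite CInt_scal.
      * fold (cauchy_int r (circ r) 1 z); rewrite cauchy_int_one by lra; ring.
      * apply cauchy_integrand_cont; [lra|exact Hz|intros t _; apply ccontR_circ].
    + intros t _; unfold F, p; replace (z + 0 * (circ r t - z))%C with z by ring; simpl; ring.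
  - intros t _; unfold F, p; replace (z + 1 * (circ r t - z))%C with (circ r t) by ring; simpl; ring.
Qed.

End CauchyC1.

Lemma translate_deriv (f : C -> C) (c z l : C) :
  cderiv f (c + z)%C l -> cderiv (fun w => f (c + w)%C) z l.
Proof.
  intros H; eapply cderiv_eq; [|apply (cderiv_comp f (fun w => c + w)%C); [exact H|]].
  2: apply cderiv_plus; [apply cderiv_const|apply cderiv_id].
  ring.
Qed.

Lemma locally_disc (z : C) (r : R) : Cmod z < r ->
  exists d, 0 < d /\ forall w, Cmod (w - z) < d -> Cmod w < r.
Proof.
  intros H; exists (r - Cmod z); split; [lra|]; intros w Hw.
  replace w with ((w - z) + z)%C by ring; apply Rle_lt_trans with (1 := Cmod_triangle _ _); lra.
Qed.

(** A function with a complex derivative is the derivative of a primitive, to which Cauchy's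
    formula for continuously differentiable functions applies. *)
Lemma deriv_cauchy_int (f f' : C -> C) (R0 : R) :
  (forall z, Cmod z < R0 -> cderiv f z (f' z)) ->
  forall r, 0 < r < R0 -> exists phi, ccont_on phi 0 (2 * PI) /\
    forall z, Cmod z < r -> f z = cauchy_int r phi 2 z.
Proof.
  intros Hf r Hr.
  set (Phi := fun w => seg f 0 w).
  assert (HP : forall z, Cmod z < R0 -> cderiv Phi z (f z)).
  { intros z Hz; apply (primitive_on_disc f 0 R0).
    - intros w Hw; exists (f' w); apply Hf; now replace (w - 0)%C with w in Hw by ring.
    - now replace (z - 0)%C with z by ring. }
  assert (Hc : forall z, Cmod z < R0 -> ccont f z) by (intros z Hz; exact (cderiv_ccont _ _ _ (Hf z Hz))).
  set (phi := fun t => (/ RtoC (2 * PI) * (Phi (circ r t) * circ r t))%C).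
  assert (H2pi : RtoC (2 * PI) <> 0%C) by (apply RtoC_neq0; generalize PI_RGT_0; lra).
  assert (Hcc : forall t, ccontR (fun t => (Phi (circ r t) * circ r t)%C) t).
  { intros t; apply continuous_Cmult; [|apply ccontR_circ].
    apply (continuous_comp (circ r) Phi); [apply ccontR_circ|].
    eapply cderiv_ccont, HP; rewrite Cmod_circ; lra. }
  assert (Hphi : ccont_on phi 0 (2 * PI)).
  { intros t _; apply continuous_Cmult; [apply continuous_Cconst|apply Hcc]. }
  exists phi; split; [exact Hphi|].
  intros z Hz.
  assert (EP : forall w, Cmod w < r -> cauchy_int r phi 1 w = Phi w).
  { intros w Hw; transitivity (/ RtoC (2 * PI) * (RtoC (2 * PI) * Phi w))%C; [|field; exact H2pi].
    rewrite <- (cauchy_C1 Phi f R0 HP Hc r w Hr Hw).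
    unfold cauchy_int; rewrite <- CInt_scal.
    - apply CInt_ext; intros t _; unfold phi; simpl; ring.
    - apply cauchy_integrand_cont; [lra|exact Hw|intros t _; apply Hcc]. }
  rewrite <- (cderiv_unique Phi z (f z)) by (apply HP; lra).
  apply cderiv_unique.
  apply cderiv_ext_loc with (cauchy_int r phi 1).
  - destruct (locally_disc z r Hz) as (d & Hd & H); exists d; split; auto.
  - eapply cderiv_eq; [|apply cauchy_int_deriv; [lra|exact Hz|exact Hphi]]; simpl; ring.
Qed.

Lemma deriv_of_deriv (f f' : C -> C) (R0 : R) :
  (forall z, Cmod z < R0 -> cderiv f z (f' z)) ->
  forall z, Cmod z < R0 -> exists l, cderiv f' z l.
Proof.
  intros Hf z Hz.
  set (r := (R0 + Cmod z) / 2).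
  assert (P := Cmod_ge_0 z).
  assert (Hr : 0 < r < R0) by (unfold r; lra); assert (Hzr : Cmod z < r) by (unfold r; lra).
  destruct (deriv_cauchy_int f f' R0 Hf r Hr) as (phi & Hphi & E).
  exists (RtoC (INR 2) * (RtoC (INR 3) * cauchy_int r phi 4 z))%C.
  apply cderiv_ext_loc with (fun w => RtoC (INR 2) * cauchy_int r phi 3 w)%C.
  - destruct (locally_disc z r Hzr) as (d & Hd & H); exists d; split; [exact Hd|].
    intros w Hw; specialize (H w Hw).
    rewrite <- (cderiv_unique f w (f' w)) by (apply Hf; lra).
    symmetry; apply cderiv_unique.
    apply cderiv_ext_loc with (cauchy_int r phi 2); [|apply cauchy_int_deriv; auto; lra].
    destruct (locally_disc w r H) as (d' & Hd' & H'); exists d'; split; [exact Hd'|].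
    intros; symmetry; apply E; auto.
  - apply cderiv_scal, cauchy_int_deriv; auto; lra.
Qed.

Definition copen (U : C -> Prop) : Prop :=
  forall z, U z -> exists d, 0 < d /\ forall w, Cmod (w - z) < d -> U w.

Theorem holomorphic_deriv (U : C -> Prop) (f : C -> C) : copen U ->
  holomorphic_on U f -> holomorphic_on U (C_derive f).
Proof.
  intros HU Hf z Hz; destruct (HU z Hz) as (d & Hd & H).
  assert (H1 := proj1 (holomorphic_cderiv U f) Hf).
  destruct (deriv_of_deriv (fun w => f (z + w)%C) (fun w => C_derive f (z + w)%C) d) with (z := RtoC 0)
    as [l Hl].
  - intros w Hw; apply translate_deriv, H1, H; now replace (z + w - z)%C with w by ring.
  - rewrite Cmod_0; exact Hd.
  - exists l; apply cderiv_is_derive.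
    apply cderiv_ext_loc with (fun w => C_derive f (z + (- z + w))%C).
    + exists 1; split; [lra|]; intros w _; f_equal; ring.
    + apply (translate_deriv (fun w => C_derive f (z + w)%C) (- z)%C).
      replace (- z + z)%C with (RtoC 0) by ring; exact Hl.
Qed.

Lemma holomorphic_ccont (U : C -> Prop) (f : C -> C) (z : C) : holomorphic_on U f -> U z -> ccont f z.
Proof. intros H Hz; eapply cderiv_ccont, (proj1 (holomorphic_cderiv U f) H z Hz). Qed.

Lemma copen_disc (r : R) : copen (fun z => Cmod z < r).
Proof. intros z Hz; exact (locally_disc z r Hz). Qed.

Theorem Cauchy_formula (f : C -> C) (R0 r : R) (z : C) :
  holomorphic_on (fun z => Cmod z < R0) f -> 0 < r < R0 -> Cmod z < r ->
  cauchy_int r (fun t => f (circ r t) * circ r t)%C 1 z = (RtoC (2 * PI) * f z)%C.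
Proof.
  intros Hf; apply cauchy_C1 with (C_derive f).
  - intros w Hw; apply (proj1 (holomorphic_cderiv _ f) Hf w Hw).
  - intros w Hw; apply (holomorphic_ccont (fun z => Cmod z < R0)); [|exact Hw].
    apply holomorphic_deriv; [apply copen_disc|exact Hf].
Qed.

(** * Removable singularities and poles *)

Lemma circ_comp_cont (f : C -> C) (R0 r : R) : holomorphic_on (fun z => Cmod z < R0) f ->
  0 < r < R0 -> forall t, ccontR (fun t => f (circ r t)) t.
Proof.
  intros Hf Hr t; apply (continuous_comp (circ r) f); [apply ccontR_circ|].
  apply (holomorphic_ccont (fun z => Cmod z < R0)); [exact Hf|rewrite Cmod_circ; lra].
Qed.

Lemma circ_neq0 (r t : R) : 0 < r -> circ r t <> 0%C.
Proof. intros Hr E; assert (E' := Cmod_circ r t ltac:(lra)); rewrite E, Cmod_0 in E'; lra. Qed.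

Lemma twoPI_neq0 : RtoC (2 * PI) <> 0%C.
Proof. apply RtoC_neq0; generalize PI_RGT_0; lra. Qed.

(** A zero at the origin can be divided out: the quotient is again a Cauchy-type integral. *)
Lemma holomorphic_divide (h : C -> C) (r0 : R) : 0 < r0 ->
  holomorphic_on (fun z => Cmod z < r0) h -> h 0%C = 0%C ->
  exists k, holomorphic_on (fun z => Cmod z < r0 / 2) k /\
    (forall z, Cmod z < r0 / 2 -> h z = (z * k z)%C).
Proof.
  intros Hr0 Hh H0.
  set (r := r0 / 2); assert (Hr : 0 < r < r0) by (unfold r; lra).
  set (k := fun z => (/ RtoC (2 * PI) * cauchy_int r (fun t => h (circ r t)) 1 z)%C).
  assert (Hc := circ_comp_cont h r0 r Hh Hr).
  exists k; split.
  - apply (holomorphic_intro _ _ (fun z => / RtoC (2 * PI) * (RtoC (INR 1) * cauchy_int r (fun t => h (circ r t)) 2 z))%C).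
    intros z Hz; apply cderiv_scal, cauchy_int_deriv; [lra|exact Hz|intros t _; apply Hc].
  - intros z Hz.
    assert (F := fun w => Cauchy_formula h r0 r w Hh Hr).
    assert (Fz := F z Hz); assert (F0 := F 0%C ltac:(rewrite Cmod_0; lra)).
    rewrite H0 in F0.
    transitivity (/ RtoC (2 * PI) * (RtoC (2 * PI) * h z - RtoC (2 * PI) * 0))%C;
      [field; exact twoPI_neq0|].
    rewrite <- Fz, <- F0; unfold k.
    transitivity (/ RtoC (2 * PI) * (z * cauchy_int r (fun t => h (circ r t)) 1 z))%C; [|ring].
    f_equal; unfold cauchy_int.
    assert (Hcc : forall t, ccontR (fun t => (h (circ r t) * circ r t)%C) t)
      by (intros t; apply continuous_Cmult; [apply Hc|apply ccontR_circ]).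
    rewrite <- CInt_scal, <- CInt_minus.
    + apply CInt_ext; intros t _.
      assert (N := circ_minus_neq0 r t z ltac:(lra) Hz); assert (N' := circ_neq0 r t ltac:(lra)).
      simpl; replace (circ r t - 0)%C with (circ r t) by ring; field; auto.
    + apply cauchy_integrand_cont; [lra|exact Hz|intros t _; apply Hcc].
    + apply cauchy_integrand_cont; [lra|rewrite Cmod_0; lra|intros t _; apply Hcc].
    + apply cauchy_integrand_cont; [lra|exact Hz|intros t _; apply Hc].
Qed.

Lemma holomorphic_restrict (U V : C -> Prop) (f : C -> C) :
  (forall z, V z -> U z) -> holomorphic_on U f -> holomorphic_on V f.
Proof. intros H Hf z Hz; apply Hf, H, Hz. Qed.

Lemma holomorphic_ext (U : C -> Prop) (f g : C -> C) : copen U ->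
  (forall z, U z -> f z = g z) -> holomorphic_on U f -> holomorphic_on U g.
Proof.
  intros HU E Hf z Hz; destruct (HU z Hz) as (d & Hd & H).
  exists (C_derive f z); apply cderiv_is_derive.
  apply cderiv_ext_loc with f; [|apply (proj1 (holomorphic_cderiv U f) Hf z Hz)].
  exists d; split; auto.
Qed.

Lemma copen_punctured (r : R) : copen (fun z => 0 < Cmod z < r).
Proof.
  intros z [H1 H2]; exists (Rmin (Cmod z) (r - Cmod z)); split; [apply Rmin_pos; lra|].
  intros w Hw.
  assert (A := Rlt_le_trans _ _ _ Hw (Rmin_l _ _)); assert (B := Rlt_le_trans _ _ _ Hw (Rmin_r _ _)).
  assert (T1 := Cmod_triangle (w - z) z); replace (w - z + z)%C with w in T1 by ring.
  assert (T2 := Cmod_triangle (z - w) w); replace (z - w + w)%C with z in T2 by ring.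
  rewrite <- Cmod_opp in A; replace (- (w - z))%C with (z - w)%C in A by ring; lra.
Qed.

Lemma Cneq0_of_pos (z : C) : 0 < Cmod z -> z <> 0%C.
Proof. intros H E; rewrite E, Cmod_0 in H; lra. Qed.

(** Riemann: multiplied by [z ^ 2], a bounded function becomes differentiable at the origin. *)
Lemma removable (g : C -> C) (r M : R) : 0 < r ->
  holomorphic_on (fun z => 0 < Cmod z < r) g -> (forall z, 0 < Cmod z < r -> Cmod (g z) <= M) ->
  exists r' k, 0 < r' <= r /\ holomorphic_on (fun z => Cmod z < r') k /\
    (forall z, 0 < Cmod z < r' -> g z = k z).
Proof.
  intros Hr Hg HM.
  assert (HM0 : 0 <= M).
  { assert (Hh : 0 < Cmod (RtoC (r / 2)) < r) by (rewrite Cmod_R, Rabs_pos_eq; lra).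
    apply Rle_trans with (2 := HM _ Hh), Cmod_ge_0. }
  set (h := fun z : C => if Req_EM_T (Cmod z) 0 then RtoC 0 else (z * z * g z)%C).
  assert (h0 : h 0%C = 0%C) by (unfold h; rewrite Cmod_0; destruct (Req_EM_T 0 0) as [_|n]; [reflexivity|now elim n]).
  assert (hE : forall z : C, z <> 0%C -> h z = (z * z * g z)%C).
  { intros z Hz; unfold h; destruct (Req_EM_T (Cmod z) 0) as [E|_]; [|reflexivity].
    now elim Hz; apply Cmod_eq_0. }
  assert (Hh : holomorphic_on (fun z => Cmod z < r) h).
  { intros z Hz; destruct (Req_EM_T (Cmod z) 0) as [E|E].
    - apply Cmod_eq_0 in E; subst z; exists (RtoC 0); apply cderiv_is_derive.
      intros eps He; exists (Rmin r (eps / (M + 1))); split.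
      { apply Rmin_pos; [exact Hr|apply Rdiv_lt_0_compat; lra]. }
      intros w Hw; rewrite h0.
      assert (W1 := Rlt_le_trans _ _ _ Hw (Rmin_l _ _)); assert (W2 := Rlt_le_trans _ _ _ Hw (Rmin_r _ _)).
      replace (w - 0)%C with w in * by ring.
      replace (h w - 0 - 0 * w)%C with (h w) by ring.
      destruct (Req_EM_T (Cmod w) 0) as [E|E].
      + apply Cmod_eq_0 in E; subst w; rewrite h0, Cmod_0; lra.
      + assert (P := Cmod_ge_0 w).
        rewrite hE by (intros ->; rewrite Cmod_0 in E; lra).
        rewrite !Cmod_mult; specialize (HM w ltac:(lra)).
        apply Rmult_lt_compat_l with (r := M + 1) in W2; [|lra].
        replace ((M + 1) * (eps / (M + 1))) with eps in W2 by (field; lra).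
        assert (Cmod w * Cmod (g w) <= eps).
        { apply Rle_trans with (Cmod w * M); [apply Rmult_le_compat_l; lra|lra]. }
        nra.
    - assert (P := Cmod_ge_0 z).
      refine (holomorphic_ext (fun z => 0 < Cmod z < r) (fun z => z * z * g z)%C h _ _ _ z _).
      + apply copen_punctured.
      + intros w Hw; symmetry; apply hE, Cneq0_of_pos, Hw.
      + apply (holomorphic_intro _ _ (fun w => 2 * w * g w + w * w * C_derive g w)%C).
        intros w Hw; apply (cderiv_mult (fun w => w * w)%C g); [apply cderiv_sqr|].
        apply (proj1 (holomorphic_cderiv _ g) Hg w Hw).
      + lra. }
  destruct (holomorphic_divide h r Hr Hh h0) as (k1 & Hk1 & E1).
  assert (K0 : k1 0%C = 0%C).
  { (* [|k1 z| = |z g z| <= M |z|] for [z <> 0], and [k1] is continuous *)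
    assert (Cc : ccont k1 0%C) by (apply (holomorphic_ccont _ _ _ Hk1); rewrite Cmod_0; lra).
    apply Cmod_eq_0, Rle_antisym; [|apply Cmod_ge_0].
    apply Rle_plus_epsilon; intros eps He; rewrite Rplus_0_l.
    destruct (proj1 (ccont_eps _ _) Cc (eps / 2)) as (d & Hd & Hw); [lra|].
    set (m := Rmin (d / 2) (Rmin (r / 4) (eps / (2 * (M + 1))))).
    assert (Hm : 0 < m).
    { unfold m; repeat apply Rmin_pos; try lra; apply Rdiv_lt_0_compat; lra. }
    assert (m1 : m <= d / 2) by apply Rmin_l.
    assert (m2 : m <= r / 4) by (apply Rle_trans with (1 := Rmin_r _ _), Rmin_l).
    assert (m3 : m <= eps / (2 * (M + 1))) by (apply Rle_trans with (1 := Rmin_r _ _), Rmin_r).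
    assert (Cm : Cmod (RtoC m) = m) by (rewrite Cmod_R, Rabs_pos_eq; lra).
    specialize (Hw (RtoC m) ltac:(replace (RtoC m - 0)%C with (RtoC m) by ring; lra)).
    assert (Nm : RtoC m <> 0%C) by (apply RtoC_neq0; lra).
    assert (E : k1 (RtoC m) = (RtoC m * g (RtoC m))%C).
    { specialize (E1 (RtoC m) ltac:(lra)); rewrite hE in E1 by exact Nm.
      transitivity (/ RtoC m * (RtoC m * k1 (RtoC m)))%C; [field; exact Nm|].
      rewrite <- E1; field; exact Nm. }
    assert (B : Cmod (k1 (RtoC m)) <= eps / 2).
    { rewrite E, Cmod_mult, Cm; specialize (HM (RtoC m) ltac:(lra)).
      apply Rle_trans with (eps / (2 * (M + 1)) * (M + 1)).
      - apply Rmult_le_compat; try lra; apply Cmod_ge_0.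
      - apply Req_le; field; lra. }
    assert (T := Cmod_triangle (k1 (RtoC m)) (- (k1 (RtoC m) - k1 0))).
    rewrite Cmod_opp in T.
    replace (k1 m + - (k1 m - k1 0))%C with (k1 0%C) in T by ring; lra. }
  destruct (holomorphic_divide k1 (r / 2) ltac:(lra) Hk1 K0) as (k & Hk & E2).
  exists (r / 2 / 2), k; split; [lra|split; [exact Hk|]].
  intros z Hz; assert (N : z <> 0%C) by (apply Cneq0_of_pos, Hz).
  specialize (E1 z ltac:(lra)); rewrite hE, (E2 z ltac:(lra)) in E1 by exact N.
  transitivity (/ z * / z * (z * z * g z))%C; [field; exact N|].
  rewrite E1; field; exact N.
Qed.

(** If [g = h / z ^ n] with [h] holomorphic, cancelling the zero of [h] at the origin gives the
    order of the pole. *)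
Lemma pole_order_exists (n : nat) (g h : C -> C) (r : R) : 0 < r ->
  holomorphic_on (fun z => Cmod z < r) h ->
  (forall z : C, 0 < Cmod z < r -> g z = (h z / z ^ n)%C) ->
  exists m, (m <= n)%nat /\ pole_order_at_0 g m /\ (h 0%C <> 0%C -> m = n).
Proof.
  revert h r; induction n as [|n IH]; intros h r Hr Hh E.
  - exists 0%nat; split; [lia|split; [|reflexivity]].
    exists r, h; split; [exact Hr|split; [exact Hh|split; [exact E|lia]]].
  - destruct (classic (h 0%C = 0%C)) as [H0|H0].
    + destruct (holomorphic_divide h r Hr Hh H0) as (k & Hk & Ek).
      destruct (IH k (r / 2) ltac:(lra) Hk) as (m & Hm & Hp & _).
      * intros z Hz; rewrite E by lra; rewrite Ek by lra.
        assert (N : z <> 0%C) by (apply Cneq0_of_pos, Hz).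
        simpl; field; split; [apply Cpow_nz, N|exact N].
      * exists m; split; [lia|split; [exact Hp|contradiction]].
    + exists (S n); split; [lia|split; [|reflexivity]].
      exists r, h; split; [exact Hr|split; [exact Hh|split; [exact E|auto]]].
Qed.

(** * Mean values of squares *)

Lemma RInt_circle_le (g : R -> R) (M : R) : (forall t, continuous g t) ->
  (forall t, g t <= M) -> RInt g 0 (2 * PI) <= 2 * PI * M.
Proof.
  intros Hg HM; assert (P := two_PI_pos).
  replace (2 * PI * M) with (RInt (fun _ => M) 0 (2 * PI)).
  - apply RInt_le; [exact P|apply (ex_RInt_continuous (V := R_CompleteNormedModule)); auto|apply ex_RInt_const|auto].
  - rewrite RInt_const; unfold scal; simpl; unfold mult; simpl; ring.
Qed.

Lemma eI_inv (t : R) : (/ eI t)%C = Cconj (eI t).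
Proof.
  unfold eI, Cconj, Cinv; simpl.
  replace (cos t * (cos t * 1) + sin t * (sin t * 1)) with 1
    by (generalize (sin2_cos2 t); unfold Rsqr; lra).
  f_equal; field.
Qed.

(** Parseval's inequality for the constant and linear Taylor coefficients. *)
Lemma mean_square (h : C -> C) (R0 r : R) : holomorphic_on (fun z => Cmod z < R0) h -> 0 < r < R0 ->
  2 * PI * (Cmod (h 0%C) ^ 2 + r ^ 2 * Cmod (C_derive h 0%C) ^ 2)
    <= RInt (fun t => Cmod (h (circ r t)) ^ 2) 0 (2 * PI).
Proof.
  intros Hh Hr.
  assert (Hc := circ_comp_cont h R0 r Hh Hr).
  assert (H0r : Cmod 0%C < r) by (rewrite Cmod_0; lra).
  assert (N := fun t => circ_neq0 r t (proj1 Hr)).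
  set (phi := fun t => (h (circ r t) * circ r t)%C).
  assert (Hphi : ccont_on phi 0 (2 * PI))
    by (intros t _; apply continuous_Cmult; [apply Hc|apply ccontR_circ]).
  set (a := h 0%C); set (b := (RtoC r * C_derive h 0%C)%C).
  assert (I0 : CInt (fun t => h (circ r t)) 0 (2 * PI) = (RtoC (2 * PI) * a)%C).
  { unfold a; rewrite <- (Cauchy_formula h R0 r 0%C Hh Hr H0r); unfold cauchy_int.
    apply CInt_ext; intros t _; simpl.
    replace (circ r t - 0)%C with (circ r t) by ring; field; apply N. }
  assert (I1 : CInt (fun t => / RtoC r * (h (circ r t) * Cconj (eI t)))%C 0 (2 * PI) = (RtoC (2 * PI) * C_derive h 0)%C).
  { assert (D : cderiv (cauchy_int r phi 1) 0%C (RtoC (2 * PI) * C_derive h 0%C)%C).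
    { apply cderiv_ext_loc with (fun w => RtoC (2 * PI) * h w)%C.
      - exists r; split; [lra|]; intros w Hw; symmetry; apply (Cauchy_formula h R0 r w Hh Hr).
        now replace (w - 0)%C with w in Hw by ring.
      - apply cderiv_scal, (proj1 (holomorphic_cderiv _ h) Hh); rewrite Cmod_0; lra. }
    assert (D' := cauchy_int_deriv r phi 1 0%C ltac:(lra) H0r Hphi).
    rewrite <- (cderiv_unique _ _ _ D), (cderiv_unique _ _ _ D'); unfold cauchy_int.
    rewrite <- CInt_scal by (apply cauchy_integrand_cont; [lra|exact H0r|exact Hphi]).
    apply CInt_ext; intros t _; unfold phi; rewrite <- eI_inv.
    assert (Ne : eI t <> 0%C) by (intros E; assert (X := Cmod_eI t); rewrite E, Cmod_0 in X; lra).
    assert (Nr : RtoC r <> 0%C) by (apply RtoC_neq0; lra).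
    unfold circ; simpl.
    replace (r * eI t - 0)%C with (RtoC r * eI t)%C by ring; field; auto. }
  (* [0 <= |h - a - b e^{i t}|^2], integrated over the circle, with [a] and [b e^{i t}] the first two Taylor terms *)
  assert (Hce : forall t, ccontR (fun t => Cconj (eI t)) t).
  { intros t; apply continuous_pairC; [apply continuous_Re|apply (continuous_opp (K := R_AbsRing) (V := R_NormedModule)), continuous_Im];
    apply (rcderiv_ccontR eI t _ (rcderiv_eI t)). }
  assert (Hhe : forall t, ccontR (fun t => (h (circ r t) * Cconj (eI t))%C) t)
    by (intros t; apply continuous_Cmult; [apply Hc|apply Hce]).
  assert (Hhe' : forall t, ccontR (fun t => (/ RtoC r * (h (circ r t) * Cconj (eI t)))%C) t)
    by (intros t; apply continuous_Cmult; [apply continuous_Cconst|apply Hhe]).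
  assert (I2 : CInt (fun t => h (circ r t) * Cconj (eI t))%C 0 (2 * PI) = (RtoC (2 * PI) * b)%C).
  { rewrite CInt_scal in I1 by (intros t _; apply Hhe).
    unfold b; transitivity (RtoC r * (RtoC (2 * PI) * C_derive h 0))%C; [|ring].
    rewrite <- I1; field; apply RtoC_neq0; lra. }
  assert (I3 : CInt eI 0 (2 * PI) = 0%C).
  { rewrite (CInt_derive (fun t => / Ci * eI t)%C).
    - rewrite eI_2PI; ring.
    - intros t; eapply rcderiv_eq; [|apply rcderiv_scal, rcderiv_eI]; field; exact Ci_neq0.
    - intros t; exact (rcderiv_ccontR eI t _ (rcderiv_eI t)). }
  set (G := fun t => (Cconj a * h (circ r t) + Cconj b * (h (circ r t) * Cconj (eI t))
     - a * Cconj b * Cconj (eI t))%C).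
  assert (G1 : forall t, ccontR (fun t => Cconj a * h (circ r t))%C t)
    by (intros t; apply continuous_Cmult; [apply continuous_Cconst|apply Hc]).
  assert (G2 : forall t, ccontR (fun t => Cconj b * (h (circ r t) * Cconj (eI t)))%C t)
    by (intros t; apply continuous_Cmult; [apply continuous_Cconst|apply Hhe]).
  assert (G3 : forall t, ccontR (fun t => a * Cconj b * Cconj (eI t))%C t)
    by (intros t; apply continuous_Cmult; [apply continuous_Cconst|apply Hce]).
  assert (G12 : forall t, ccontR (fun t => Cconj a * h (circ r t) + Cconj b * (h (circ r t) * Cconj (eI t)))%C t)
    by (intros t; apply continuous_Cplus; [apply G1|apply G2]).
  assert (HG : forall t, ccontR G t) by (intros t; apply continuous_Cminus; [apply G12|apply G3]).
  assert (I3' : CInt (fun t => Cconj (eI t)) 0 (2 * PI) = 0%C).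
  { rewrite (CInt_derive (fun t => - / Ci * Cconj (eI t))%C).
    - rewrite eI_2PI; ring.
    - intros t; eapply rcderiv_eq; [|apply rcderiv_scal, (rcderiv_pair _ t (- Ci * Cconj (eI t))%C)].
      + field; exact Ci_neq0.
      + unfold eI, Cconj, Re, Im; simpl.
        replace (- 0 * cos t - - (1) * - sin t) with (- sin t) by ring; apply is_derive_cos.
      + unfold eI, Cconj, Re, Im; simpl.
        replace (- 0 * - sin t + - (1) * cos t) with (- cos t) by ring.
        apply (is_derive_opp (K := R_AbsRing) (V := R_NormedModule)), is_derive_sin.
    - exact Hce. }
  assert (IG : CInt G 0 (2 * PI) = (RtoC (2 * PI) * (RtoC (Cmod a ^ 2 + Cmod b ^ 2)))%C).
  { unfold G.
    rewrite (CInt_minus (fun t => Cconj a * h (circ r t) + Cconj b * (h (circ r t) * Cconj (eI t)))%C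
      (fun t => a * Cconj b * Cconj (eI t))%C) by (intros t _; auto).
    rewrite (CInt_plus (fun t => Cconj a * h (circ r t))%C
       (fun t => Cconj b * (h (circ r t) * Cconj (eI t)))%C) by (intros t _; auto).
    rewrite !CInt_scal by (intros t _; auto).
    rewrite I0, I2, I3', RtoC_plus, !Cmod2_conj; ring. }
  apply (f_equal Re) in IG.
  assert (IG' : RInt (fun t => Re (G t)) 0 (2 * PI) = 2 * PI * (Cmod a ^ 2 + Cmod b ^ 2)).
  { etransitivity; [exact IG|]; simpl; ring. }
  assert (Hb : Cmod b ^ 2 = r ^ 2 * Cmod (C_derive h 0%C) ^ 2).
  { unfold b; rewrite Cmod_mult, Cmod_R, Rabs_pos_eq by lra; ring. }
  rewrite <- Hb.
  assert (Hsq : forall t, continuous (fun t => Cmod (h (circ r t)) ^ 2) t).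
  { intros t; apply (continuous_ext (fun t => Re (h (circ r t)) * Re (h (circ r t)) + Im (h (circ r t)) * Im (h (circ r t)))).
    - intros s; cbv beta; match goal with |- ?x = ?y => change (@eq R x y) end.
      rewrite Cmod_sqr; ring.
    - apply continuous_Rplus.
      + apply continuous_Rmult; apply continuous_Re, Hc.
      + apply continuous_Rmult; apply continuous_Im, Hc. }
  assert (HRG : forall t, continuous (fun t => Re (G t)) t) by (intros t; apply continuous_Re, HG).
  set (S := Cmod a ^ 2 + Cmod b ^ 2) in *.
  assert (L : RInt (fun t => 2 * Re (G t) - S) 0 (2 * PI) <= RInt (fun t => Cmod (h (circ r t)) ^ 2) 0 (2 * PI)).
  { apply RInt_le.
    - apply two_PI_pos.
    - apply (ex_RInt_continuous (V := R_CompleteNormedModule)); intros t _.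
      apply continuous_Rminus; [apply continuous_Rmult; [apply continuous_const|apply HRG]|apply continuous_const].
    - apply (ex_RInt_continuous (V := R_CompleteNormedModule)); intros t _; apply Hsq.
    - intros t _.
      assert (P := pow2_ge_0 (Cmod (h (circ r t) - a - b * eI t))).
      unfold S, G; rewrite !Cmod_sqr in *; simpl in *; unfold Re, Im, Rminus in *; simpl in *.
      destruct (h (circ r t)) as [u v]; destruct a as [a1 a2]; destruct b as [b1 b2]; simpl in *.
      assert (E := sin2_cos2 t); unfold Rsqr in E.
      set (cc := cos t) in *; set (ss := sin t) in *.
      assert (X : (b1 * cc - b2 * ss) ^ 2 + (b1 * ss + b2 * cc) ^ 2 = b1 ^ 2 + b2 ^ 2).
      { transitivity ((b1 ^ 2 + b2 ^ 2) * (ss * ss + cc * cc)); [ring|rewrite E; ring]. }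
      nra. }
  apply Rle_trans with (2 := L).
  apply Req_le; symmetry.
  assert (EX : ex_RInt (fun t => Re (G t)) 0 (2 * PI))
    by (apply (ex_RInt_continuous (V := R_CompleteNormedModule)); intros; apply HRG).
  assert (EX2 : ex_RInt (fun t => 2 * Re (G t)) 0 (2 * PI))
    by (exact (ex_RInt_scal (V := R_NormedModule) _ _ _ 2 EX)).
  assert (E1 := RInt_minus (V := R_CompleteNormedModule) (fun t => 2 * Re (G t)) (fun _ => S) 0 (2 * PI) EX2 (ex_RInt_const _ _ _)).
  assert (E2 := RInt_scal (V := R_CompleteNormedModule) (fun t => Re (G t)) 0 (2 * PI) 2 EX).
  rewrite RInt_const in E1.
  unfold minus, scal, plus, opp in E1, E2; simpl in E1, E2; unfold mult in E1, E2; simpl in E1, E2.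
  etransitivity; [exact E1|].
  change (RInt (fun t => 2 * Re (G t)) 0 (2 * PI) = 2 * RInt (fun t => Re (G t)) 0 (2 * PI)) in E2.
  change (RInt (fun t => 2 * Re (G t)) 0 (2 * PI) + - ((2 * PI - 0) * S) = 2 * PI * S).
  rewrite E2, IG'; ring.
Qed.

(** * Smooth functions of two real variables *)

Definition Dx (g : R -> R -> R) (x y : R) : R := Derive (fun t => g t y) x.
Definition Dy (g : R -> R -> R) (x y : R) : R := Derive (fun t => g x t) y.

Definition Cn (n : nat) (U : C -> Prop) (g : R -> R -> R) : Prop :=
  forall x y : R, U (x, y) -> ex_diff_n g n x y.

Definition smooth (U : C -> Prop) (g : R -> R -> R) : Prop := forall n, Cn n U g.

Lemma copen_2d (U : C -> Prop) (P : R -> R -> Prop) (x y : R) : copen U -> U (x, y) ->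
  (forall u v, U (u, v) -> P u v) -> locally_2d P x y.
Proof.
  intros HU Hxy HP; destruct (HU _ Hxy) as (d & Hd & H).
  assert (Hd2 : 0 < d / 2) by lra.
  exists (mkposreal _ Hd2); intros u v Hu Hv; simpl in Hu, Hv.
  apply HP, H, Rle_lt_trans with (1 := Cmod_le_abs _); simpl.
  unfold Rminus in Hu, Hv; lra.
Qed.

Section Calculus.
Context (U : C -> Prop) (HU : copen U).

Lemma open_x (P : R -> Prop) (x y : R) : U (x, y) -> (forall u, U (u, y) -> P u) -> locally x P.
Proof.
  intros Hxy HP; destruct (HU _ Hxy) as (d & Hd & H).
  exists (mkposreal d Hd); intros u Hu; apply HP, H.
  apply Rle_lt_trans with (1 := Cmod_le_abs _); simpl.
  replace (y + - y) with 0 by ring; rewrite Rabs_R0, Rplus_0_r; exact Hu.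
Qed.

Lemma open_y (P : R -> Prop) (x y : R) : U (x, y) -> (forall v, U (x, v) -> P v) -> locally y P.
Proof.
  intros Hxy HP; destruct (HU _ Hxy) as (d & Hd & H).
  exists (mkposreal d Hd); intros u Hu; apply HP, H.
  apply Rle_lt_trans with (1 := Cmod_le_abs _); simpl.
  replace (x + - x) with 0 by ring; rewrite Rabs_R0, Rplus_0_l; exact Hu.
Qed.

Lemma Dx_ext (f g : R -> R -> R) (x y : R) : (forall u v, U (u, v) -> f u v = g u v) ->
  U (x, y) -> Dx f x y = Dx g x y.
Proof.
  intros E Hxy; apply Derive_ext_loc, (open_x _ x y Hxy); intros u Hu; apply E, Hu.
Qed.

Lemma Dy_ext (f g : R -> R -> R) (x y : R) : (forall u v, U (u, v) -> f u v = g u v) ->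
  U (x, y) -> Dy f x y = Dy g x y.
Proof.
  intros E Hxy; apply Derive_ext_loc, (open_y _ x y Hxy); intros u Hu; apply E, Hu.
Qed.

Lemma Cn_ext (n : nat) (f g : R -> R -> R) : (forall u v, U (u, v) -> f u v = g u v) ->
  Cn n U f -> Cn n U g.
Proof.
  intros E Hf x y Hxy; apply ex_diff_n_ext_loc with f; [|apply Hf, Hxy].
  apply (copen_2d U); auto.
Qed.

Lemma Cn_weaken (n m : nat) (f : R -> R -> R) : (m <= n)%nat -> Cn n U f -> Cn m U f.
Proof. intros H Hf x y Hxy; apply ex_diff_n_m with n; auto. Qed.

Lemma Cn_cont (n : nat) (f : R -> R -> R) (x y : R) : Cn n U f -> U (x, y) -> continuity_2d_pt f x y.
Proof. intros Hf Hxy; specialize (Hf x y Hxy); destruct n; apply Hf. Qed.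

Lemma Cn_ex_x (n : nat) (f : R -> R -> R) (x y : R) : Cn (S n) U f -> U (x, y) ->
  ex_derive (fun t => f t y) x.
Proof. intros Hf Hxy; apply (Hf x y Hxy). Qed.

Lemma Cn_ex_y (n : nat) (f : R -> R -> R) (x y : R) : Cn (S n) U f -> U (x, y) ->
  ex_derive (fun t => f x t) y.
Proof. intros Hf Hxy; apply (Hf x y Hxy). Qed.

Lemma Cn_Dx (n : nat) (f : R -> R -> R) : Cn (S n) U f -> Cn n U (Dx f).
Proof. intros Hf x y Hxy; exact (ex_diff_n_deriv_aux1 f n x y (Hf x y Hxy)). Qed.

Lemma Cn_Dy (n : nat) (f : R -> R -> R) : Cn (S n) U f -> Cn n U (Dy f).
Proof. intros Hf x y Hxy; exact (ex_diff_n_deriv_aux2 f n x y (Hf x y Hxy)). Qed.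

Lemma Cn_S_intro (n : nat) (f fx fy : R -> R -> R) :
  (forall x y, U (x, y) -> continuity_2d_pt f x y) ->
  (forall x y, U (x, y) -> is_derive (fun t => f t y) x (fx x y)) ->
  (forall x y, U (x, y) -> is_derive (fun t => f x t) y (fy x y)) ->
  Cn n U fx -> Cn n U fy -> Cn (S n) U f.
Proof.
  intros Hc Hx Hy Cx Cy x y Hxy; split; [apply Hc, Hxy|].
  split; [exists (fx x y); apply Hx, Hxy|split; [exists (fy x y); apply Hy, Hxy|split]].
  - apply (Cn_ext n fx (Dx f)); auto.
    intros u v Huv; symmetry; apply is_derive_unique, Hx, Huv.
  - apply (Cn_ext n fy (Dy f)); auto.
    intros u v Huv; symmetry; apply is_derive_unique, Hy, Huv.
Qed.

Lemma Cn_is_x (n : nat) (f : R -> R -> R) (x y : R) : Cn (S n) U f -> U (x, y) ->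
  is_derive (fun t => f t y) x (Dx f x y).
Proof. intros Hf Hxy; apply Derive_correct, (Cn_ex_x n); assumption. Qed.

Lemma Cn_is_y (n : nat) (f : R -> R -> R) (x y : R) : Cn (S n) U f -> U (x, y) ->
  is_derive (fun t => f x t) y (Dy f x y).
Proof. intros Hf Hxy; apply Derive_correct, (Cn_ex_y n); assumption. Qed.

Lemma Cn_const (n : nat) (c : R) : Cn n U (fun _ _ => c).
Proof.
  revert c; induction n as [|n IH]; intros c.
  - intros x y _; split; [apply continuity_2d_pt_const|auto].
  - apply Cn_S_intro with (fun _ _ => 0) (fun _ _ => 0); auto.
    + intros x y _; apply continuity_2d_pt_const.
    + intros x y _; exact (is_derive_const (K := R_AbsRing) (V := R_NormedModule) c x).
    + intros x y _; exact (is_derive_const (K := R_AbsRing) (V := R_NormedModule) c y).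
Qed.

Lemma Cn_plus (n : nat) (f g : R -> R -> R) : Cn n U f -> Cn n U g ->
  Cn n U (fun x y => f x y + g x y).
Proof.
  revert f g; induction n as [|n IH]; intros f g Hf Hg.
  - intros x y Hxy; split; [|auto]; apply continuity_2d_pt_plus; [apply (Hf x y Hxy)|apply (Hg x y Hxy)].
  - apply Cn_S_intro with (fun x y => Dx f x y + Dx g x y) (fun x y => Dy f x y + Dy g x y).
    + intros x y Hxy; apply continuity_2d_pt_plus; eapply Cn_cont; eauto.
    + intros x y Hxy; exact (is_derive_plus (K := R_AbsRing) (V := R_NormedModule) _ _ x _ _
        (Cn_is_x n f x y Hf Hxy) (Cn_is_x n g x y Hg Hxy)).
    + intros x y Hxy; exact (is_derive_plus (K := R_AbsRing) (V := R_NormedModule) _ _ y _ _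
        (Cn_is_y n f x y Hf Hxy) (Cn_is_y n g x y Hg Hxy)).
    + apply IH; apply Cn_Dx; assumption.
    + apply IH; apply Cn_Dy; assumption.
Qed.

Lemma Cn_mult (n : nat) (f g : R -> R -> R) : Cn n U f -> Cn n U g ->
  Cn n U (fun x y => f x y * g x y).
Proof.
  revert f g; induction n as [|n IH]; intros f g Hf Hg.
  - intros x y Hxy; split; [|auto]; apply continuity_2d_pt_mult; [apply (Hf x y Hxy)|apply (Hg x y Hxy)].
  - assert (Wf := Cn_weaken (S n) n f ltac:(lia) Hf); assert (Wg := Cn_weaken (S n) n g ltac:(lia) Hg).
    apply Cn_S_intro with (fun x y => Dx f x y * g x y + f x y * Dx g x y)
      (fun x y => Dy f x y * g x y + f x y * Dy g x y).
    + intros x y Hxy; apply continuity_2d_pt_mult; eapply Cn_cont; eauto.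
    + intros x y Hxy; exact (Derive.is_derive_mult _ _ x _ _
        (Cn_is_x n f x y Hf Hxy) (Cn_is_x n g x y Hg Hxy)).
    + intros x y Hxy; exact (Derive.is_derive_mult _ _ y _ _
        (Cn_is_y n f x y Hf Hxy) (Cn_is_y n g x y Hg Hxy)).
    + apply Cn_plus; apply IH; auto; apply Cn_Dx; assumption.
    + apply Cn_plus; apply IH; auto; apply Cn_Dy; assumption.
Qed.

Lemma Cn_opp (n : nat) (f : R -> R -> R) : Cn n U f -> Cn n U (fun x y => - f x y).
Proof.
  intros Hf; apply Cn_ext with (fun x y => -1 * f x y); [intros; ring|].
  apply Cn_mult; [apply Cn_const|exact Hf].
Qed.

Lemma Cn_minus (n : nat) (f g : R -> R -> R) : Cn n U f -> Cn n U g ->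
  Cn n U (fun x y => f x y - g x y).
Proof. intros Hf Hg; apply Cn_plus; [|apply Cn_opp]; assumption. Qed.

Lemma Cn_inv (n : nat) (f : R -> R -> R) : (forall x y, U (x, y) -> f x y <> 0) ->
  Cn n U f -> Cn n U (fun x y => / f x y).
Proof.
  intros H0; induction n as [|n IH]; intros Hf.
  - intros x y Hxy; split; [|auto]; apply continuity_2d_pt_inv; [apply (Hf x y Hxy)|auto].
  - assert (Wf := Cn_weaken (S n) n f ltac:(lia) Hf); assert (Wi := IH Wf).
    apply Cn_S_intro with (fun x y => - (Dx f x y) * (/ f x y * / f x y))
      (fun x y => - (Dy f x y) * (/ f x y * / f x y)).
    + intros x y Hxy; apply continuity_2d_pt_inv; [eapply Cn_cont; eauto|auto].
    + intros x y Hxy.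
      replace (- Dx f x y * (/ f x y * / f x y)) with (- Dx f x y / f x y ^ 2) by (field; auto).
      exact (is_derive_inv (fun t => f t y) x _ (Cn_is_x n f x y Hf Hxy) (H0 x y Hxy)).
    + intros x y Hxy.
      replace (- Dy f x y * (/ f x y * / f x y)) with (- Dy f x y / f x y ^ 2) by (field; auto).
      exact (is_derive_inv (fun t => f x t) y _ (Cn_is_y n f x y Hf Hxy) (H0 x y Hxy)).
    + apply Cn_mult; [apply Cn_opp, Cn_Dx, Hf|apply Cn_mult; exact Wi].
    + apply Cn_mult; [apply Cn_opp, Cn_Dy, Hf|apply Cn_mult; exact Wi].
Qed.

Lemma Dx_plus (f g : R -> R -> R) (x y : R) : smooth U f -> smooth U g -> U (x, y) ->
  Dx (fun x y => f x y + g x y) x y = Dx f x y + Dx g x y.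
Proof.
  intros Hf Hg Hxy; apply Derive_plus; [exact (Cn_ex_x 0 f x y (Hf 1%nat) Hxy)|exact (Cn_ex_x 0 g x y (Hg 1%nat) Hxy)].
Qed.

Lemma Dy_plus (f g : R -> R -> R) (x y : R) : smooth U f -> smooth U g -> U (x, y) ->
  Dy (fun x y => f x y + g x y) x y = Dy f x y + Dy g x y.
Proof.
  intros Hf Hg Hxy; apply Derive_plus; [exact (Cn_ex_y 0 f x y (Hf 1%nat) Hxy)|exact (Cn_ex_y 0 g x y (Hg 1%nat) Hxy)].
Qed.

Lemma Dx_mult (f g : R -> R -> R) (x y : R) : smooth U f -> smooth U g -> U (x, y) ->
  Dx (fun x y => f x y * g x y) x y = Dx f x y * g x y + f x y * Dx g x y.
Proof.
  intros Hf Hg Hxy; apply Derive_mult; [exact (Cn_ex_x 0 f x y (Hf 1%nat) Hxy)|exact (Cn_ex_x 0 g x y (Hg 1%nat) Hxy)].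
Qed.

Lemma Dy_mult (f g : R -> R -> R) (x y : R) : smooth U f -> smooth U g -> U (x, y) ->
  Dy (fun x y => f x y * g x y) x y = Dy f x y * g x y + f x y * Dy g x y.
Proof.
  intros Hf Hg Hxy; apply Derive_mult; [exact (Cn_ex_y 0 f x y (Hf 1%nat) Hxy)|exact (Cn_ex_y 0 g x y (Hg 1%nat) Hxy)].
Qed.

Lemma smooth_Dx (f : R -> R -> R) : smooth U f -> smooth U (Dx f).
Proof. intros H n; apply Cn_Dx, H. Qed.

Lemma smooth_Dy (f : R -> R -> R) : smooth U f -> smooth U (Dy f).
Proof. intros H n; apply Cn_Dy, H. Qed.

Lemma smooth_plus (f g : R -> R -> R) : smooth U f -> smooth U g -> smooth U (fun x y => f x y + g x y).
Proof. intros Hf Hg n; apply Cn_plus; auto. Qed.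

Lemma smooth_minus (f g : R -> R -> R) : smooth U f -> smooth U g -> smooth U (fun x y => f x y - g x y).
Proof. intros Hf Hg n; apply Cn_minus; auto. Qed.

Lemma smooth_mult (f g : R -> R -> R) : smooth U f -> smooth U g -> smooth U (fun x y => f x y * g x y).
Proof. intros Hf Hg n; apply Cn_mult; auto. Qed.

Lemma smooth_const (c : R) : smooth U (fun _ _ => c).
Proof. intros n; apply Cn_const. Qed.

Lemma smooth_inv (f : R -> R -> R) : (forall x y, U (x, y) -> f x y <> 0) -> smooth U f ->
  smooth U (fun x y => / f x y).
Proof. intros H0 Hf n; apply Cn_inv; auto. Qed.

Lemma smooth_ext (f g : R -> R -> R) : (forall u v, U (u, v) -> f u v = g u v) ->
  smooth U f -> smooth U g.
Proof. intros E Hf n; apply Cn_ext with f; auto. Qed.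

Lemma smooth_cont (f : R -> R -> R) (x y : R) : smooth U f -> U (x, y) -> continuity_2d_pt f x y.
Proof. intros Hf; exact (Cn_cont 0 f x y (Hf 0%nat)). Qed.

Lemma smooth_schwarz (f : R -> R -> R) (x y : R) : smooth U f -> U (x, y) ->
  Dx (Dy f) x y = Dy (Dx f) x y.
Proof.
  intros Hf Hxy; apply Schwarz.
  - apply (copen_2d U); auto; intros u v Huv; split; [|split; [|split]].
    + exact (Cn_ex_x 0 f u v (Hf 1%nat) Huv).
    + exact (Cn_ex_y 0 f u v (Hf 1%nat) Huv).
    + exact (Cn_ex_x 0 (Dy f) u v (smooth_Dy f Hf 1%nat) Huv).
    + exact (Cn_ex_y 0 (Dx f) u v (smooth_Dx f Hf 1%nat) Huv).
  - exact (smooth_cont (Dx (Dy f)) x y (smooth_Dx _ (smooth_Dy _ Hf)) Hxy).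
  - exact (smooth_cont (Dy (Dx f)) x y (smooth_Dy _ (smooth_Dx _ Hf)) Hxy).
Qed.

(** A complex derivative acts along the two axes by [l] and by [l i]; taking real and imaginary parts
    gives the Cauchy-Riemann equations. *)
Lemma rcderiv_hor (h : C -> C) (x y : R) (l : C) : cderiv h (x, y) l ->
  rcderiv (fun t => h (t, y)) x l.
Proof.
  intros H.
  assert (E : forall t, (t, y) = ((0, y) + RtoC t * 1)%C)
    by (intros; apply injective_projections; simpl; ring).
  apply (rcderiv_ext (fun t => h ((0, y) + RtoC t * 1)%C)); [intros; now rewrite <- E|].
  eapply rcderiv_eq; [|apply rcderiv_comp; [rewrite <- E; exact H|apply rcderiv_affine]]; ring.
Qed.

Lemma rcderiv_ver (h : C -> C) (x y : R) (l : C) : cderiv h (x, y) l ->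
  rcderiv (fun t => h (x, t)) y (l * Ci)%C.
Proof.
  intros H.
  assert (E : forall t, (x, t) = ((x, 0) + RtoC t * Ci)%C)
    by (intros; apply injective_projections; simpl; ring).
  apply (rcderiv_ext (fun t => h ((x, 0) + RtoC t * Ci)%C)); [intros; now rewrite <- E|].
  eapply rcderiv_eq; [|apply rcderiv_comp; [rewrite <- E; exact H|apply rcderiv_affine]]; ring.
Qed.

Lemma is_derive_Re_hor (h : C -> C) (x y : R) : holomorphic_on U h -> U (x, y) ->
  is_derive (fun t => Re (h (t, y))) x (Re (C_derive h (x, y))).
Proof.
  intros Hh Hxy; apply (rcderiv_Re (fun t => h (t, y))), rcderiv_hor.
  apply (proj1 (holomorphic_cderiv U h) Hh _ Hxy).
Qed.

Lemma is_derive_Im_hor (h : C -> C) (x y : R) : holomorphic_on U h -> U (x, y) ->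
  is_derive (fun t => Im (h (t, y))) x (Im (C_derive h (x, y))).
Proof.
  intros Hh Hxy; apply (rcderiv_Im (fun t => h (t, y))), rcderiv_hor.
  apply (proj1 (holomorphic_cderiv U h) Hh _ Hxy).
Qed.

Lemma is_derive_Re_ver (h : C -> C) (x y : R) : holomorphic_on U h -> U (x, y) ->
  is_derive (fun t => Re (h (x, t))) y (- Im (C_derive h (x, y))).
Proof.
  intros Hh Hxy.
  replace (- Im (C_derive h (x, y))) with (Re (C_derive h (x, y) * Ci)) by (simpl; unfold Re, Im; ring).
  apply (rcderiv_Re (fun t => h (x, t))), rcderiv_ver.
  apply (proj1 (holomorphic_cderiv U h) Hh _ Hxy).
Qed.

Lemma is_derive_Im_ver (h : C -> C) (x y : R) : holomorphic_on U h -> U (x, y) ->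
  is_derive (fun t => Im (h (x, t))) y (Re (C_derive h (x, y))).
Proof.
  intros Hh Hxy.
  replace (Re (C_derive h (x, y))) with (Im (C_derive h (x, y) * Ci)) by (simpl; unfold Re, Im; ring).
  apply (rcderiv_Im (fun t => h (x, t))), rcderiv_ver.
  apply (proj1 (holomorphic_cderiv U h) Hh _ Hxy).
Qed.

Lemma holomorphic_continuity_2d (h : C -> C) (x y : R) : holomorphic_on U h -> U (x, y) ->
  continuity_2d_pt (fun u v => Re (h (u, v))) x y /\ continuity_2d_pt (fun u v => Im (h (u, v))) x y.
Proof.
  intros Hh Hxy.
  assert (Hc : @continuous (prod_UniformSpace R_UniformSpace R_UniformSpace) C_UniformSpace
    (fun p => h (fst p, snd p)) (x, y)).
  { apply (continuous_ext (T := C_UniformSpace) (U := C_UniformSpace) h).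
    - intros p; f_equal; apply surjective_pairing.
    - exact (holomorphic_ccont U h _ Hh Hxy). }
  split; [apply (continuity_2d_Re (fun u v => h (u, v)))|apply (continuity_2d_Im (fun u v => h (u, v)))]; exact Hc.
Qed.

Lemma Cn_holomorphic (n : nat) (h : C -> C) : holomorphic_on U h ->
  Cn n U (fun x y => Re (h (x, y))) /\ Cn n U (fun x y => Im (h (x, y))).
Proof.
  revert h; induction n as [|n IH]; intros h Hh.
  - split; intros x y Hxy; (split; [apply holomorphic_continuity_2d; assumption|auto]).
  - destruct (IH (C_derive h) (holomorphic_deriv U h HU Hh)) as [H1 H2].
    split.
    + apply Cn_S_intro with (fun x y => Re (C_derive h (x, y))) (fun x y => - Im (C_derive h (x, y))); auto.
      * intros x y Hxy; apply holomorphic_continuity_2d; assumption.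
      * intros x y; apply is_derive_Re_hor, Hh.
      * intros x y; apply is_derive_Re_ver, Hh.
      * apply Cn_opp, H2.
    + apply Cn_S_intro with (fun x y => Im (C_derive h (x, y))) (fun x y => Re (C_derive h (x, y))); auto.
      * intros x y Hxy; apply holomorphic_continuity_2d; assumption.
      * intros x y; apply is_derive_Im_hor, Hh.
      * intros x y; apply is_derive_Im_ver, Hh.
Qed.

Lemma smooth_Re (h : C -> C) : holomorphic_on U h -> smooth U (fun x y => Re (h (x, y))).
Proof. intros Hh n; apply Cn_holomorphic, Hh. Qed.

Lemma smooth_Im (h : C -> C) : holomorphic_on U h -> smooth U (fun x y => Im (h (x, y))).
Proof. intros Hh n; apply Cn_holomorphic, Hh. Qed.

End Calculus.

(** * Chain rule and logarithm of smooth functions *)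

Lemma smooth_chain (U : C -> Prop) (g : R -> R -> R) (p q : R -> R) (t dp dq : R) :
  copen U -> smooth U g -> U (p t, q t) -> is_derive p t dp -> is_derive q t dq ->
  is_derive (fun s => g (p s) (q s)) t (Dx g (p t) (q t) * dp + Dy g (p t) (q t) * dq).
Proof.
  intros HU Hg Ht Hp Hq.
  apply is_derive_Reals, derivable_pt_lim_comp_2d; [|apply is_derive_Reals; assumption..].
  apply filterdiff_differentiable_pt_lim.
  apply (is_derive_filterdiff g (p t) (q t) (Dx g) (Dy g (p t) (q t))).
  - apply locally_C; destruct (HU _ Ht) as (d & Hd & H); exists d; split; [exact Hd|].
    intros [u v] Huv; exact (Cn_is_x U 0 g u v (Hg 1%nat) (H _ Huv)).
  - exact (Cn_is_y U 0 g _ _ (Hg 1%nat) Ht).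
  - apply continuity_2d_pt_filterlim, (smooth_cont U); [apply smooth_Dx, Hg|exact Ht].
Qed.

Lemma smooth_ln (U : C -> Prop) (g : R -> R -> R) : copen U ->
  (forall x y, U (x, y) -> 0 < g x y) -> smooth U g -> smooth U (fun x y => ln (g x y)).
Proof.
  intros HU Hp Hg n.
  assert (Hi : smooth U (fun x y => / g x y)).
  { apply smooth_inv; auto; intros x y Hxy; specialize (Hp x y Hxy); lra. }
  assert (Hx : forall x y, U (x, y) -> is_derive (fun t => ln (g t y)) x (Dx g x y * / g x y)).
  { intros x y Hxy; exact (is_derive_comp (K := R_AbsRing) (V := R_NormedModule) ln (fun t => g t y) x _ _
       (is_derive_ln _ (Hp x y Hxy)) (Cn_is_x U 0 g x y (Hg 1%nat) Hxy)). }
  assert (Hy : forall x y, U (x, y) -> is_derive (fun t => ln (g x t)) y (Dy g x y * / g x y)).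
  { intros x y Hxy; exact (is_derive_comp (K := R_AbsRing) (V := R_NormedModule) ln (fun t => g x t) y _ _
       (is_derive_ln _ (Hp x y Hxy)) (Cn_is_y U 0 g x y (Hg 1%nat) Hxy)). }
  assert (Hc : forall x y, U (x, y) -> continuity_2d_pt (fun x y => ln (g x y)) x y).
  { intros x y Hxy; apply continuity_1d_2d_pt_comp; [|apply (smooth_cont U); assumption].
    apply derivable_continuous_pt; exists (/ g x y); apply is_derive_Reals, is_derive_ln, Hp, Hxy. }
  destruct n as [|n].
  - intros x y Hxy; split; auto.
  - apply (Cn_S_intro U HU n _ (fun x y => Dx g x y * / g x y) (fun x y => Dy g x y * / g x y)); auto;
      apply smooth_mult; auto; [apply smooth_Dx|apply smooth_Dy]; exact Hg.
Qed.

(** * Polar coordinates *)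

Definition polar (g : R -> R -> R) (s th : R) : R := g (exp s * cos th) (exp s * sin th).

(** The derivatives along [x d/dx + y d/dy] and [- y d/dx + x d/dy], that is, with respect to the
    logarithm of the radius and to the angle. *)
Definition Dr (g : R -> R -> R) (x y : R) : R := x * Dx g x y + y * Dy g x y.
Definition Dth (g : R -> R -> R) (x y : R) : R := - y * Dx g x y + x * Dy g x y.

Definition annulus (r : R) (z : C) : Prop := 0 < Cmod z < r.

Lemma Cmod_polar (s th : R) : Cmod (exp s * cos th, exp s * sin th) = exp s.
Proof.
  transitivity (Cmod (circ (exp s) th)); [f_equal|apply Cmod_circ, Rlt_le, exp_pos].
  apply injective_projections; simpl; ring.
Qed.

Lemma annulus_polar (s s1 th : R) : s < s1 -> annulus (exp s1) (exp s * cos th, exp s * sin th).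
Proof.
  intros H; unfold annulus; rewrite Cmod_polar; split; [apply exp_pos|apply exp_increasing, H].
Qed.

Lemma copen_annulus (r : R) : copen (annulus r).
Proof. apply copen_punctured. Qed.

Lemma smooth_x (U : C -> Prop) : copen U -> smooth U (fun x _ => x).
Proof.
  intros HU n; destruct n as [|n]; [intros x y _; split; [apply continuity_2d_pt_id1|auto]|].
  apply (Cn_S_intro U HU n _ (fun _ _ => 1) (fun _ _ => 0)); try (apply (smooth_const U HU)).
  - intros x y _; apply continuity_2d_pt_id1.
  - intros x y _; exact (is_derive_id (K := R_AbsRing) x).
  - intros x y _; exact (is_derive_const (K := R_AbsRing) (V := R_NormedModule) x y).
Qed.

Lemma smooth_y (U : C -> Prop) : copen U -> smooth U (fun _ y => y).
Proof.
  intros HU n; destruct n as [|n]; [intros x y _; split; [apply continuity_2d_pt_id2|auto]|].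
  apply (Cn_S_intro U HU n _ (fun _ _ => 0) (fun _ _ => 1)); try (apply (smooth_const U HU)).
  - intros x y _; apply continuity_2d_pt_id2.
  - intros x y _; exact (is_derive_const (K := R_AbsRing) (V := R_NormedModule) y x).
  - intros x y _; exact (is_derive_id (K := R_AbsRing) y).
Qed.

Section Polar.
Context (s1 : R).
Let U := annulus (exp s1).

Lemma smooth_Dr (g : R -> R -> R) : smooth U g -> smooth U (Dr g).
Proof.
  intros Hg; apply smooth_plus; try apply copen_annulus; apply smooth_mult; try apply copen_annulus.
  - apply smooth_x, copen_annulus.
  - apply smooth_Dx, Hg.
  - apply smooth_y, copen_annulus.
  - apply smooth_Dy, Hg.
Qed.

Lemma smooth_opp (g : R -> R -> R) : smooth U g -> smooth U (fun x y => - g x y).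
Proof. intros Hg n; apply Cn_opp; [apply copen_annulus|apply Hg]. Qed.

Lemma smooth_Dth (g : R -> R -> R) : smooth U g -> smooth U (Dth g).
Proof.
  intros Hg; apply smooth_plus; try apply copen_annulus; apply smooth_mult; try apply copen_annulus.
  - apply (smooth_opp (fun x y => y)), smooth_y, copen_annulus.
  - apply smooth_Dx, Hg.
  - apply smooth_x, copen_annulus.
  - apply smooth_Dy, Hg.
Qed.

Lemma polar_derive_s (g : R -> R -> R) (s th : R) : smooth U g -> s < s1 ->
  is_derive (fun s => polar g s th) s (polar (Dr g) s th).
Proof.
  intros Hg Hs.
  replace (polar (Dr g) s th) with (Dx g (exp s * cos th) (exp s * sin th) * (exp s * cos th)
     + Dy g (exp s * cos th) (exp s * sin th) * (exp s * sin th)) by (unfold polar, Dr; ring).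
  apply (smooth_chain U g (fun s => exp s * cos th) (fun s => exp s * sin th)); auto.
  - apply copen_annulus.
  - apply annulus_polar, Hs.
  - auto_derive; [auto|ring].
  - auto_derive; [auto|ring].
Qed.

Lemma polar_derive_th (g : R -> R -> R) (s th : R) : smooth U g -> s < s1 ->
  is_derive (fun th => polar g s th) th (polar (Dth g) s th).
Proof.
  intros Hg Hs.
  replace (polar (Dth g) s th) with (Dx g (exp s * cos th) (exp s * sin th) * (- (exp s * sin th))
     + Dy g (exp s * cos th) (exp s * sin th) * (exp s * cos th)) by (unfold polar, Dth; ring).
  apply (smooth_chain U g (fun th => exp s * cos th) (fun th => exp s * sin th)); auto.
  - apply copen_annulus.
  - apply annulus_polar, Hs.
  - auto_derive; [auto|ring].
  - auto_derive; [auto|ring].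
Qed.

Lemma polar_cont (g : R -> R -> R) (s th : R) : smooth U g -> s < s1 -> continuous (fun th => polar g s th) th.
Proof.
  intros Hg Hs; apply (ex_derive_continuous (V := R_NormedModule)).
  exists (polar (Dth g) s th); apply polar_derive_th; assumption.
Qed.

Lemma polar_cont2 (g : R -> R -> R) (s th : R) : smooth U g -> s < s1 -> continuity_2d_pt (polar g) s th.
Proof.
  intros Hg Hs; apply continuity_2d_pt_filterlim.
  assert (Hc := smooth_cont U g (exp s * cos th) (exp s * sin th) Hg (annulus_polar s s1 th Hs)).
  apply continuity_2d_pt_filterlim in Hc.
  assert (He : continuous (fun p : R * R => exp (fst p)) (s, th)).
  { apply (continuous_comp fst exp); [apply continuous_fst|apply continuous_exp]. }
  assert (Hco : continuous (fun p : R * R => cos (snd p)) (s, th)).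
  { apply (continuous_comp snd cos); [apply continuous_snd|apply continuous_cos]. }
  assert (Hsi : continuous (fun p : R * R => sin (snd p)) (s, th)).
  { apply (continuous_comp snd sin); [apply continuous_snd|apply continuous_sin]. }
  exact (continuous_comp (U := prod_UniformSpace R_UniformSpace R_UniformSpace) (V := prod_UniformSpace R_UniformSpace R_UniformSpace)
    (fun p : R * R => (exp (fst p) * cos (snd p), exp (fst p) * sin (snd p)))
    (fun z : R * R => g (fst z) (snd z)) (s, th)
    (continuous_pairC _ _ _ (continuous_Rmult _ _ _ He Hco) (continuous_Rmult _ _ _ He Hsi)) Hc).
Qed.

Definition circle_mean (g : R -> R -> R) (s : R) : R := RInt (fun th => polar g s th) 0 (2 * PI).

Lemma circle_mean_derive (g : R -> R -> R) (s : R) : smooth U g -> s < s1 ->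
  is_derive (circle_mean g) s (circle_mean (Dr g) s).
Proof.
  intros Hg Hs.
  apply (RInt_param_derive (polar g) (polar (Dr g)) 0 (2 * PI) (s - 1) s1 s); [..|lra].
  - intros u x Hu; apply polar_derive_s; [exact Hg|lra].
  - intros u x Hu; apply polar_cont2; [apply smooth_Dr, Hg|lra].
  - intros u x Hu; apply polar_cont; [exact Hg|lra].
Qed.

Lemma circle_mean_Dth (g : R -> R -> R) (s : R) : smooth U g -> s < s1 -> circle_mean (Dth g) s = 0.
Proof.
  intros Hg Hs; apply (is_RInt_unique (V := R_CompleteNormedModule)).
  assert (E : @zero R_NormedModule = minus (polar g s (2 * PI)) (polar g s 0)).
  { unfold polar; rewrite cos_2PI, sin_2PI, cos_0, sin_0; symmetry; exact (minus_eq_zero (G := R_AbelianGroup) _). }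
  change (is_RInt (fun th => polar (Dth g) s th) 0 (2 * PI) (@zero R_NormedModule)); rewrite E.
  apply (is_RInt_derive (V := R_CompleteNormedModule) (fun th => polar g s th)).
  - intros x _; apply polar_derive_th; assumption.
  - intros x _; apply polar_cont; [apply smooth_Dth, Hg|exact Hs].
Qed.

Lemma circle_mean_plus (g h : R -> R -> R) (s : R) : smooth U g -> smooth U h -> s < s1 ->
  circle_mean (fun x y => g x y + h x y) s = circle_mean g s + circle_mean h s.
Proof.
  intros Hg Hh Hs; apply (RInt_plus (V := R_CompleteNormedModule) (fun th => polar g s th) (fun th => polar h s th));
    apply (ex_RInt_continuous (V := R_CompleteNormedModule)); intros; apply polar_cont; assumption.
Qed.

Lemma circle_mean_le (g : R -> R -> R) (s M : R) : smooth U g -> s < s1 ->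
  (forall th, polar g s th <= M) -> circle_mean g s <= 2 * PI * M.
Proof.
  intros Hg Hs HM; unfold circle_mean.
  apply RInt_circle_le; [intros; apply polar_cont; assumption|exact HM].
Qed.

Definition Lap (g : R -> R -> R) (x y : R) : R := Dx (Dx g) x y + Dy (Dy g) x y.

Lemma polar_laplacian (g : R -> R -> R) (x y : R) : smooth U g -> U (x, y) ->
  Dr (Dr g) x y + Dth (Dth g) x y = (x ^ 2 + y ^ 2) * Lap g x y.
Proof.
  intros Hg Hxy.
  assert (HU : copen U) by apply copen_annulus.
  assert (Sx := smooth_x U HU); assert (Sy := smooth_y U HU).
  assert (Sny : smooth U (fun x y => - y)) by (apply (smooth_opp (fun x y => y)), Sy).
  assert (Gx := smooth_Dx U g Hg); assert (Gy := smooth_Dy U g Hg).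
  assert (X1 : Dx (fun x _ => x) x y = 1) by (unfold Dx; apply Derive_id).
  assert (X2 : Dy (fun x _ => x) x y = 0) by (unfold Dy; apply Derive_const).
  assert (Y1 : Dx (fun _ y => y) x y = 0) by (unfold Dx; apply Derive_const).
  assert (Y2 : Dy (fun _ y => y) x y = 1) by (unfold Dy; apply Derive_id).
  assert (N1 : Dx (fun _ y => - y) x y = 0) by (unfold Dx; apply Derive_const).
  assert (N2 : Dy (fun _ y => - y) x y = -1).
  { unfold Dy; rewrite Derive_opp, Derive_id; ring. }
  unfold Dr at 1; unfold Dth at 1.
  unfold Dr, Dth.
  rewrite (Dx_plus U), (Dy_plus U), (Dx_plus U), (Dy_plus U) by (auto; apply smooth_mult; auto).
  rewrite !(Dx_mult U (fun x _ => x)), !(Dx_mult U (fun _ y => y)), !(Dx_mult U (fun _ y => - y)) by auto.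
  rewrite !(Dy_mult U (fun x _ => x)), !(Dy_mult U (fun _ y => y)), !(Dy_mult U (fun _ y => - y)) by auto.
  rewrite X1, X2, Y1, Y2, N1, N2.
  rewrite (smooth_schwarz U HU g x y Hg Hxy); unfold Lap; ring.
Qed.

End Polar.

(** * Vanishing order of positive functions with bounded logarithmic Laplacian *)

Lemma is_derive_continuity_pt (f : R -> R) (x l : R) : is_derive f x l -> continuity_pt f x.
Proof.
  intros H; apply derivable_continuous_pt; exists l; apply is_derive_Reals, H.
Qed.

Lemma circle_mean_opp (s1 : R) (g : R -> R -> R) (s : R) : smooth (annulus (exp s1)) g -> s < s1 ->
  circle_mean (fun x y => - g x y) s = - circle_mean g s.
Proof.
  intros Hg Hs; apply (RInt_opp (V := R_CompleteNormedModule) (fun th => polar g s th)).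
  apply (ex_RInt_continuous (V := R_CompleteNormedModule)); intros.
  apply (polar_cont s1); assumption.
Qed.

Lemma Lap_ln (U : C -> Prop) (g : R -> R -> R) (x y : R) : copen U -> smooth U g ->
  (forall x y, U (x, y) -> 0 < g x y) -> U (x, y) ->
  Lap (fun x y => ln (g x y)) x y = (g x y * Lap g x y - (Dx g x y ^ 2 + Dy g x y ^ 2)) / g x y ^ 2.
Proof.
  intros HU Hg Hp Hxy.
  assert (P := Hp x y Hxy).
  assert (E1 : Dx (Dx (fun x y => ln (g x y))) x y = Dx (fun x y => Dx g x y / g x y) x y).
  { apply (Dx_ext U HU); [|exact Hxy]; intros u v Huv; apply is_derive_unique.
    exact (is_derive_comp (K := R_AbsRing) (V := R_NormedModule) ln (fun t => g t v) u _ _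
       (is_derive_ln _ (Hp u v Huv)) (Cn_is_x U 0 g u v (Hg 1%nat) Huv)). }
  assert (E2 : Dy (Dy (fun x y => ln (g x y))) x y = Dy (fun x y => Dy g x y / g x y) x y).
  { apply (Dy_ext U HU); [|exact Hxy]; intros u v Huv; apply is_derive_unique.
    exact (is_derive_comp (K := R_AbsRing) (V := R_NormedModule) ln (fun t => g u t) v _ _
       (is_derive_ln _ (Hp u v Huv)) (Cn_is_y U 0 g u v (Hg 1%nat) Huv)). }
  unfold Lap at 1; rewrite E1, E2.
  assert (F1 : Dx (fun x y => Dx g x y / g x y) x y = (Dx (Dx g) x y * g x y - Dx g x y * Dx g x y) / g x y ^ 2).
  { apply is_derive_unique, (is_derive_div (fun t => Dx g t y) (fun t => g t y)); [..|lra].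
    - exact (Cn_is_x U 0 (Dx g) x y (smooth_Dx U g Hg 1%nat) Hxy).
    - exact (Cn_is_x U 0 g x y (Hg 1%nat) Hxy). }
  assert (F2 : Dy (fun x y => Dy g x y / g x y) x y = (Dy (Dy g) x y * g x y - Dy g x y * Dy g x y) / g x y ^ 2).
  { apply is_derive_unique, (is_derive_div (fun t => Dy g x t) (fun t => g x t)); [..|lra].
    - exact (Cn_is_y U 0 (Dy g) x y (smooth_Dy U g Hg 1%nat) Hxy).
    - exact (Cn_is_y U 0 g x y (Hg 1%nat) Hxy). }
  rewrite F1, F2; unfold Lap; field; lra.
Qed.

(** The circle means of [ln rho], as functions of the logarithm of the radius, have a
    second derivative bounded below by an integrable function near minus infinity, so towards minus
    infinity they decrease at most linearly; a flat zero would make them decrease faster. *)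
Lemma not_flat (s1 : R) (rho : R -> R -> R) (K0 : R) :
  let U := annulus (exp s1) in
  smooth U rho -> (forall x y, U (x, y) -> 0 < rho x y) -> 0 <= K0 ->
  (forall x y, U (x, y) -> Rabs (rho x y * Lap rho x y - (Dx rho x y ^ 2 + Dy rho x y ^ 2)) <= K0 * rho x y ^ 2) ->
  exists k : nat, forall M d, 0 < d ->
    ~ (forall x y, 0 < Cmod (x, y) < d -> rho x y <= M * Cmod (x, y) ^ k).
Proof.
  intros U Hrho Hpos HK HL.
  assert (HU : copen U) by apply copen_annulus.
  set (lam := fun x y => ln (rho x y)).
  assert (Hlam : smooth U lam) by (apply smooth_ln; assumption).
  assert (HLap : forall x y, U (x, y) -> - K0 <= Lap lam x y).
  { intros x y Hxy; unfold lam; rewrite (Lap_ln U) by assumption.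
    specialize (Hpos x y Hxy); specialize (HL x y Hxy).
    apply Rabs_le_between in HL; apply Rle_div_r; [apply pow_lt, Hpos|]; lra. }
  set (m := circle_mean lam); set (m1 := circle_mean (Dr lam)); set (m2 := circle_mean (Dr (Dr lam))).
  assert (D1 : forall s, s < s1 -> is_derive m s (m1 s)) by (intros; apply (circle_mean_derive s1); assumption).
  assert (S1 : smooth U (Dr lam)) by (apply smooth_Dr; assumption).
  assert (S2 : smooth U (Dr (Dr lam))) by (apply smooth_Dr; assumption).
  assert (T1 : smooth U (Dth lam)) by (apply smooth_Dth; assumption).
  assert (T2 : smooth U (Dth (Dth lam))) by (apply smooth_Dth; assumption).
  assert (D2 : forall s, s < s1 -> is_derive m1 s (m2 s)) by (intros; apply (circle_mean_derive s1); assumption).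
  assert (B2 : forall s, s < s1 -> - (2 * PI * (K0 * exp (2 * s))) <= m2 s).
  { intros s Hs.
    assert (E : circle_mean (fun x y => - (Dr (Dr lam) x y + Dth (Dth lam) x y)) s = - m2 s).
    { rewrite (circle_mean_opp s1), (circle_mean_plus s1) by (auto; apply smooth_plus; assumption).
      rewrite (circle_mean_Dth s1) by assumption; unfold m2; ring. }
    assert (L : circle_mean (fun x y => - (Dr (Dr lam) x y + Dth (Dth lam) x y)) s <= 2 * PI * (K0 * exp (2 * s))).
    { apply (circle_mean_le s1); [apply smooth_opp, smooth_plus; assumption|exact Hs|].
      intros th; unfold polar.
      assert (Hin := annulus_polar s s1 th Hs).
      rewrite (polar_laplacian s1) by assumption.
      specialize (HLap _ _ Hin).
      set (X := exp s * cos th) in *; set (Y := exp s * sin th) in *.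
      assert (EX : X ^ 2 + Y ^ 2 = exp (2 * s)).
      { replace (2 * s) with (s + s) by ring; rewrite exp_plus; unfold X, Y.
        transitivity (exp s * exp s * ((sin th)² + (cos th)²)); [unfold Rsqr; ring|].
        rewrite sin2_cos2; ring. }
      rewrite EX; assert (P := exp_pos (2 * s)); nra. }
    rewrite E in L; lra. }
  set (s0 := s1 - 1).
  set (K := m1 s0 + PI * K0 * exp (2 * s0)).
  assert (B1 : forall s, s < s0 -> m1 s <= K).
  { intros s Hs.
    assert (Dmu : forall x, x <= s0 ->
      is_derive (fun s => m1 s + PI * K0 * exp (2 * s)) x (m2 x + PI * K0 * (2 * exp (2 * x)))).
    { intros x Hx.
      assert (De : is_derive (fun s => PI * K0 * exp (2 * s)) x (PI * K0 * (2 * exp (2 * x))))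
        by (auto_derive; [auto|ring]).
      exact (is_derive_plus (K := R_AbsRing) (V := R_NormedModule) _ _ x _ _
        (D2 x ltac:(unfold s0 in *; lra)) De). }
    destruct (MVT_gen (fun s => m1 s + PI * K0 * exp (2 * s)) s s0 (fun s => m2 s + PI * K0 * (2 * exp (2 * s)))) as (c & Hc & E).
    - intros x Hx; rewrite Rmin_left, Rmax_right in Hx by lra; apply Dmu; lra.
    - intros x Hx; rewrite Rmin_left, Rmax_right in Hx by lra.
      apply (is_derive_continuity_pt _ x (m2 x + PI * K0 * (2 * exp (2 * x)))), Dmu; lra.
    - rewrite Rmin_left, Rmax_right in Hc by lra.
      specialize (B2 c ltac:(unfold s0 in *; lra)).
      assert (P := exp_pos (2 * s)); assert (P' := PI_RGT_0).
      assert (0 <= (m2 c + PI * K0 * (2 * exp (2 * c))) * (s0 - s)) by (apply Rmult_le_pos; lra).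
      assert (0 <= PI * K0 * exp (2 * s)) by (apply Rmult_le_pos; [apply Rmult_le_pos; lra|lra]).
      unfold K; lra. }
  assert (B0 : forall s, s < s0 -> m s0 - K * (s0 - s) <= m s).
  { intros s Hs.
    destruct (MVT_gen m s s0 m1) as (c & Hc & E).
    - intros x Hx; rewrite Rmin_left, Rmax_right in Hx by lra; apply D1; unfold s0 in *; lra.
    - intros x Hx; rewrite Rmin_left, Rmax_right in Hx by lra.
      apply (is_derive_continuity_pt _ x (m1 x)), D1; unfold s0 in *; lra.
    - rewrite Rmin_left, Rmax_right in Hc by lra.
      assert (m1 c <= K).
      { destruct (Rlt_le_dec c s0) as [Hlt|Hge]; [apply B1, Hlt|].
        replace c with s0 by lra; unfold K.
        assert (P := exp_pos (2 * s0)); assert (P' := PI_RGT_0).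
        assert (0 <= PI * K0 * exp (2 * s0)) by (apply Rmult_le_pos; [apply Rmult_le_pos; lra|lra]); lra. }
      nra. }
  assert (PP := PI_RGT_0).
  destruct (INR_unbounded ((K + 1) / (2 * PI))) as [k Hk].
  assert (Hk' : K + 1 < 2 * PI * INR k).
  { apply Rmult_lt_compat_l with (r := 2 * PI) in Hk; [|lra].
    replace (2 * PI * ((K + 1) / (2 * PI))) with (K + 1) in Hk by (field; lra); exact Hk. }
  exists k; intros M d Hd Hflat.
  assert (HM : 0 < M).
  { set (s := Rmin s0 (ln d) - 1).
    assert (s < s1) by (unfold s, s0; generalize (Rmin_l (s1 - 1) (ln d)); lra).
    assert (Hs : exp s < d).
    { apply Rlt_le_trans with (exp (ln d)); [apply exp_increasing|rewrite exp_ln; lra].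
      unfold s; generalize (Rmin_r s0 (ln d)); lra. }
    assert (A := Hpos _ _ (annulus_polar s s1 0 H)).
    assert (B := Hflat (exp s * cos 0) (exp s * sin 0)); rewrite Cmod_polar in B.
    specialize (B (conj (exp_pos s) Hs)).
    assert (Q := pow_lt (exp s) k (exp_pos s)); nra. }
  set (A := m s0 - K * s0 - 2 * PI * ln M).
  set (s := Rmin (Rmin s0 (ln d)) (- Rabs A) - 1).
  assert (Hs0 : s < s0).
  { unfold s; generalize (Rmin_l (Rmin s0 (ln d)) (- Rabs A)) (Rmin_l s0 (ln d)); lra. }
  assert (Hsd : exp s < d).
  { apply Rlt_le_trans with (exp (ln d)); [apply exp_increasing|rewrite exp_ln; lra].
    unfold s; generalize (Rmin_l (Rmin s0 (ln d)) (- Rabs A)) (Rmin_r s0 (ln d)); lra. }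
  assert (HsA : s <= - Rabs A - 1) by (unfold s; generalize (Rmin_r (Rmin s0 (ln d)) (- Rabs A)); lra).
  assert (Hs1 : s < s1) by (unfold s0 in *; lra).
  assert (L : m s <= 2 * PI * (ln M + INR k * s)).
  { apply (circle_mean_le s1); [exact Hlam|exact Hs1|].
    intros th; unfold polar, lam.
    assert (Hb := Hflat (exp s * cos th) (exp s * sin th)); rewrite Cmod_polar in Hb.
    specialize (Hb (conj (exp_pos s) Hsd)).
    rewrite <- ln_exp with (x := INR k * s).
    rewrite <- ln_mult by (try exact HM; apply exp_pos).
    apply ln_le; [apply Hpos, annulus_polar, Hs1|].
    apply Rle_trans with (1 := Hb), Req_le; f_equal.
    rewrite <- (exp_ln (exp s ^ k)) by (apply pow_lt, exp_pos).
    rewrite ln_pow, ln_exp by apply exp_pos; reflexivity. }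
  specialize (B0 s Hs0).
  assert (RA := Rle_abs A); assert (RA' := Rle_abs (- A)); rewrite Rabs_Ropp in RA'.
  assert (s < 0) by (assert (Q := Rabs_pos A); lra).
  assert ((2 * PI * INR k - K) * s <= 1 * s) by nra.
  unfold A in *; lra.
Qed.

(** * Leading homogeneous parts *)

Fixpoint vanish (k : nat) (g : R -> R -> R) : Prop :=
  match k with
  | O => True
  | S k => g 0 0 = 0 /\ vanish k (Dx g) /\ vanish k (Dy g)
  end.

(** The homogeneous part of degree [m] of the Taylor expansion at the origin, by Euler's identity. *)
Fixpoint hom (m : nat) (g : R -> R -> R) (x y : R) : R :=
  match m with
  | O => g 0 0
  | S k => (x * hom k (Dx g) x y + y * hom k (Dy g) x y) / INR (S k)
  end.

Lemma hom_scal (m : nat) (g : R -> R -> R) (t x y : R) : hom m g (t * x) (t * y) = t ^ m * hom m g x y.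
Proof.
  revert g; induction m as [|m IH]; intros g; [simpl; ring|].
  change (hom (S m) g (t * x) (t * y)) with ((t * x * hom m (Dx g) (t * x) (t * y) + t * y * hom m (Dy g) (t * x) (t * y)) / INR (S m)).
  change (hom (S m) g x y) with ((x * hom m (Dx g) x y + y * hom m (Dy g) x y) / INR (S m)).
  rewrite !IH; simpl pow; field; apply not_0_INR; lia.
Qed.

Section Jets.
Context (r0 : R) (Hr0 : 0 < r0).
Let U := fun z : C => Cmod z < r0.

Lemma jet_disc_open : copen U.
Proof. apply copen_disc. Qed.

Lemma jet_disc_center : U (0, 0).
Proof.
  unfold U; change (Cmod (RtoC 0) < r0); rewrite Cmod_0; exact Hr0.
Qed.

Lemma jet_disc_scal (t x y : R) : 0 <= t <= 1 -> U (x, y) -> U (t * x, t * y).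
Proof.
  unfold U; intros Ht H.
  replace (t * x, t * y) with (RtoC t * (x, y))%C by (apply injective_projections; simpl; ring).
  rewrite Cmod_mult, Cmod_R, Rabs_pos_eq by lra; assert (P := Cmod_ge_0 (x, y)); nra.
Qed.

Lemma hom_ext (m : nat) (g h : R -> R -> R) (x y : R) :
  (forall u v, U (u, v) -> g u v = h u v) -> hom m g x y = hom m h x y.
Proof.
  revert g h; induction m as [|m IH]; intros g h E; [apply E, jet_disc_center|].
  change ((x * hom m (Dx g) x y + y * hom m (Dy g) x y) / INR (S m)
    = (x * hom m (Dx h) x y + y * hom m (Dy h) x y) / INR (S m)).
  rewrite (IH (Dx g) (Dx h)), (IH (Dy g) (Dy h)); [reflexivity|..].
  - intros u v; apply (Dy_ext U jet_disc_open), E.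
  - intros u v; apply (Dx_ext U jet_disc_open), E.
Qed.

Lemma hom_derive_x (m : nat) (g : R -> R -> R) (x y : R) : smooth U g ->
  is_derive (fun t => hom (S m) g t y) x (hom m (Dx g) x y).
Proof.
  revert g; induction m as [|m IH]; intros g Hg.
  - simpl; auto_derive; [auto|field].
  - assert (A := IH (Dx g) (smooth_Dx U g Hg)); assert (B := IH (Dy g) (smooth_Dy U g Hg)).
    rewrite (hom_ext m (Dx (Dy g)) (Dy (Dx g))) in B by (intros; apply (smooth_schwarz U jet_disc_open); assumption).
    assert (HN : INR (S (S m)) <> 0) by (apply not_0_INR; lia).
    assert (HN' : INR (S m) <> 0) by (apply not_0_INR; lia).
    apply (is_derive_ext (fun t => / INR (S (S m)) * (t * hom (S m) (Dx g) t y + y * hom (S m) (Dy g) t y))).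
    { intros t; change (hom (S (S m)) g t y) with ((t * hom (S m) (Dx g) t y + y * hom (S m) (Dy g) t y) / INR (S (S m))).
      cbv beta; unfold Rdiv; apply Rmult_comm. }
    replace (hom (S m) (Dx g) x y) with
      (/ INR (S (S m)) * ((1 * hom (S m) (Dx g) x y + x * hom m (Dx (Dx g)) x y) + y * hom m (Dy (Dx g)) x y)).
    + apply is_derive_scal.
      exact (is_derive_plus (K := R_AbsRing) (V := R_NormedModule) _ _ x _ _
        (Derive.is_derive_mult (fun t => t) _ x 1 _ (is_derive_id (K := R_AbsRing) x) A)
        (is_derive_scal _ x y _ B)).
    + assert (E : x * hom m (Dx (Dx g)) x y + y * hom m (Dy (Dx g)) x y = INR (S m) * hom (S m) (Dx g) x y).
      { change (hom (S m) (Dx g) x y) with ((x * hom m (Dx (Dx g)) x y + y * hom m (Dy (Dx g)) x y) / INR (S m)).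
        field; exact HN'. }
      rewrite Rplus_assoc, E, (S_INR (S m)); field; rewrite <- S_INR; exact HN.
Qed.

Lemma hom_derive_y (m : nat) (g : R -> R -> R) (x y : R) : smooth U g ->
  is_derive (fun t => hom (S m) g x t) y (hom m (Dy g) x y).
Proof.
  revert g; induction m as [|m IH]; intros g Hg.
  - simpl; auto_derive; [auto|field].
  - assert (A := IH (Dx g) (smooth_Dx U g Hg)); assert (B := IH (Dy g) (smooth_Dy U g Hg)).
    rewrite (hom_ext m (Dy (Dx g)) (Dx (Dy g))) in A by (intros; symmetry; apply (smooth_schwarz U jet_disc_open); assumption).
    assert (HN : INR (S (S m)) <> 0) by (apply not_0_INR; lia).
    assert (HN' : INR (S m) <> 0) by (apply not_0_INR; lia).
    apply (is_derive_ext (fun t => / INR (S (S m)) * (x * hom (S m) (Dx g) x t + t * hom (S m) (Dy g) x t))).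
    { intros t; change (hom (S (S m)) g x t) with ((x * hom (S m) (Dx g) x t + t * hom (S m) (Dy g) x t) / INR (S (S m))).
      cbv beta; unfold Rdiv; apply Rmult_comm. }
    replace (hom (S m) (Dy g) x y) with
      (/ INR (S (S m)) * (x * hom m (Dx (Dy g)) x y + (1 * hom (S m) (Dy g) x y + y * hom m (Dy (Dy g)) x y))).
    + apply is_derive_scal.
      exact (is_derive_plus (K := R_AbsRing) (V := R_NormedModule) _ _ y _ _
        (is_derive_scal _ y x _ A)
        (Derive.is_derive_mult (fun t => t) _ y 1 _ (is_derive_id (K := R_AbsRing) y) B)).
    + assert (E : x * hom m (Dx (Dy g)) x y + y * hom m (Dy (Dy g)) x y = INR (S m) * hom (S m) (Dy g) x y).
      { change (hom (S m) (Dy g) x y) with ((x * hom m (Dx (Dy g)) x y + y * hom m (Dy (Dy g)) x y) / INR (S m)).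
        field; exact HN'. }
      transitivity (/ INR (S (S m)) * (hom (S m) (Dy g) x y + (x * hom m (Dx (Dy g)) x y + y * hom m (Dy (Dy g)) x y))); [ring|].
      rewrite E, (S_INR (S m)); field; rewrite <- S_INR; exact HN.
Qed.

Lemma hom0_vanish (m : nat) (g : R -> R -> R) : smooth U g -> vanish m g ->
  (forall x y, hom m g x y = 0) -> vanish (S m) g.
Proof.
  revert g; induction m as [|m IH]; intros g Hg Hv H0.
  - simpl in *; split; [exact (H0 0 0)|auto].
  - destruct Hv as (H & Hx & Hy); split; [exact H|split].
    + apply IH; [apply smooth_Dx, Hg|exact Hx|]; intros x y.
      rewrite <- (is_derive_unique _ _ _ (hom_derive_x m g x y Hg)).
      rewrite (Derive_ext _ (fun _ => 0)) by (intros; apply H0); apply Derive_const.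
    + apply IH; [apply smooth_Dy, Hg|exact Hy|]; intros x y.
      rewrite <- (is_derive_unique _ _ _ (hom_derive_y m g x y Hg)).
      rewrite (Derive_ext _ (fun _ => 0)) by (intros; apply H0); apply Derive_const.
Qed.

Lemma Cmod_scal (t x y : R) : 0 <= t -> Cmod (t * x, t * y) = t * Cmod (x, y).
Proof.
  intros Ht; replace (t * x, t * y) with (RtoC t * (x, y))%C by (apply injective_projections; simpl; ring).
  rewrite Cmod_mult, Cmod_R, Rabs_pos_eq by lra; reflexivity.
Qed.

Lemma ray_derive (g : R -> R -> R) (t x y : R) : smooth U g -> 0 <= t <= 1 -> U (x, y) ->
  is_derive (fun s => g (s * x) (s * y)) t (Dx g (t * x) (t * y) * x + Dy g (t * x) (t * y) * y).
Proof.
  intros Hg Ht Hxy.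
  apply (smooth_chain U g (fun s => s * x) (fun s => s * y)); [apply jet_disc_open|exact Hg|apply jet_disc_scal; assumption|..];
    (auto_derive; [auto|ring]).
Qed.

(** By induction on the degree, the mean value theorem along rays reducing [g] to its gradient. *)
Lemma taylor_hom (k : nat) (g : R -> R -> R) : smooth U g -> vanish k g ->
  exists K d, 0 <= K /\ 0 < d <= r0 /\
    forall x y, Cmod (x, y) < d -> Rabs (g x y - hom k g x y) <= K * Cmod (x, y) ^ S k.
Proof.
  revert g; induction k as [|k IH]; intros g Hg Hv.
  - assert (Cx := smooth_cont U (Dx g) 0 0 (smooth_Dx U g Hg) jet_disc_center (mkposreal 1 Rlt_0_1)).
    assert (Cy := smooth_cont U (Dy g) 0 0 (smooth_Dy U g Hg) jet_disc_center (mkposreal 1 Rlt_0_1)).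
    destruct Cx as [d1 H1]; destruct Cy as [d2 H2]; simpl in H1, H2.
    set (K := (Rabs (Dx g 0 0) + 1) + (Rabs (Dy g 0 0) + 1)).
    assert (HK : 0 <= K) by (unfold K; generalize (Rabs_pos (Dx g 0 0)) (Rabs_pos (Dy g 0 0)); lra).
    exists K, (Rmin r0 (Rmin d1 d2)); split; [exact HK|split].
    { split; [|apply Rmin_l]; repeat apply Rmin_pos; try apply cond_pos; exact Hr0. }
    intros x y Hxy.
    assert (L1 := Rlt_le_trans _ _ _ Hxy (Rmin_l _ _)).
    assert (L2 := Rlt_le_trans _ _ _ Hxy (Rle_trans _ _ _ (Rmin_r _ _) (Rmin_l _ _))).
    assert (L3 := Rlt_le_trans _ _ _ Hxy (Rle_trans _ _ _ (Rmin_r _ _) (Rmin_r _ _))).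
    assert (Bx : Rabs x <= Cmod (x, y)) by exact (re_le_Cmod (x, y)).
    assert (By : Rabs y <= Cmod (x, y)) by exact (im_le_Cmod (x, y)).
    destruct (MVT_gen (fun s => g (s * x) (s * y)) 0 1 (fun t => Dx g (t * x) (t * y) * x + Dy g (t * x) (t * y) * y)) as (c & Hc & E).
    + intros t Ht; rewrite Rmin_left, Rmax_right in Ht by lra; apply ray_derive; auto; lra.
    + intros t Ht; rewrite Rmin_left, Rmax_right in Ht by lra.
      eapply is_derive_continuity_pt, ray_derive; auto; lra.
    + rewrite Rmin_left, Rmax_right in Hc by lra.
      rewrite !Rmult_1_l, !Rmult_0_l in E; simpl hom; rewrite E.
      assert (Q := Cmod_ge_0 (x, y)).
      assert (Rc : forall u, Rabs u <= Cmod (x, y) -> Rabs (c * u) <= Cmod (x, y)).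
      { intros u Hu; rewrite Rabs_mult, (Rabs_pos_eq c) by lra; assert (P := Rabs_pos u); nra. }
      specialize (H1 (c * x) (c * y)); specialize (H2 (c * x) (c * y)).
      rewrite !Rminus_0_r in H1, H2.
      specialize (H1 ltac:(specialize (Rc x Bx); lra) ltac:(specialize (Rc y By); lra)).
      specialize (H2 ltac:(specialize (Rc x Bx); lra) ltac:(specialize (Rc y By); lra)).
      set (a := Dx g (c * x) (c * y)) in *; set (b := Dy g (c * x) (c * y)) in *.
      assert (Ha : Rabs a <= Rabs (Dx g 0 0) + 1).
      { replace a with ((a - Dx g 0 0) + Dx g 0 0) by ring; apply Rle_trans with (1 := Rabs_triang _ _); lra. }
      assert (Hb : Rabs b <= Rabs (Dy g 0 0) + 1).
      { replace b with ((b - Dy g 0 0) + Dy g 0 0) by ring; apply Rle_trans with (1 := Rabs_triang _ _); lra. }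
      replace ((a * x + b * y) * (1 - 0)) with (a * x + b * y) by ring.
      apply Rle_trans with (1 := Rabs_triang _ _); rewrite !Rabs_mult.
      assert (Rabs a * Rabs x <= (Rabs (Dx g 0 0) + 1) * Cmod (x, y)) by (apply Rmult_le_compat; auto using Rabs_pos).
      assert (Rabs b * Rabs y <= (Rabs (Dy g 0 0) + 1) * Cmod (x, y)) by (apply Rmult_le_compat; auto using Rabs_pos).
      unfold K; lra.
  - destruct Hv as (H0 & Vx & Vy).
    destruct (IH (Dx g) (smooth_Dx U g Hg) Vx) as (K1 & d1 & HK1 & Hd1 & T1).
    destruct (IH (Dy g) (smooth_Dy U g Hg) Vy) as (K2 & d2 & HK2 & Hd2 & T2).
    exists (K1 + K2), (Rmin d1 d2); split; [lra|split].
    { split; [apply Rmin_pos; lra|apply Rle_trans with (1 := Rmin_l _ _); lra]. }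
    intros x y Hxy.
    assert (L1 := Rlt_le_trans _ _ _ Hxy (Rmin_l _ _)).
    assert (L2 := Rlt_le_trans _ _ _ Hxy (Rmin_r _ _)).
    assert (Hin : U (x, y)) by (unfold U; lra).
    assert (Bx : Rabs x <= Cmod (x, y)) by exact (re_le_Cmod (x, y)).
    assert (By : Rabs y <= Cmod (x, y)) by exact (im_le_Cmod (x, y)).
    assert (Q := Cmod_ge_0 (x, y)).
    assert (HN : INR (S k) <> 0) by (apply not_0_INR; lia).
    set (h := x * hom k (Dx g) x y + y * hom k (Dy g) x y).
    assert (Eh : hom (S k) g x y = h / INR (S k)) by reflexivity.
    assert (Dt : forall t, 0 <= t <= 1 -> is_derive (fun s => g (s * x) (s * y) - s ^ S k * (h / INR (S k))) t
      ((Dx g (t * x) (t * y) - t ^ k * hom k (Dx g) x y) * x + (Dy g (t * x) (t * y) - t ^ k * hom k (Dy g) x y) * y)).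
    { intros t Ht.
      assert (De : is_derive (fun s => s ^ S k * (h / INR (S k))) t (t ^ k * h)).
      { replace (t ^ k * h) with (INR (S k) * 1 * t ^ k * (h / INR (S k))) by (field; exact HN).
        rewrite (Rmult_comm _ (h / INR (S k))).
        apply (is_derive_ext (fun s => (h / INR (S k)) * s ^ S k)); [intros; apply Rmult_comm|].
        apply is_derive_scal; exact (is_derive_pow (fun s => s) (S k) t 1 (is_derive_id (K := R_AbsRing) t)). }
      replace ((Dx g (t * x) (t * y) - t ^ k * hom k (Dx g) x y) * x + (Dy g (t * x) (t * y) - t ^ k * hom k (Dy g) x y) * y)
        with ((Dx g (t * x) (t * y) * x + Dy g (t * x) (t * y) * y) - t ^ k * h) by (unfold h; ring).
      exact (is_derive_minus (K := R_AbsRing) (V := R_NormedModule) _ _ t _ _ (ray_derive g t x y Hg Ht Hin) De). }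
    destruct (MVT_gen (fun s => g (s * x) (s * y) - s ^ S k * (h / INR (S k))) 0 1
      (fun t => (Dx g (t * x) (t * y) - t ^ k * hom k (Dx g) x y) * x + (Dy g (t * x) (t * y) - t ^ k * hom k (Dy g) x y) * y))
      as (c & Hc & E).
    + intros t Ht; rewrite Rmin_left, Rmax_right in Ht by lra; apply Dt; lra.
    + intros t Ht; rewrite Rmin_left, Rmax_right in Ht by lra.
      eapply is_derive_continuity_pt, Dt; lra.
    + rewrite Rmin_left, Rmax_right in Hc by lra.
      rewrite !Rmult_1_l, !Rmult_0_l, H0, pow1, pow_ne_zero, Rmult_0_l, Rmult_1_l in E by lia.
      rewrite Eh.
      replace (g x y - h / INR (S k)) with ((g x y - h / INR (S k) - (0 - 0))) by ring; rewrite E.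
      rewrite <- !(hom_scal k _ c x y).
      assert (Mc : Cmod (c * x, c * y) <= Cmod (x, y)) by (rewrite Cmod_scal by lra; nra).
      specialize (T1 (c * x) (c * y) ltac:(lra)); specialize (T2 (c * x) (c * y) ltac:(lra)).
      assert (Pw : Cmod (c * x, c * y) ^ S k <= Cmod (x, y) ^ S k) by (apply pow_incr; split; [apply Cmod_ge_0|exact Mc]).
      set (a := Dx g (c * x) (c * y) - hom k (Dx g) (c * x) (c * y)) in *.
      set (b := Dy g (c * x) (c * y) - hom k (Dy g) (c * x) (c * y)) in *.
      replace ((a * x + b * y) * (1 - 0)) with (a * x + b * y) by ring.
      apply Rle_trans with (1 := Rabs_triang _ _); rewrite !Rabs_mult.
      set (p := Cmod (x, y) ^ S k) in *.
      assert (Ha : Rabs a <= K1 * p) by (apply Rle_trans with (1 := T1), Rmult_le_compat_l; assumption).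
      assert (Hb : Rabs b <= K2 * p) by (apply Rle_trans with (1 := T2), Rmult_le_compat_l; assumption).
      assert (Rabs a * Rabs x <= K1 * p * Cmod (x, y)) by (apply Rmult_le_compat; auto using Rabs_pos).
      assert (Rabs b * Rabs y <= K2 * p * Cmod (x, y)) by (apply Rmult_le_compat; auto using Rabs_pos).
      change (Cmod (x, y) ^ S (S k)) with (Cmod (x, y) * p); lra.
Qed.

(** Taylor's formula in the form in which a differential relation for [g] passes to the limit. *)
Lemma blow_up (k : nat) (g : R -> R -> R) (x y : R) : smooth U g -> vanish k g ->
  is_lim_seq (fun n => g (/ INR (S n) * x) (/ INR (S n) * y) / (/ INR (S n)) ^ k) (hom k g x y).
Proof.
  intros Hg Hv; destruct (taylor_hom k g Hg Hv) as (K & d & HK & Hd & T).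
  assert (Q := Cmod_ge_0 (x, y)).
  apply is_lim_seq_spec; intros eps.
  set (B := K * Cmod (x, y) ^ S k).
  assert (HB : 0 <= B) by (apply Rmult_le_pos; [exact HK|apply pow_le, Q]).
  destruct (INR_unbounded (Cmod (x, y) / d + B / eps)) as [N HN].
  exists N; intros n Hn.
  assert (HNn : INR N < INR (S n)) by (apply lt_INR; lia).
  set (t := / INR (S n)).
  assert (HSn : 0 < INR (S n)) by (apply lt_0_INR; lia).
  assert (Ht : 0 < t) by (apply Rinv_0_lt_compat, HSn).
  assert (He := cond_pos eps).
  assert (P1 : 0 <= Cmod (x, y) / d) by (apply Rle_div_r; lra).
  assert (P2 : 0 <= B / eps) by (apply Rle_div_r; lra).
  assert (E1 : t * Cmod (x, y) < d).
  { assert (A : Cmod (x, y) / d < INR (S n)) by lra.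
    apply Rlt_div_l in A; [|lra].
    unfold t; rewrite Rmult_comm; apply Rlt_div_l; [exact HSn|lra]. }
  assert (E2 : t * B < eps).
  { assert (A : B / eps < INR (S n)) by lra.
    apply Rlt_div_l in A; [|lra].
    unfold t; rewrite Rmult_comm; apply Rlt_div_l; [exact HSn|lra]. }
  assert (Hp : 0 < t ^ k) by (apply pow_lt, Ht).
  specialize (T (t * x) (t * y)); rewrite Cmod_scal, hom_scal in T by lra; specialize (T E1).
  replace (g (t * x) (t * y) / t ^ k - hom k g x y) with ((g (t * x) (t * y) - t ^ k * hom k g x y) / t ^ k) by (field; lra).
  unfold Rdiv; rewrite Rabs_mult, (Rabs_pos_eq (/ t ^ k)) by (apply Rlt_le, Rinv_0_lt_compat, Hp).
  apply Rle_lt_trans with (t * B); [|exact E2].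
  apply Rle_div_l; [exact Hp|].
  apply Rle_trans with (1 := T), Req_le; unfold B; rewrite Rpow_mult_distr; simpl; ring.
Qed.

End Jets.

(** * Leading parts of functions with bounded logarithmic Laplacian *)

Lemma polar_form (x y : R) : exists th, 0 <= th <= 2 * PI /\
  x = Cmod (x, y) * cos th /\ y = Cmod (x, y) * sin th.
Proof.
  assert (PP := PI_RGT_0).
  set (r := Cmod (x, y)).
  assert (Er : r ^ 2 = x ^ 2 + y ^ 2) by exact (Cmod_sqr (x, y)).
  assert (Hr : 0 <= r) by apply Cmod_ge_0.
  destruct (Req_dec r 0) as [E0|N0].
  - exists 0; rewrite E0 in *; split; [lra|]; nra.
  - set (u := x / r); set (v := y / r).
    assert (Ex : x = r * u) by (unfold u; field; exact N0).
    assert (Ey : y = r * v) by (unfold v; field; exact N0).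
    assert (Huv : u ^ 2 + v ^ 2 = 1).
    { unfold u, v; replace ((x / r) ^ 2 + (y / r) ^ 2) with ((x ^ 2 + y ^ 2) / r ^ 2) by (field; exact N0).
      rewrite <- Er; field; exact N0. }
    assert (Hu : -1 <= u <= 1) by nra.
    assert (Es : sqrt (1 - u²) = Rabs v).
    { replace (1 - u²) with (v²) by (unfold Rsqr; nra); apply sqrt_Rsqr_abs. }
    destruct (acos_bound u) as [A1 A2].
    destruct (Rle_dec 0 v) as [Hv|Hv].
    + exists (acos u); rewrite cos_acos, sin_acos, Es, Rabs_pos_eq by auto; split; [lra|auto].
    + exists (2 * PI - acos u); split; [lra|].
      rewrite cos_minus, sin_minus, cos_2PI, sin_2PI, cos_acos, sin_acos, Es, Rabs_left by lra.
      split; [rewrite Ex at 1|rewrite Ey at 1]; ring.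
Qed.

(** A periodic solution of [b b'' = b' ^ 2] is locally of the form
    [C exp (a t)] where it does not vanish; near a maximum it is constant, and the interval of
    constancy can be enlarged by a fixed amount. *)
Lemma log_affine_periodic_const (b b1 b2 : R -> R) (t0 : R) :
  (forall t, is_derive b t (b1 t)) -> (forall t, is_derive b1 t (b2 t)) ->
  (forall t, b (t + 2 * PI) = b t) -> (forall t, b t * b2 t = b1 t ^ 2) ->
  0 <= t0 <= 2 * PI -> 0 < b t0 ->
  exists B, 0 < B /\ forall t, 0 <= t <= 2 * PI -> b t = B.
Proof.
  intros D1 D2 Hper Hode Ht0 Hb0.
  assert (PP := PI_RGT_0).
  assert (H2 : 0 <= 2 * PI) by lra.
  assert (Cb : forall t, continuity_pt b t) by (intros; eapply is_derive_continuity_pt, D1).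
  assert (Cb1 : forall t, continuity_pt b1 t) by (intros; eapply is_derive_continuity_pt, D2).
  destruct (continuity_ab_maj b 0 (2 * PI) H2 (fun t _ => Cb t)) as (t1 & Hmax & Ht1).
  set (B := b t1) in *.
  assert (HB : 0 < B) by (apply Rlt_le_trans with (1 := Hb0), Hmax, Ht0).
  destruct (continuity_ab_maj (fun t => Rabs (b1 t)) 0 (2 * PI) H2) as (t2 & HM & _).
  { intros t _; apply (continuity_pt_comp b1 Rabs); [apply Cb1|apply Rcontinuity_abs]. }
  set (M := Rabs (b1 t2)) in *.
  assert (HM0 : 0 <= M) by apply Rabs_pos.
  assert (Hglob : forall t, -1 < t < 2 * PI + 1 -> b t <= B).
  { intros t Ht.
    assert (P1 := PI2_1); destruct (Rlt_le_dec t 0) as [Hn|Hn].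
    - rewrite <- Hper; apply Hmax; lra.
    - destruct (Rle_lt_dec t (2 * PI)) as [Hp|Hp]; [apply Hmax; lra|].
      replace t with ((t - 2 * PI) + 2 * PI) by ring; rewrite Hper; apply Hmax; lra. }
  assert (Hcrit : forall t, 0 <= t <= 2 * PI -> b t = B -> b1 t = 0).
  { intros t Ht E.
    assert (pr : derivable_pt b t) by (exists (b1 t); apply is_derive_Reals, D1).
    rewrite <- (is_derive_unique _ _ _ (D1 t)), <- (Derive_Reals b t pr).
    apply (deriv_maximum b (t - 1) (t + 1)); [lra|lra|].
    intros u Hu1 Hu2; rewrite E; apply Hglob; lra. }
  set (eta := B / (2 * (M + 1))).
  assert (Heta : 0 < eta) by (apply Rdiv_lt_0_compat; lra).
  assert (HetaM : M * eta <= B / 2).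
  { replace (B / 2) with ((M + 1) * eta) by (unfold eta; field; lra); nra. }
  assert (Hstep : forall s t, 0 <= s <= 2 * PI -> 0 <= t <= 2 * PI -> Rabs (t - s) <= eta -> b s = B -> b t = B).
  { intros s t Hs Ht Hst Es.
    assert (Hpos : forall u, Rmin s t <= u <= Rmax s t -> 0 < b u).
    { intros u Hu.
      assert (Hu' : 0 <= u <= 2 * PI /\ Rabs (u - s) <= eta).
      { unfold Rmin, Rmax in Hu; destruct (Rle_dec s t);
          (split; [lra|]); apply Rabs_le_between; apply Rabs_le_between in Hst; lra. }
      destruct Hu' as [Hu1 Hu2].
      destruct (MVT_gen b s u b1) as (c & Hc & E); [intros; apply D1|intros; apply Cb|].
      assert (Hc' : 0 <= c <= 2 * PI).
      { unfold Rmin, Rmax in Hc; destruct (Rle_dec s u); lra. }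
      assert (L : Rabs (b u - b s) <= M * eta).
      { rewrite E, Rabs_mult; apply Rmult_le_compat; auto using Rabs_pos. }
      apply Rabs_le_between in L; rewrite Es in L; lra. }
    assert (Hb1 : forall u, Rmin s t <= u <= Rmax s t -> b1 u = 0).
    { intros u Hu.
      assert (Hseg : forall v, Rmin s u <= v <= Rmax s u -> Rmin s t <= v <= Rmax s t).
      { intros v; unfold Rmin, Rmax in *; destruct (Rle_dec s t), (Rle_dec s u); lra. }
      assert (Dq : forall v, Rmin s u <= v <= Rmax s u -> is_derive (fun v => b1 v / b v) v 0).
      { intros v Hv; specialize (Hpos v (Hseg v Hv)).
        replace 0 with ((b2 v * b v - b1 v * b1 v) / b v ^ 2).
        - apply is_derive_div; [apply D2|apply D1|lra].
        - replace (b2 v * b v - b1 v * b1 v) with (b v * b2 v - b1 v ^ 2) by ring.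
          rewrite Hode; field; lra. }
      destruct (MVT_gen (fun v => b1 v / b v) s u (fun _ => 0)) as (c & _ & E).
      - intros v Hv; apply Dq; lra.
      - intros v Hv; eapply is_derive_continuity_pt, Dq; lra.
      - rewrite (Hcrit s Hs Es) in E.
        specialize (Hpos u Hu).
        assert (E' : b1 u / b u = 0) by (unfold Rdiv in *; lra).
        apply Rmult_eq_reg_r with (/ b u); [unfold Rdiv in E'; lra|].
        apply Rinv_neq_0_compat; lra. }
    destruct (MVT_gen b s t b1) as (c & Hc & E); [intros; apply D1|intros; apply Cb|].
    rewrite (Hb1 c Hc) in E; lra. }
  assert (Hn : forall n t, 0 <= t <= 2 * PI -> Rabs (t - t1) <= INR n * eta -> b t = B).
  { induction n as [|n IH]; intros t Ht Hd.
    - simpl in Hd; replace t with t1; [reflexivity|].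
      assert (P := Rabs_pos (t - t1)); assert (Z : Rabs (t - t1) = 0) by lra.
      assert (t - t1 = 0) by (destruct (Req_dec (t - t1) 0) as [H|H]; [exact H|apply Rabs_no_R0 in H; lra]); lra.
    - assert (HN : 0 < INR (S n)) by (apply lt_0_INR; lia).
      assert (Hn0 := pos_INR n); rewrite S_INR in *.
      set (l := INR n / (INR n + 1)).
      assert (Hl : 0 <= l <= 1).
      { unfold l; split; [apply Rle_div_r; lra|apply Rle_div_l; lra]. }
      assert (El : l * (INR n + 1) = INR n) by (unfold l; field; lra).
      apply (Hstep (t1 + l * (t - t1))); [nra|exact Ht|..].
      + replace (t - (t1 + l * (t - t1))) with ((1 - l) * (t - t1)) by ring.
        rewrite Rabs_mult, (Rabs_pos_eq (1 - l)) by lra.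
        apply Rle_trans with ((1 - l) * ((INR n + 1) * eta)); [apply Rmult_le_compat_l; lra|].
        apply Req_le; replace ((1 - l) * ((INR n + 1) * eta)) with ((INR n + 1 - l * (INR n + 1)) * eta) by ring.
        rewrite El; ring.
      + apply IH; [nra|].
        replace (t1 + l * (t - t1) - t1) with (l * (t - t1)) by ring.
        rewrite Rabs_mult, (Rabs_pos_eq l) by lra.
        apply Rle_trans with (l * ((INR n + 1) * eta)); [apply Rmult_le_compat_l; lra|].
        apply Req_le; rewrite <- Rmult_assoc, El; reflexivity. }
  exists B; split; [exact HB|]; intros t Ht.
  destruct (INR_unbounded (2 * PI / eta)) as [n Hn'].
  apply (Hn n t Ht).
  apply Rgt_lt, Rlt_div_l in Hn'; [|exact Heta].
  apply Rabs_le_between; lra.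
Qed.

Definition plane (z : C) : Prop := True.

Lemma copen_plane : copen plane.
Proof. intros z _; exists 1; split; [lra|exact (fun _ _ => I)]. Qed.

Lemma smooth_hom (m : nat) (g : R -> R -> R) : smooth plane (hom m g).
Proof.
  assert (HU := copen_plane).
  revert g; induction m as [|m IH]; intros g; [exact (smooth_const plane HU (g 0 0))|].
  apply (smooth_ext plane HU (fun x y => (x * hom m (Dx g) x y + y * hom m (Dy g) x y) * / INR (S m))).
  - reflexivity.
  - apply smooth_mult; [exact HU| |apply smooth_const, HU].
    apply smooth_plus; [exact HU|..]; apply smooth_mult; auto; [apply smooth_x|apply smooth_y]; exact HU.
Qed.

Lemma vanish_hom0 (k : nat) (g : R -> R -> R) (x y : R) : vanish (S k) g -> hom k g x y = 0.
Proof.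
  revert g; induction k as [|k IH]; intros g H; [apply H|].
  destruct H as (_ & Hx & Hy).
  change ((x * hom k (Dx g) x y + y * hom k (Dy g) x y) / INR (S k) = 0).
  rewrite (IH _ Hx), (IH _ Hy); field; apply not_0_INR; lia.
Qed.

Section Leading.
Context (r0 : R) (Hr0 : 0 < r0).
Let U := fun z : C => Cmod z < r0.
Context (rho : R -> R -> R) (K0 : R).
Context (Hrho : smooth U rho) (H00 : rho 0 0 = 0).
Context (Hpos : forall x y, annulus r0 (x, y) -> 0 < rho x y) (HK0 : 0 <= K0).
Context (HL : forall x y, annulus r0 (x, y) ->
  Rabs (rho x y * Lap rho x y - (Dx rho x y ^ 2 + Dy rho x y ^ 2)) <= K0 * rho x y ^ 2).

Let HU : copen U := copen_disc r0.

Lemma leading_part : exists m, vanish m rho /\ exists x y, hom m rho x y <> 0.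
Proof.
  apply NNPP; intros Hno.
  assert (Hall : forall m, vanish m rho).
  { induction m as [|m IH]; [exact I|].
    apply (hom0_vanish r0 Hr0); [exact Hrho|exact IH|].
    intros x y; apply NNPP; intros Hn; apply Hno; exists m; split; [exact IH|now exists x, y]. }
  assert (Er0 : exp (ln r0) = r0) by (apply exp_ln, Hr0).
  destruct (not_flat (ln r0) rho K0) as [k Hk]; rewrite ?Er0; auto.
  - intros n x y [_ Hxy]; exact (Hrho n x y Hxy).
  - destruct (taylor_hom r0 Hr0 k rho Hrho (Hall k)) as (K & d & HK & Hd & T).
    apply (Hk (K * d) d); [lra|]; intros x y Hxy.
    specialize (T x y (proj2 Hxy)).
    rewrite (vanish_hom0 k rho x y (Hall (S k))), Rminus_0_r in T.
    apply Rle_trans with (1 := Rle_abs _), Rle_trans with (1 := T); simpl.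
    assert (P := pow_lt (Cmod (x, y)) k (proj1 Hxy)).
    assert (0 <= K * Cmod (x, y) ^ k) by (apply Rmult_le_pos; lra).
    assert (K * Cmod (x, y) ^ k * Cmod (x, y) <= K * Cmod (x, y) ^ k * d) by (apply Rmult_le_compat_l; lra).
    lra.
Qed.

Lemma scaled_annulus (x y : R) : (x, y) <> (0, 0) ->
  exists N, forall n, (N <= n)%nat -> annulus r0 (/ INR (S n) * x, / INR (S n) * y).
Proof.
  intros Hxy.
  assert (Hp : 0 < Cmod (x, y)) by (apply Cmod_gt_0; exact Hxy).
  destruct (INR_unbounded (Cmod (x, y) / r0)) as [N HN]; exists N; intros n Hn.
  assert (HNn : INR N < INR (S n)) by (apply lt_INR; lia).
  assert (HSn : 0 < INR (S n)) by (apply lt_0_INR; lia).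
  assert (Ht : 0 < / INR (S n)) by (apply Rinv_0_lt_compat, HSn).
  unfold annulus; rewrite Cmod_scal by lra; split; [apply Rmult_lt_0_compat; assumption|].
  assert (A : Cmod (x, y) / r0 < INR (S n)) by lra.
  apply Rlt_div_l in A; [|exact Hr0].
  rewrite Rmult_comm; apply Rlt_div_l; [exact HSn|lra].
Qed.

Lemma leading_nonneg (m : nat) (x y : R) : vanish m rho -> (x, y) <> (0, 0) -> 0 <= hom m rho x y.
Proof.
  intros Hv Hxy; destruct (scaled_annulus x y Hxy) as [N HN].
  assert (L := blow_up r0 Hr0 m rho x y Hrho Hv).
  refine (is_lim_seq_le_loc (fun _ => 0) _ (Finite 0) (Finite (hom m rho x y)) _ (is_lim_seq_const 0) L).
  exists N; intros n Hn; apply Rlt_le, Rdiv_lt_0_compat; [apply Hpos, HN, Hn|].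
  apply pow_lt, Rinv_0_lt_compat, lt_0_INR; lia.
Qed.

Lemma leading_pde (k : nat) (x y : R) : vanish (S (S k)) rho -> (x, y) <> (0, 0) ->
  hom (S (S k)) rho x y * (hom k (Dx (Dx rho)) x y + hom k (Dy (Dy rho)) x y)
    = hom (S k) (Dx rho) x y ^ 2 + hom (S k) (Dy rho) x y ^ 2.
Proof.
  intros Hv Hxy; destruct (scaled_annulus x y Hxy) as [N HN].
  assert (Sx := smooth_Dx U rho Hrho); assert (Sy := smooth_Dy U rho Hrho).
  destruct Hv as (Hv0 & (Hvx0 & Vxx & Vxy) & (Hvy0 & Vyx & Vyy)).
  assert (Hv : vanish (S (S k)) rho) by (repeat split; assumption).
  assert (L := blow_up r0 Hr0 (S (S k)) rho x y Hrho Hv).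
  assert (Lx := blow_up r0 Hr0 (S k) (Dx rho) x y Sx (conj Hvx0 (conj Vxx Vxy))).
  assert (Ly := blow_up r0 Hr0 (S k) (Dy rho) x y Sy (conj Hvy0 (conj Vyx Vyy))).
  assert (Lxx := blow_up r0 Hr0 k (Dx (Dx rho)) x y (smooth_Dx U _ Sx) Vxx).
  assert (Lyy := blow_up r0 Hr0 k (Dy (Dy rho)) x y (smooth_Dy U _ Sy) Vyy).
  set (t := fun n => / INR (S n)).
  assert (Ht : forall n, 0 < t n) by (intros n; apply Rinv_0_lt_compat, lt_0_INR; lia).
  set (u0 := fun n => rho (t n * x) (t n * y) / t n ^ S (S k)).
  set (u1 := fun n => Dx rho (t n * x) (t n * y) / t n ^ S k).
  set (u2 := fun n => Dy rho (t n * x) (t n * y) / t n ^ S k).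
  set (u3 := fun n => Dx (Dx rho) (t n * x) (t n * y) / t n ^ k).
  set (u4 := fun n => Dy (Dy rho) (t n * x) (t n * y) / t n ^ k).
  assert (LL : is_lim_seq (fun n => u0 n * (u3 n + u4 n) - (u1 n * u1 n + u2 n * u2 n))
    (hom (S (S k)) rho x y * (hom k (Dx (Dx rho)) x y + hom k (Dy (Dy rho)) x y)
     - (hom (S k) (Dx rho) x y * hom (S k) (Dx rho) x y + hom (S k) (Dy rho) x y * hom (S k) (Dy rho) x y))).
  { apply is_lim_seq_minus'; [apply is_lim_seq_mult'; [exact L|apply is_lim_seq_plus'; assumption]|].
    apply is_lim_seq_plus'; apply is_lim_seq_mult'; assumption. }
  assert (Lt : is_lim_seq t 0).
  { apply is_lim_seq_spec; intros eps.
    destruct (archimed_cor1 eps (cond_pos eps)) as (M & HM & HM').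
    exists M; intros n Hn; rewrite Rminus_0_r, Rabs_pos_eq by (apply Rlt_le, Ht).
    apply Rle_lt_trans with (2 := HM); apply Rinv_le_contravar; [apply lt_0_INR; lia|apply le_INR; lia]. }
  assert (L0 : is_lim_seq (fun n => K0 * ((t n * u0 n) * (t n * u0 n))) 0).
  { replace (Finite 0) with (Finite (K0 * ((0 * hom (S (S k)) rho x y) * (0 * hom (S (S k)) rho x y)))) by (f_equal; ring).
    apply is_lim_seq_mult'; [apply is_lim_seq_const|]; apply is_lim_seq_mult'; apply is_lim_seq_mult'; assumption. }
  assert (B : forall n, (N <= n)%nat ->
    Rabs (u0 n * (u3 n + u4 n) - (u1 n * u1 n + u2 n * u2 n)) <= K0 * ((t n * u0 n) * (t n * u0 n))).
  { intros n Hn; specialize (HL _ _ (HN n Hn)); fold (t n) in HL.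
    assert (Hp := Ht n); unfold u0, u1, u2, u3, u4, Lap in *.
    set (a := t n) in *; assert (Hk : 0 < a ^ k) by (apply pow_lt, Hp).
    simpl pow; simpl pow in HL.
    set (X := rho (a * x) (a * y)) in *; set (X1 := Dx rho (a * x) (a * y)) in *; set (X2 := Dy rho (a * x) (a * y)) in *.
    set (X3 := Dx (Dx rho) (a * x) (a * y)) in *; set (X4 := Dy (Dy rho) (a * x) (a * y)) in *.
    replace (X / (a * (a * a ^ k)) * (X3 / a ^ k + X4 / a ^ k)
       - (X1 / (a * a ^ k) * (X1 / (a * a ^ k)) + X2 / (a * a ^ k) * (X2 / (a * a ^ k))))
      with ((X * (X3 + X4) - (X1 * (X1 * 1) + X2 * (X2 * 1))) * / ((a * a ^ k) * (a * a ^ k))) by (field; lra).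
    assert (Hd : 0 < (a * a ^ k) * (a * a ^ k)) by (repeat apply Rmult_lt_0_compat; assumption).
    rewrite Rabs_mult, (Rabs_pos_eq (/ _)) by (apply Rlt_le, Rinv_0_lt_compat, Hd).
    apply Rle_div_l; [exact Hd|].
    apply Rle_trans with (1 := HL), Req_le; field; lra. }
  assert (Z : is_lim_seq (fun n => u0 n * (u3 n + u4 n) - (u1 n * u1 n + u2 n * u2 n)) 0).
  { apply is_lim_seq_abs_0.
    apply (is_lim_seq_le_le_loc (fun _ => 0) _ (fun n => K0 * ((t n * u0 n) * (t n * u0 n)))).
    - exists N; intros n Hn; split; [apply Rabs_pos|apply B, Hn].
    - apply is_lim_seq_const.
    - exact L0. }
  assert (E := is_lim_seq_unique _ _ LL); rewrite (is_lim_seq_unique _ _ Z) in E.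
  apply Rbar_finite_eq in E.
  apply Rminus_diag_uniq; rewrite E; ring.
Qed.

(** The logarithm of the leading part is harmonic; on the unit circle it is therefore affine in the
    angle, hence constant, and positivity forces the degree to be even. *)
Theorem leading_power : exists n c K d, (0 < n)%nat /\ 0 < c /\ 0 <= K /\ 0 < d <= r0 /\
  forall x y, Cmod (x, y) < d -> Rabs (rho x y - c * Cmod (x, y) ^ (2 * n)) <= K * Cmod (x, y) ^ S (2 * n).
Proof.
  destruct leading_part as (m & Hv & x0 & y0 & Hne).
  assert (PP := PI_RGT_0).
  destruct m as [|m]; [elim Hne; exact H00|].
  set (q := hom (S m) rho) in *.
  assert (Hz0 : (x0, y0) <> (0, 0)).
  { intros E; injection E; intros -> ->; apply Hne; unfold q.
    assert (A := hom_scal (S m) rho 0 0 0); rewrite !Rmult_0_l, pow_ne_zero, Rmult_0_l in A by lia; exact A. }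
  assert (Hqpos : 0 < q x0 y0) by (assert (A := leading_nonneg (S m) x0 y0 Hv Hz0); fold q in A; lra).
  assert (Hpar : exists n, S m = (2 * n)%nat).
  { destruct (Nat.Even_or_Odd (S m)) as [[n En]|[n En]]; [now exists n|exfalso].
    assert (A := hom_scal (S m) rho (-1) x0 y0).
    assert (Em : (-1) ^ S m = -1) by (rewrite En, pow_add, pow_1_even; ring).
    rewrite Em in A; fold q in A.
    assert (Hz : (-1 * x0, -1 * y0) <> (0, 0)).
    { intros E; apply Hz0; assert (X1 := f_equal fst E); assert (X2 := f_equal snd E).
      unfold fst, snd in X1, X2; apply injective_projections; unfold fst, snd; lra. }
    assert (B := leading_nonneg (S m) _ _ Hv Hz); fold q in B; lra. }
  destruct Hpar as [n En].
  destruct m as [|m]; [lia|].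
  set (qx := hom (S m) (Dx rho)); set (qy := hom (S m) (Dy rho)).
  set (qxx := hom m (Dx (Dx rho))); set (qxy := hom m (Dx (Dy rho))); set (qyy := hom m (Dy (Dy rho))).
  assert (Sq := smooth_hom (S (S m)) rho : smooth plane q).
  assert (Sx := smooth_hom (S m) (Dx rho) : smooth plane qx).
  assert (Sy := smooth_hom (S m) (Dy rho) : smooth plane qy).
  assert (Rx := smooth_Dx U rho Hrho); assert (Ry := smooth_Dy U rho Hrho).
  assert (Eyx : forall x y, hom m (Dy (Dx rho)) x y = qxy x y).
  { intros x y; apply (hom_ext r0 Hr0); intros; symmetry; apply (smooth_schwarz U HU); assumption. }
  assert (E1 : forall x y, Dx q x y = qx x y) by (intros; apply is_derive_unique, (hom_derive_x r0 Hr0), Hrho).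
  assert (E2 : forall x y, Dy q x y = qy x y) by (intros; apply is_derive_unique, (hom_derive_y r0 Hr0), Hrho).
  assert (E3 : forall x y, Dx qx x y = qxx x y) by (intros; apply is_derive_unique, (hom_derive_x r0 Hr0), Rx).
  assert (E4 : forall x y, Dy qx x y = qxy x y).
  { intros x y; rewrite <- Eyx; apply is_derive_unique, (hom_derive_y r0 Hr0), Rx. }
  assert (E5 : forall x y, Dx qy x y = qxy x y) by (intros; apply is_derive_unique, (hom_derive_x r0 Hr0), Ry).
  assert (E6 : forall x y, Dy qy x y = qyy x y) by (intros; apply is_derive_unique, (hom_derive_y r0 Hr0), Ry).
  set (M := INR (S (S m))); assert (HM : M <> 0) by (apply not_0_INR; lia).
  assert (HM' : INR (S m) <> 0) by (apply not_0_INR; lia).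
  assert (EM : INR (S m) = M - 1) by (unfold M; rewrite (S_INR (S m)); ring).
  assert (Eu0 : forall x y, x * qx x y + y * qy x y = M * q x y).
  { intros x y; change (q x y) with ((x * qx x y + y * qy x y) / M); field; exact HM. }
  assert (Eu1 : forall x y, x * qxx x y + y * qxy x y = (M - 1) * qx x y).
  { intros x y; rewrite <- Eyx, <- EM; change (qx x y) with ((x * qxx x y + y * hom m (Dy (Dx rho)) x y) / INR (S m)).
    field; exact HM'. }
  assert (Eu2 : forall x y, x * qxy x y + y * qyy x y = (M - 1) * qy x y).
  { intros x y; rewrite <- EM; change (qy x y) with ((x * qxy x y + y * qyy x y) / INR (S m)).
    field; exact HM'. }
  assert (Pde : forall x y, (x, y) <> (0, 0) -> q x y * (qxx x y + qyy x y) = qx x y ^ 2 + qy x y ^ 2)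
    by (intros x y; exact (leading_pde m x y Hv)).
  set (b := fun t => q (cos t) (sin t)).
  set (b1 := fun t => qx (cos t) (sin t) * (- sin t) + qy (cos t) (sin t) * cos t).
  set (b2 := fun t => ((qxx (cos t) (sin t) * (- sin t) + qxy (cos t) (sin t) * cos t) * (- sin t)
     + qx (cos t) (sin t) * (- cos t)) + ((qxy (cos t) (sin t) * (- sin t) + qyy (cos t) (sin t) * cos t) * cos t
     + qy (cos t) (sin t) * (- sin t))).
  assert (Dc : forall g, smooth plane g -> forall t, is_derive (fun t => g (cos t) (sin t)) t
     (Dx g (cos t) (sin t) * (- sin t) + Dy g (cos t) (sin t) * cos t)).
  { intros g Hg t; apply (smooth_chain plane g cos sin); [apply copen_plane|exact Hg|exact I|apply is_derive_cos|apply is_derive_sin]. }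
  assert (D1 : forall t, is_derive b t (b1 t)).
  { intros t; unfold b1; rewrite <- E1, <- E2; apply Dc, Sq. }
  assert (D2 : forall t, is_derive b1 t (b2 t)).
  { intros t; unfold b2; rewrite <- E3, <- E4, <- E6; rewrite (E4 (cos t)), <- (E5 (cos t)), (E5 (cos t)).
    assert (A1 := Derive.is_derive_mult (fun t => qx (cos t) (sin t)) (fun t => - sin t) t _ _ (Dc qx Sx t)
      (is_derive_opp (K := R_AbsRing) (V := R_NormedModule) _ t _ (is_derive_sin t))).
    assert (A2 := Derive.is_derive_mult (fun t => qy (cos t) (sin t)) cos t _ _ (Dc qy Sy t) (is_derive_cos t)).
    assert (A := is_derive_plus (K := R_AbsRing) (V := R_NormedModule) _ _ t _ _ A1 A2).
    rewrite (E4 (cos t)), (E5 (cos t)) in A; exact A. }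
  assert (Huv : forall t, (cos t, sin t) <> (0, 0)).
  { intros t E; injection E; intros Es Ec; assert (A := sin2_cos2 t); rewrite Es, Ec in A; unfold Rsqr in A; lra. }
  destruct (polar_form x0 y0) as (t0 & Ht0 & Ex0 & Ey0).
  assert (Hr : 0 < Cmod (x0, y0)) by (apply Cmod_gt_0; exact Hz0).
  destruct (log_affine_periodic_const b b1 b2 t0 D1 D2) as (B & HB & Hconst); auto.
  - intros t; unfold b; rewrite cos_plus, sin_plus, cos_2PI, sin_2PI; f_equal; ring.
  - intros t; unfold b, b1, b2.
    assert (A0 := Eu0 (cos t) (sin t)); assert (A1 := Eu1 (cos t) (sin t)); assert (A2 := Eu2 (cos t) (sin t)).
    assert (A3 := Pde (cos t) (sin t) (Huv t)); assert (A4 := sin2_cos2 t); unfold Rsqr in A4.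
    set (c := cos t) in *; set (s := sin t) in *.
    set (Q := q c s) in *; set (Qx := qx c s) in *; set (Qy := qy c s) in *.
    set (Qxx := qxx c s) in *; set (Qxy := qxy c s) in *; set (Qyy := qyy c s) in *.
    assert (F1 : s * s * Qxx - 2 * (s * c) * Qxy + c * c * Qyy = (Qxx + Qyy) - (M - 1) * (M * Q)).
    { rewrite <- A0.
      replace ((M - 1) * (c * Qx + s * Qy)) with (c * ((M - 1) * Qx) + s * ((M - 1) * Qy)) by ring.
      rewrite <- A1, <- A2.
      transitivity ((s * s + c * c) * (Qxx + Qyy) - (c * (c * Qxx + s * Qxy) + s * (c * Qxy + s * Qyy))); [ring|].
      rewrite A4; ring. }
    assert (F2 : (c * Qx + s * Qy) ^ 2 + (Qx * - s + Qy * c) ^ 2 = Qx ^ 2 + Qy ^ 2).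
    { transitivity ((s * s + c * c) * (Qx ^ 2 + Qy ^ 2)); [ring|rewrite A4; ring]. }
    rewrite A0 in F2.
    transitivity (Q * ((s * s * Qxx - 2 * (s * c) * Qxy + c * c * Qyy) - (c * Qx + s * Qy))); [ring|].
    rewrite F1, A0.
    transitivity (Q * (Qxx + Qyy) - (M * Q) ^ 2); [ring|]; rewrite A3; lra.
  - unfold b; assert (A := hom_scal (S (S m)) rho (Cmod (x0, y0)) (cos t0) (sin t0)).
    rewrite <- Ex0, <- Ey0 in A; fold q in A.
    assert (P := pow_lt (Cmod (x0, y0)) (S (S m)) Hr).
    rewrite A in Hqpos; clear - Hqpos P.
    destruct (Rlt_le_dec 0 (q (cos t0) (sin t0))) as [H|H]; [exact H|].
    exfalso; nra.
  - destruct (taylor_hom r0 Hr0 (S (S m)) rho Hrho Hv) as (K & d & HK & Hd & T).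
    exists n, B, K, d; split; [lia|split; [exact HB|split; [exact HK|split; [exact Hd|]]]].
    intros x y Hxy; specialize (T x y Hxy); fold q in T.
    destruct (polar_form x y) as (t & Ht & Ex & Ey).
    assert (A := hom_scal (S (S m)) rho (Cmod (x, y)) (cos t) (sin t)).
    rewrite <- Ex, <- Ey in A; fold q in A; fold (b t) in A; rewrite (Hconst t Ht) in A.
    rewrite A, En, (Rmult_comm _ B) in T; exact T.
Qed.

End Leading.

(** * The mean curvature of a conformally parametrized surface *)

Lemma metric_derive_hyperbolic (p u v w : R3) : 0 < 1 - dot p p ->
  metric_derive hyperbolic p u v w = 16 * dot p u / (1 - dot p p) ^ 3 * dot v w.
Proof.
  intros H; unfold metric_derive, hyperbolic; apply is_derive_unique.
  set (k := dot v w).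
  apply (is_derive_ext (fun t => 4 / (1 - (dot p p + t * (2 * dot p u) + t * t * dot u u)) ^ 2 * k)).
  - intros t.
    replace (dot (lincomb 1 p t u) (lincomb 1 p t u)) with (dot p p + t * (2 * dot p u) + t * t * dot u u);
      [reflexivity|unfold dot, lincomb, c1, c2, c3; simpl; ring].
  - set (pp := dot p p) in *; set (pu := dot p u); set (uu := dot u u).
    auto_derive.
    + replace (1 - (pp + 0 * (2 * pu) + 0 * 0 * uu)) with (1 - pp) by ring.
      replace (1 + - (pp + 0 * (2 * pu) + 0 * 0 * uu)) with (1 - pp) by ring.
      apply Rgt_not_eq; nra.
    + field; lra.
Qed.

(** A Gram identity: [u], [v] and their cross product form an orthogonal frame. *)
Lemma frame_identity (u v a b : R3) (E : R) : dot u u = E -> dot v v = E -> dot u v = 0 ->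
  E ^ 2 * dot a b = E * (dot a u * dot b u + dot a v * dot b v) + dot a (cross u v) * dot b (cross u v).
Proof.
  intros Hu Hv Huv.
  assert (G : dot a (cross u v) * dot b (cross u v) =
    dot a b * (dot u u * dot v v - dot u v ^ 2)
    - dot a u * (dot u b * dot v v - dot u v * dot v b)
    + dot a v * (dot u b * dot u v - dot u u * dot v b)).
  { unfold dot, cross, c1, c2, c3; simpl; ring. }
  rewrite G, Hu, Hv, Huv.
  replace (dot u b) with (dot b u) by (unfold dot; ring).
  replace (dot v b) with (dot b v) by (unfold dot; ring); ring.
Qed.

Lemma cross_norm (u v : R3) (E : R) : dot u u = E -> dot v v = E -> dot u v = 0 ->
  dot (cross u v) (cross u v) = E ^ 2.
Proof.
  intros Hu Hv Huv; assert (G : dot (cross u v) (cross u v) = dot u u * dot v v - dot u v ^ 2)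
    by (unfold dot, cross, c1, c2, c3; simpl; ring).
  rewrite G, Hu, Hv, Huv; ring.
Qed.

Lemma dot_add_l (a b w : R3) : dot (lincomb 1 a 1 b) w = dot a w + dot b w.
Proof. unfold dot, lincomb, c1, c2, c3; simpl; ring. Qed.

Definition lapv (f : C -> R3) (z : C) : R3 := lincomb 1 (dx (dx f) z) 1 (dy (dy f) z).

(** Tested against the normal, the Christoffel terms of the conformal factor reduce to the term with
    [dot f n]. *)
Lemma hyp_mean_curvature_formula (f : C -> R3) (z : C) (E : R) :
  0 < 1 - dot (f z) (f z) -> 0 < E ->
  dot (dx f z) (dx f z) = E -> dot (dy f z) (dy f z) = E -> dot (dx f z) (dy f z) = 0 ->
  let n := cross (dx f z) (dy f z) in
  hyp_mean_curvature f z =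
    (1 - dot (f z) (f z)) * dot (lapv f z) n / (4 * E ^ 2) - dot (f z) n / E.
Proof.
  intros HR HE Hu Hv Huv n.
  unfold hyp_mean_curvature, hyp_second_form, koszul.
  rewrite !metric_derive_hyperbolic by exact HR.
  unfold lapv; rewrite dot_add_l.
  assert (Nn : dot n n = E ^ 2) by (apply cross_norm; assumption).
  assert (Nu : dot (dx f z) n = 0) by (unfold n, dot, cross, c1, c2, c3; simpl; ring).
  assert (Nv : dot (dy f z) n = 0) by (unfold n, dot, cross, c1, c2, c3; simpl; ring).
  set (p := f z) in *; set (R := 1 - dot p p) in *.
  set (u := dx f z) in *; set (v := dy f z) in *.
  set (uu := dx (dx f) z); set (uv := dx (dy f) z); set (vv := dy (dy f) z).
  assert (Hs : / sqrt (hyperbolic p n n) = R / (2 * E)).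
  { unfold hyperbolic; fold R; rewrite Nn.
    replace (4 / R ^ 2 * E ^ 2) with (Rsqr (2 * E / R)) by (unfold Rsqr; field; lra).
    rewrite sqrt_Rsqr by (apply Rlt_le, Rdiv_lt_0_compat; lra); field; lra. }
  assert (EN : hyp_normal f z = lincomb (R / (2 * E)) n 0 n).
  { unfold hyp_normal; fold p u v; fold n; cbv zeta; rewrite Hs; reflexivity. }
  rewrite EN.
  assert (DN : forall a, dot a (lincomb (R / (2 * E)) n 0 n) = R / (2 * E) * dot a n)
    by (intros a; unfold dot, lincomb, c1, c2, c3; simpl; ring).
  unfold hyperbolic; fold R; rewrite !DN, Nu, Nv, Hu, Hv, Huv.
  field; lra.
Qed.

(** For a conformal parametrization the Laplacian [w] of [f] is normal, and mean curvature one then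
    determines it: with denominators cleared, this is the equation
    [Delta (ln (1 - |f|^2)) = - |w|^2 / (4 E)], whose right side stays bounded wherever [f] extends
    smoothly as an immersion. *)
Lemma mean_curvature_one_pde (p u v w : R3) (E : R) :
  0 < E -> dot u u = E -> dot v v = E -> dot u v = 0 -> dot w u = 0 -> dot w v = 0 ->
  (1 - dot p p) * dot w (cross u v) / (4 * E ^ 2) - dot p (cross u v) / E = 1 ->
  (1 - dot p p) * (-2 * dot p w - 4 * E) - ((-2 * dot p u) ^ 2 + (-2 * dot p v) ^ 2)
    = - ((1 - dot p p) ^ 2 * (dot w w / (4 * E))).
Proof.
  intros HE Hu Hv Huv Hwu Hwv H1.
  assert (F1 := frame_identity u v p p E Hu Hv Huv).
  assert (F2 := frame_identity u v p w E Hu Hv Huv).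
  assert (F3 := frame_identity u v w w E Hu Hv Huv).
  rewrite Hwu, Hwv in F2, F3.
  set (n := cross u v) in *.
  set (pp := dot p p) in *; set (pw := dot p w) in *; set (ww := dot w w) in *.
  set (pu := dot p u) in *; set (pv := dot p v) in *; set (pn := dot p n) in *; set (wn := dot w n) in *.
  assert (E2 : E ^ 2 <> 0) by (apply pow_nonzero; lra).
  assert (Ew : ww = (wn / E) ^ 2) by (replace ww with ((E ^ 2 * ww) / E ^ 2) by (field; lra); rewrite F3; field; lra).
  assert (Epw : pw = (pn / E) * (wn / E)) by (replace pw with ((E ^ 2 * pw) / E ^ 2) by (field; lra); rewrite F2; field; lra).
  assert (Epp : pu ^ 2 + pv ^ 2 = E * (pp - (pn / E) ^ 2)).
  { apply Rmult_eq_reg_l with E; [|lra].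
    replace (E * (E * (pp - (pn / E) ^ 2))) with (E ^ 2 * pp - pn ^ 2) by (field; lra); rewrite F1; ring. }
  replace ((-2 * pu) ^ 2 + (-2 * pv) ^ 2) with (4 * (pu ^ 2 + pv ^ 2)) by ring.
  rewrite Epp, Epw, Ew.
  set (phi := pn / E) in *; set (D := wn / E) in *.
  assert (H2 : (1 - pp) * D = 4 * E * (1 + phi)).
  { replace ((1 - pp) * D) with (4 * E * ((1 - pp) * wn / (4 * E ^ 2))) by (unfold D; field; lra).
    replace ((1 - pp) * wn / (4 * E ^ 2)) with (1 + phi) by lra; ring. }
  replace ((1 - pp) ^ 2 * (D ^ 2 / (4 * E))) with (((1 - pp) * D) ^ 2 / (4 * E)) by (field; lra).
  replace ((1 - pp) * (-2 * (phi * D) - 4 * E)) with (-2 * phi * ((1 - pp) * D) - 4 * E * (1 - pp)) by ring.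
  rewrite H2; field; lra.
Qed.

Section Surface.
Context (U : C -> Prop) (HU : copen U).

Lemma smooth_dot3 (a1 a2 a3 b1 b2 b3 : R -> R -> R) :
  smooth U a1 -> smooth U a2 -> smooth U a3 -> smooth U b1 -> smooth U b2 -> smooth U b3 ->
  smooth U (fun x y => a1 x y * b1 x y + a2 x y * b2 x y + a3 x y * b3 x y).
Proof. intros; repeat apply smooth_plus; auto; apply smooth_mult; auto. Qed.

Lemma Dx_dot3 (a1 a2 a3 b1 b2 b3 : R -> R -> R) (x y : R) :
  smooth U a1 -> smooth U a2 -> smooth U a3 -> smooth U b1 -> smooth U b2 -> smooth U b3 -> U (x, y) ->
  Dx (fun x y => a1 x y * b1 x y + a2 x y * b2 x y + a3 x y * b3 x y) x y =
    (Dx a1 x y * b1 x y + Dx a2 x y * b2 x y + Dx a3 x y * b3 x y)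
    + (a1 x y * Dx b1 x y + a2 x y * Dx b2 x y + a3 x y * Dx b3 x y).
Proof.
  intros.
  rewrite (Dx_plus U (fun x y => a1 x y * b1 x y + a2 x y * b2 x y) (fun x y => a3 x y * b3 x y)),
    (Dx_plus U (fun x y => a1 x y * b1 x y) (fun x y => a2 x y * b2 x y)), !(Dx_mult U);
    auto; try (apply smooth_mult; assumption); [ring|].
  apply smooth_plus; auto; apply smooth_mult; assumption.
Qed.

Lemma Dy_dot3 (a1 a2 a3 b1 b2 b3 : R -> R -> R) (x y : R) :
  smooth U a1 -> smooth U a2 -> smooth U a3 -> smooth U b1 -> smooth U b2 -> smooth U b3 -> U (x, y) ->
  Dy (fun x y => a1 x y * b1 x y + a2 x y * b2 x y + a3 x y * b3 x y) x y =
    (Dy a1 x y * b1 x y + Dy a2 x y * b2 x y + Dy a3 x y * b3 x y)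
    + (a1 x y * Dy b1 x y + a2 x y * Dy b2 x y + a3 x y * Dy b3 x y).
Proof.
  intros.
  rewrite (Dy_plus U (fun x y => a1 x y * b1 x y + a2 x y * b2 x y) (fun x y => a3 x y * b3 x y)),
    (Dy_plus U (fun x y => a1 x y * b1 x y) (fun x y => a2 x y * b2 x y)), !(Dy_mult U);
    auto; try (apply smooth_mult; assumption); [ring|].
  apply smooth_plus; auto; apply smooth_mult; assumption.
Qed.

Context (f : C -> R3).
Let f1 := fun x y => c1 (f (x, y)).
Let f2 := fun x y => c2 (f (x, y)).
Let f3 := fun x y => c3 (f (x, y)).

Lemma smooth_on_components : smooth_on U f <-> smooth U f1 /\ smooth U f2 /\ smooth U f3.
Proof.
  split.
  - intros H; repeat split; intros n x y Hxy; apply (H (x, y) n Hxy).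
  - intros (H1 & H2 & H3) [x y] n Hxy; repeat split; [apply H1|apply H2|apply H3]; exact Hxy.
Qed.

Context (Hf : smooth_on U f).

Lemma smooth_f1 : smooth U f1. Proof. apply smooth_on_components, Hf. Qed.
Lemma smooth_f2 : smooth U f2. Proof. apply smooth_on_components, Hf. Qed.
Lemma smooth_f3 : smooth U f3. Proof. apply smooth_on_components, Hf. Qed.

Definition sq_dist (x y : R) : R := 1 - dot (f (x, y)) (f (x, y)).

Lemma smooth_sq_dist : smooth U sq_dist.
Proof.
  apply smooth_minus; [exact HU|apply smooth_const, HU|].
  exact (smooth_dot3 f1 f2 f3 f1 f2 f3 smooth_f1 smooth_f2 smooth_f3 smooth_f1 smooth_f2 smooth_f3).
Qed.

Lemma Dx_sq_dist (x y : R) : U (x, y) -> Dx sq_dist x y = -2 * dot (f (x, y)) (dx f (x, y)).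
Proof.
  intros Hxy; assert (S1 := smooth_f1); assert (S2 := smooth_f2); assert (S3 := smooth_f3).
  assert (E := Dx_dot3 f1 f2 f3 f1 f2 f3 x y S1 S2 S3 S1 S2 S3 Hxy).
  assert (Sd := smooth_dot3 f1 f2 f3 f1 f2 f3 S1 S2 S3 S1 S2 S3).
  assert (E' : Dx sq_dist x y = Dx (fun _ _ => 1) x y
     + Dx (fun x y => -1 * (f1 x y * f1 x y + f2 x y * f2 x y + f3 x y * f3 x y)) x y).
  { rewrite <- (Dx_plus U); auto; [|apply smooth_const, HU|apply smooth_mult; auto; apply smooth_const, HU].
    apply (Dx_ext U HU); [|exact Hxy]; intros u v _; unfold sq_dist, dot; fold (f1 u v) (f2 u v) (f3 u v); ring. }
  rewrite E', (Dx_mult U (fun _ _ => -1)), E by (auto; apply smooth_const, HU).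
  unfold Dx at 1 2; rewrite !Derive_const.
  change (dot (f (x, y)) (dx f (x, y))) with (f1 x y * Dx f1 x y + f2 x y * Dx f2 x y + f3 x y * Dx f3 x y); ring.
Qed.

Lemma Dy_sq_dist (x y : R) : U (x, y) -> Dy sq_dist x y = -2 * dot (f (x, y)) (dy f (x, y)).
Proof.
  intros Hxy; assert (S1 := smooth_f1); assert (S2 := smooth_f2); assert (S3 := smooth_f3).
  assert (E := Dy_dot3 f1 f2 f3 f1 f2 f3 x y S1 S2 S3 S1 S2 S3 Hxy).
  assert (Sd := smooth_dot3 f1 f2 f3 f1 f2 f3 S1 S2 S3 S1 S2 S3).
  assert (E' : Dy sq_dist x y = Dy (fun _ _ => 1) x y
     + Dy (fun x y => -1 * (f1 x y * f1 x y + f2 x y * f2 x y + f3 x y * f3 x y)) x y).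
  { rewrite <- (Dy_plus U); auto; [|apply smooth_const, HU|apply smooth_mult; auto; apply smooth_const, HU].
    apply (Dy_ext U HU); [|exact Hxy]; intros u v _; unfold sq_dist, dot; fold (f1 u v) (f2 u v) (f3 u v); ring. }
  rewrite E', (Dy_mult U (fun _ _ => -1)), E by (auto; apply smooth_const, HU).
  unfold Dy at 1 2; rewrite !Derive_const.
  change (dot (f (x, y)) (dy f (x, y))) with (f1 x y * Dy f1 x y + f2 x y * Dy f2 x y + f3 x y * Dy f3 x y); ring.
Qed.

Lemma Lap_sq_dist (x y : R) : U (x, y) -> Lap sq_dist x y = -2 * dot (f (x, y)) (lapv f (x, y))
  - 2 * (dot (dx f (x, y)) (dx f (x, y)) + dot (dy f (x, y)) (dy f (x, y))).
Proof.
  intros Hxy; assert (S1 := smooth_f1); assert (S2 := smooth_f2); assert (S3 := smooth_f3).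
  assert (X1 := smooth_Dx U _ S1); assert (X2 := smooth_Dx U _ S2); assert (X3 := smooth_Dx U _ S3).
  assert (Y1 := smooth_Dy U _ S1); assert (Y2 := smooth_Dy U _ S2); assert (Y3 := smooth_Dy U _ S3).
  unfold Lap.
  rewrite (Dx_ext U HU (Dx sq_dist) (fun x y => (-2) * (f1 x y * Dx f1 x y + f2 x y * Dx f2 x y + f3 x y * Dx f3 x y)))
    by (auto; intros u v Huv; rewrite Dx_sq_dist by exact Huv; reflexivity).
  rewrite (Dy_ext U HU (Dy sq_dist) (fun x y => (-2) * (f1 x y * Dy f1 x y + f2 x y * Dy f2 x y + f3 x y * Dy f3 x y)))
    by (auto; intros u v Huv; rewrite Dy_sq_dist by exact Huv; reflexivity).
  rewrite (Dx_mult U (fun _ _ => -2)), (Dy_mult U (fun _ _ => -2)), Dx_dot3, Dy_dot3;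
    auto; try apply smooth_const, HU; try (apply smooth_dot3; assumption).
  replace (Dx (fun _ _ => -2) x y) with 0 by (symmetry; exact (Derive_const (-2) x)).
  replace (Dy (fun _ _ => -2) x y) with 0 by (symmetry; exact (Derive_const (-2) y)).
  change (dot (f (x, y)) (lapv f (x, y))) with
    (f1 x y * (1 * Dx (Dx f1) x y + 1 * Dy (Dy f1) x y) + f2 x y * (1 * Dx (Dx f2) x y + 1 * Dy (Dy f2) x y)
      + f3 x y * (1 * Dx (Dx f3) x y + 1 * Dy (Dy f3) x y)).
  change (dot (dx f (x, y)) (dx f (x, y))) with (Dx f1 x y * Dx f1 x y + Dx f2 x y * Dx f2 x y + Dx f3 x y * Dx f3 x y).
  change (dot (dy f (x, y)) (dy f (x, y))) with (Dy f1 x y * Dy f1 x y + Dy f2 x y * Dy f2 x y + Dy f3 x y * Dy f3 x y).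
  ring.
Qed.

Context (Hconf : forall z, U z -> dot (dx f z) (dx f z) = dot (dy f z) (dy f z) /\ dot (dx f z) (dy f z) = 0).

Lemma lap_normal (x y : R) : U (x, y) ->
  dot (lapv f (x, y)) (dx f (x, y)) = 0 /\ dot (lapv f (x, y)) (dy f (x, y)) = 0.
Proof.
  intros Hxy; assert (S1 := smooth_f1); assert (S2 := smooth_f2); assert (S3 := smooth_f3).
  assert (X1 := smooth_Dx U _ S1); assert (X2 := smooth_Dx U _ S2); assert (X3 := smooth_Dx U _ S3).
  assert (Y1 := smooth_Dy U _ S1); assert (Y2 := smooth_Dy U _ S2); assert (Y3 := smooth_Dy U _ S3).
  assert (Heq : forall u v, U (u, v) -> Dx f1 u v * Dx f1 u v + Dx f2 u v * Dx f2 u v + Dx f3 u v * Dx f3 u v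
     = Dy f1 u v * Dy f1 u v + Dy f2 u v * Dy f2 u v + Dy f3 u v * Dy f3 u v)
    by (intros u v Huv; apply (Hconf (u, v) Huv)).
  assert (Hort : forall u v, U (u, v) -> Dx f1 u v * Dy f1 u v + Dx f2 u v * Dy f2 u v + Dx f3 u v * Dy f3 u v = 0)
    by (intros u v Huv; apply (Hconf (u, v) Huv)).
  assert (A1 := Dx_ext U HU _ _ x y Heq Hxy); assert (A2 := Dy_ext U HU _ _ x y Heq Hxy).
  assert (B1 := Dx_ext U HU _ (fun _ _ => 0) x y Hort Hxy); assert (B2 := Dy_ext U HU _ (fun _ _ => 0) x y Hort Hxy).
  rewrite !Dx_dot3 in A1 by auto; rewrite !Dy_dot3 in A2 by auto.
  rewrite Dx_dot3 in B1 by auto; rewrite Dy_dot3 in B2 by auto.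
  replace (Dx (fun _ _ => 0) x y) with 0 in B1 by (symmetry; exact (Derive_const 0 x)).
  replace (Dy (fun _ _ => 0) x y) with 0 in B2 by (symmetry; exact (Derive_const 0 y)).
  rewrite (smooth_schwarz U HU f1 x y S1 Hxy), (smooth_schwarz U HU f2 x y S2 Hxy), (smooth_schwarz U HU f3 x y S3 Hxy) in *.
  change (dot (lapv f (x, y)) (dx f (x, y))) with
    ((1 * Dx (Dx f1) x y + 1 * Dy (Dy f1) x y) * Dx f1 x y + (1 * Dx (Dx f2) x y + 1 * Dy (Dy f2) x y) * Dx f2 x y
      + (1 * Dx (Dx f3) x y + 1 * Dy (Dy f3) x y) * Dx f3 x y).
  change (dot (lapv f (x, y)) (dy f (x, y))) with
    ((1 * Dx (Dx f1) x y + 1 * Dy (Dy f1) x y) * Dy f1 x y + (1 * Dx (Dx f2) x y + 1 * Dy (Dy f2) x y) * Dy f2 x y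
      + (1 * Dx (Dx f3) x y + 1 * Dy (Dy f3) x y) * Dy f3 x y).
  split; lra.
Qed.

Lemma sq_dist_pde (x y : R) : U (x, y) -> 0 < sq_dist x y -> 0 < dot (dx f (x, y)) (dx f (x, y)) ->
  hyp_mean_curvature f (x, y) = 1 ->
  sq_dist x y * Lap sq_dist x y - (Dx sq_dist x y ^ 2 + Dy sq_dist x y ^ 2)
   = - (sq_dist x y ^ 2 * (dot (lapv f (x, y)) (lapv f (x, y)) / (4 * dot (dx f (x, y)) (dx f (x, y))))).
Proof.
  intros Hxy HR HE H1; destruct (Hconf _ Hxy) as [C1 C2]; destruct (lap_normal x y Hxy) as [L1 L2].
  rewrite Lap_sq_dist, Dx_sq_dist, Dy_sq_dist by exact Hxy.
  rewrite (hyp_mean_curvature_formula f (x, y) (dot (dx f (x, y)) (dx f (x, y)))) in H1 by auto.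
  rewrite <- C1.
  assert (P := mean_curvature_one_pde (f (x, y)) (dx f (x, y)) (dy f (x, y)) (lapv f (x, y)) _ HE eq_refl (eq_sym C1) C2 L1 L2 H1).
  unfold sq_dist; rewrite <- P; ring.
Qed.

End Surface.

(** * Null immersions: pointwise algebra *)

(** For [q = F' F^H] the derivative of [F F^H] in the real direction is [q + q^H], and the quotient
    rule applied to [p = (x_1, x_2, x_3) / (x_0 + 1)] gives [ball_tangent q p / (x_0 + 1)] as the
    derivative of [p]. *)
Definition ball_tangent (q11 q12 q21 q22 : C) (p : R3) : R3 :=
  let t := Re q11 + Re q22 in
  (Re q12 + Re q21 - c1 p * t, Im q12 - Im q21 - c2 p * t, Re q11 - Re q22 - c3 p * t).

(** The light-like vector [2 w w^H] in Minkowski coordinates: time and space components. *)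
Definition null0 (w1 w2 : C) : R := Re w1 ^ 2 + Im w1 ^ 2 + (Re w2 ^ 2 + Im w2 ^ 2).
Definition nullv (w1 w2 : C) : R3 :=
  (2 * (Re w1 * Re w2 + Im w1 * Im w2), 2 * (Im w1 * Re w2 - Re w1 * Im w2),
   Re w1 ^ 2 + Im w1 ^ 2 - (Re w2 ^ 2 + Im w2 ^ 2)).

Section Null.
Context (p : R3) (w1 w2 : C).
Let s := dot p p.
Let M11 : C := RtoC (1 + s + 2 * c3 p).
Let M22 : C := RtoC (1 + s - 2 * c3 p).
Let M12 : C := (2 * c1 p, 2 * c2 p).
Let M21 : C := (2 * c1 p, - (2 * c2 p)).
Let A11 : C := (- (w1 * w2))%C.
Let A12 : C := (w1 * w1)%C.
Let A21 : C := (- (w2 * w2))%C.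
Let A22 : C := (w1 * w2)%C.
Let q11 := (A11 * M11 + A12 * M21)%C.
Let q12 := (A11 * M12 + A12 * M22)%C.
Let q21 := (A21 * M11 + A22 * M21)%C.
Let q22 := (A21 * M12 + A22 * M22)%C.
Let u := ball_tangent q11 q12 q21 q22 p.
Let v := ball_tangent (Ci * q11)%C (Ci * q12)%C (Ci * q21)%C (Ci * q22)%C p.
Let g0 := null0 w1 w2.
Let g := nullv w1 w2.
Let k := dot p g.
Let sg := g0 * (1 + s) - 2 * k.

Ltac expand := unfold u, v, ball_tangent, q11, q12, q21, q22, A11, A12, A21, A22, M11, M12, M21, M22, sg, k, g, g0, s,
  null0, nullv, dot, cross, lincomb, c1, c2, c3, Re, Im, Cmult, Cplus, Copp, RtoC, Ci;
  destruct p as [[p1 p2] p3]; destruct w1 as [a1 a2]; destruct w2 as [b1 b2]; simpl fst; simpl snd.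

Lemma null_uu : dot u u = sg ^ 2.
Proof. expand; ring. Qed.

Lemma null_vv : dot v v = sg ^ 2.
Proof. expand; ring. Qed.

Lemma null_uv : dot u v = 0.
Proof. expand; ring. Qed.

Lemma null_cross : cross u v =
  lincomb (sg * (1 - s)) g (- (sg * (2 * (g0 - k)))) p.
Proof. expand; f_equal; [f_equal|]; ring. Qed.

Definition null_normal : R3 := lincomb (1 - s) g (- (2 * (g0 - k))) p.

Lemma null_gg : dot g g = g0 ^ 2.
Proof. expand; ring. Qed.

(** Mean curvature one, after clearing denominators. *)
Lemma null_curvature :
  (1 - s) * (dot g null_normal - g0 * dot p null_normal) - sg * dot p null_normal = sg ^ 2.
Proof.
  assert (E1 : dot g null_normal = (1 - s) * g0 ^ 2 - 2 * (g0 - k) * k).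
  { rewrite <- null_gg; unfold null_normal, k, dot, lincomb, c1, c2, c3; simpl; ring. }
  assert (E2 : dot p null_normal = (1 - s) * k - 2 * (g0 - k) * s).
  { unfold null_normal, k, s, dot, lincomb, c1, c2, c3; simpl; ring. }
  rewrite E1, E2; unfold sg; ring.
Qed.

End Null.

(** A traceless nilpotent matrix is [e] times [w] times the row orthogonal to [w]. *)
Lemma nilpotent_param (A11 A12 A21 : C) : (A11 * A11 + A12 * A21 = 0)%C ->
  exists e w1 w2 : C, (A11 = - (e * (w1 * w2)))%C /\ (A12 = e * (w1 * w1))%C /\ (A21 = - (e * (w2 * w2)))%C.
Proof.
  intros H; destruct (classic (A12 = 0%C)) as [E|N].
  - exists (- A21)%C, 0%C, 1%C; rewrite E in *; repeat split; try ring.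
    assert (H' : (A11 * A11 = 0)%C) by (rewrite <- H; ring).
    assert (A11 = 0%C) as ->; [|ring].
    apply NNPP; intros N; apply (Cmult_neq_0 A11 A11 N N H').
  - exists A12, 1%C, (- A11 / A12)%C; repeat split; try (field; exact N).
    assert (E : A21 = (- (A11 * A11) / A12)%C).
    { transitivity ((A11 * A11 + A12 * A21 - A11 * A11) / A12)%C; [field; exact N|rewrite H; field; exact N]. }
    rewrite E; field; exact N.
Qed.

Lemma ball_tangent_scal (e q11 q12 q21 q22 : C) (p : R3) :
  ball_tangent (e * q11) (e * q12) (e * q21) (e * q22) p =
  lincomb (Re e) (ball_tangent q11 q12 q21 q22 p) (Im e) (ball_tangent (Ci * q11) (Ci * q12) (Ci * q21) (Ci * q22) p).
Proof.
  unfold ball_tangent, lincomb, c1, c2, c3, Cmult, Re, Im, Ci; simpl; f_equal; [f_equal|]; ring.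
Qed.

Definition sqn (z : C) : R := Re z ^ 2 + Im z ^ 2.

Lemma sqn_mult (z w : C) : sqn (z * w) = sqn z * sqn w.
Proof. unfold sqn, Re, Im; simpl; ring. Qed.

Lemma sqn_pos (z : C) : z <> 0%C -> 0 < sqn z.
Proof. intros H; unfold sqn; rewrite <- Cmod_sqr; apply pow_lt, Cmod_gt_0, H. Qed.

Lemma sqn_nonneg (z : C) : 0 <= sqn z.
Proof. unfold sqn; nra. Qed.

(** [a b c d] are the entries of [F] at one point, [a' b' c' d'] those of its derivative; [G11] to
    [G22] are the entries of [F' F^H], [N] and [NA] the squared norms of [F'] and [F' F^{-1}], and
    [(l0, lv)] the Laplacian of [F F^H] in Minkowski coordinates. *)
Section Point.
Context (a b c d a' b' c' d' : C).
Context (Hdet : (a * d - b * c = 1)%C) (Hnull : (a' * d' - b' * c' = 0)%C).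
Context (Htr : (a' * d + a * d' - b' * c - b * c' = 0)%C).
Context (Hne : ~ (a' = 0%C /\ b' = 0%C /\ c' = 0%C /\ d' = 0%C)).

Let x0 := (sqn a + sqn b + sqn c + sqn d) / 2.
Let x3 := (sqn a + sqn b - sqn c - sqn d) / 2.
Let x12 := (a * Cconj c + b * Cconj d)%C.
Let T := x0 + 1.
Let p : R3 := (Re x12 / T, Im x12 / T, x3 / T).
Let s := dot p p.
Let G11 := (a' * Cconj a + b' * Cconj b)%C.
Let G12 := (a' * Cconj c + b' * Cconj d)%C.
Let G21 := (c' * Cconj a + d' * Cconj b)%C.
Let G22 := (c' * Cconj c + d' * Cconj d)%C.
Let fx := lincomb (/ T) (ball_tangent G11 G12 G21 G22 p) 0 p.
Let fy := lincomb (/ T) (ball_tangent (Ci * G11) (Ci * G12) (Ci * G21) (Ci * G22) p) 0 p.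
Let N := sqn a' + sqn b' + sqn c' + sqn d'.
Let l0 := 2 * N.
Let lv : R3 := (4 * Re (a' * Cconj c' + b' * Cconj d'), 4 * Im (a' * Cconj c' + b' * Cconj d'),
  2 * (sqn a' + sqn b' - sqn c' - sqn d')).
Let NA := sqn (a' * d - b' * c) + sqn (b' * a - a' * b) + sqn (c' * d - d' * c) + sqn (d' * a - c' * b).

Lemma point_x0 : 0 < x0.
Proof.
  unfold x0.
  assert (P1 := sqn_nonneg a); assert (P2 := sqn_nonneg b); assert (P3 := sqn_nonneg c); assert (P4 := sqn_nonneg d).
  destruct (Rlt_le_dec 0 (sqn a + sqn b + sqn c + sqn d)) as [H|H]; [lra|exfalso].
  assert (Za : a = 0%C) by (apply NNPP; intros N'; apply sqn_pos in N'; lra).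
  assert (Zb : b = 0%C) by (apply NNPP; intros N'; apply sqn_pos in N'; lra).
  rewrite Za, Zb in Hdet; apply (f_equal Re) in Hdet; simpl in Hdet; lra.
Qed.

Lemma point_hyperboloid : x0 ^ 2 = 1 + (sqn x12 + x3 ^ 2).
Proof.
  assert (E : sqn (a * d - b * c) = (x0 + x3) * (x0 - x3) - sqn x12).
  { unfold x0, x3, x12, sqn, Re, Im, Cconj; simpl; field. }
  rewrite Hdet in E; unfold sqn at 1 in E; simpl in E; lra.
Qed.

Lemma point_T : 0 < T.
Proof. assert (P := point_x0); unfold T; lra. Qed.

Lemma point_s : 1 - s = 2 / T.
Proof.
  assert (P := point_x0); assert (H := point_hyperboloid); assert (PT := point_T).
  assert (E : s = (sqn x12 + x3 ^ 2) / T ^ 2).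
  { unfold s, p, dot, c1, c2, c3, sqn; simpl; field; lra. }
  replace (sqn x12 + x3 ^ 2) with (x0 ^ 2 - 1) in E by lra.
  rewrite E; unfold T; field; unfold T in PT; lra.
Qed.

Lemma point_in_ball : 0 < 1 - s.
Proof. rewrite point_s; apply Rdiv_lt_0_compat; [lra|exact point_T]. Qed.

(** Writing [F' F^{-1} = e w v], with [v] the row orthogonal to [w], makes the pair [f_x],
    [f_y] a copy, rotated and scaled by [e / 2], of two vectors that depend on [w] and [p] only, to
    which the lemmas on light-like vectors apply. In the last clause [w] stands for the Laplacian of [f], known only through its component
    along the normal. *)
Theorem point_null :
  dot fx fx = dot fy fy /\ dot fx fy = 0 /\ 0 < dot fx fx /\ 0 < NA /\
  dot fx fx * NA * T ^ 2 = N ^ 2 /\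
  forall w, T * dot w (cross fx fy) = dot lv (cross fx fy) - l0 * dot p (cross fx fy) ->
    (1 - s) * dot w (cross fx fy) / (4 * dot fx fx ^ 2) - dot p (cross fx fy) / dot fx fx = 1.
Proof.
  assert (PT := point_T); assert (PB := point_in_ball); assert (PS := point_s).
  set (A11 := (a' * d - b' * c)%C); set (A12 := (b' * a - a' * b)%C); set (A21 := (c' * d - d' * c)%C).
  assert (E22 : (d' * a - c' * b = - A11)%C).
  { transitivity ((a' * d + a * d' - b' * c - b * c') - A11)%C; [unfold A11; ring|rewrite Htr; ring]. }
  assert (HA : (A11 * A11 + A12 * A21 = 0)%C).
  { transitivity (- ((a' * d' - b' * c') * (a * d - b * c)) + A11 * (a' * d + a * d' - b' * c - b * c'))%C;
      [unfold A11, A12, A21; ring|rewrite Hnull, Htr; ring]. }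
  destruct (nilpotent_param A11 A12 A21 HA) as (e & w1 & w2 & P11 & P12 & P21).
  assert (Fa : (a' = A11 * a + A12 * c)%C).
  { transitivity (a' * (a * d - b * c))%C; [rewrite Hdet; ring|unfold A11, A12; ring]. }
  assert (Fb : (b' = A11 * b + A12 * d)%C).
  { transitivity (b' * (a * d - b * c))%C; [rewrite Hdet; ring|unfold A11, A12; ring]. }
  assert (Fc : (c' = A21 * a + (- A11) * c)%C).
  { rewrite <- E22; transitivity (c' * (a * d - b * c))%C; [rewrite Hdet; ring|unfold A21; ring]. }
  assert (Fd : (d' = A21 * b + (- A11) * d)%C).
  { rewrite <- E22; transitivity (d' * (a * d - b * c))%C; [rewrite Hdet; ring|unfold A21; ring]. }
  set (M11 := RtoC (1 + s + 2 * c3 p)); set (M22 := RtoC (1 + s - 2 * c3 p)).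
  set (M12 := (2 * c1 p, 2 * c2 p) : C); set (M21 := (2 * c1 p, - (2 * c2 p)) : C).
  assert (Es : 1 + s = (1 - s) * x0).
  { replace (1 + s) with (2 - (1 - s)) by ring; rewrite PS; unfold T; field; unfold T in PT; lra. }
  assert (E3 : 2 * c3 p = (1 - s) * x3) by (rewrite PS; unfold p, c3; simpl; field; lra).
  assert (E1 : 2 * c1 p = (1 - s) * Re x12) by (rewrite PS; unfold p, c1; simpl; field; lra).
  assert (E2 : 2 * c2 p = (1 - s) * Im x12) by (rewrite PS; unfold p, c2; simpl; field; lra).
  set (R0 := RtoC (1 - s)).
  assert (X11 : M11 = (R0 * (a * Cconj a + b * Cconj b))%C).
  { unfold M11, R0; rewrite Es, E3; apply injective_projections; unfold x0, x3, sqn, Re, Im; simpl; field. }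
  assert (X22 : M22 = (R0 * (c * Cconj c + d * Cconj d))%C).
  { unfold M22, R0; rewrite Es, E3; apply injective_projections; unfold x0, x3, sqn, Re, Im; simpl; field. }
  assert (X12 : M12 = (R0 * (a * Cconj c + b * Cconj d))%C).
  { unfold M12, R0; rewrite E1, E2; apply injective_projections; unfold x12, Re, Im; simpl; ring. }
  assert (X21 : M21 = (R0 * (c * Cconj a + d * Cconj b))%C).
  { unfold M21, R0; rewrite E1, E2; apply injective_projections; unfold x12, Re, Im; simpl; ring. }
  set (q11 := (- (w1 * w2) * M11 + (w1 * w1) * M21)%C); set (q12 := (- (w1 * w2) * M12 + (w1 * w1) * M22)%C).
  set (q21 := (- (w2 * w2) * M11 + (w1 * w2) * M21)%C); set (q22 := (- (w2 * w2) * M12 + (w1 * w2) * M22)%C).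
  assert (Q11 : (R0 * G11 = e * q11)%C) by (unfold G11, q11; rewrite Fa, Fb, X11, X21, P11, P12; ring).
  assert (Q12 : (R0 * G12 = e * q12)%C) by (unfold G12, q12; rewrite Fa, Fb, X12, X22, P11, P12; ring).
  assert (Q21 : (R0 * G21 = e * q21)%C) by (unfold G21, q21; rewrite Fc, Fd, X11, X21, P11, P21; ring).
  assert (Q22 : (R0 * G22 = e * q22)%C) by (unfold G22, q22; rewrite Fc, Fd, X12, X22, P11, P21; ring).
  set (u := ball_tangent q11 q12 q21 q22 p); set (v := ball_tangent (Ci * q11) (Ci * q12) (Ci * q21) (Ci * q22) p).
  set (g0 := null0 w1 w2); set (g := nullv w1 w2); set (k := dot p g).
  set (sg := g0 * (1 + s) - 2 * k).
  assert (Uu : dot u u = sg ^ 2) by exact (null_uu p w1 w2).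
  assert (Vv : dot v v = sg ^ 2) by exact (null_vv p w1 w2).
  assert (Uv : dot u v = 0) by exact (null_uv p w1 w2).
  assert (Cr : cross u v = lincomb (sg * (1 - s)) g (- (sg * (2 * (g0 - k)))) p) by exact (null_cross p w1 w2).
  set (m := null_normal p w1 w2).
  assert (Cm : forall y, dot y (cross u v) = sg * dot y m).
  { intros y; rewrite Cr; unfold m, null_normal; fold g0 g k s.
    unfold dot, lincomb, c1, c2, c3; simpl; ring. }
  set (e1 := Re e); set (e2 := Im e).
  assert (EE : sqn e = e1 ^ 2 + e2 ^ 2) by reflexivity.
  assert (Fx : fx = lincomb (e1 / 2) u (e2 / 2) v).
  { assert (H : ball_tangent G11 G12 G21 G22 p = lincomb (/ (1 - s)) (ball_tangent (R0 * G11) (R0 * G12) (R0 * G21) (R0 * G22) p) 0 p).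
    { unfold ball_tangent, lincomb, c1, c2, c3, R0, Re, Im; simpl; f_equal; [f_equal|]; field; lra. }
    unfold fx; rewrite H, Q11, Q12, Q21, Q22, ball_tangent_scal; fold u v e1 e2.
    replace (/ T) with ((1 - s) / 2) by (rewrite PS; field; lra).
    unfold lincomb, c1, c2, c3; simpl; f_equal; [f_equal|]; field; lra. }
  assert (Fy : fy = lincomb (- e2 / 2) u (e1 / 2) v).
  { assert (H : ball_tangent (Ci * G11) (Ci * G12) (Ci * G21) (Ci * G22) p =
      lincomb (/ (1 - s)) (ball_tangent ((Ci * e) * q11) ((Ci * e) * q12) ((Ci * e) * q21) ((Ci * e) * q22) p) 0 p).
    { rewrite <- !Cmult_assoc, <- Q11, <- Q12, <- Q21, <- Q22.
      unfold ball_tangent, lincomb, c1, c2, c3, R0, Re, Im; simpl; f_equal; [f_equal|]; field; lra. }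
    unfold fy; rewrite H, ball_tangent_scal; fold u v.
    replace (Re (Ci * e)) with (- e2) by (unfold e2, Re, Im; simpl; ring).
    replace (Im (Ci * e)) with e1 by (unfold e1, Re, Im; simpl; ring).
    replace (/ T) with ((1 - s) / 2) by (rewrite PS; field; lra).
    unfold lincomb, c1, c2, c3; simpl; f_equal; [f_equal|]; field; lra. }
  assert (Dl : forall x1 x2 y1 y2, dot (lincomb x1 u x2 v) (lincomb y1 u y2 v) =
     x1 * y1 * dot u u + (x1 * y2 + x2 * y1) * dot u v + x2 * y2 * dot v v).
  { intros; unfold dot, lincomb, c1, c2, c3; simpl; ring. }
  assert (Exx : dot fx fx = sqn e * sg ^ 2 / 4) by (rewrite Fx, Dl, Uu, Vv, Uv, EE; field).
  assert (Eyy : dot fy fy = sqn e * sg ^ 2 / 4) by (rewrite Fy, Dl, Uu, Vv, Uv, EE; field).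
  assert (Exy : dot fx fy = 0) by (rewrite Fx, Fy, Dl, Uu, Vv, Uv; field).
  assert (Cn' : forall y, dot y (cross fx fy) = sqn e / 4 * sg * dot y m).
  { intros y; transitivity (sqn e / 4 * dot y (cross u v)); [|rewrite Cm; ring].
    rewrite Fx, Fy, EE; unfold dot, cross, lincomb, c1, c2, c3; simpl; field; lra. }
  (* with [v F = (y1, y2)] below, [F' = e w (v F)], so that the Laplacian of [F F^H] is a
     multiple of the light-like vector of [w] *)
  assert (Hsg : RtoC sg = ((- w2) * (M11 * - Cconj w2 + M12 * Cconj w1) + w1 * (M21 * - Cconj w2 + M22 * Cconj w1))%C).
  { unfold sg, k, g, g0, M11, M12, M21, M22, null0, nullv, dot, c1, c2, c3.
    apply injective_projections; unfold Re, Im; simpl; ring. }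
  set (y1 := (- w2 * a + w1 * c)%C); set (y2 := (- w2 * b + w1 * d)%C).
  assert (Hsg' : sg = (1 - s) * (sqn y1 + sqn y2)).
  { apply RtoC_inj; rewrite Hsg, X11, X12, X21, X22; unfold R0.
    apply injective_projections; unfold y1, y2, sqn, Re, Im; simpl; ring. }
  assert (Ha : (a' = e * w1 * y1)%C) by (rewrite Fa, P11, P12; unfold y1; ring).
  assert (Hb : (b' = e * w1 * y2)%C) by (rewrite Fb, P11, P12; unfold y2; ring).
  assert (Hc : (c' = e * w2 * y1)%C) by (rewrite Fc, P11, P21; unfold y1; ring).
  assert (Hd : (d' = e * w2 * y2)%C) by (rewrite Fd, P11, P21; unfold y2; ring).
  set (Y := sqn y1 + sqn y2) in *.
  assert (Eg0 : g0 = sqn w1 + sqn w2) by reflexivity.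
  assert (EN : N = sqn e * g0 * Y).
  { unfold N; rewrite Ha, Hb, Hc, Hd, !sqn_mult, Eg0; unfold Y; ring. }
  assert (El0 : l0 = 2 * (sqn e * Y) * g0) by (unfold l0; rewrite EN; ring).
  assert (Elv : lv = lincomb (2 * (sqn e * Y)) g 0 p).
  { unfold lv; rewrite Ha, Hb, Hc, Hd; unfold g, nullv, Y, sqn, lincomb, c1, c2, c3, Re, Im; simpl.
    f_equal; [f_equal|]; ring. }
  assert (ENA : NA = sqn e * g0 ^ 2).
  { unfold NA; rewrite E22; fold A11 A12 A21; rewrite P11, P12, P21, Eg0.
    unfold sqn, Re, Im; simpl; ring. }
  assert (Pe : 0 < sqn e).
  { apply sqn_pos; intros Z; apply Hne; rewrite Ha, Hb, Hc, Hd, Z; repeat split; ring. }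
  assert (PN : 0 < N).
  { assert (Q1 := sqn_nonneg a'); assert (Q2 := sqn_nonneg b'); assert (Q3 := sqn_nonneg c'); assert (Q4 := sqn_nonneg d').
    destruct (Rlt_le_dec 0 N) as [H|H]; [exact H|exfalso; apply Hne; unfold N in H].
    repeat split; apply NNPP; intros Z; apply sqn_pos in Z; lra. }
  assert (Pg0' : 0 <= g0) by (rewrite Eg0; generalize (sqn_nonneg w1) (sqn_nonneg w2); lra).
  assert (PY' : 0 <= Y) by (unfold Y; generalize (sqn_nonneg y1) (sqn_nonneg y2); lra).
  assert (Pg0 : 0 < g0) by (destruct Pg0' as [H|H]; [exact H|rewrite <- H in EN; lra]).
  assert (PY : 0 < Y) by (destruct PY' as [H|H]; [exact H|rewrite <- H in EN; lra]).
  assert (Psg : 0 < sg) by (rewrite Hsg'; apply Rmult_lt_0_compat; assumption).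
  assert (Psg2 : 0 < sg ^ 2) by (apply pow_lt, Psg).
  rewrite Eyy, Exx, Exy, ENA, EN.
  repeat split; auto.
  - apply Rdiv_lt_0_compat; [apply Rmult_lt_0_compat; assumption|lra].
  - apply Rmult_lt_0_compat; [exact Pe|apply pow_lt, Pg0].
  - rewrite Hsg'; replace T with (2 / (1 - s)) by (rewrite PS; field; lra); field; lra.
  - intros w Hw; rewrite !Cn' in *.
    assert (W : sg * dot w m = (1 - s) * (sqn e * Y) * (sg * dot g m - g0 * (sg * dot p m))).
    { assert (Lm : dot lv m = 2 * (sqn e * Y) * dot g m).
      { rewrite Elv; unfold dot, lincomb, c1, c2, c3; simpl; ring. }
      rewrite Lm, El0 in Hw.
      apply Rmult_eq_reg_l with (sqn e / 4 * T); [|apply Rgt_not_eq, Rmult_lt_0_compat; lra].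
      transitivity (T * (sqn e / 4 * sg * dot w m)); [ring|]; rewrite Hw, PS; field; lra. }
    assert (NC := null_curvature p w1 w2); fold m g0 g k in NC; fold s in NC; fold sg in NC.
    replace (sqn e / 4 * sg * dot w m) with (sqn e / 4 * (sg * dot w m)) by ring.
    rewrite W.
    replace ((1 - s) * (sqn e * Y) * (sg * dot g m - g0 * (sg * dot p m)))
      with (sqn e * sg ^ 2 * (dot g m - g0 * dot p m)).
    2: { replace ((1 - s) * (sqn e * Y)) with (sqn e * sg) by (rewrite Hsg'; ring); ring. }
    apply Rmult_eq_reg_r with (sg ^ 2); [|lra].
    rewrite Rmult_1_l.
    transitivity ((1 - s) * (dot g m - g0 * dot p m) - sg * dot p m); [field; lra|exact NC].
Qed.

End Point.

(** * The surface of a null immersion *)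

Section Hermitian.
Context (U : C -> Prop) (HU : copen U).

(** Value, gradient and Laplacian are carried along together, so that sums and multiples of
    Hermitian products [Re (h conj k)] are differentiated at one stroke. *)
Definition jet2 (X X1 X2 L : R -> R -> R) : Prop :=
  smooth U X /\ forall x y, U (x, y) -> Dx X x y = X1 x y /\ Dy X x y = X2 x y /\ Lap X x y = L x y.

Lemma Lap_plus (f g : R -> R -> R) (x y : R) : smooth U f -> smooth U g -> U (x, y) ->
  Lap (fun x y => f x y + g x y) x y = Lap f x y + Lap g x y.
Proof.
  intros Hf Hg Hxy; unfold Lap.
  rewrite (Dx_ext U HU (Dx (fun x y => f x y + g x y)) (fun x y => Dx f x y + Dx g x y))
    by (auto; intros; apply (Dx_plus U); assumption).
  rewrite (Dy_ext U HU (Dy (fun x y => f x y + g x y)) (fun x y => Dy f x y + Dy g x y))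
    by (auto; intros; apply (Dy_plus U); assumption).
  rewrite (Dx_plus U), (Dy_plus U); auto using smooth_Dx, smooth_Dy; ring.
Qed.

Lemma Lap_mult (f g : R -> R -> R) (x y : R) : smooth U f -> smooth U g -> U (x, y) ->
  Lap (fun x y => f x y * g x y) x y =
    Lap f x y * g x y + 2 * (Dx f x y * Dx g x y + Dy f x y * Dy g x y) + f x y * Lap g x y.
Proof.
  intros Hf Hg Hxy; unfold Lap.
  assert (Fx := smooth_Dx U f Hf); assert (Fy := smooth_Dy U f Hf).
  assert (Gx := smooth_Dx U g Hg); assert (Gy := smooth_Dy U g Hg).
  rewrite (Dx_ext U HU (Dx (fun x y => f x y * g x y)) (fun x y => Dx f x y * g x y + f x y * Dx g x y))
    by (auto; intros; apply (Dx_mult U); assumption).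
  rewrite (Dy_ext U HU (Dy (fun x y => f x y * g x y)) (fun x y => Dy f x y * g x y + f x y * Dy g x y))
    by (auto; intros; apply (Dy_mult U); assumption).
  rewrite (Dx_plus U), (Dy_plus U), !(Dx_mult U), !(Dy_mult U); auto; try (apply smooth_mult; assumption); ring.
Qed.

Lemma jet2_plus X X1 X2 L Y Y1 Y2 M : jet2 X X1 X2 L -> jet2 Y Y1 Y2 M ->
  jet2 (fun x y => X x y + Y x y) (fun x y => X1 x y + Y1 x y) (fun x y => X2 x y + Y2 x y)
    (fun x y => L x y + M x y).
Proof.
  intros [S1 H1] [S2 H2]; split; [apply smooth_plus; assumption|]; intros x y Hxy.
  destruct (H1 x y Hxy) as (A1 & A2 & A3); destruct (H2 x y Hxy) as (B1 & B2 & B3).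
  rewrite (Dx_plus U), (Dy_plus U), Lap_plus, A1, A2, A3, B1, B2, B3 by assumption; auto.
Qed.

Lemma Dx_const (k x y : R) : Dx (fun _ _ => k) x y = 0.
Proof. exact (Derive_const k x). Qed.

Lemma Dy_const (k x y : R) : Dy (fun _ _ => k) x y = 0.
Proof. exact (Derive_const k y). Qed.

Lemma Lap_const (k x y : R) : Lap (fun _ _ => k) x y = 0.
Proof.
  unfold Lap, Dx at 1, Dy at 1.
  rewrite (Derive_ext _ (fun _ => 0)), Derive_const by (intros; apply Dx_const).
  rewrite (Derive_ext _ (fun _ => 0)), Derive_const by (intros; apply Dy_const); ring.
Qed.

Lemma jet2_scal (k : R) X X1 X2 L : jet2 X X1 X2 L ->
  jet2 (fun x y => k * X x y) (fun x y => k * X1 x y) (fun x y => k * X2 x y) (fun x y => k * L x y).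
Proof.
  intros [S1 H1]; assert (Sk := smooth_const U HU k).
  split; [apply smooth_mult; assumption|]; intros x y Hxy.
  destruct (H1 x y Hxy) as (A1 & A2 & A3).
  rewrite (Dx_mult U (fun _ _ => k)), (Dy_mult U (fun _ _ => k)), (Lap_mult (fun _ _ => k)), Dx_const, Dy_const, Lap_const, A1, A2, A3 by assumption.
  repeat split; ring.
Qed.

Lemma jet2_ext X Y X1 X2 L Y1 Y2 M : (forall x y, X x y = Y x y) ->
  (forall x y, X1 x y = Y1 x y) -> (forall x y, X2 x y = Y2 x y) -> (forall x y, L x y = M x y) ->
  jet2 X X1 X2 L -> jet2 Y Y1 Y2 M.
Proof.
  intros E0 E1 E2 E3 [S H]; split; [apply (smooth_ext U HU X); auto|]; intros x y Hxy.
  destruct (H x y Hxy) as (A1 & A2 & A3); rewrite <- E1, <- E2, <- E3, <- A1, <- A2, <- A3.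
  split; [|split].
  - apply (Dx_ext U HU); auto.
  - apply (Dy_ext U HU); auto.
  - unfold Lap; f_equal; [apply (Dx_ext U HU)|apply (Dy_ext U HU)]; auto; intros;
      [apply (Dx_ext U HU)|apply (Dy_ext U HU)]; auto.
Qed.

Definition herm (h k : C -> C) (x y : R) : R := Re (h (x, y) * Cconj (k (x, y))).

Lemma herm_eq (h k : C -> C) (x y : R) :
  herm h k x y = Re (h (x, y)) * Re (k (x, y)) + Im (h (x, y)) * Im (k (x, y)).
Proof. unfold herm, Re, Im; simpl; ring. Qed.

Lemma smooth_herm (h k : C -> C) : holomorphic_on U h -> holomorphic_on U k -> smooth U (herm h k).
Proof.
  intros Hh Hk; apply (smooth_ext U HU (fun x y => Re (h (x, y)) * Re (k (x, y)) + Im (h (x, y)) * Im (k (x, y)))).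
  - intros; symmetry; apply herm_eq.
  - apply smooth_plus; auto; apply smooth_mult; auto using smooth_Re, smooth_Im.
Qed.

Definition Cimul (h : C -> C) (z : C) : C := (Ci * h z)%C.

Lemma Dx_herm (h k : C -> C) (x y : R) : holomorphic_on U h -> holomorphic_on U k -> U (x, y) ->
  Dx (herm h k) x y = herm (C_derive h) k x y + herm h (C_derive k) x y.
Proof.
  intros Hh Hk Hxy; apply is_derive_unique.
  apply (is_derive_ext (fun t => Re (h (t, y)) * Re (k (t, y)) + Im (h (t, y)) * Im (k (t, y)))).
  { intros; symmetry; apply herm_eq. }
  assert (A := Derive.is_derive_mult _ _ x _ _ (is_derive_Re_hor U h x y Hh Hxy) (is_derive_Re_hor U k x y Hk Hxy)).
  assert (B := Derive.is_derive_mult _ _ x _ _ (is_derive_Im_hor U h x y Hh Hxy) (is_derive_Im_hor U k x y Hk Hxy)).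
  assert (D := is_derive_plus (K := R_AbsRing) (V := R_NormedModule) _ _ x _ _ A B).
  refine (eq_rect _ (fun l => is_derive _ x l) D _ _).
  rewrite !herm_eq; unfold plus; simpl; ring.
Qed.

Lemma Dy_herm (h k : C -> C) (x y : R) : holomorphic_on U h -> holomorphic_on U k -> U (x, y) ->
  Dy (herm h k) x y = herm (Cimul (C_derive h)) k x y + herm h (Cimul (C_derive k)) x y.
Proof.
  intros Hh Hk Hxy; apply is_derive_unique.
  apply (is_derive_ext (fun t => Re (h (x, t)) * Re (k (x, t)) + Im (h (x, t)) * Im (k (x, t)))).
  { intros; symmetry; apply herm_eq. }
  assert (A := Derive.is_derive_mult _ _ y _ _ (is_derive_Re_ver U h x y Hh Hxy) (is_derive_Re_ver U k x y Hk Hxy)).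
  assert (B := Derive.is_derive_mult _ _ y _ _ (is_derive_Im_ver U h x y Hh Hxy) (is_derive_Im_ver U k x y Hk Hxy)).
  assert (D := is_derive_plus (K := R_AbsRing) (V := R_NormedModule) _ _ y _ _ A B).
  refine (eq_rect _ (fun l => is_derive _ y l) D _ _).
  rewrite !herm_eq; unfold Cimul, plus; simpl; unfold Re, Im; simpl; ring.
Qed.

Lemma hol_Cimul (h : C -> C) : holomorphic_on U h -> holomorphic_on U (Cimul h).
Proof.
  intros Hh; apply (holomorphic_intro U _ (fun z => Ci * C_derive h z)%C); intros z Hz.
  apply cderiv_scal, (proj1 (holomorphic_cderiv U h) Hh z Hz).
Qed.

Lemma C_derive_Cimul (h : C -> C) (z : C) : holomorphic_on U h -> U z ->
  C_derive (Cimul h) z = (Ci * C_derive h z)%C.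
Proof.
  intros Hh Hz; apply cderiv_unique, cderiv_scal, (proj1 (holomorphic_cderiv U h) Hh z Hz).
Qed.

Lemma jet2_herm (h k : C -> C) : holomorphic_on U h -> holomorphic_on U k ->
  jet2 (herm h k)
    (fun x y => herm (C_derive h) k x y + herm h (C_derive k) x y)
    (fun x y => herm (Cimul (C_derive h)) k x y + herm h (Cimul (C_derive k)) x y)
    (fun x y => 4 * herm (C_derive h) (C_derive k) x y).
Proof.
  intros Hh Hk; split; [apply smooth_herm; assumption|]; intros x y Hxy.
  assert (Hh' := holomorphic_deriv U h HU Hh); assert (Hk' := holomorphic_deriv U k HU Hk).
  assert (Ih := hol_Cimul _ Hh'); assert (Ik := hol_Cimul _ Hk').
  split; [apply Dx_herm; assumption|split; [apply Dy_herm; assumption|]].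
  unfold Lap.
  rewrite (Dx_ext U HU _ (fun x y => herm (C_derive h) k x y + herm h (C_derive k) x y))
    by (auto; intros; apply Dx_herm; assumption).
  rewrite (Dy_ext U HU _ (fun x y => herm (Cimul (C_derive h)) k x y + herm h (Cimul (C_derive k)) x y))
    by (auto; intros; apply Dy_herm; assumption).
  rewrite (Dx_plus U), (Dy_plus U) by (auto; apply smooth_herm; assumption).
  rewrite !Dx_herm, !Dy_herm by assumption.
  unfold herm, Cimul; fold (Cimul (C_derive h)) (Cimul (C_derive k)).
  change (fun z : C => (Ci * C_derive h z)%C) with (Cimul (C_derive h)).
  change (fun z : C => (Ci * C_derive k z)%C) with (Cimul (C_derive k)).
  rewrite !C_derive_Cimul by assumption.
  unfold Re, Im; simpl; ring.
Qed.

End Hermitian.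

Section NullSurface.
Context (U : C -> Prop) (HU : copen U).
Context (fa fb fc fd : C -> C).
Context (Ha : holomorphic_on U fa) (Hb : holomorphic_on U fb) (Hc : holomorphic_on U fc) (Hd : holomorphic_on U fd).
Context (Hdet : forall z, U z -> (fa z * fd z - fb z * fc z = 1)%C).
Context (Hnull : forall z, U z -> (C_derive fa z * C_derive fd z - C_derive fb z * C_derive fc z = 0)%C).
Context (Hne : forall z, U z ->
  ~ (C_derive fa z = 0%C /\ C_derive fb z = 0%C /\ C_derive fc z = 0%C /\ C_derive fd z = 0%C)).

Definition x0_coord (z : C) : R := (sqn (fa z) + sqn (fb z) + sqn (fc z) + sqn (fd z)) / 2.
Definition x3_coord (z : C) : R := (sqn (fa z) + sqn (fb z) - sqn (fc z) - sqn (fd z)) / 2.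
Definition x12_coord (z : C) : C := (fa z * Cconj (fc z) + fb z * Cconj (fd z))%C.
(** The denominator of the stereographic projection. *)
Definition x0_succ (z : C) : R := x0_coord z + 1.
Definition ball_map (z : C) : R3 := (Re (x12_coord z) / x0_succ z, Im (x12_coord z) / x0_succ z, x3_coord z / x0_succ z).
(** The squared norms of [F'] and of [F' F^{-1}]. *)
Definition deriv_sq (z : C) : R := sqn (C_derive fa z) + sqn (C_derive fb z) + sqn (C_derive fc z) + sqn (C_derive fd z).
Definition logderiv_sq (z : C) : R :=
  sqn (C_derive fa z * fd z - C_derive fb z * fc z) + sqn (C_derive fb z * fa z - C_derive fa z * fb z)
  + sqn (C_derive fc z * fd z - C_derive fd z * fc z) + sqn (C_derive fd z * fa z - C_derive fc z * fb z).

Let X0 := fun x y => x0_coord (x, y).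
Let X1 := fun x y => Re (x12_coord (x, y)).
Let X2 := fun x y => Im (x12_coord (x, y)).
Let X3 := fun x y => x3_coord (x, y).
Let T := fun x y => x0_succ (x, y).

Let G11 z := (C_derive fa z * Cconj (fa z) + C_derive fb z * Cconj (fb z))%C.
Let G12 z := (C_derive fa z * Cconj (fc z) + C_derive fb z * Cconj (fd z))%C.
Let G21 z := (C_derive fc z * Cconj (fa z) + C_derive fd z * Cconj (fb z))%C.
Let G22 z := (C_derive fc z * Cconj (fc z) + C_derive fd z * Cconj (fd z))%C.

Ltac hexp := unfold deriv_sq, X0, X1, X2, X3, x0_coord, x3_coord, x12_coord, G11, G12, G21, G22, herm, Cimul, sqn;
  repeat match goal with |- context [C_derive ?h ?z] => generalize (C_derive h z); intros [? ?] end;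
  repeat match goal with
  | |- context [fa ?z] => generalize (fa z); intros [? ?]
  | |- context [fb ?z] => generalize (fb z); intros [? ?]
  | |- context [fc ?z] => generalize (fc z); intros [? ?]
  | |- context [fd ?z] => generalize (fd z); intros [? ?]
  end;
  unfold Re, Im, Cconj; simpl; field.

Lemma jet_X0 : jet2 U X0 (fun x y => Re (G11 (x, y)) + Re (G22 (x, y)))
  (fun x y => - Im (G11 (x, y)) - Im (G22 (x, y))) (fun x y => 2 * deriv_sq (x, y)).
Proof.
  eapply (jet2_ext U HU); [..|exact (jet2_scal U HU (/ 2) _ _ _ _ (jet2_plus U HU _ _ _ _ _ _ _ _
    (jet2_plus U HU _ _ _ _ _ _ _ _ (jet2_herm U HU fa fa Ha Ha) (jet2_herm U HU fb fb Hb Hb))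
    (jet2_plus U HU _ _ _ _ _ _ _ _ (jet2_herm U HU fc fc Hc Hc) (jet2_herm U HU fd fd Hd Hd))))];
  intros x y; hexp.
Qed.

Lemma jet_X3 : jet2 U X3 (fun x y => Re (G11 (x, y)) - Re (G22 (x, y)))
  (fun x y => - Im (G11 (x, y)) + Im (G22 (x, y)))
  (fun x y => 2 * (sqn (C_derive fa (x, y)) + sqn (C_derive fb (x, y)) - sqn (C_derive fc (x, y)) - sqn (C_derive fd (x, y)))).
Proof.
  eapply (jet2_ext U HU); [..|exact (jet2_scal U HU (/ 2) _ _ _ _ (jet2_plus U HU _ _ _ _ _ _ _ _
    (jet2_plus U HU _ _ _ _ _ _ _ _ (jet2_herm U HU fa fa Ha Ha) (jet2_herm U HU fb fb Hb Hb))
    (jet2_scal U HU (-1) _ _ _ _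
    (jet2_plus U HU _ _ _ _ _ _ _ _ (jet2_herm U HU fc fc Hc Hc) (jet2_herm U HU fd fd Hd Hd)))))];
  intros x y; hexp.
Qed.

Lemma jet_X1 : jet2 U X1 (fun x y => Re (G12 (x, y)) + Re (G21 (x, y)))
  (fun x y => - Im (G12 (x, y)) - Im (G21 (x, y)))
  (fun x y => 4 * Re (C_derive fa (x, y) * Cconj (C_derive fc (x, y)) + C_derive fb (x, y) * Cconj (C_derive fd (x, y)))).
Proof.
  eapply (jet2_ext U HU); [..|exact (jet2_plus U HU _ _ _ _ _ _ _ _ (jet2_herm U HU fa fc Ha Hc) (jet2_herm U HU fb fd Hb Hd))];
  intros x y; hexp.
Qed.

(** Reduced to real parts by [Im (h conj k) = - Re (i h conj k)]. *)
Lemma jet_X2 : jet2 U X2 (fun x y => Im (G12 (x, y)) - Im (G21 (x, y)))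
  (fun x y => Re (G12 (x, y)) - Re (G21 (x, y)))
  (fun x y => 4 * Im (C_derive fa (x, y) * Cconj (C_derive fc (x, y)) + C_derive fb (x, y) * Cconj (C_derive fd (x, y)))).
Proof.
  assert (Ia := hol_Cimul U fa Ha); assert (Ib := hol_Cimul U fb Hb).
  assert (J := jet2_scal U HU (-1) _ _ _ _ (jet2_plus U HU _ _ _ _ _ _ _ _
    (jet2_herm U HU (Cimul fa) fc Ia Hc) (jet2_herm U HU (Cimul fb) fd Ib Hd))).
  destruct J as [S J]; split.
  - apply (smooth_ext U HU _ X2) in S; [exact S|]; intros u v _; hexp.
  - intros x y Hxy; destruct (J x y Hxy) as (J1 & J2 & J3).
    unfold herm, Cimul in J1, J2, J3; fold (Cimul fa) (Cimul fb) in J1, J2, J3.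
    change (fun z : C => (Ci * fa z)%C) with (Cimul fa) in *.
    change (fun z : C => (Ci * fb z)%C) with (Cimul fb) in *.
    rewrite (C_derive_Cimul U fa), (C_derive_Cimul U fb) in J1, J2, J3 by assumption.
    assert (E : forall u v, U (u, v) -> X2 u v = -1 * (Re (Cimul fa (u, v) * Cconj (fc (u, v))) + Re (Cimul fb (u, v) * Cconj (fd (u, v))))).
    { intros u v _; hexp. }
    split; [|split].
    + rewrite (Dx_ext U HU _ _ x y E Hxy); etransitivity; [exact J1|]; hexp.
    + rewrite (Dy_ext U HU _ _ x y E Hxy); etransitivity; [exact J2|]; hexp.
    + transitivity (Lap (fun u v => -1 * (Re (Cimul fa (u, v) * Cconj (fc (u, v))) + Re (Cimul fb (u, v) * Cconj (fd (u, v))))) x y).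
      * unfold Lap; f_equal; [apply (Dx_ext U HU)|apply (Dy_ext U HU)]; auto; intros;
          [apply (Dx_ext U HU)|apply (Dy_ext U HU)]; auto.
      * etransitivity; [exact J3|]; hexp.
Qed.

Lemma x0_succ_pos (z : C) : 0 < x0_succ z.
Proof.
  unfold x0_succ, x0_coord; generalize (sqn_nonneg (fa z)) (sqn_nonneg (fb z)) (sqn_nonneg (fc z)) (sqn_nonneg (fd z)); lra.
Qed.

Lemma jet_T : jet2 U T (fun x y => Re (G11 (x, y)) + Re (G22 (x, y)))
  (fun x y => - Im (G11 (x, y)) - Im (G22 (x, y))) (fun x y => 2 * deriv_sq (x, y)).
Proof.
  destruct jet_X0 as [S J]; assert (S1 := smooth_const U HU 1).
  split; [exact (smooth_plus U HU X0 (fun _ _ => 1) S S1)|]; intros x y Hxy; destruct (J x y Hxy) as (J1 & J2 & J3).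
  change T with (fun x y => X0 x y + (fun _ _ => 1) x y).
  rewrite (Dx_plus U X0), (Dy_plus U X0), (Lap_plus U HU X0), Dx_const, Dy_const, Lap_const, J1, J2, J3 by assumption.
  repeat split; ring.
Qed.

Lemma quotient_jet (X Xx Xy L : R -> R -> R) : jet2 U X Xx Xy L ->
  let q := fun x y => X x y / T x y in
  smooth U q /\ forall x y, U (x, y) ->
    Dx q x y = (Xx x y - q x y * (Re (G11 (x, y)) + Re (G22 (x, y)))) / T x y /\
    Dy q x y = (Xy x y - q x y * (- Im (G11 (x, y)) - Im (G22 (x, y)))) / T x y /\
    T x y * Lap q x y = L x y - q x y * (2 * deriv_sq (x, y))
      - 2 * ((Re (G11 (x, y)) + Re (G22 (x, y))) * Dx q x y + (- Im (G11 (x, y)) - Im (G22 (x, y))) * Dy q x y).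
Proof.
  intros [S J] q; destruct jet_T as [ST JT].
  assert (HT : forall x y, T x y <> 0) by (intros x y; apply Rgt_not_eq, x0_succ_pos).
  assert (Sq : smooth U q) by (apply smooth_mult; auto; apply smooth_inv; auto).
  split; [exact Sq|]; intros x y Hxy.
  destruct (J x y Hxy) as (J1 & J2 & J3); destruct (JT x y Hxy) as (K1 & K2 & K3).
  assert (E : forall u v, U (u, v) -> X u v = T u v * q u v) by (intros; unfold q; field; apply HT).
  assert (E1 := Dx_ext U HU _ _ x y E Hxy); assert (E2 := Dy_ext U HU _ _ x y E Hxy).
  rewrite (Dx_mult U), K1, J1 in E1 by assumption; rewrite (Dy_mult U), K2, J2 in E2 by assumption.
  assert (E3 : Lap X x y = Lap (fun u v => T u v * q u v) x y).
  { unfold Lap; f_equal; [apply (Dx_ext U HU)|apply (Dy_ext U HU)]; auto; intros;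
      [apply (Dx_ext U HU)|apply (Dy_ext U HU)]; auto. }
  rewrite (Lap_mult U HU), J3, K1, K2, K3 in E3 by assumption.
  split; [|split].
  - rewrite E1; field; apply HT.
  - rewrite E2; field; apply HT.
  - rewrite E3; ring.
Qed.

Lemma det_derive (z : C) : U z ->
  (C_derive fa z * fd z + fa z * C_derive fd z - C_derive fb z * fc z - fb z * C_derive fc z = 0)%C.
Proof.
  intros Hz.
  assert (D : forall h, holomorphic_on U h -> cderiv h z (C_derive h z)) by (intros h Hh; apply (proj1 (holomorphic_cderiv U h) Hh z Hz)).
  assert (H := cderiv_minus _ _ z _ _ (cderiv_mult _ _ z _ _ (D fa Ha) (D fd Hd)) (cderiv_mult _ _ z _ _ (D fb Hb) (D fc Hc))).
  assert (H0 : cderiv (fun w => fa w * fd w - fb w * fc w)%C z 0%C).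
  { apply cderiv_ext_loc with (fun _ => 1%C); [|apply cderiv_const].
    destruct (HU z Hz) as (d & Hdp & HUd); exists d; split; [exact Hdp|]; intros w Hw; symmetry; apply Hdet, HUd, Hw. }
  rewrite <- (cderiv_unique _ _ _ H0), (cderiv_unique _ _ _ H); ring.
Qed.

(** The derivatives of the coordinates of [F F^H] are given by [F' F^H], and its Laplacian by
    [4 F' F'^H]; the quotient rule then reduces every clause to the algebra at one point. *)
Theorem null_surface : smooth_on U ball_map /\ forall z, U z ->
  dot (ball_map z) (ball_map z) < 1 /\ 1 - dot (ball_map z) (ball_map z) = 2 / x0_succ z /\
  dot (dx ball_map z) (dx ball_map z) = dot (dy ball_map z) (dy ball_map z) /\ dot (dx ball_map z) (dy ball_map z) = 0 /\
  0 < dot (dx ball_map z) (dx ball_map z) /\ 0 < logderiv_sq z /\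
  dot (dx ball_map z) (dx ball_map z) * logderiv_sq z * x0_succ z ^ 2 = deriv_sq z ^ 2 /\
  hyp_mean_curvature ball_map z = 1.
Proof.
  destruct (quotient_jet _ _ _ _ jet_X1) as [S1 J1]; destruct (quotient_jet _ _ _ _ jet_X2) as [S2 J2].
  destruct (quotient_jet _ _ _ _ jet_X3) as [S3 J3].
  split; [apply smooth_on_components; repeat split; assumption|].
  intros z Hz; destruct z as [x y].
  destruct (J1 x y Hz) as (J11 & J12 & J13); destruct (J2 x y Hz) as (J21 & J22 & J23); destruct (J3 x y Hz) as (J31 & J32 & J33).
  set (z := (x, y) : C) in *.
  set (a := fa z); set (b := fb z); set (c := fc z); set (d := fd z).
  set (a' := C_derive fa z); set (b' := C_derive fb z); set (c' := C_derive fc z); set (d' := C_derive fd z).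
  assert (PB := point_in_ball a b c d (Hdet z Hz)).
  assert (PS := point_s a b c d (Hdet z Hz)).
  destruct (point_null a b c d a' b' c' d' (Hdet z Hz) (Hnull z Hz) (det_derive z Hz) (Hne z Hz)) as
    (Q1 & Q2 & Q3 & Q4 & Q5 & Q6).
  assert (PT := x0_succ_pos z).
  set (p := ball_map z) in *.
  set (t1 := Re (G11 z) + Re (G22 z)) in *; set (t2 := - Im (G11 z) - Im (G22 z)) in *.
  set (FX := lincomb (/ x0_succ z) (ball_tangent (G11 z) (G12 z) (G21 z) (G22 z) p) 0 p).
  set (FY := lincomb (/ x0_succ z) (ball_tangent (Ci * G11 z) (Ci * G12 z) (Ci * G21 z) (Ci * G22 z) p) 0 p).
  change (dot FX FX = dot FY FY) in Q1; change (dot FX FY = 0) in Q2; change (0 < dot FX FX) in Q3.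
  change (0 < logderiv_sq z) in Q4; change (dot FX FX * logderiv_sq z * x0_succ z ^ 2 = deriv_sq z ^ 2) in Q5.
  change (forall w, x0_succ z * dot w (cross FX FY) = dot (4 * Re (a' * Cconj c' + b' * Cconj d'), 4 * Im (a' * Cconj c' + b' * Cconj d'),
    2 * (sqn a' + sqn b' - sqn c' - sqn d')) (cross FX FY) - 2 * deriv_sq z * dot p (cross FX FY) ->
    (1 - dot p p) * dot w (cross FX FY) / (4 * dot FX FX ^ 2) - dot p (cross FX FY) / dot FX FX = 1) in Q6.
  change (0 < 1 - dot p p) in PB; change (1 - dot p p = 2 / x0_succ z) in PS.
  assert (Fx : dx ball_map z = FX).
  { change (dx ball_map z) with (Dx (fun x y => X1 x y / T x y) x y, Dx (fun x y => X2 x y / T x y) x y, Dx (fun x y => X3 x y / T x y) x y).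
    rewrite J11, J21, J31.
    change (((Re (G12 z) + Re (G21 z) - c1 p * t1) / x0_succ z, (Im (G12 z) - Im (G21 z) - c2 p * t1) / x0_succ z, (Re (G11 z) - Re (G22 z) - c3 p * t1) / x0_succ z)
     = (/ x0_succ z * (Re (G12 z) + Re (G21 z) - c1 p * t1) + 0 * c1 p, / x0_succ z * (Im (G12 z) - Im (G21 z) - c2 p * t1) + 0 * c2 p,
        / x0_succ z * (Re (G11 z) - Re (G22 z) - c3 p * t1) + 0 * c3 p)).
    unfold Rdiv; f_equal; [f_equal|]; ring. }
  assert (RI : forall q, Re (Ci * q) = - Im q) by (intros q; unfold Re, Im; simpl; ring).
  assert (II : forall q, Im (Ci * q) = Re q) by (intros q; unfold Re, Im; simpl; ring).
  assert (Fy : dy ball_map z = FY).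
  { change (dy ball_map z) with (Dy (fun x y => X1 x y / T x y) x y, Dy (fun x y => X2 x y / T x y) x y, Dy (fun x y => X3 x y / T x y) x y).
    rewrite J12, J22, J32.
    unfold FY, ball_tangent; rewrite !RI, !II.
    change (((- Im (G12 z) - Im (G21 z) - c1 p * t2) / x0_succ z, (Re (G12 z) - Re (G21 z) - c2 p * t2) / x0_succ z, (- Im (G11 z) + Im (G22 z) - c3 p * t2) / x0_succ z)
     = (/ x0_succ z * (- Im (G12 z) + - Im (G21 z) - c1 p * (- Im (G11 z) + - Im (G22 z))) + 0 * c1 p,
        / x0_succ z * (Re (G12 z) - Re (G21 z) - c2 p * (- Im (G11 z) + - Im (G22 z))) + 0 * c2 p,
        / x0_succ z * (- Im (G11 z) - - Im (G22 z) - c3 p * (- Im (G11 z) + - Im (G22 z))) + 0 * c3 p)).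
    unfold t2, Rdiv; f_equal; [f_equal|]; ring. }
  rewrite <- Fx, <- Fy in Q1, Q2, Q6; rewrite <- Fx in Q3, Q5.
  split; [lra|].
  split; [exact PS|split; [exact Q1|split; [exact Q2|split; [exact Q3|split; [exact Q4|split; [exact Q5|]]]]]].
  rewrite (hyp_mean_curvature_formula ball_map z (dot (dx ball_map z) (dx ball_map z))); auto.
  apply (Q6 (lapv ball_map z)).
  assert (L : lapv ball_map z = (Lap (fun x y => X1 x y / T x y) x y, Lap (fun x y => X2 x y / T x y) x y, Lap (fun x y => X3 x y / T x y) x y)).
  { unfold lapv, lincomb, c1, c2, c3; simpl fst; simpl snd; rewrite !Rmult_1_l; reflexivity. }
  set (n := cross (dx ball_map z) (dy ball_map z)).
  assert (Nx : dot (dx ball_map z) n = 0) by (unfold n, dot, cross, c1, c2, c3; simpl; ring).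
  assert (Ny : dot (dy ball_map z) n = 0) by (unfold n, dot, cross, c1, c2, c3; simpl; ring).
  set (w := lapv ball_map z) in *.
  assert (W1 : x0_succ z * c1 w = 4 * Re (a' * Cconj c' + b' * Cconj d') - c1 p * (2 * deriv_sq z) - 2 * (t1 * c1 (dx ball_map z) + t2 * c1 (dy ball_map z))).
  { rewrite L; exact J13. }
  assert (W2 : x0_succ z * c2 w = 4 * Im (a' * Cconj c' + b' * Cconj d') - c2 p * (2 * deriv_sq z) - 2 * (t1 * c2 (dx ball_map z) + t2 * c2 (dy ball_map z))).
  { rewrite L; exact J23. }
  assert (W3 : x0_succ z * c3 w = 2 * (sqn a' + sqn b' - sqn c' - sqn d') - c3 p * (2 * deriv_sq z) - 2 * (t1 * c3 (dx ball_map z) + t2 * c3 (dy ball_map z))).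
  { rewrite L; exact J33. }
  set (v1 := 4 * Re (a' * Cconj c' + b' * Cconj d')) in *.
  set (v2 := 4 * Im (a' * Cconj c' + b' * Cconj d')) in *.
  set (v3 := 2 * (sqn a' + sqn b' - sqn c' - sqn d')) in *.
  change (x0_succ z * (c1 w * c1 n + c2 w * c2 n + c3 w * c3 n) = (v1 * c1 n + v2 * c2 n + v3 * c3 n)
    - 2 * deriv_sq z * (c1 p * c1 n + c2 p * c2 n + c3 p * c3 n)).
  unfold dot in Nx, Ny.
  replace (x0_succ z * (c1 w * c1 n + c2 w * c2 n + c3 w * c3 n)) with
    ((x0_succ z * c1 w) * c1 n + (x0_succ z * c2 w) * c2 n + (x0_succ z * c3 w) * c3 n) by ring.
  rewrite W1, W2, W3.
  match goal with |- ?l = ?r => replace l with (r - 2 * t1 * (c1 (dx ball_map z) * c1 n + c2 (dx ball_map z) * c2 n + c3 (dx ball_map z) * c3 n)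
    - 2 * t2 * (c1 (dy ball_map z) * c1 n + c2 (dy ball_map z) * c2 n + c3 (dy ball_map z) * c3 n)) by ring end.
  rewrite Nx, Ny; ring.
Qed.

End NullSurface.

(** * Matrices and poles *)

Lemma entry_mk (g : nat -> nat -> C) (i j : nat) : (i < 2)%nat -> (j < 2)%nat ->
  entry (mk_matrix 2 2 g) i j = g i j.
Proof.
  intros Hi Hj; destruct i as [|[|i]]; [| |lia]; (destruct j as [|[|j]]; [| |lia]); reflexivity.
Qed.

Lemma entry_mul2 (A B : M2C) (i j : nat) : (i < 2)%nat -> (j < 2)%nat ->
  entry (mul2 A B) i j = (entry A i 0 * entry B 0 j + entry A i 1 * entry B 1 j)%C.
Proof.
  intros Hi Hj; unfold mul2, Mmult; rewrite (entry_mk _ i j Hi Hj); simpl pred.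
  rewrite sum_Sn, sum_O; reflexivity.
Qed.

Definition e00 (F : C -> M2C) (z : C) : C := entry (F z) 0 0.
Definition e01 (F : C -> M2C) (z : C) : C := entry (F z) 0 1.
Definition e10 (F : C -> M2C) (z : C) : C := entry (F z) 1 0.
Definition e11 (F : C -> M2C) (z : C) : C := entry (F z) 1 1.

Definition surface (F : C -> M2C) : C -> R3 := ball_map (e00 F) (e01 F) (e10 F) (e11 F).
Definition surface_x0_succ (F : C -> M2C) : C -> R := x0_succ (e00 F) (e01 F) (e10 F) (e11 F).
Definition surface_deriv_sq (F : C -> M2C) : C -> R := deriv_sq (e00 F) (e01 F) (e10 F) (e11 F).
Definition surface_logderiv_sq (F : C -> M2C) : C -> R := logderiv_sq (e00 F) (e01 F) (e10 F) (e11 F).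

Lemma bryant_point_surface (F : C -> M2C) (z : C) : bryant_point (F z) = surface F z.
Proof.
  assert (L2 : (0 < 2)%nat) by lia; assert (L3 : (1 < 2)%nat) by lia.
  unfold bryant_point, hx0, hx1, hx2, hx3, conj_transpose; rewrite !entry_mul2, !entry_mk by assumption.
  unfold surface, ball_map, x0_succ, x0_coord, x3_coord, x12_coord, sqn, e00, e01, e10, e11.
  generalize (entry (F z) 0 0) (entry (F z) 0 1) (entry (F z) 1 0) (entry (F z) 1 1).
  intros [a1 a2] [b1 b2] [c1' c2'] [d1 d2]; unfold Re, Im, Cconj; simpl.
  f_equal; [f_equal|]; unfold Rdiv; f_equal; try f_equal; ring.
Qed.

Lemma null_immersion_entries (U : C -> Prop) (F : C -> M2C) : holomorphic_null_immersion_SL2 U F <->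
  (holomorphic_on U (e00 F) /\ holomorphic_on U (e01 F) /\ holomorphic_on U (e10 F) /\ holomorphic_on U (e11 F)) /\
  (forall z, U z -> (e00 F z * e11 F z - e01 F z * e10 F z = 1)%C) /\
  (forall z, U z -> (C_derive (e00 F) z * C_derive (e11 F) z - C_derive (e01 F) z * C_derive (e10 F) z = 0)%C) /\
  (forall z, U z -> ~ (C_derive (e00 F) z = 0%C /\ C_derive (e01 F) z = 0%C /\ C_derive (e10 F) z = 0%C /\ C_derive (e11 F) z = 0%C)).
Proof.
  assert (L2 : (0 < 2)%nat) by lia; assert (L3 : (1 < 2)%nat) by lia.
  split.
  - intros [H1 H2]; split; [|split; [|split]].
    + repeat split; apply H1; lia.
    + intros z Hz; apply (H2 z Hz).
    + intros z Hz; destruct (H2 z Hz) as (_ & H & _).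
      unfold det2, mderive in H; rewrite !entry_mk in H by assumption; exact H.
    + intros z Hz (Za & Zb & Zc & Zd); destruct (H2 z Hz) as (_ & _ & H); apply H.
      unfold mderive, mat2; apply mk_matrix_ext; intros i j Hi Hj.
      destruct i as [|[|i]]; [| |lia]; (destruct j as [|[|j]]; [| |lia]); assumption.
  - intros ((Ha & Hb & Hc & Hd) & H1 & H2 & H3); split.
    + intros i j Hi Hj; destruct i as [|[|i]]; [| |lia]; (destruct j as [|[|j]]; [| |lia]); assumption.
    + intros z Hz; split; [exact (H1 z Hz)|split].
      * unfold det2, mderive; rewrite !entry_mk by assumption; exact (H2 z Hz).
      * intros E; apply (H3 z Hz).
        assert (E' : forall i j, (i < 2)%nat -> (j < 2)%nat -> entry (mderive F z) i j = 0%C).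
        { intros i j Hi Hj; rewrite E; unfold mat2; rewrite entry_mk by assumption.
          destruct i as [|i], j as [|j]; reflexivity. }
        unfold mderive in E'; repeat split.
        -- rewrite <- (E' 0%nat 0%nat L2 L2), entry_mk by assumption; reflexivity.
        -- rewrite <- (E' 0%nat 1%nat L2 L3), entry_mk by assumption; reflexivity.
        -- rewrite <- (E' 1%nat 0%nat L3 L2), entry_mk by assumption; reflexivity.
        -- rewrite <- (E' 1%nat 1%nat L3 L3), entry_mk by assumption; reflexivity.
Qed.

Definition log_derivative (F : C -> M2C) (z : C) : M2C := mul2 (mderive F z) (inv2 (F z)).

Lemma log_derivative_entries (F : C -> M2C) (z : C) : (e00 F z * e11 F z - e01 F z * e10 F z = 1)%C ->
  e00 (log_derivative F) z = (C_derive (e00 F) z * e11 F z - C_derive (e01 F) z * e10 F z)%C /\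
  e01 (log_derivative F) z = (C_derive (e01 F) z * e00 F z - C_derive (e00 F) z * e01 F z)%C /\
  e10 (log_derivative F) z = (C_derive (e10 F) z * e11 F z - C_derive (e11 F) z * e10 F z)%C /\
  e11 (log_derivative F) z = (C_derive (e11 F) z * e00 F z - C_derive (e10 F) z * e01 F z)%C.
Proof.
  intros H; assert (L2 : (0 < 2)%nat) by lia; assert (L3 : (1 < 2)%nat) by lia.
  assert (Hd : det2 (F z) = 1%C) by exact H.
  assert (D1 : forall u : C, (u / 1 = u)%C) by (intros; field; apply RtoC_neq0; lra).
  change (e00 (log_derivative F) z) with (entry (log_derivative F z) 0 0); change (e01 (log_derivative F) z) with (entry (log_derivative F z) 0 1).
  change (e10 (log_derivative F) z) with (entry (log_derivative F z) 1 0); change (e11 (log_derivative F) z) with (entry (log_derivative F z) 1 1).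
  unfold log_derivative; rewrite !entry_mul2 by assumption; unfold mderive, inv2, mat2; rewrite !entry_mk, Hd by assumption.
  rewrite !D1.
  change (fun w => entry (F w) 0 0) with (e00 F); change (fun w => entry (F w) 0 1) with (e01 F);
    change (fun w => entry (F w) 1 0) with (e10 F); change (fun w => entry (F w) 1 1) with (e11 F).
  unfold e00, e01, e10, e11; repeat split; ring.
Qed.

(** The exponent is common to the four entries, so [H] may vanish in some of them; the pole has order
    exactly [n] when [H] is not zero at the origin. *)
Definition pole_factor (F : C -> M2C) (n : nat) (r : R) (H : nat -> nat -> C -> C) : Prop :=
  forall i j, (i < 2)%nat -> (j < 2)%nat ->
    holomorphic_on (fun z => Cmod z < r) (H i j) /\
    forall z : C, 0 < Cmod z < r -> entry (F z) i j = (H i j z / z ^ n)%C.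

Definition entries_sq (H : nat -> nat -> C -> C) (z : C) : R :=
  sqn (H 0%nat 0%nat z) + sqn (H 0%nat 1%nat z) + sqn (H 1%nat 0%nat z) + sqn (H 1%nat 1%nat z).

Lemma index_cases (P : nat -> nat -> Prop) : P 0%nat 0%nat -> P 0%nat 1%nat -> P 1%nat 0%nat -> P 1%nat 1%nat ->
  forall i j, (i < 2)%nat -> (j < 2)%nat -> P i j.
Proof.
  intros; destruct i as [|[|i]]; [| |lia]; (destruct j as [|[|j]]; [| |lia]); assumption.
Qed.

Lemma mpole_factor (F : C -> M2C) (n : nat) : (0 < n)%nat -> mpole_order_at_0 F n ->
  exists r H, 0 < r <= 1 /\ pole_factor F n r H /\
    0 < entries_sq H 0%C.
Proof.
  intros Hn (m & Hm & En).
  assert (Hle : forall i j, (i < 2)%nat -> (j < 2)%nat -> (m i j <= n)%nat) by (apply index_cases; lia).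
  assert (Hex : forall i j, (i < 2)%nat -> (j < 2)%nat -> exists r h, 0 < r /\
    holomorphic_on (fun z => Cmod z < r) h /\
    (forall z : C, 0 < Cmod z < r -> entry (F z) i j = (h z / z ^ n)%C) /\
    (m i j = n -> h 0%C <> 0%C)).
  { intros i j Hi Hj; destruct (Hm i j Hi Hj) as (r & h & Hr & Hh & E & H0).
    exists r, (fun z => z ^ (n - m i j) * h z)%C; split; [exact Hr|split; [|split]].
    - apply (holomorphic_intro _ _ (fun z => RtoC (INR (n - m i j)) * z ^ pred (n - m i j) * h z + z ^ (n - m i j) * C_derive h z)%C).
      intros z Hz; apply (cderiv_mult (fun z => z ^ (n - m i j))%C h); [apply cderiv_pow|].
      apply (proj1 (holomorphic_cderiv _ h) Hh z Hz).
    - intros z Hz; rewrite E by exact Hz.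
      assert (N : z <> 0%C) by (apply Cneq0_of_pos, Hz).
      assert (Ep : (z ^ n = z ^ (n - m i j) * z ^ m i j)%C).
      { rewrite <- Cpow_add_r; f_equal; specialize (Hle i j Hi Hj); lia. }
      rewrite Ep; field; split; apply Cpow_nz, N.
    - intros Em; rewrite Em, Nat.sub_diag; simpl; specialize (H0 ltac:(lia)).
      intros Z; apply H0; etransitivity; [|exact Z]; ring. }
  destruct (Hex 0 0 ltac:(lia) ltac:(lia))%nat as (r00 & h00 & P00 & Q00 & R00 & S00).
  destruct (Hex 0 1 ltac:(lia) ltac:(lia))%nat as (r01 & h01 & P01 & Q01 & R01 & S01).
  destruct (Hex 1 0 ltac:(lia) ltac:(lia))%nat as (r10 & h10 & P10 & Q10 & R10 & S10).
  destruct (Hex 1 1 ltac:(lia) ltac:(lia))%nat as (r11 & h11 & P11 & Q11 & R11 & S11).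
  set (r := Rmin 1 (Rmin (Rmin r00 r01) (Rmin r10 r11))).
  assert (Hr : 0 < r) by (unfold r; repeat apply Rmin_pos; lra).
  assert (B0 : r <= 1) by apply Rmin_l.
  assert (B1 : r <= Rmin (Rmin r00 r01) (Rmin r10 r11)) by apply Rmin_r.
  assert (B2 := Rle_trans _ _ _ B1 (Rmin_l _ _)); assert (B3 := Rle_trans _ _ _ B1 (Rmin_r _ _)).
  assert (C0 := Rle_trans _ _ _ B2 (Rmin_l _ _)); assert (C1 := Rle_trans _ _ _ B2 (Rmin_r _ _)).
  assert (C2 := Rle_trans _ _ _ B3 (Rmin_l _ _)); assert (C3 := Rle_trans _ _ _ B3 (Rmin_r _ _)).
  exists r, (fun i j => match i, j with 0%nat, 0%nat => h00 | 0%nat, _ => h01 | _, 0%nat => h10 | _, _ => h11 end).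
  split; [lra|split].
  - unfold pole_factor; apply index_cases;
      (split; [eapply holomorphic_restrict; [|eassumption]; intros z Hz; cbv beta in *; lra
              |intros z Hz; first [apply R00|apply R01|apply R10|apply R11]; lra]).
  - unfold entries_sq; generalize (sqn_nonneg (h00 0%C)) (sqn_nonneg (h01 0%C)) (sqn_nonneg (h10 0%C)) (sqn_nonneg (h11 0%C)).
    assert (Hor : (m 0 0 = n \/ m 0 1 = n \/ m 1 0 = n \/ m 1 1 = n)%nat) by lia.
    destruct Hor as [K|[K|[K|K]]].
    + generalize (sqn_pos _ (S00 K)); lra.
    + generalize (sqn_pos _ (S01 K)); lra.
    + generalize (sqn_pos _ (S10 K)); lra.
    + generalize (sqn_pos _ (S11 K)); lra.
Qed.

Lemma mpole_of_factor (F : C -> M2C) (n : nat) (r : R) (H : nat -> nat -> C -> C) : 0 < r ->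
  pole_factor F n r H ->
  0 < entries_sq H 0%C ->
  mpole_order_at_0 F n.
Proof.
  intros Hr HF Hpos.
  assert (Hex : forall i j, (i < 2)%nat -> (j < 2)%nat -> exists m, (m <= n)%nat /\
    pole_order_at_0 (fun z => entry (F z) i j) m /\ (H i j 0%C <> 0%C -> m = n)).
  { intros i j Hi Hj; destruct (HF i j Hi Hj) as [H1 H2].
    exact (pole_order_exists n _ (H i j) r Hr H1 H2). }
  destruct (Hex 0 0 ltac:(lia) ltac:(lia))%nat as (m00 & A00 & P00 & Q00).
  destruct (Hex 0 1 ltac:(lia) ltac:(lia))%nat as (m01 & A01 & P01 & Q01).
  destruct (Hex 1 0 ltac:(lia) ltac:(lia))%nat as (m10 & A10 & P10 & Q10).
  destruct (Hex 1 1 ltac:(lia) ltac:(lia))%nat as (m11 & A11 & P11 & Q11).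
  exists (fun i j => match i, j with 0%nat, 0%nat => m00 | 0%nat, _ => m01 | _, 0%nat => m10 | _, _ => m11 end).
  split; [apply index_cases; assumption|].
  assert (Z0 : forall u : C, u = 0%C -> sqn u = 0) by (intros u ->; unfold sqn; simpl; ring).
  assert (Hor : H 0%nat 0%nat 0%C <> 0%C \/ H 0%nat 1%nat 0%C <> 0%C \/ H 1%nat 0%nat 0%C <> 0%C \/ H 1%nat 1%nat 0%C <> 0%C).
  { apply NNPP; intros Hno.
    unfold entries_sq in Hpos; rewrite (Z0 (H 0%nat 0%nat 0%C)), (Z0 (H 0%nat 1%nat 0%C)), (Z0 (H 1%nat 0%nat 0%C)), (Z0 (H 1%nat 1%nat 0%C)) in Hpos; [lra|..];
      apply NNPP; intros X; apply Hno; auto. }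
  destruct Hor as [K|[K|[K|K]]].
  - specialize (Q00 K); lia.
  - specialize (Q01 K); lia.
  - specialize (Q10 K); lia.
  - specialize (Q11 K); lia.
Qed.

(** * Limits at the puncture *)

Lemma continuous_eps_C (g : C -> R) (z : C) : @continuous C_UniformSpace R_UniformSpace g z ->
  forall eps, 0 < eps -> exists d, 0 < d /\ forall w, Cmod (w - z) < d -> Rabs (g w - g z) < eps.
Proof.
  intros H eps He.
  assert (L : locally (g z) (fun y => Rabs (y - g z) < eps)) by (exists (mkposreal eps He); intros y Hy; exact Hy).
  exact (proj1 (locally_C _ _) (H _ L)).
Qed.

Lemma limit_eq (g h : C -> R) (r : R) : 0 < r ->
  @continuous C_UniformSpace R_UniformSpace g (RtoC 0) -> @continuous C_UniformSpace R_UniformSpace h (RtoC 0) ->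
  (forall z, 0 < Cmod z < r -> g z = h z) -> g (RtoC 0) = h (RtoC 0).
Proof.
  intros Hr Hg Hh E.
  apply Rminus_diag_uniq, Rabs_eq_0, Rle_antisym; [|apply Rabs_pos].
  apply Rle_plus_epsilon; intros eps He; rewrite Rplus_0_l.
  assert (Hc : @continuous C_UniformSpace R_UniformSpace (fun z => g z - h z) (RtoC 0)) by (apply continuous_Rminus; assumption).
  destruct (continuous_eps_C _ _ Hc eps He) as (d & Hd & H).
  set (m := Rmin (d / 2) (r / 2)).
  assert (Hm : 0 < m) by (unfold m; apply Rmin_pos; lra).
  assert (m1 : m <= d / 2) by apply Rmin_l; assert (m2 : m <= r / 2) by apply Rmin_r.
  assert (Cm : Cmod (RtoC m) = m) by (rewrite Cmod_R, Rabs_pos_eq; lra).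
  specialize (H (RtoC m)); replace (RtoC m - 0)%C with (RtoC m) in H by ring.
  specialize (H ltac:(lra)); rewrite (E (RtoC m)) in H by lra.
  replace (h (RtoC m) - h (RtoC m) - (g (RtoC 0) - h (RtoC 0))) with (- (g (RtoC 0) - h (RtoC 0))) in H by ring.
  rewrite Rabs_Ropp in H; lra.
Qed.

(** * Surfaces that agree on an open set *)

Section Agree.
Context (U : C -> Prop) (HU : copen U).

Lemma dx_ext (f g : C -> R3) (z : C) : (forall w, U w -> f w = g w) -> U z -> dx f z = dx g z.
Proof.
  intros E Hz; destruct z as [x y].
  change (dx f (x, y)) with (Dx (fun x y => c1 (f (x, y))) x y, Dx (fun x y => c2 (f (x, y))) x y, Dx (fun x y => c3 (f (x, y))) x y).
  change (dx g (x, y)) with (Dx (fun x y => c1 (g (x, y))) x y, Dx (fun x y => c2 (g (x, y))) x y, Dx (fun x y => c3 (g (x, y))) x y).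
  f_equal; [f_equal|]; apply (Dx_ext U HU); auto; intros u v Huv; rewrite E; auto.
Qed.

Lemma dy_ext (f g : C -> R3) (z : C) : (forall w, U w -> f w = g w) -> U z -> dy f z = dy g z.
Proof.
  intros E Hz; destruct z as [x y].
  change (dy f (x, y)) with (Dy (fun x y => c1 (f (x, y))) x y, Dy (fun x y => c2 (f (x, y))) x y, Dy (fun x y => c3 (f (x, y))) x y).
  change (dy g (x, y)) with (Dy (fun x y => c1 (g (x, y))) x y, Dy (fun x y => c2 (g (x, y))) x y, Dy (fun x y => c3 (g (x, y))) x y).
  f_equal; [f_equal|]; apply (Dy_ext U HU); auto; intros u v Huv; rewrite E; auto.
Qed.

Lemma hyp_mean_curvature_ext (f g : C -> R3) (z : C) : (forall w, U w -> f w = g w) -> U z ->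
  hyp_mean_curvature f z = hyp_mean_curvature g z.
Proof.
  intros E Hz.
  assert (X : forall w, U w -> dx f w = dx g w) by (intros; apply dx_ext; auto).
  assert (Y : forall w, U w -> dy f w = dy g w) by (intros; apply dy_ext; auto).
  unfold hyp_mean_curvature, hyp_second_form, hyp_normal; cbv zeta.
  rewrite (dx_ext (dx f) (dx g) z X Hz), (dx_ext (dy f) (dy g) z Y Hz), (dy_ext (dy f) (dy g) z Y Hz).
  rewrite (E z Hz), (X z Hz), (Y z Hz); reflexivity.
Qed.

Lemma smooth_continuous (g : R -> R -> R) (z : C) : smooth U g -> U z ->
  @continuous C_UniformSpace R_UniformSpace (fun w => g (Re w) (Im w)) z.
Proof.
  intros Hg Hz P [e He].
  destruct z as [x y].
  destruct (smooth_cont U g x y Hg Hz e) as [d Hd].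
  apply locally_C; exists d; split; [apply cond_pos|]; intros w Hw; apply He.
  destruct w as [u v]; apply Hd.
  - eapply Rle_lt_trans; [|exact Hw]; exact (re_le_Cmod ((u, v) - (x, y))%C).
  - eapply Rle_lt_trans; [|exact Hw]; exact (im_le_Cmod ((u, v) - (x, y))%C).
Qed.

Lemma smooth_on_continuous_dot (f : C -> R3) (z : C) : smooth_on U f -> U z ->
  @continuous C_UniformSpace R_UniformSpace (fun w => dot (f w) (f w)) z /\
  @continuous C_UniformSpace R_UniformSpace (fun w => dot (dx f w) (dx f w)) z /\
  @continuous C_UniformSpace R_UniformSpace (fun w => dot (dy f w) (dy f w)) z /\
  @continuous C_UniformSpace R_UniformSpace (fun w => dot (dx f w) (dy f w)) z /\
  @continuous C_UniformSpace R_UniformSpace (fun w => dot (lapv f w) (lapv f w)) z.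
Proof.
  intros Hf Hz; apply smooth_on_components in Hf; destruct Hf as (S1 & S2 & S3).
  assert (J : forall g, smooth U g ->
    @continuous C_UniformSpace R_UniformSpace (fun w => g (Re w) (Im w)) z /\
    @continuous C_UniformSpace R_UniformSpace (fun w => Dx g (Re w) (Im w)) z /\
    @continuous C_UniformSpace R_UniformSpace (fun w => Dy g (Re w) (Im w)) z /\
    @continuous C_UniformSpace R_UniformSpace (fun w => 1 * Dx (Dx g) (Re w) (Im w) + 1 * Dy (Dy g) (Re w) (Im w)) z).
  { intros g Hg; assert (Gx := smooth_Dx U g Hg); assert (Gy := smooth_Dy U g Hg).
    split; [|split; [|split]]; try (apply smooth_continuous; assumption).
    apply (smooth_continuous (fun x y => 1 * Dx (Dx g) x y + 1 * Dy (Dy g) x y)); [|exact Hz].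
    apply smooth_plus; auto; apply smooth_mult; auto using smooth_const, smooth_Dx, smooth_Dy. }
  destruct (J _ S1) as (A1 & A2 & A3 & A4); destruct (J _ S2) as (B1 & B2 & B3 & B4); destruct (J _ S3) as (D1 & D2 & D3 & D4).
  assert (K : forall u1 u2 u3 v1 v2 v3 : C -> R,
    @continuous C_UniformSpace R_UniformSpace u1 z -> @continuous C_UniformSpace R_UniformSpace u2 z ->
    @continuous C_UniformSpace R_UniformSpace u3 z -> @continuous C_UniformSpace R_UniformSpace v1 z ->
    @continuous C_UniformSpace R_UniformSpace v2 z -> @continuous C_UniformSpace R_UniformSpace v3 z ->
    @continuous C_UniformSpace R_UniformSpace (fun w => u1 w * v1 w + u2 w * v2 w + u3 w * v3 w) z).
  { intros; repeat apply continuous_Rplus; apply continuous_Rmult; assumption. }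
  assert (A1' : @continuous C_UniformSpace R_UniformSpace (fun w => c1 (f w)) z).
  { eapply continuous_ext; [|exact A1]; intros [u v]; reflexivity. }
  assert (B1' : @continuous C_UniformSpace R_UniformSpace (fun w => c2 (f w)) z).
  { eapply continuous_ext; [|exact B1]; intros [u v]; reflexivity. }
  assert (D1' : @continuous C_UniformSpace R_UniformSpace (fun w => c3 (f w)) z).
  { eapply continuous_ext; [|exact D1]; intros [u v]; reflexivity. }
  split; [exact (K _ _ _ _ _ _ A1' B1' D1' A1' B1' D1')|].
  split; [exact (K _ _ _ _ _ _ A2 B2 D2 A2 B2 D2)|].
  split; [exact (K _ _ _ _ _ _ A3 B3 D3 A3 B3 D3)|].
  split; [exact (K _ _ _ _ _ _ A2 B2 D2 A3 B3 D3)|exact (K _ _ _ _ _ _ A4 B4 D4 A4 B4 D4)].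
Qed.

End Agree.

Lemma orthogonal_independent (u v : R3) : dot u u = dot v v -> dot u v = 0 -> 0 < dot u u ->
  forall a b, lincomb a u b v = (0, 0, 0) -> a = 0 /\ b = 0.
Proof.
  intros Huv H0 Hp a b E.
  assert (E1 : dot (lincomb a u b v) u = a * dot u u + b * dot u v) by (unfold dot, lincomb, c1, c2, c3; simpl; ring).
  assert (E2 : dot (lincomb a u b v) v = a * dot u v + b * dot v v) by (unfold dot, lincomb, c1, c2, c3; simpl; ring).
  assert (Z : forall w, dot (0, 0, 0) w = 0) by (intros; unfold dot, c1, c2, c3; simpl; ring).
  rewrite E, Z, H0 in E1, E2; rewrite <- Huv in E2.
  split; [apply Rmult_eq_reg_r with (dot u u)|apply Rmult_eq_reg_r with (dot u u)]; lra.
Qed.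

Lemma independent_norm_pos (u v : R3) : (forall a b, lincomb a u b v = (0, 0, 0) -> a = 0 /\ b = 0) ->
  0 < dot u u.
Proof.
  intros H; destruct (Rle_lt_or_eq_dec 0 (dot u u)) as [P|P]; [unfold dot; nra|exact P|exfalso].
  destruct u as [[u1 u2] u3]; unfold dot, c1, c2, c3 in P; simpl in P.
  assert (Z1 : u1 = 0) by nra; assert (Z2 : u2 = 0) by nra; assert (Z3 : u3 = 0) by nra.
  destruct (H 1 0); [|lra].
  unfold lincomb, c1, c2, c3; simpl; rewrite Z1, Z2, Z3; f_equal; [f_equal|]; ring.
Qed.

(** * Null immersions with a pole *)

Lemma sqn_Cmod (z : C) : sqn z = Cmod z ^ 2.
Proof. rewrite Cmod_sqr; reflexivity. Qed.

Lemma Cmod_Cpow (z : C) (n : nat) : Cmod (z ^ n) = Cmod z ^ n.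
Proof.
  induction n as [|n IH]; [exact Cmod_1|].
  change (z ^ S n)%C with (z * z ^ n)%C; rewrite Cmod_mult, IH; reflexivity.
Qed.

Lemma sqn_pow (z : C) (n : nat) : sqn (z ^ n) = Cmod z ^ (2 * n).
Proof. rewrite sqn_Cmod, Cmod_Cpow, <- pow_mult; f_equal; lia. Qed.

Lemma sqn_div_pow (q z : C) (n : nat) : z <> 0%C -> sqn (q / z ^ n)%C * Cmod z ^ (2 * n) = sqn q.
Proof.
  intros Hz; rewrite <- sqn_pow, <- sqn_mult; f_equal; field; apply Cpow_nz, Hz.
Qed.

(** [x_0 + 1] times [|z| ^ (2 n)] for [F = H / z ^ n]. *)
Definition cleared_x0_succ (H : nat -> nat -> C -> C) (n : nat) (z : C) : R := entries_sq H z / 2 + Cmod z ^ (2 * n).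

(** [|F'|^2] times [|z| ^ (2 n + 2)] for [F = H / z ^ n]. *)
Definition cleared_deriv_sq (H : nat -> nat -> C -> C) (n : nat) (z : C) : R :=
  sqn (z * C_derive (H 0%nat 0%nat) z - RtoC (INR n) * H 0%nat 0%nat z) + sqn (z * C_derive (H 0%nat 1%nat) z - RtoC (INR n) * H 0%nat 1%nat z)
  + sqn (z * C_derive (H 1%nat 0%nat) z - RtoC (INR n) * H 1%nat 0%nat z) + sqn (z * C_derive (H 1%nat 1%nat) z - RtoC (INR n) * H 1%nat 1%nat z).

Lemma derive_div_pow (g h : C -> C) (n : nat) (r : R) (z : C) : 0 < Cmod z < r ->
  holomorphic_on (fun z => Cmod z < r) h ->
  (forall z : C, 0 < Cmod z < r -> g z = (h z / z ^ n)%C) ->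
  C_derive g z = ((z * C_derive h z - RtoC (INR n) * h z) / z ^ S n)%C.
Proof.
  intros Hz Hh E; assert (N := Cneq0_of_pos z (proj1 Hz)).
  apply cderiv_unique.
  apply cderiv_ext_loc with (fun w => h w * / w ^ n)%C.
  { destruct (copen_punctured r z Hz) as (d & Hd & H); exists d; split; [exact Hd|]; intros w Hw; symmetry; apply E, H, Hw. }
  assert (D := cderiv_mult h (fun w => / w ^ n)%C z _ _ (proj1 (holomorphic_cderiv _ h) Hh z (proj2 Hz))
    (cderiv_inv (fun w => w ^ n)%C z _ (cderiv_pow n z) (Cpow_nz z n N))).
  refine (cderiv_eq _ _ _ _ _ D).
  destruct n as [|n].
  - simpl; field; exact N.
  - simpl pred; change (z ^ S (S n))%C with (z * (z * z ^ n))%C; change (z ^ S n)%C with (z * z ^ n)%C.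
    field; split; [apply Cpow_nz, N|exact N].
Qed.

Section Pole.
Context (F : C -> M2C) (n : nat) (r : R) (H : nat -> nat -> C -> C).
Context (HF : pole_factor F n r H).

Lemma pole_hol (i j : nat) : (i < 2)%nat -> (j < 2)%nat -> holomorphic_on (fun z => Cmod z < r) (H i j).
Proof. intros Hi Hj; apply (HF i j Hi Hj). Qed.

Lemma pole_entry (i j : nat) (z : C) : (i < 2)%nat -> (j < 2)%nat -> 0 < Cmod z < r ->
  entry (F z) i j = (H i j z / z ^ n)%C.
Proof. intros Hi Hj; apply (HF i j Hi Hj). Qed.

Lemma pole_x0_succ (z : C) : 0 < Cmod z < r -> surface_x0_succ F z * Cmod z ^ (2 * n) = cleared_x0_succ H n z.
Proof.
  intros Hz; assert (N := Cneq0_of_pos z (proj1 Hz)).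
  unfold surface_x0_succ, x0_succ, x0_coord, cleared_x0_succ, entries_sq, e00, e01, e10, e11; rewrite !(pole_entry _ _ z) by (lia || assumption).
  rewrite <- (sqn_div_pow (H 0%nat 0%nat z) z n N), <- (sqn_div_pow (H 0%nat 1%nat z) z n N),
    <- (sqn_div_pow (H 1%nat 0%nat z) z n N), <- (sqn_div_pow (H 1%nat 1%nat z) z n N); field.
Qed.

Lemma pole_deriv_sq (z : C) : 0 < Cmod z < r -> surface_deriv_sq F z * Cmod z ^ (2 * S n) = cleared_deriv_sq H n z.
Proof.
  intros Hz; assert (N := Cneq0_of_pos z (proj1 Hz)).
  assert (D : forall i j, (i < 2)%nat -> (j < 2)%nat -> C_derive (fun w => entry (F w) i j) z
    = ((z * C_derive (H i j) z - RtoC (INR n) * H i j z) / z ^ S n)%C).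
  { intros i j Hi Hj; apply (derive_div_pow _ _ n r z Hz); apply HF; assumption. }
  unfold surface_deriv_sq, deriv_sq.
  change (C_derive (e00 F) z) with (C_derive (fun w => entry (F w) 0 0) z); change (C_derive (e01 F) z) with (C_derive (fun w => entry (F w) 0 1) z).
  change (C_derive (e10 F) z) with (C_derive (fun w => entry (F w) 1 0) z); change (C_derive (e11 F) z) with (C_derive (fun w => entry (F w) 1 1) z).
  rewrite !D by lia.
  rewrite !Rmult_plus_distr_r, !sqn_div_pow by exact N; reflexivity.
Qed.

Lemma continuous_sqn (g : C -> C) (z : C) : ccont g z ->
  @continuous C_UniformSpace R_UniformSpace (fun w => sqn (g w)) z.
Proof.
  intros Hg; assert (G1 := continuous_Re _ z Hg); assert (G2 := continuous_Im _ z Hg).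
  apply (continuous_ext (fun w => Re (g w) * Re (g w) + Im (g w) * Im (g w))).
  { intros w; apply Rminus_diag_uniq; unfold sqn; simpl; ring. }
  apply continuous_Rplus; apply continuous_Rmult; assumption.
Qed.

Lemma continuous_entries_sq (z : C) : Cmod z < r -> @continuous C_UniformSpace R_UniformSpace (entries_sq H) z.
Proof.
  intros Hz; unfold entries_sq; apply continuous_Rplus; [apply continuous_Rplus; [apply continuous_Rplus|]|]; apply continuous_sqn;
    (eapply holomorphic_ccont; [apply pole_hol; lia|exact Hz]).
Qed.

Lemma continuous_Cmod_pow (k : nat) (z : C) : @continuous C_UniformSpace R_UniformSpace (fun w => Cmod w ^ (2 * k)) z.
Proof.
  apply (continuous_ext (fun w => sqn (w ^ k))); [intros w; apply sqn_pow|].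
  apply continuous_sqn, continuous_Cpow, continuous_id.
Qed.

Lemma continuous_cleared_x0_succ (z : C) : Cmod z < r -> @continuous C_UniformSpace R_UniformSpace (cleared_x0_succ H n) z.
Proof.
  intros Hz; unfold cleared_x0_succ; apply continuous_Rplus; [|apply continuous_Cmod_pow].
  apply continuous_Rmult; [apply continuous_entries_sq, Hz|apply continuous_const].
Qed.

Lemma continuous_cleared_deriv_sq (z : C) : Cmod z < r -> @continuous C_UniformSpace R_UniformSpace (cleared_deriv_sq H n) z.
Proof.
  intros Hz; unfold cleared_deriv_sq.
  assert (K : forall i j, (i < 2)%nat -> (j < 2)%nat -> ccont (fun w => w * C_derive (H i j) w - RtoC (INR n) * H i j w)%C z).
  { intros i j Hi Hj; apply continuous_Cminus; apply continuous_Cmult.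
    - apply continuous_id.
    - apply (holomorphic_ccont _ _ _ (holomorphic_deriv _ _ (copen_disc r) (pole_hol i j Hi Hj)) Hz).
    - apply continuous_Cconst.
    - apply (holomorphic_ccont _ _ _ (pole_hol i j Hi Hj) Hz). }
  apply continuous_Rplus; [apply continuous_Rplus; [apply continuous_Rplus|]|];
    (apply (continuous_sqn (fun w => w * C_derive (H _ _) w - RtoC (INR n) * H _ _ w)%C); apply K; lia).
Qed.

Lemma cleared_deriv_sq_0 : cleared_deriv_sq H n 0%C = INR n ^ 2 * entries_sq H 0%C.
Proof.
  unfold cleared_deriv_sq, entries_sq, sqn.
  repeat match goal with |- context [C_derive ?h ?z] => generalize (C_derive h z); intros [? ?] end.
  destruct (H 0%nat 0%nat 0%C), (H 0%nat 1%nat 0%C), (H 1%nat 0%nat 0%C), (H 1%nat 1%nat 0%C); unfold Re, Im; simpl; ring.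
Qed.

Lemma cleared_x0_succ_pos (z : C) : 0 < entries_sq H 0%C -> 0 < cleared_x0_succ H n z.
Proof.
  intros H0; unfold cleared_x0_succ.
  assert (P : 0 <= entries_sq H z) by (unfold entries_sq; generalize (sqn_nonneg (H 0%nat 0%nat z)) (sqn_nonneg (H 0%nat 1%nat z))
    (sqn_nonneg (H 1%nat 0%nat z)) (sqn_nonneg (H 1%nat 1%nat z)); lra).
  assert (Q := pow_le (Cmod z) (2 * n) (Cmod_ge_0 z)).
  destruct (Req_dec (Cmod z) 0) as [Z|Z].
  - assert (Z' : z = 0%C) by (apply Cmod_eq_0, Z); subst z; lra.
  - assert (0 < Cmod z ^ (2 * n)) by (apply pow_lt; generalize (Cmod_ge_0 z); lra); lra.
Qed.

End Pole.

(** The identity [|f_x|^2 |F' F^{-1}|^2 (x_0 + 1)^2 = |F'|^4] multiplied by [|z|^(4 n + 4)]: every factor now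
    has a limit at the puncture. *)
Lemma pole_metric_identity (F : C -> M2C) (n : nat) (r : R) (H : nat -> nat -> C -> C) (z : C) :
  holomorphic_null_immersion_SL2 punctured_disc F -> r <= 1 -> pole_factor F n r H -> 0 < Cmod z < r ->
  dot (dx (surface F) z) (dx (surface F) z) * (Cmod z ^ 4 * surface_logderiv_sq F z) * cleared_x0_succ H n z ^ 2 = cleared_deriv_sq H n z ^ 2.
Proof.
  intros HN Hr HF Hz; apply null_immersion_entries in HN; destruct HN as ((Ha & Hb & Hc & Hd) & Hdet & Hnull & Hne).
  destruct (null_surface _ (copen_punctured 1) _ _ _ _ Ha Hb Hc Hd Hdet Hnull Hne) as [_ J].
  destruct (J z ltac:(lra)) as (_ & _ & _ & _ & _ & _ & E & _).
  rewrite <- (pole_x0_succ F n r H HF z Hz), <- (pole_deriv_sq F n r H HF z Hz).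
  fold (surface_x0_succ F) (surface_deriv_sq F) (surface_logderiv_sq F) (surface F) in E.
  replace (2 * S n)%nat with (2 + 2 * n)%nat by lia; rewrite pow_add.
  set (m := Cmod z ^ (2 * n)).
  transitivity (dot (dx (surface F) z) (dx (surface F) z) * surface_logderiv_sq F z * surface_x0_succ F z ^ 2 * (Cmod z ^ 4 * m ^ 2)); [ring|rewrite E; ring].
Qed.

Lemma log_derivative_norm (F : C -> M2C) (z : C) : (e00 F z * e11 F z - e01 F z * e10 F z = 1)%C ->
  surface_logderiv_sq F z = sqn (e00 (log_derivative F) z) + sqn (e01 (log_derivative F) z) + sqn (e10 (log_derivative F) z) + sqn (e11 (log_derivative F) z).
Proof.
  intros E; destruct (log_derivative_entries F z E) as (-> & -> & -> & ->); unfold surface_logderiv_sq, logderiv_sq; reflexivity.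
Qed.

Lemma pole_logderiv_sq (F : C -> M2C) (r : R) (H : nat -> nat -> C -> C) (z : C) :
  (e00 F z * e11 F z - e01 F z * e10 F z = 1)%C ->
  pole_factor (log_derivative F) 2 r H -> 0 < Cmod z < r ->
  Cmod z ^ 4 * surface_logderiv_sq F z = entries_sq H z.
Proof.
  intros E HA Hz; rewrite (log_derivative_norm F z E); unfold e00, e01, e10, e11.
  assert (N := Cneq0_of_pos z (proj1 Hz)).
  rewrite !(pole_entry _ _ _ _ HA _ _ z) by (lia || assumption); change 4%nat with (2 * 2)%nat.
  rewrite Rmult_comm, !Rmult_plus_distr_r, !sqn_div_pow by exact N; reflexivity.
Qed.

(** * The smooth extension across a pole *)

Section Extension.
Context (F : C -> M2C) (n : nat) (r : R) (H : nat -> nat -> C -> C).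
Context (HN : holomorphic_null_immersion_SL2 punctured_disc F).
Context (Hr : 0 < r <= 1) (Hn : (0 < n)%nat) (HF : pole_factor F n r H) (H0 : 0 < entries_sq H 0%C).

(** Numerator and denominator of the surface, both multiplied by [|z| ^ (2 n)]; this form is smooth across the puncture. *)
Definition near_puncture (z : C) : R3 :=
  let y12 := (H 0%nat 0%nat z * Cconj (H 1%nat 0%nat z) + H 0%nat 1%nat z * Cconj (H 1%nat 1%nat z))%C in
  let y3 := (sqn (H 0%nat 0%nat z) + sqn (H 0%nat 1%nat z) - sqn (H 1%nat 0%nat z) - sqn (H 1%nat 1%nat z)) / 2 in
  (Re y12 / cleared_x0_succ H n z, Im y12 / cleared_x0_succ H n z, y3 / cleared_x0_succ H n z).

Lemma near_puncture_eq (z : C) : 0 < Cmod z < r -> near_puncture z = surface F z.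
Proof.
  intros Hz; assert (N := Cneq0_of_pos z (proj1 Hz)).
  assert (Pm : 0 < Cmod z ^ (2 * n)) by (apply pow_lt, Hz).
  assert (PT : 0 < surface_x0_succ F z) by apply x0_succ_pos.
  unfold surface, ball_map; fold (surface_x0_succ F z); unfold x12_coord, x3_coord, e00, e01, e10, e11.
  rewrite !(pole_entry F n r H HF _ _ z) by (lia || assumption).
  unfold near_puncture; rewrite <- (pole_x0_succ F n r H HF z Hz).
  assert (Q : forall p q, (p * Cconj q = RtoC (Cmod z ^ (2 * n)) * (p / z ^ n * Cconj (q / z ^ n)))%C).
  { intros p q; unfold Cdiv; rewrite Cmult_conj, Cinv_conj by (apply Cpow_nz, N).
    rewrite <- sqn_pow, sqn_Cmod, Cmod2_conj.
    assert (N2 : Cconj (z ^ n) <> 0%C).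
    { intros Z; apply (Cpow_nz z n N); rewrite <- (Cconj_conj (z ^ n)), Z.
      unfold Cconj; simpl; apply injective_projections; simpl; ring. }
    field; split; [exact N2|apply Cpow_nz, N]. }
  rewrite (Q (H 0%nat 0%nat z)), (Q (H 0%nat 1%nat z)).
  rewrite <- (sqn_div_pow (H 0%nat 0%nat z) z n N), <- (sqn_div_pow (H 0%nat 1%nat z) z n N),
    <- (sqn_div_pow (H 1%nat 0%nat z) z n N), <- (sqn_div_pow (H 1%nat 1%nat z) z n N).
  set (m := Cmod z ^ (2 * n)) in *.
  generalize (H 0%nat 0%nat z / z ^ n)%C (H 0%nat 1%nat z / z ^ n)%C (H 1%nat 0%nat z / z ^ n)%C (H 1%nat 1%nat z / z ^ n)%C.
  intros [p1 p2] [q1 q2] [u1 u2] [v1 v2]; unfold Re, Im; simpl.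
  f_equal; [f_equal|]; field; lra.
Qed.

Lemma smooth_Cmod_pow (U : C -> Prop) (k : nat) : copen U -> smooth U (fun x y => Cmod (x, y) ^ (2 * k)).
Proof.
  intros HU; apply (smooth_ext U HU (fun x y => (x * x + y * y) ^ k)).
  { intros u v _; rewrite pow_mult, Cmod_sqr; unfold Re, Im; simpl; f_equal; ring. }
  induction k as [|k IH]; simpl.
  - apply smooth_const, HU.
  - apply smooth_mult; auto; apply smooth_plus; auto; apply smooth_mult; auto using smooth_x, smooth_y.
Qed.

Lemma smooth_near_puncture : smooth_on (fun z => Cmod z < r) near_puncture.
Proof.
  set (U := fun z : C => Cmod z < r); assert (HU : copen U) by apply copen_disc.
  assert (h00 := pole_hol F n r H HF 0 0 ltac:(lia) ltac:(lia)); assert (h01 := pole_hol F n r H HF 0 1 ltac:(lia) ltac:(lia)).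
  assert (h10 := pole_hol F n r H HF 1 0 ltac:(lia) ltac:(lia)); assert (h11 := pole_hol F n r H HF 1 1 ltac:(lia) ltac:(lia)).
  fold U in h00, h01, h10, h11.
  assert (Ssq : forall h, holomorphic_on U h -> smooth U (fun x y => sqn (h (x, y)))).
  { intros h Hh; apply (smooth_ext U HU (fun x y => Re (h (x, y)) * Re (h (x, y)) + Im (h (x, y)) * Im (h (x, y)))).
    - intros u v _; unfold sqn; ring.
    - apply smooth_plus; auto; apply smooth_mult; auto using smooth_Re, smooth_Im. }
  assert (ST : smooth U (fun x y => cleared_x0_succ H n (x, y))).
  { unfold cleared_x0_succ, entries_sq; apply smooth_plus; auto; [|apply smooth_Cmod_pow, HU].
    apply smooth_mult; auto; [|apply smooth_const, HU].
    apply smooth_plus; auto; apply smooth_plus; auto; apply smooth_plus; auto. }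
  assert (SI : smooth U (fun x y => / cleared_x0_succ H n (x, y))).
  { apply smooth_inv; auto; intros x y _; apply Rgt_not_eq, cleared_x0_succ_pos, H0. }
  apply smooth_on_components; split; [|split].
  - apply smooth_mult; auto.
    apply (smooth_ext U HU (fun x y => herm (H 0%nat 0%nat) (H 1%nat 0%nat) x y + herm (H 0%nat 1%nat) (H 1%nat 1%nat) x y));
      [intros; unfold herm; reflexivity|].
    apply smooth_plus; auto; apply smooth_herm; auto.
  - apply smooth_mult; auto.
    apply (smooth_ext U HU (fun x y => (Im (H 0%nat 0%nat (x, y)) * Re (H 1%nat 0%nat (x, y)) - Re (H 0%nat 0%nat (x, y)) * Im (H 1%nat 0%nat (x, y)))
      + (Im (H 0%nat 1%nat (x, y)) * Re (H 1%nat 1%nat (x, y)) - Re (H 0%nat 1%nat (x, y)) * Im (H 1%nat 1%nat (x, y))))).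
    { intros; unfold Re, Im; simpl; ring. }
    apply smooth_plus; auto; apply smooth_minus; auto; apply smooth_mult; auto using smooth_Re, smooth_Im.
  - apply smooth_mult; auto; apply smooth_mult; auto; [|apply smooth_const, HU].
    apply smooth_minus; auto; apply smooth_minus; auto; apply smooth_plus; auto.
Qed.

(** The value at the puncture comes from the regular form; elsewhere the surface itself is kept, since
    [H] represents [F] only near the puncture. *)
Definition filled (z : C) : R3 := if Req_EM_T (Cmod z) 0 then near_puncture z else surface F z.

Lemma filled_punctured (z : C) : punctured_disc z -> filled z = surface F z.
Proof. intros Hz; unfold filled; destruct (Req_EM_T (Cmod z) 0) as [Z|Z]; [unfold punctured_disc in Hz; lra|reflexivity]. Qed.

Lemma filled_near (z : C) : Cmod z < r -> filled z = near_puncture z.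
Proof.
  intros Hz; unfold filled; destruct (Req_EM_T (Cmod z) 0) as [Z|Z]; [reflexivity|].
  symmetry; apply near_puncture_eq; generalize (Cmod_ge_0 z); lra.
Qed.

Lemma smooth_on_ext (U : C -> Prop) (f g : C -> R3) : copen U -> (forall z, U z -> f z = g z) ->
  smooth_on U f -> smooth_on U g.
Proof.
  intros HU E Hf; apply smooth_on_components in Hf; destruct Hf as (S1 & S2 & S3); apply smooth_on_components.
  split; [apply (smooth_ext U HU (fun x y => c1 (f (x, y))))|split;
    [apply (smooth_ext U HU (fun x y => c2 (f (x, y))))|apply (smooth_ext U HU (fun x y => c3 (f (x, y))))]]; auto;
    intros u v Huv; rewrite E; auto.
Qed.

Lemma pole_surface : smooth_on punctured_disc (surface F) /\ forall z, punctured_disc z ->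
  dot (surface F z) (surface F z) < 1 /\ 1 - dot (surface F z) (surface F z) = 2 / surface_x0_succ F z /\
  dot (dx (surface F) z) (dx (surface F) z) = dot (dy (surface F) z) (dy (surface F) z) /\ dot (dx (surface F) z) (dy (surface F) z) = 0 /\
  0 < dot (dx (surface F) z) (dx (surface F) z) /\ hyp_mean_curvature (surface F) z = 1.
Proof.
  apply null_immersion_entries in HN; destruct HN as ((Ha & Hb & Hc & Hd) & Hdet & Hnull & Hne).
  destruct (null_surface _ (copen_punctured 1) _ _ _ _ Ha Hb Hc Hd Hdet Hnull Hne) as [S J].
  split; [exact S|intros z Hz]; destruct (J z Hz) as (J1 & J2 & J3 & J4 & J5 & _ & _ & J8); repeat split; assumption.
Qed.

Lemma smooth_filled : smooth_on disc filled.
Proof.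
  intros z k Hz; destruct (Rlt_dec (Cmod z) r) as [L|L].
  - apply (smooth_on_ext (fun z => Cmod z < r) near_puncture filled (copen_disc r)); auto using smooth_near_puncture.
    intros; symmetry; apply filled_near; assumption.
  - assert (P : punctured_disc z) by (unfold punctured_disc, disc in *; lra).
    apply (smooth_on_ext punctured_disc (surface F) filled (copen_punctured 1)); auto; [|apply pole_surface].
    intros; symmetry; apply filled_punctured; assumption.
Qed.

(** [1 - |f|^2 = 2 |z|^(2 n) / (|z|^(2 n) (x_0 + 1))] tends to [0]. *)
Lemma filled_unit : dot (filled 0%C) (filled 0%C) = 1.
Proof.
  assert (H00 : Cmod (RtoC 0) < r) by (rewrite Cmod_0; lra).
  assert (Hd0 : disc (RtoC 0)) by (unfold disc; lra).
  destruct (smooth_on_continuous_dot disc (copen_disc 1) filled (RtoC 0) smooth_filled Hd0) as [Cf _].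
  transitivity (1 - 2 * Cmod 0%C ^ (2 * n) * / cleared_x0_succ H n 0%C);
    [|rewrite Cmod_0, pow_i by lia; ring].
  apply (limit_eq (fun z => dot (filled z) (filled z)) (fun z => 1 - 2 * Cmod z ^ (2 * n) * / cleared_x0_succ H n z) r (proj1 Hr)).
  - exact Cf.
  - apply continuous_Rminus; [apply continuous_const|].
    apply continuous_Rmult; [apply continuous_Rmult; [apply continuous_const|apply continuous_Cmod_pow]|].
    apply continuous_Rinv; [apply (continuous_cleared_x0_succ F n r H HF); exact H00|apply Rgt_not_eq, cleared_x0_succ_pos, H0].
  - intros z Hz; assert (P : punctured_disc z) by (unfold punctured_disc; lra).
    rewrite (filled_punctured z P); destruct (proj2 pole_surface z P) as (_ & E & _).
    assert (PT : 0 < surface_x0_succ F z) by apply x0_succ_pos.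
    assert (Pm : 0 < Cmod z ^ (2 * n)) by (apply pow_lt, Hz).
    rewrite <- (pole_x0_succ F n r H HF z Hz).
    replace (dot (surface F z) (surface F z)) with (1 - (1 - dot (surface F z) (surface F z))) by ring; rewrite E; field; lra.
Qed.

(** At the puncture the metric identity reads [|f_x|^2 |A_0|^2 (|H_0|^2 / 2)^2 = n^4 |H_0|^4] with [A_0], [H_0] the leading
    coefficients of [F' F^{-1}] and [F]. *)
Lemma filled_immersed (rA : R) (HA : nat -> nat -> C -> C) : 0 < rA <= 1 -> pole_factor (log_derivative F) 2 rA HA ->
  0 < dot (dx filled 0%C) (dx filled 0%C).
Proof.
  intros HrA HAf.
  assert (Hd0 : disc (RtoC 0)) by (unfold disc; rewrite Cmod_0; lra).
  destruct (smooth_on_continuous_dot disc (copen_disc 1) filled (RtoC 0) smooth_filled Hd0) as (_ & Cx & _).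
  set (s := Rmin r rA); assert (Hs : 0 < s) by (apply Rmin_pos; lra).
  assert (s1 : s <= r) by apply Rmin_l; assert (s2 : s <= rA) by apply Rmin_r.
  assert (E : dot (dx filled 0%C) (dx filled 0%C) * entries_sq HA 0%C * cleared_x0_succ H n 0%C ^ 2 = cleared_deriv_sq H n 0%C ^ 2).
  { apply (limit_eq (fun z => dot (dx filled z) (dx filled z) * entries_sq HA z * cleared_x0_succ H n z ^ 2) (fun z => cleared_deriv_sq H n z ^ 2) s Hs).
    - simpl pow; repeat apply continuous_Rmult; [exact Cx| | | |apply continuous_const].
      + apply (continuous_entries_sq _ _ _ _ HAf); rewrite Cmod_0; lra.
      + apply (continuous_cleared_x0_succ F n r H HF); rewrite Cmod_0; lra.
      + apply (continuous_cleared_x0_succ F n r H HF); rewrite Cmod_0; lra.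
    - simpl pow; repeat apply continuous_Rmult; [| |apply continuous_const];
        (apply (continuous_cleared_deriv_sq F n r H HF); rewrite Cmod_0; lra).
    - intros z Hz; assert (P : punctured_disc z) by (unfold punctured_disc; lra).
      rewrite (dx_ext punctured_disc (copen_punctured 1) filled (surface F) z filled_punctured P).
      rewrite <- (pole_metric_identity F n r H z HN (proj2 Hr) HF ltac:(lra)).
      rewrite (pole_logderiv_sq F rA HA z); auto; [|lra].
      apply null_immersion_entries in HN; apply HN, P. }
  rewrite (cleared_deriv_sq_0 n H) in E.
  assert (P : 0 < (INR n ^ 2 * entries_sq H 0%C) ^ 2).
  { apply pow_lt, Rmult_lt_0_compat; [apply pow_lt, lt_0_INR, Hn|exact H0]. }
  destruct (Rle_lt_or_eq_dec 0 (dot (dx filled 0%C) (dx filled 0%C))) as [G|G]; [unfold dot; nra|exact G|].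
  rewrite <- G in E; lra.
Qed.

Lemma filled_conformal (rA : R) (HA : nat -> nat -> C -> C) : 0 < rA <= 1 -> pole_factor (log_derivative F) 2 rA HA ->
  conformal_immersion euclidean disc filled.
Proof.
  intros HrA HAf; split; [exact smooth_filled|].
  assert (K : forall z, disc z -> dot (dx filled z) (dx filled z) = dot (dy filled z) (dy filled z) /\
    dot (dx filled z) (dy filled z) = 0 /\ 0 < dot (dx filled z) (dx filled z)).
  { assert (K1 : forall z, punctured_disc z -> dot (dx filled z) (dx filled z) = dot (dy filled z) (dy filled z) /\
      dot (dx filled z) (dy filled z) = 0 /\ 0 < dot (dx filled z) (dx filled z)).
    { intros z P; rewrite (dx_ext punctured_disc (copen_punctured 1) filled (surface F) z filled_punctured P),
        (dy_ext punctured_disc (copen_punctured 1) filled (surface F) z filled_punctured P).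
      destruct (proj2 pole_surface z P) as (_ & _ & E1 & E2 & E3 & _); auto. }
    intros z Hz; destruct (Req_EM_T (Cmod z) 0) as [Z|Z];
      [|apply K1; unfold punctured_disc, disc in *; generalize (Cmod_ge_0 z); lra].
    apply Cmod_eq_0 in Z; subst z.
    destruct (smooth_on_continuous_dot disc (copen_disc 1) filled (RtoC 0) smooth_filled Hz) as (_ & Cx & Cy & Cxy & _).
    split; [|split; [|exact (filled_immersed rA HA HrA HAf)]].
    - apply (limit_eq (fun z => dot (dx filled z) (dx filled z)) (fun z => dot (dy filled z) (dy filled z)) 1 Rlt_0_1 Cx Cy).
      intros z P; apply K1, P.
    - apply (limit_eq (fun z => dot (dx filled z) (dy filled z)) (fun _ => 0) 1 Rlt_0_1 Cxy); [apply continuous_const|].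
      intros z P; apply K1, P. }
  intros z Hz; destruct (K z Hz) as (K1 & K2 & K3); unfold euclidean.
  split; [apply orthogonal_independent; assumption|split; assumption].
Qed.

End Extension.

Theorem pole_smooth_end (F : C -> M2C) :
  holomorphic_null_immersion_SL2 punctured_disc F -> has_pole_at_0 F ->
  mpole_order_at_0 (log_derivative F) 2 ->
  smooth_bryant_end (fun z => bryant_point (F z)).
Proof.
  intros HN (n & Hn & Hp) HA.
  destruct (mpole_factor F n Hn Hp) as (r & H & Hr & HF & H0).
  destruct (mpole_factor (log_derivative F) 2 ltac:(lia) HA) as (rA & HAc & HrA & HAf & _).
  assert (EQ : (fun z => bryant_point (F z)) = surface F).
  { apply functional_extensionality; intros z; apply bryant_point_surface. }
  rewrite EQ.
  destruct (pole_surface F HN) as [S J]; split.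
  - split; [intros z Hz; apply (J z Hz)|split].
    + split; [exact S|intros z Hz].
      destruct (J z Hz) as (_ & _ & E1 & E2 & E3 & _).
      split; [apply orthogonal_independent; assumption|unfold hyperbolic; rewrite E1, E2; split; ring].
    + intros z Hz; apply (J z Hz).
  - exists (filled F n H 0%C), (filled F n H); split; [|split; [|split; [reflexivity|]]].
    + exact (filled_unit F n r H HN Hr Hn HF H0).
    + exact (filled_conformal F n r H HN Hr Hn HF H0 rA HAc HrA HAf).
    + apply filled_punctured.
Qed.

(** * Unitary quotients of matrices with the same Hermitian square *)

Section Unitary.
Context (a b c d a' b' c' d' : C).
Context (Hdet : (a * d - b * c = 1)%C) (Hdet' : (a' * d' - b' * c' = 1)%C).
Context (E11 : (a * Cconj a + b * Cconj b = a' * Cconj a' + b' * Cconj b')%C).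
Context (E12 : (a * Cconj c + b * Cconj d = a' * Cconj c' + b' * Cconj d')%C).
Context (E21 : (c * Cconj a + d * Cconj b = c' * Cconj a' + d' * Cconj b')%C).
Context (E22 : (c * Cconj c + d * Cconj d = c' * Cconj c' + d' * Cconj d')%C).

Let u11 := (d * a' - b * c')%C.
Let u12 := (d * b' - b * d')%C.
Let u21 := (a * c' - c * a')%C.
Let u22 := (a * d' - c * b')%C.

Lemma conj_det : (Cconj a' * Cconj d' - Cconj b' * Cconj c' = 1)%C.
Proof.
  rewrite <- !Cmult_conj; transitivity (Cconj (a' * d' - b' * c')).
  - unfold Cconj; apply injective_projections; simpl; ring.
  - rewrite Hdet'; unfold Cconj; apply injective_projections; simpl; ring.
Qed.

(** With [^H] the conjugate transpose, [F F^H = F' F'^H] gives [F^{-1} F' = F^H / F'^H], the inverse conjugate transpose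
    of [F^{-1} F']: the quotient is unitary. *)
Lemma quotient_unitary : u11 = Cconj u22 /\ u12 = (- Cconj u21)%C.
Proof.
  assert (D := conj_det).
  assert (CM : forall p q s t : C, Cconj (p * q - s * t) = (Cconj p * Cconj q - Cconj s * Cconj t)%C).
  { intros p q s t; unfold Cconj; apply injective_projections; simpl; ring. }
  assert (A' : a' = ((a * Cconj a + b * Cconj b) * Cconj d' - (a * Cconj c + b * Cconj d) * Cconj b')%C).
  { rewrite E11, E12; transitivity (a' * (Cconj a' * Cconj d' - Cconj b' * Cconj c'))%C; [rewrite D; ring|ring]. }
  assert (B' : b' = ((a * Cconj c + b * Cconj d) * Cconj a' - (a * Cconj a + b * Cconj b) * Cconj c')%C).
  { rewrite E11, E12; transitivity (b' * (Cconj a' * Cconj d' - Cconj b' * Cconj c'))%C; [rewrite D; ring|ring]. }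
  assert (C' : c' = ((c * Cconj a + d * Cconj b) * Cconj d' - (c * Cconj c + d * Cconj d) * Cconj b')%C).
  { rewrite E21, E22; transitivity (c' * (Cconj a' * Cconj d' - Cconj b' * Cconj c'))%C; [rewrite D; ring|ring]. }
  assert (D' : d' = ((c * Cconj c + d * Cconj d) * Cconj a' - (c * Cconj a + d * Cconj b) * Cconj c')%C).
  { rewrite E21, E22; transitivity (d' * (Cconj a' * Cconj d' - Cconj b' * Cconj c'))%C; [rewrite D; ring|ring]. }
  unfold u22, u21; rewrite !CM.
  split.
  - unfold u11; rewrite A', C' at 1.
    transitivity ((a * d - b * c) * (Cconj a * Cconj d' - Cconj c * Cconj b'))%C; [ring|rewrite Hdet; ring].
  - unfold u12; rewrite B', D' at 1.
    transitivity ((a * d - b * c) * (Cconj c * Cconj a' - Cconj a * Cconj c'))%C; [ring|rewrite Hdet; ring].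
Qed.

Lemma quotient_product : (a' = a * u11 + b * u21)%C /\ (b' = a * u12 + b * u22)%C /\
  (c' = c * u11 + d * u21)%C /\ (d' = c * u12 + d * u22)%C.
Proof.
  unfold u11, u12, u21, u22; repeat split.
  - transitivity ((a * d - b * c) * a')%C; [rewrite Hdet|]; ring.
  - transitivity ((a * d - b * c) * b')%C; [rewrite Hdet|]; ring.
  - transitivity ((a * d - b * c) * c')%C; [rewrite Hdet|]; ring.
  - transitivity ((a * d - b * c) * d')%C; [rewrite Hdet|]; ring.
Qed.

Lemma quotient_norm : sqn u11 + sqn u12 = 1.
Proof.
  destruct quotient_unitary as [Q1 Q2].
  assert (D : (u11 * u22 - u12 * u21 = 1)%C).
  { transitivity ((a * d - b * c) * (a' * d' - b' * c'))%C; [unfold u11, u12, u21, u22; ring|rewrite Hdet, Hdet'; ring]. }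
  assert (R1 : u22 = Cconj u11) by (rewrite Q1, Cconj_conj; reflexivity).
  assert (R2 : u21 = (- Cconj u12)%C) by (rewrite Q2; unfold Cconj; apply injective_projections; simpl; ring).
  rewrite R1, R2 in D.
  apply (f_equal fst) in D; revert D; generalize u11 u12; intros [x1 x2] [y1 y2]; unfold sqn, Re, Im; simpl; intros D; lra.
Qed.

(** [(U - I)(U - I)^H = (2 - tr U) I] for [U] in [SU(2)]. *)
Lemma quotient_distance :
  sqn (a' - a) + sqn (b' - b) + sqn (c' - c) + sqn (d' - d) = (2 - 2 * Re u11) * (sqn a + sqn b + sqn c + sqn d).
Proof.
  destruct quotient_unitary as [Q1 Q2]; destruct quotient_product as (P1 & P2 & P3 & P4); assert (N := quotient_norm).
  assert (R1 : u22 = Cconj u11) by (rewrite Q1, Cconj_conj; reflexivity).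
  assert (R2 : u21 = (- Cconj u12)%C) by (rewrite Q2; unfold Cconj; apply injective_projections; simpl; ring).
  rewrite P1, P2, P3, P4, R1, R2.
  replace (2 - 2 * Re u11) with (sqn u11 + sqn u12 + 1 - 2 * Re u11) by lra.
  generalize u11 u12; intros [x1 x2] [y1 y2]; destruct a, b, c, d; unfold sqn, Re, Im; simpl; ring.
Qed.

Lemma quotient_trivial : Re u11 = 1 -> a' = a /\ b' = b /\ c' = c /\ d' = d.
Proof.
  intros H; assert (D := quotient_distance); rewrite H in D.
  assert (Z : forall q : C, sqn q = 0 -> q = 0%C).
  { intros q Hq; apply NNPP; intros K; generalize (sqn_pos q K); lra. }
  assert (K1 := sqn_nonneg (a' - a)); assert (K2 := sqn_nonneg (b' - b)); assert (K3 := sqn_nonneg (c' - c)); assert (K4 := sqn_nonneg (d' - d)).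
  assert (Y : forall p q : C, sqn (p - q) = 0 -> p = q).
  { intros p q E; apply Z in E; replace p with (p - q + q)%C by ring; rewrite E; ring. }
  repeat split; apply Y; lra.
Qed.

End Unitary.

(** * Functions that are holomorphic together with their conjugate *)

Lemma conj_holomorphic_deriv (U : C -> Prop) (g h : C -> C) (z : C) : copen U -> holomorphic_on U g -> holomorphic_on U h ->
  (forall w, U w -> g w = Cconj (h w)) -> U z -> C_derive g z = 0%C.
Proof.
  intros HU Hg Hh E Hz; destruct z as [x y].
  assert (E1 : Re (C_derive g (x, y)) = Re (C_derive h (x, y))).
  { rewrite <- (is_derive_unique _ _ _ (is_derive_Re_hor U g x y Hg Hz)), <- (is_derive_unique _ _ _ (is_derive_Re_hor U h x y Hh Hz)).
    apply (Dx_ext U HU (fun x y => Re (g (x, y))) (fun x y => Re (h (x, y)))); [|exact Hz]; intros u v Huv; rewrite E by exact Huv; reflexivity. }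
  assert (E2 : Im (C_derive g (x, y)) = Im (C_derive h (x, y))).
  { apply Ropp_eq_reg; rewrite <- (is_derive_unique _ _ _ (is_derive_Re_ver U g x y Hg Hz)), <- (is_derive_unique _ _ _ (is_derive_Re_ver U h x y Hh Hz)).
    apply (Dy_ext U HU (fun x y => Re (g (x, y))) (fun x y => Re (h (x, y)))); [|exact Hz]; intros u v Huv; rewrite E by exact Huv; reflexivity. }
  assert (IE : forall u v, U (u, v) -> Im (g (u, v)) = - Im (h (u, v))) by (intros u v Huv; rewrite E by exact Huv; reflexivity).
  assert (E3 : Im (C_derive g (x, y)) = - Im (C_derive h (x, y))).
  { rewrite <- (is_derive_unique _ _ _ (is_derive_Im_hor U g x y Hg Hz)), <- (is_derive_unique _ _ _ (is_derive_Im_hor U h x y Hh Hz)).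
    rewrite <- Derive_opp; apply (Dx_ext U HU (fun x y => Im (g (x, y))) (fun x y => - Im (h (x, y))) x y IE Hz). }
  assert (E4 : Re (C_derive g (x, y)) = - Re (C_derive h (x, y))).
  { rewrite <- (is_derive_unique _ _ _ (is_derive_Im_ver U g x y Hg Hz)), <- (is_derive_unique _ _ _ (is_derive_Im_ver U h x y Hh Hz)).
    rewrite <- Derive_opp; apply (Dy_ext U HU (fun x y => Im (g (x, y))) (fun x y => - Im (h (x, y))) x y IE Hz). }
  unfold Re, Im in *; apply injective_projections; [change (fst (C_derive g (x, y)) = 0)|change (snd (C_derive g (x, y)) = 0)]; lra.
Qed.

Lemma copen_left : copen left_half_plane.
Proof.
  intros z Hz; unfold left_half_plane in *; exists (- Re z); split; [lra|]; intros w Hw.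
  assert (K := re_le_Cmod (w - z)); assert (K2 := Rle_abs (Re (w - z))).
  replace (Re (w - z)) with (Re w - Re z) in * by (unfold Re; simpl; ring); lra.
Qed.

(** The discs [|z + S| < S] exhaust the left half plane. *)
Lemma half_plane_constant (g : C -> C) : holomorphic_on left_half_plane g ->
  (forall z, left_half_plane z -> C_derive g z = 0%C) ->
  forall z w, left_half_plane z -> left_half_plane w -> g z = g w.
Proof.
  intros Hg H0 z w Hz Hw.
  assert (K : forall z, left_half_plane z -> exists S0, 0 < S0 /\ forall S, S0 < S -> Cmod (z - RtoC (- S)) < S).
  { intros q Hq; unfold left_half_plane in Hq; exists (Rmax 1 (Cmod q ^ 2 / (- 2 * Re q))).
    split; [generalize (Rmax_l 1 (Cmod q ^ 2 / (- 2 * Re q))); lra|]; intros S HS.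
    assert (S1 := Rmax_l 1 (Cmod q ^ 2 / (- 2 * Re q))); assert (S2 := Rmax_r 1 (Cmod q ^ 2 / (- 2 * Re q))).
    assert (L : Cmod q ^ 2 < S * (- 2 * Re q)).
    { apply Rmult_lt_reg_r with (/ (- 2 * Re q)); [apply Rinv_0_lt_compat; lra|].
      replace (S * (- 2 * Re q) * / (- 2 * Re q)) with S by (field; lra); unfold Rdiv in *; lra. }
    apply Rsqr_incrst_0; [|apply Cmod_ge_0|lra].
    rewrite !Rsqr_pow2, Cmod_sqr; rewrite Cmod_sqr in L; unfold Re, Im in *; simpl in *; nra. }
  destruct (K z Hz) as (S1 & P1 & Q1); destruct (K w Hw) as (S2 & P2 & Q2).
  set (S := S1 + S2).
  assert (C0 : forall q, Cmod (q - RtoC (- S)) < S -> g q = g (RtoC (- S))).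
  { apply cderiv0_const; intros q Hq.
    assert (Hq' : left_half_plane q).
    { unfold left_half_plane; assert (J := re_le_Cmod (q - RtoC (- S))); assert (J2 := Rle_abs (Re (q - RtoC (- S)))).
      replace (Re (q - RtoC (- S))) with (Re q + S) in * by (unfold Re; simpl; ring); lra. }
    rewrite <- (H0 q Hq'); apply (proj1 (holomorphic_cderiv _ g) Hg q Hq'). }
  rewrite (C0 z), (C0 w); [reflexivity|apply Q2; unfold S; lra|apply Q1; unfold S; lra].
Qed.

(** * The order of contact of a smooth end with the boundary sphere *)

(** The Laplacian of [ln (1 - |f|^2)] is bounded near the puncture, because the extension of [f] is
    smooth and immersed there. *)
Lemma end_contact (f fbar : C -> R3) :
  bryant_surface punctured_disc f -> conformal_immersion euclidean disc fbar -> dot (fbar 0%C) (fbar 0%C) = 1 ->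
  (forall z, punctured_disc z -> fbar z = f z) ->
  exists (n : nat) (c K d : R), (0 < n)%nat /\ 0 < c /\ 0 <= K /\ 0 < d <= 1 /\
    forall z, 0 < Cmod z < d -> Rabs (1 - dot (f z) (f z) - c * Cmod z ^ (2 * n)) <= K * Cmod z ^ S (2 * n).
Proof.
  intros (Hball & _ & HH) (Hs & Hc) Hp E.
  assert (H0 : disc (RtoC 0)) by (unfold disc; rewrite Cmod_0; lra).
  destruct (smooth_on_continuous_dot disc (copen_disc 1) fbar (RtoC 0) Hs H0) as (_ & Cx & _ & _ & Cl).
  assert (Hpos : forall z, disc z -> 0 < dot (dx fbar z) (dx fbar z)).
  { intros z Hz; destruct (Hc z Hz) as (I & _); exact (independent_norm_pos _ _ I). }
  set (L := fun z => dot (lapv fbar z) (lapv fbar z) * / (4 * dot (dx fbar z) (dx fbar z))).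
  assert (CL : @continuous C_UniformSpace R_UniformSpace L (RtoC 0)).
  { apply continuous_Rmult; [exact Cl|apply continuous_Rinv].
    - apply continuous_Rmult; [apply continuous_const|exact Cx].
    - generalize (Hpos _ H0); lra. }
  destruct (continuous_eps_C L (RtoC 0) CL 1 Rlt_0_1) as (d0 & Hd0 & HL).
  set (r0 := Rmin d0 1); assert (Hr0 : 0 < r0) by (apply Rmin_pos; lra).
  assert (B1 : r0 <= d0) by apply Rmin_l; assert (B2 : r0 <= 1) by apply Rmin_r.
  assert (Hconf : forall z, disc z -> dot (dx fbar z) (dx fbar z) = dot (dy fbar z) (dy fbar z) /\ dot (dx fbar z) (dy fbar z) = 0).
  { intros z Hz; destruct (Hc z Hz) as (_ & Q1 & Q2); split; [exact Q1|exact Q2]. }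
  assert (Hann : forall x y, annulus r0 (x, y) -> punctured_disc (x, y)) by (intros x y; unfold annulus, punctured_disc; lra).
  assert (Hrho : forall x y, punctured_disc (x, y) -> 0 < sq_dist fbar x y).
  { intros x y P; unfold sq_dist; rewrite (E _ P); generalize (Hball _ P); lra. }
  destruct (leading_power r0 Hr0 (sq_dist fbar) (Rabs (L (RtoC 0)) + 1)) as (n & c & K & d & Hn & Hcp & HK & Hd & HP).
  - intros k x y Hxy; apply (smooth_sq_dist disc (copen_disc 1) fbar Hs k x y); unfold disc; lra.
  - unfold sq_dist; change (0, 0)%R with (RtoC 0); rewrite Hp; ring.
  - intros x y Hxy; apply Hrho, Hann, Hxy.
  - generalize (Rabs_pos (L (RtoC 0))); lra.
  - intros x y Hxy; assert (P := Hann x y Hxy); assert (D : disc (x, y)) by (destruct P; assumption).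
    rewrite (sq_dist_pde disc (copen_disc 1) fbar Hs Hconf x y D (Hrho x y P) (Hpos _ D)).
    + change (dot (lapv fbar (x, y)) (lapv fbar (x, y)) / (4 * dot (dx fbar (x, y)) (dx fbar (x, y)))) with (L (x, y)).
      rewrite Rabs_Ropp, Rabs_mult, (Rabs_pos_eq (sq_dist fbar x y ^ 2)) by apply pow2_ge_0.
      rewrite Rmult_comm; apply Rmult_le_compat_r; [apply pow2_ge_0|].
      assert (Q : Rabs (L (x, y) - L (RtoC 0)) < 1).
      { apply HL; replace ((x, y) - 0)%C with ((x, y) : C) by (unfold Cminus, Cplus, Copp; simpl; f_equal; ring).
        unfold annulus in Hxy; lra. }
      generalize (Rabs_triang (L (x, y) - L (RtoC 0)) (L (RtoC 0))).
      replace (L (x, y) - L (RtoC 0) + L (RtoC 0)) with (L (x, y)) by ring; lra.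
    + rewrite (hyp_mean_curvature_ext punctured_disc (copen_punctured 1) fbar f _ E P); apply HH, P.
  - exists n, c, K, d; repeat (split; [assumption || lra|]).
    intros [x y] Hz; rewrite <- E by (unfold punctured_disc; lra); apply HP, Hz.
Qed.

(** * The exponential covering *)

Lemma Cmod_Cexp (w : C) : Cmod (Cexp w) = exp (Re w).
Proof. apply Cmod_polar. Qed.

Lemma Cexp_punctured (w : C) : left_half_plane w -> punctured_disc (Cexp w).
Proof.
  intros Hw; unfold punctured_disc; rewrite Cmod_Cexp; split; [apply exp_pos|].
  rewrite <- exp_0; apply exp_increasing, Hw.
Qed.

Lemma Cexp_plus (w v : C) : Cexp (w + v) = (Cexp w * Cexp v)%C.
Proof.
  destruct w as [x y], v as [s t]; unfold Cexp, Re, Im; simpl; rewrite exp_plus, cos_plus, sin_plus.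
  apply injective_projections; simpl; ring.
Qed.

Definition period : C := (0, 2 * PI).

Lemma Cexp_period (w : C) : Cexp (w + period) = Cexp w.
Proof.
  rewrite Cexp_plus; replace (Cexp period) with (RtoC 1); [ring|].
  unfold Cexp, period, Re, Im; simpl; rewrite exp_0, cos_2PI, sin_2PI; apply injective_projections; simpl; ring.
Qed.

Lemma left_half_period (w : C) : left_half_plane w -> left_half_plane (w + period).
Proof. unfold left_half_plane, Re, period; simpl; lra. Qed.

Lemma cderiv_Cexp (w : C) : cderiv Cexp w (Cexp w).
Proof.
  assert (D0 : cderiv Cexp 0%C 1%C).
  { intros eps He.
    set (eta := Rmin (eps / 7) 1); assert (Heta : 0 < eta) by (apply Rmin_pos; lra).
    assert (e1 : eta <= eps / 7) by apply Rmin_l; assert (e2 : eta <= 1) by apply Rmin_r.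
    destruct (proj1 (is_derive_eps exp 0 1) (eq_rect _ (is_derive exp 0) (is_derive_exp 0) _ exp_0) eta Heta) as (d1 & P1 & Q1).
    destruct (proj1 (is_derive_eps cos 0 0) (eq_rect _ (is_derive cos 0) (is_derive_cos 0) _ (eq_trans (f_equal Ropp sin_0) Ropp_0)) eta Heta) as (d2 & P2 & Q2).
    destruct (proj1 (is_derive_eps sin 0 1) (eq_rect _ (is_derive sin 0) (is_derive_sin 0) _ cos_0) eta Heta) as (d3 & P3 & Q3).
    set (d := Rmin (Rmin d1 d2) (Rmin d3 (eta / 2))).
    assert (B1 : d <= Rmin d1 d2) by apply Rmin_l; assert (B2 : d <= Rmin d3 (eta / 2)) by apply Rmin_r.
    assert (B3 := Rle_trans _ _ _ B1 (Rmin_l _ _)); assert (B4 := Rle_trans _ _ _ B1 (Rmin_r _ _)).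
    assert (B5 := Rle_trans _ _ _ B2 (Rmin_l _ _)); assert (B6 := Rle_trans _ _ _ B2 (Rmin_r _ _)).
    exists d; split; [unfold d; repeat apply Rmin_pos; lra|]; intros [x y] Hw.
    replace ((x, y) - 0)%C with ((x, y) : C) in * by (unfold Cminus, Cplus, Copp; simpl; f_equal; ring).
    assert (X := re_le_Cmod (x, y)); assert (Y := im_le_Cmod (x, y)); unfold Re, Im in X, Y; simpl fst in X; simpl snd in Y.
    specialize (Q1 x); specialize (Q2 y); specialize (Q3 y).
    rewrite Rminus_0_r in Q1, Q2, Q3; rewrite exp_0 in Q1; rewrite cos_0 in Q2; rewrite sin_0, Rminus_0_r in Q3.
    specialize (Q1 ltac:(lra)); specialize (Q2 ltac:(lra)); specialize (Q3 ltac:(lra)).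
    set (m := Cmod (x, y)) in *.
    eapply Rle_trans; [apply Cmod_le_abs|].
    replace (Re (Cexp (x, y) - Cexp 0 - 1 * (x, y))) with ((exp x - 1 - 1 * x) + (cos y - 1) * exp x).
    2: { unfold Cexp, Re, Im; simpl; rewrite exp_0, cos_0; ring. }
    replace (Im (Cexp (x, y) - Cexp 0 - 1 * (x, y))) with ((exp x - 1) * sin y + (sin y - 1 * y)).
    2: { unfold Cexp, Re, Im; simpl; rewrite exp_0, sin_0; ring. }
    assert (A1 : Rabs (exp x - 1) <= 2 * Rabs x).
    { replace (exp x - 1) with ((exp x - 1 - 1 * x) + x) by ring; eapply Rle_trans; [apply Rabs_triang|].
      assert (eta * Rabs x <= 1 * Rabs x) by (apply Rmult_le_compat_r; [apply Rabs_pos|lra]); lra. }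
    assert (A2 : Rabs (sin y) <= 2 * Rabs y).
    { replace (sin y) with ((sin y - 1 * y) + y) by ring; eapply Rle_trans; [apply Rabs_triang|].
      assert (eta * Rabs y <= 1 * Rabs y) by (apply Rmult_le_compat_r; [apply Rabs_pos|lra]); lra. }
    assert (A3 : Rabs (exp x) <= 2).
    { replace (exp x) with ((exp x - 1) + 1) by ring; eapply Rle_trans; [apply Rabs_triang|rewrite Rabs_R1]; unfold m in *; lra. }
    assert (A4 : Rabs (cos y - 1) <= eta * Rabs y).
    { replace (cos y - 1) with (cos y - 1 - 0 * y) by ring; exact Q2. }
    assert (A5 : Rabs ((cos y - 1) * exp x) <= eta * m * 2).
    { rewrite Rabs_mult; apply Rmult_le_compat; auto using Rabs_pos.
      eapply Rle_trans; [exact A4|apply Rmult_le_compat_l; lra]. }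
    assert (A6 : Rabs ((exp x - 1) * sin y) <= eta * (2 * m)).
    { rewrite Rabs_mult; apply Rmult_le_compat; auto using Rabs_pos; lra. }
    assert (A7 : eta * Rabs x <= eta * m) by (apply Rmult_le_compat_l; lra).
    assert (A8 : eta * Rabs y <= eta * m) by (apply Rmult_le_compat_l; lra).
    assert (A9 : 6 * eta * m <= eps * m) by (apply Rmult_le_compat_r; [apply Cmod_ge_0|lra]).
    assert (T1 := Rabs_triang (exp x - 1 - 1 * x) ((cos y - 1) * exp x)).
    assert (T2 := Rabs_triang ((exp x - 1) * sin y) (sin y - 1 * y)); lra. }
  assert (D : cderiv (fun v => Cexp w * Cexp (- w + v))%C w (Cexp w * 1)%C).
  { apply cderiv_scal; apply translate_deriv; replace (- w + w)%C with (RtoC 0) by ring; exact D0. }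
  apply (cderiv_eq _ _ _ _ (Cmult_1_r (Cexp w))).
  refine (cderiv_ext_loc _ _ _ _ _ D); exists 1; split; [lra|]; intros v _.
  rewrite <- Cexp_plus; f_equal; ring.
Qed.

(** * Triviality of the monodromy *)

Definition norm_sq (F : C -> M2C) (z : C) : R := sqn (e00 F z) + sqn (e01 F z) + sqn (e10 F z) + sqn (e11 F z).

(** [1 - |f|^2] gives back [x_0], and then [f] gives back the matrix [F F^H]. *)
Lemma same_point_same_product (F : C -> M2C) (z w : C) :
  1 - dot (surface F z) (surface F z) = 2 / surface_x0_succ F z -> 1 - dot (surface F w) (surface F w) = 2 / surface_x0_succ F w ->
  surface F z = surface F w ->
  (e00 F z * Cconj (e00 F z) + e01 F z * Cconj (e01 F z) = e00 F w * Cconj (e00 F w) + e01 F w * Cconj (e01 F w))%C /\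
  (e00 F z * Cconj (e10 F z) + e01 F z * Cconj (e11 F z) = e00 F w * Cconj (e10 F w) + e01 F w * Cconj (e11 F w))%C /\
  (e10 F z * Cconj (e00 F z) + e11 F z * Cconj (e01 F z) = e10 F w * Cconj (e00 F w) + e11 F w * Cconj (e01 F w))%C /\
  (e10 F z * Cconj (e10 F z) + e11 F z * Cconj (e11 F z) = e10 F w * Cconj (e10 F w) + e11 F w * Cconj (e11 F w))%C.
Proof.
  intros Tz Tw E; rewrite E, Tw in Tz.
  assert (Pz : 0 < surface_x0_succ F z) by apply x0_succ_pos; assert (Pw : 0 < surface_x0_succ F w) by apply x0_succ_pos.
  assert (ET : surface_x0_succ F z = surface_x0_succ F w).
  { apply Rinv_eq_reg; unfold Rdiv in Tz; lra. }
  unfold surface, ball_map in E; fold (surface_x0_succ F z) (surface_x0_succ F w) in E; rewrite ET in E.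
  apply (f_equal (fun p : R3 => (c1 p * surface_x0_succ F w, c2 p * surface_x0_succ F w, c3 p * surface_x0_succ F w))) in E.
  unfold c1, c2, c3 in E; simpl in E.
  assert (Q : forall X, X / surface_x0_succ F w * surface_x0_succ F w = X) by (intros; field; lra).
  rewrite !Q in E; injection E as E1 E2 E3.
  unfold surface_x0_succ, x0_succ, x0_coord in ET; unfold x3_coord in E3; unfold x12_coord in E1, E2.
  revert ET E1 E2 E3.
  destruct (e00 F z), (e01 F z), (e10 F z), (e11 F z), (e00 F w), (e01 F w), (e10 F w), (e11 F w).
  unfold sqn, Re, Im; simpl; intros.
  repeat split; apply injective_projections; simpl; lra.
Qed.

Section Monodromy.
Context (f : C -> R3) (F : C -> M2C) (n : nat) (c K d : R).
Context (HN : holomorphic_null_immersion_SL2 left_half_plane F).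
Context (Hf : forall w, left_half_plane w -> f (Cexp w) = bryant_point (F w)).
Context (Hn : (0 < n)%nat) (Hc : 0 < c) (HK : 0 <= K) (Hd : 0 < d <= 1).
Context (Hcontact : forall z, 0 < Cmod z < d ->
  Rabs (1 - dot (f z) (f z) - c * Cmod z ^ (2 * n)) <= K * Cmod z ^ S (2 * n)).

Lemma entry_hol (i j : nat) : (i < 2)%nat -> (j < 2)%nat -> holomorphic_on left_half_plane (fun w => entry (F w) i j).
Proof. apply HN. Qed.

Lemma half_det (w : C) : left_half_plane w -> (e00 F w * e11 F w - e01 F w * e10 F w = 1)%C.
Proof. intros Hw; apply null_immersion_entries in HN; apply HN, Hw. Qed.

Lemma half_sq_dist (w : C) : left_half_plane w -> 1 - dot (surface F w) (surface F w) = 2 / surface_x0_succ F w.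
Proof.
  intros Hw; apply null_immersion_entries in HN; destruct HN as ((Ha & Hb & Hc' & Hd') & Hdet & Hnull & Hne).
  destruct (null_surface _ copen_left _ _ _ _ Ha Hb Hc' Hd' Hdet Hnull Hne) as [_ J]; apply (J w Hw).
Qed.

Lemma half_norm_sq (w : C) : left_half_plane w ->
  norm_sq F w = 4 / (1 - dot (f (Cexp w)) (f (Cexp w))) - 2.
Proof.
  intros Hw; rewrite Hf, bryant_point_surface, half_sq_dist by exact Hw.
  assert (P : 0 < surface_x0_succ F w) by apply x0_succ_pos.
  replace (4 / (2 / surface_x0_succ F w) - 2) with (2 * (surface_x0_succ F w - 1)) by (field; lra).
  unfold norm_sq, surface_x0_succ, x0_succ, x0_coord; field.
Qed.

(** [z ^ n F] read on the half plane: the power of the exponential has period [2 pi i], so this function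
    has the monodromy of [F], and its norm has a finite nonzero limit. *)
Definition lifted (i j : nat) (w : C) : C := (Cexp w ^ n * entry (F w) i j)%C.

Lemma lifted_hol (i j : nat) : (i < 2)%nat -> (j < 2)%nat -> holomorphic_on left_half_plane (lifted i j).
Proof.
  intros Hi Hj.
  apply (holomorphic_intro _ _ (fun w => (RtoC (INR n) * Cexp w ^ pred n * Cexp w) * entry (F w) i j
    + Cexp w ^ n * C_derive (fun w => entry (F w) i j) w)%C).
  intros w Hw; apply (cderiv_mult (fun w => Cexp w ^ n)%C (fun w => entry (F w) i j)).
  - apply (cderiv_comp (fun z => z ^ n)%C Cexp); [apply cderiv_pow|apply cderiv_Cexp].
  - apply (proj1 (holomorphic_cderiv _ (fun w => entry (F w) i j)) (entry_hol i j Hi Hj) w Hw).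
Qed.

Lemma lifted_entries_sq (w : C) : entries_sq lifted w = Cmod (Cexp w) ^ (2 * n) * norm_sq F w.
Proof. unfold entries_sq, lifted; rewrite !sqn_mult, sqn_pow; unfold norm_sq, e00, e01, e10, e11; ring. Qed.

(** [|F|^2 = 4 / (1 - |f|^2) - 2] and [1 - |f|^2 ~ c |z|^(2 n)]. *)
Lemma lifted_limit (eps : R) : 0 < eps -> exists S0, S0 < 0 /\
  forall w, Re w < S0 -> Rabs (entries_sq lifted w - 4 / c) <= eps.
Proof.
  intros He.
  set (B := 8 * K / (c * c) + 2).
  assert (HB : 0 < B) by (unfold B; assert (0 <= 8 * K / (c * c)) by (apply Rdiv_le_0_compat; nra); lra).
  set (t0 := Rmin (Rmin (d / 2) (eps / B)) (c / (2 * K + 1))).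
  assert (Ht0 : 0 < t0) by (unfold t0; repeat apply Rmin_pos; try lra; apply Rdiv_lt_0_compat; lra).
  assert (b1 : t0 <= Rmin (d / 2) (eps / B)) by apply Rmin_l; assert (b2 := Rle_trans _ _ _ b1 (Rmin_l _ _)).
  assert (b3 := Rle_trans _ _ _ b1 (Rmin_r _ _)); assert (b4 : t0 <= c / (2 * K + 1)) by apply Rmin_r.
  exists (ln t0); split; [rewrite <- ln_1; apply ln_increasing; lra|]; intros w Hw.
  set (t := Cmod (Cexp w)).
  assert (Ht : 0 < t < t0).
  { unfold t; rewrite Cmod_Cexp; split; [apply exp_pos|rewrite <- (exp_ln t0 Ht0); apply exp_increasing, Hw]. }
  assert (Hw' : left_half_plane w).
  { unfold left_half_plane; apply exp_lt_inv; rewrite exp_0, <- Cmod_Cexp; fold t; lra. }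
  rewrite lifted_entries_sq, half_norm_sq by exact Hw'.
  assert (HC := Hcontact (Cexp w) ltac:(fold t; lra)); fold t in HC |- *.
  set (rho := 1 - dot (f (Cexp w)) (f (Cexp w))) in *.
  change (t ^ S (2 * n)) with (t * t ^ (2 * n)) in HC.
  set (m := t ^ (2 * n)) in *; assert (Hm : 0 < m) by (apply pow_lt, Ht).
  assert (Hm1 : m <= t).
  { assert (P1 : t ^ pred (2 * n) <= 1) by (rewrite <- (pow1 (pred (2 * n))); apply pow_incr; lra).
    unfold m; replace (t ^ (2 * n)) with (t * t ^ pred (2 * n)).
    - rewrite <- (Rmult_1_r t) at 3; apply Rmult_le_compat_l; lra.
    - change (t ^ S (pred (2 * n)) = t ^ (2 * n)); f_equal; lia. }
  apply Rabs_le_between in HC.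
  assert (KT : K * t <= c / 2).
  { assert (t * (2 * K + 1) <= c).
    { apply Rle_trans with (c / (2 * K + 1) * (2 * K + 1)); [apply Rmult_le_compat_r; lra|right; field; lra]. }
    lra. }
  assert (R1 : c / 2 * m <= rho) by nra.
  assert (R0 : 0 < rho) by nra.
  replace (m * (4 / rho - 2) - 4 / c) with (- (4 * (rho - c * m) / (c * rho)) - 2 * m) by (field; lra).
  assert (Q : Rabs (4 * (rho - c * m) / (c * rho)) <= 8 * K / (c * c) * t).
  { assert (Pcr : 0 < c * rho) by nra.
    unfold Rdiv; rewrite Rabs_mult, (Rabs_pos_eq (/ (c * rho))) by (apply Rlt_le, Rinv_0_lt_compat, Pcr).
    apply Rmult_le_reg_r with (c * rho); [exact Pcr|].
    rewrite Rmult_assoc, Rinv_l, Rmult_1_r by lra.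
    apply Rle_trans with (4 * (K * (t * m))).
    - rewrite Rabs_mult, (Rabs_pos_eq 4) by lra; apply Rmult_le_compat_l; [lra|apply Rabs_le; lra].
    - replace (8 * K * / (c * c) * t * (c * rho)) with (8 * K * t * (rho / c)) by (field; lra).
      assert (rho / c >= m / 2).
      { apply Rle_ge, Rmult_le_reg_r with c; [exact Hc|]; unfold Rdiv; rewrite (Rmult_assoc rho), Rinv_l by lra; lra. }
      assert (0 <= K * t) by nra; nra. }
  eapply Rle_trans; [apply Rabs_triang|]; rewrite !Rabs_Ropp, (Rabs_pos_eq (2 * m)) by lra.
  assert (B * t <= eps).
  { apply Rle_trans with (B * (eps / B)); [apply Rmult_le_compat_l; lra|right; field; lra]. }
  unfold B in *; lra.
Qed.

(** The means of [|H|^2] over a circle and at its centre have the same limit, and their difference bounds [|H'|^2]. *)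
Lemma lifted_deriv_small (delta : R) : 0 < delta -> exists S0, S0 < 0 /\
  forall w i j, Re w < S0 -> (i < 2)%nat -> (j < 2)%nat -> Cmod (C_derive (lifted i j) w) <= delta.
Proof.
  intros Hdl.
  set (eps := delta ^ 2 / 8); assert (He : 0 < eps) by (unfold eps; assert (0 < delta ^ 2) by (apply pow_lt, Hdl); lra).
  destruct (lifted_limit eps He) as (S1 & HS1 & HL).
  exists (S1 - 1); split; [lra|]; intros w.
  assert (Hsum : Re w < S1 - 1 -> Cmod (C_derive (lifted 0 0) w) ^ 2 + Cmod (C_derive (lifted 0 1) w) ^ 2
    + Cmod (C_derive (lifted 1 0) w) ^ 2 + Cmod (C_derive (lifted 1 1) w) ^ 2 <= delta ^ 2).
  { intros Hw.
    assert (Hin : forall z : C, Cmod z < 1 -> Re (w + z) < S1).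
    { intros z Hz; assert (J := re_le_Cmod z); assert (J2 := Rle_abs (Re z)).
      replace (Re (w + z)) with (Re w + Re z) by (unfold Re; simpl; ring); lra. }
    assert (Hinl : forall z : C, Cmod z < 1 -> left_half_plane (w + z)) by (intros z Hz; unfold left_half_plane; generalize (Hin z Hz); lra).
    assert (Hh : forall i j, (i < 2)%nat -> (j < 2)%nat -> holomorphic_on (fun z => Cmod z < 1) (fun z => lifted i j (w + z)%C)).
    { intros i j Hi Hj; apply (holomorphic_intro _ _ (fun z => C_derive (lifted i j) (w + z)%C)); intros z Hz.
      apply translate_deriv; apply (proj1 (holomorphic_cderiv _ (lifted i j)) (lifted_hol i j Hi Hj) _ (Hinl z Hz)). }
    assert (Hd0 : forall i j, (i < 2)%nat -> (j < 2)%nat -> C_derive (fun z => lifted i j (w + z)%C) 0%C = C_derive (lifted i j) w).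
    { intros i j Hi Hj; apply cderiv_unique; apply translate_deriv; replace (w + 0)%C with w by ring.
      apply (proj1 (holomorphic_cderiv _ (lifted i j)) (lifted_hol i j Hi Hj)); unfold left_half_plane; lra. }
    assert (Hcirc : forall t, Cmod (circ (/ 2) t) < 1) by (intros t; rewrite Cmod_circ; lra).
    assert (Hcont : forall i j, (i < 2)%nat -> (j < 2)%nat -> forall t, continuous (fun t => Cmod (lifted i j (w + circ (/ 2) t)) ^ 2) t).
    { intros i j Hi Hj t; apply (continuous_ext (fun t => sqn (lifted i j (w + circ (/ 2) t)%C))).
      { intros s; apply sqn_Cmod. }
      assert (Q : @continuous R_UniformSpace C_UniformSpace (fun t => lifted i j (w + circ (/ 2) t)%C) t).
      { apply (continuous_comp (circ (/ 2)) (fun z => lifted i j (w + z)%C)); [apply ccontR_circ|].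
        apply (holomorphic_ccont _ _ _ (Hh i j Hi Hj)); apply Hcirc. }
      assert (Q1 := continuous_Re _ t Q); assert (Q2 := continuous_Im _ t Q).
      apply (continuous_ext (fun t => Re (lifted i j (w + circ (/ 2) t)) * Re (lifted i j (w + circ (/ 2) t))
        + Im (lifted i j (w + circ (/ 2) t)) * Im (lifted i j (w + circ (/ 2) t)))); [intros s; apply Rminus_diag_uniq; unfold sqn; simpl; ring|].
      apply continuous_Rplus; apply continuous_Rmult; assumption. }
    assert (M : forall i j, (i < 2)%nat -> (j < 2)%nat ->
      2 * PI * (Cmod (lifted i j w) ^ 2 + (/ 2) ^ 2 * Cmod (C_derive (lifted i j) w) ^ 2)
        <= RInt (fun t => Cmod (lifted i j (w + circ (/ 2) t)) ^ 2) 0 (2 * PI)).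
    { intros i j Hi Hj; rewrite <- (Hd0 i j Hi Hj).
      replace (lifted i j w) with (lifted i j (w + 0)) by (f_equal; ring).
      apply (mean_square (fun z => lifted i j (w + z)%C) 1 (/ 2) (Hh i j Hi Hj)); lra. }
    assert (Exi : forall g : R -> R, (forall t, continuous g t) -> ex_RInt g 0 (2 * PI)).
    { intros g Hg; apply (ex_RInt_continuous (V := R_CompleteNormedModule)); intros; apply Hg. }
    assert (L2 : (0 < 2)%nat) by lia; assert (L3 : (1 < 2)%nat) by lia.
    set (g00 := fun t => Cmod (lifted 0 0 (w + circ (/ 2) t)) ^ 2); set (g01 := fun t => Cmod (lifted 0 1 (w + circ (/ 2) t)) ^ 2).
    set (g10 := fun t => Cmod (lifted 1 0 (w + circ (/ 2) t)) ^ 2); set (g11 := fun t => Cmod (lifted 1 1 (w + circ (/ 2) t)) ^ 2).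
    assert (C00 : forall t, continuous g00 t) by (apply Hcont; assumption); assert (C01 : forall t, continuous g01 t) by (apply Hcont; assumption).
    assert (C10 : forall t, continuous g10 t) by (apply Hcont; assumption); assert (C11 : forall t, continuous g11 t) by (apply Hcont; assumption).
    assert (P1 : forall g h : R -> R, (forall t, continuous g t) -> (forall t, continuous h t) ->
      RInt g 0 (2 * PI) + RInt h 0 (2 * PI) = RInt (fun t => g t + h t) 0 (2 * PI)).
    { intros g h Hg Hh'; symmetry; apply (RInt_plus (V := R_CompleteNormedModule)); apply Exi; assumption. }
    assert (Hp : forall g h : R -> R, (forall t, continuous g t) -> (forall t, continuous h t) -> forall t, continuous (fun t => g t + h t) t).
    { intros g h Hg Hh' t; apply continuous_Rplus; auto. }
    assert (Tot : RInt g00 0 (2 * PI) + RInt g01 0 (2 * PI) + RInt g10 0 (2 * PI) + RInt g11 0 (2 * PI) <= 2 * PI * (4 / c + eps)).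
    { rewrite (P1 g00 g01), (P1 (fun t => g00 t + g01 t) g10), (P1 (fun t => g00 t + g01 t + g10 t) g11); auto.
      apply RInt_circle_le; [auto 6|]; intros t.
      assert (A := HL (w + circ (/ 2) t)%C (Hin _ (Hcirc t))); apply Rabs_le_between in A.
      unfold entries_sq in A; rewrite !sqn_Cmod in A; unfold g00, g01, g10, g11; lra. }
    assert (A := HL w ltac:(lra)); apply Rabs_le_between in A; unfold entries_sq in A; rewrite !sqn_Cmod in A.
    assert (M00 := M 0%nat 0%nat L2 L2); assert (M01 := M 0%nat 1%nat L2 L3); assert (M10 := M 1%nat 0%nat L3 L2); assert (M11 := M 1%nat 1%nat L3 L3).
    fold g00 in M00; fold g01 in M01; fold g10 in M10; fold g11 in M11.
    set (D := Cmod (C_derive (lifted 0 0) w) ^ 2 + Cmod (C_derive (lifted 0 1) w) ^ 2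
      + Cmod (C_derive (lifted 1 0) w) ^ 2 + Cmod (C_derive (lifted 1 1) w) ^ 2).
    assert (Z : 2 * PI * ((Cmod (lifted 0 0 w) ^ 2 + Cmod (lifted 0 1 w) ^ 2 + Cmod (lifted 1 0 w) ^ 2 + Cmod (lifted 1 1 w) ^ 2) + (/ 2) ^ 2 * D)
      <= 2 * PI * (4 / c + eps)) by (unfold D; lra).
    apply Rmult_le_reg_l in Z; [|generalize PI_RGT_0; lra].
    unfold eps in *; lra. }
  intros i j Hw Hi Hj; specialize (Hsum Hw).
  assert (P := fun i j => pow2_ge_0 (Cmod (C_derive (lifted i j) w))).
  assert (P00 := P 0%nat 0%nat); assert (P01 := P 0%nat 1%nat); assert (P10 := P 1%nat 0%nat); assert (P11 := P 1%nat 1%nat).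
  apply Rsqr_incr_0_var; [|lra]; rewrite !Rsqr_pow2.
  revert i j Hi Hj; apply index_cases; lra.
Qed.

(** Integrate the derivative over one period. *)
Lemma lifted_shift_small (delta : R) : 0 < delta -> exists S0, S0 < 0 /\
  forall w i j, Re w < S0 -> (i < 2)%nat -> (j < 2)%nat -> sqn (lifted i j (w + period) - lifted i j w) <= delta.
Proof.
  intros Hdl; assert (HPI := PI_RGT_0).
  set (e := Rmin 1 delta / (2 * (2 * PI))).
  assert (Hm : 0 < Rmin 1 delta) by (apply Rmin_pos; lra); assert (m1 := Rmin_l 1 delta); assert (m2 := Rmin_r 1 delta).
  assert (He : 0 < e) by (unfold e; apply Rdiv_lt_0_compat; lra).
  destruct (lifted_deriv_small e He) as (S0 & HS & HD); exists S0; split; [exact HS|].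
  intros w i j Hw Hi Hj.
  set (h := lifted i j); assert (Hh : holomorphic_on left_half_plane h) by (apply lifted_hol; assumption).
  assert (Hh' := holomorphic_deriv _ _ copen_left Hh).
  assert (Hline : forall t, Re (w + RtoC t * period) = Re w) by (intros t; unfold Re, period; simpl; ring).
  assert (Hl : forall t, left_half_plane (w + RtoC t * period)) by (intros t; unfold left_half_plane; rewrite Hline; lra).
  assert (I : CInt (fun t => C_derive h (w + RtoC t * period) * period)%C 0 1 = (h (w + RtoC 1 * period) - h (w + RtoC 0 * period))%C).
  { apply (CInt_derive (fun t => h (w + RtoC t * period)%C)).
    - intros t; apply (rcderiv_comp h (fun t => w + RtoC t * period)%C); [|apply rcderiv_affine].
      apply (proj1 (holomorphic_cderiv _ h) Hh _ (Hl t)).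
    - intros t; apply continuous_Cmult; [|apply continuous_Cconst].
      eapply (rcderiv_ccontR (fun t => C_derive h (w + RtoC t * period)%C)).
      apply (rcderiv_comp (C_derive h) (fun t => w + RtoC t * period)%C); [|apply rcderiv_affine].
      apply (proj1 (holomorphic_cderiv _ (C_derive h)) Hh' _ (Hl t)). }
  replace (w + RtoC 1 * period)%C with (w + period)%C in I by ring; replace (w + RtoC 0 * period)%C with w in I by ring.
  rewrite <- I, sqn_Cmod.
  assert (Cp : Cmod period = 2 * PI).
  { replace period with (RtoC (2 * PI) * Ci)%C by (unfold period, Ci, RtoC; apply injective_projections; simpl; ring).
    rewrite Cmod_mult, Cmod_R, Rabs_pos_eq, Cmod_Ci by lra; ring. }
  assert (Bd : Cmod (CInt (fun t => C_derive h (w + RtoC t * period) * period)%C 0 1) <= 2 * (e * (2 * PI)) * (1 - 0)).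
  { apply CInt_bound; [lra| |].
    - intros t _; apply continuous_Cmult; [|apply continuous_Cconst].
      eapply (rcderiv_ccontR (fun t => C_derive h (w + RtoC t * period)%C)).
      apply (rcderiv_comp (C_derive h) (fun t => w + RtoC t * period)%C); [|apply rcderiv_affine].
      apply (proj1 (holomorphic_cderiv _ (C_derive h)) Hh' _ (Hl t)).
    - intros t _; rewrite Cmod_mult, Cp; apply Rmult_le_compat_r; [lra|]; apply HD; auto; rewrite Hline; exact Hw. }
  replace (2 * (e * (2 * PI)) * (1 - 0)) with (Rmin 1 delta) in Bd by (unfold e; field; lra).
  assert (G := Cmod_ge_0 (CInt (fun t => C_derive h (w + RtoC t * period) * period)%C 0 1)); nra.
Qed.

Lemma monodromy_relations (w : C) : left_half_plane w ->
  (e00 F w * Cconj (e00 F w) + e01 F w * Cconj (e01 F w) = e00 F (w + period) * Cconj (e00 F (w + period)) + e01 F (w + period) * Cconj (e01 F (w + period)))%C /\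
  (e00 F w * Cconj (e10 F w) + e01 F w * Cconj (e11 F w) = e00 F (w + period) * Cconj (e10 F (w + period)) + e01 F (w + period) * Cconj (e11 F (w + period)))%C /\
  (e10 F w * Cconj (e00 F w) + e11 F w * Cconj (e01 F w) = e10 F (w + period) * Cconj (e00 F (w + period)) + e11 F (w + period) * Cconj (e01 F (w + period)))%C /\
  (e10 F w * Cconj (e10 F w) + e11 F w * Cconj (e11 F w) = e10 F (w + period) * Cconj (e10 F (w + period)) + e11 F (w + period) * Cconj (e11 F (w + period)))%C.
Proof.
  intros Hw; assert (Hw' := left_half_period w Hw); apply same_point_same_product; try (apply half_sq_dist; assumption).
  rewrite <- !bryant_point_surface, <- !Hf, Cexp_period by assumption; reflexivity.
Qed.

(** The upper left entry of [F(w)^{-1} F(w + 2 pi i)]. It suffices to follow this one entry: the quotient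
    is in [SU(2)], and there the real part of this entry is [1] only for the identity. *)
Definition monodromy_entry (w : C) : C := (e11 F w * e00 F (w + period) - e01 F w * e10 F (w + period))%C.

Lemma shifted_hol (i j : nat) : (i < 2)%nat -> (j < 2)%nat -> holomorphic_on left_half_plane (fun w => entry (F (w + period)) i j).
Proof.
  intros Hi Hj; apply (holomorphic_intro _ _ (fun w => C_derive (fun w => entry (F w) i j) (w + period)%C)).
  intros w Hw; assert (D := proj1 (holomorphic_cderiv _ (fun w => entry (F w) i j)) (entry_hol i j Hi Hj) _ (left_half_period w Hw)).
  replace (w + period)%C with (period + w)%C in * by ring.
  assert (D' := translate_deriv (fun w => entry (F w) i j) period w _ D).
  refine (cderiv_ext_loc _ _ _ _ _ D'); exists 1; split; [lra|]; intros v _; do 2 f_equal; ring.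
Qed.

Lemma hol_cross (g h k l : C -> C) : holomorphic_on left_half_plane g -> holomorphic_on left_half_plane h ->
  holomorphic_on left_half_plane k -> holomorphic_on left_half_plane l ->
  holomorphic_on left_half_plane (fun w => g w * h w - k w * l w)%C.
Proof.
  intros Hg Hh Hk Hl; assert (D := fun g => proj1 (holomorphic_cderiv left_half_plane g)).
  apply (holomorphic_intro _ _ (fun z => (C_derive g z * h z + g z * C_derive h z) - (C_derive k z * l z + k z * C_derive l z))%C).
  intros z Hz; apply cderiv_minus; apply cderiv_mult; apply D; assumption.
Qed.

Lemma monodromy_entry_constant (w v : C) : left_half_plane w -> left_half_plane v -> monodromy_entry w = monodromy_entry v.
Proof.
  assert (L2 : (0 < 2)%nat) by lia; assert (L3 : (1 < 2)%nat) by lia.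
  assert (Hm : holomorphic_on left_half_plane monodromy_entry).
  { exact (hol_cross _ _ _ _ (entry_hol 1 1 L3 L3) (shifted_hol 0 0 L2 L2) (entry_hol 0 1 L2 L3) (shifted_hol 1 0 L3 L2)). }
  apply (half_plane_constant monodromy_entry Hm); intros z Hz.
  apply (conj_holomorphic_deriv left_half_plane monodromy_entry (fun w => e00 F w * e11 F (w + period) - e10 F w * e01 F (w + period))%C z copen_left Hm); [| |exact Hz].
  - exact (hol_cross _ _ _ _ (entry_hol 0 0 L2 L2) (shifted_hol 1 1 L3 L3) (entry_hol 1 0 L3 L2) (shifted_hol 0 1 L2 L3)).
  - intros u Hu; destruct (monodromy_relations u Hu) as (E1 & E2 & E3 & E4).
    apply (quotient_unitary _ _ _ _ _ _ _ _ (half_det u Hu) (half_det _ (left_half_period u Hu)) E1 E2 E3 E4).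
Qed.

Lemma lifted_period (i j : nat) (w : C) : lifted i j (w + period) = (Cexp w ^ n * entry (F (w + period)) i j)%C.
Proof. unfold lifted; rewrite Cexp_period; reflexivity. Qed.

(** The squared distance of [H(w)] and [H(w + 2 pi i)] is [2 - 2 Re u] times [|H|^2], with [u] the constant
    entry of the quotient. The distance tends to [0] and [|H|^2] to [4 / c], so [Re u = 1]. *)
Theorem monodromy_trivial (w : C) : left_half_plane w ->
  e00 F (w + period) = e00 F w /\ e01 F (w + period) = e01 F w /\ e10 F (w + period) = e10 F w /\ e11 F (w + period) = e11 F w.
Proof.
  intros Hw.
  assert (L2 : (0 < 2)%nat) by lia; assert (L3 : (1 < 2)%nat) by lia.
  assert (Key : forall v, left_half_plane v -> entries_sq (fun i j v => lifted i j (v + period) - lifted i j v)%C v = (2 - 2 * Re (monodromy_entry w)) * entries_sq lifted v).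
  { intros v Hv; rewrite (monodromy_entry_constant w v Hw Hv).
    destruct (monodromy_relations v Hv) as (E1 & E2 & E3 & E4).
    assert (Q := quotient_distance _ _ _ _ _ _ _ _ (half_det v Hv) (half_det _ (left_half_period v Hv)) E1 E2 E3 E4).
    fold (monodromy_entry v) in Q; rewrite lifted_entries_sq; unfold norm_sq.
    transitivity (Cmod (Cexp v) ^ (2 * n) * ((2 - 2 * Re (monodromy_entry v)) * (sqn (e00 F v) + sqn (e01 F v) + sqn (e10 F v) + sqn (e11 F v)))); [|ring].
    rewrite <- Q, <- sqn_pow, !Rmult_plus_distr_l, <- !sqn_mult; unfold entries_sq; rewrite !lifted_period; unfold lifted, e00, e01, e10, e11.
    assert (Fac : forall p q s : C, (p * q - p * s = p * (q - s))%C) by (intros; ring).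
    rewrite !Fac; reflexivity. }
  assert (Ic : 0 < / c) by (apply Rinv_0_lt_compat, Hc).
  assert (Small : forall eps, 0 < eps -> 0 <= (2 - 2 * Re (monodromy_entry w)) * / c <= eps).
  { intros eps He.
    destruct (lifted_limit (2 / c) ltac:(unfold Rdiv; lra)) as (S1 & HS1 & HL).
    destruct (lifted_shift_small (eps / 4) ltac:(lra)) as (S2 & HS2 & HD).
    set (v := RtoC (Rmin S1 S2 - 1)).
    assert (v1 : Re v < S1) by (unfold v, Re; simpl; generalize (Rmin_l S1 S2); lra).
    assert (v2 : Re v < S2) by (unfold v, Re; simpl; generalize (Rmin_r S1 S2); lra).
    assert (Hv : left_half_plane v) by (unfold left_half_plane; lra).
    assert (A := HL v v1); apply Rabs_le_between in A.
    assert (E := Key v Hv).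
    assert (B := fun i j => HD v i j v2); assert (B00 := B 0%nat 0%nat L2 L2); assert (B01 := B 0%nat 1%nat L2 L3).
    assert (B10 := B 1%nat 0%nat L3 L2); assert (B11 := B 1%nat 1%nat L3 L3).
    unfold entries_sq at 1 in E.
    assert (G := fun i j => sqn_nonneg (lifted i j (v + period) - lifted i j v)).
    assert (G00 := G 0%nat 0%nat); assert (G01 := G 0%nat 1%nat); assert (G10 := G 1%nat 0%nat); assert (G11 := G 1%nat 1%nat).
    unfold Rdiv in A; set (k := 2 - 2 * Re (monodromy_entry w)) in *; set (q := entries_sq lifted v) in *.
    assert (q2 : / c <= q) by lra.
    assert (K1 : 0 <= k * q <= eps) by lra.
    assert (K0 : 0 <= k) by (apply Rmult_le_reg_r with q; lra).
    split; [nra|]; assert (k * / c <= k * q) by (apply Rmult_le_compat_l; lra); lra. }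
  assert (R1 : Re (monodromy_entry w) = 1).
  { assert (Z : (2 - 2 * Re (monodromy_entry w)) * / c = 0).
    { apply Rle_antisym; [|apply (Small 1); lra].
      apply Rle_plus_epsilon; intros eps He; rewrite Rplus_0_l; apply (Small eps He). }
    apply Rmult_integral in Z; destruct Z as [Z|Z]; lra. }
  destruct (monodromy_relations w Hw) as (E1 & E2 & E3 & E4).
  exact (quotient_trivial _ _ _ _ _ _ _ _ (half_det w Hw) (half_det _ (left_half_period w Hw)) E1 E2 E3 E4 R1).
Qed.

End Monodromy.

(** * Descent to the punctured disc *)

Lemma matrix_eq (A B : M2C) : (forall i j, (i < 2)%nat -> (j < 2)%nat -> entry A i j = entry B i j) -> A = B.
Proof.
  intros E; rewrite <- (mk_matrix_bij (RtoC 0) A), <- (mk_matrix_bij (RtoC 0) B).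
  apply mk_matrix_ext; exact E.
Qed.

Lemma Cexp_surjective (z : C) : punctured_disc z -> exists w, left_half_plane w /\ Cexp w = z.
Proof.
  intros Hz; destruct z as [x y]; destruct (polar_form x y) as (th & _ & Ex & Ey).
  set (m := Cmod (x, y)) in *; unfold punctured_disc in Hz; fold m in Hz.
  exists (ln m, th); split.
  - unfold left_half_plane, Re; simpl; rewrite <- ln_1; apply ln_increasing; lra.
  - unfold Cexp, Re, Im; simpl; rewrite exp_ln, <- Ex, <- Ey by lra; reflexivity.
Qed.

(** The multiple of the period is a natural number up to exchanging the two points, which avoids signs
    when periodicity is iterated. *)
Lemma Cexp_fibre (w v : C) : Cexp w = Cexp v -> exists k : nat,
  v = (w + RtoC (INR k) * period)%C \/ w = (v + RtoC (INR k) * period)%C.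
Proof.
  intros E.
  assert (E0 : exp (Re w) = exp (Re v)) by (rewrite <- !Cmod_Cexp, E; reflexivity).
  apply exp_inv in E0.
  assert (E1 : exp (Re w) * cos (Im w) = exp (Re v) * cos (Im v)) by exact (f_equal Re E).
  assert (E2 : exp (Re w) * sin (Im w) = exp (Re v) * sin (Im v)) by exact (f_equal Im E).
  rewrite E0 in E1, E2; assert (P := exp_pos (Re v)).
  apply Rmult_eq_reg_l in E1; [|lra]; apply Rmult_eq_reg_l in E2; [|lra].
  assert (Hc : cos (Im v - Im w) = 1) by (rewrite cos_minus, E1, E2; generalize (sin2_cos2 (Im v)); unfold Rsqr; lra).
  assert (Hs : sin ((Im v - Im w) / 2) = 0).
  { replace (Im v - Im w) with (2 * ((Im v - Im w) / 2)) in Hc by field; rewrite cos_2a_sin in Hc; nra. }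
  apply sin_eq_0_0 in Hs; destruct Hs as (k & Hk).
  assert (Hk' : Im v = Im w + IZR k * (2 * PI)) by lra.
  destruct (Z.le_gt_cases 0 k) as [Pk|Pk].
  - exists (Z.to_nat k); left; rewrite INR_IZR_INZ, Z2Nat.id by exact Pk.
    destruct w as [w1 w2], v as [v1 v2]; unfold Re, Im in *; simpl in *.
    apply injective_projections; simpl; lra.
  - exists (Z.to_nat (- k)); right; rewrite INR_IZR_INZ, Z2Nat.id by lia; rewrite opp_IZR.
    destruct w as [w1 w2], v as [v1 v2]; unfold Re, Im in *; simpl in *.
    apply injective_projections; simpl; lra.
Qed.

(** A primitive of [1 / z], normalised so that its exponential at the centre is the centre. *)
Lemma local_log (z0 w0 : C) : z0 <> 0%C -> Cexp w0 = z0 -> exists l : C -> C,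
  l z0 = w0 /\ forall z, Cmod (z - z0) < Cmod z0 -> cderiv l z (/ z)%C /\ Cexp (l z) = z.
Proof.
  intros Hz0 Hw0.
  assert (NZ : forall z, Cmod (z - z0) < Cmod z0 -> z <> 0%C).
  { intros z Hz Z; subst z; replace (0 - z0)%C with (- z0)%C in Hz by ring; rewrite Cmod_opp in Hz; lra. }
  set (l := fun z => (w0 + seg (fun w => / w)%C z0 z)%C).
  assert (Dl : forall z, Cmod (z - z0) < Cmod z0 -> cderiv l z (/ z)%C).
  { intros z Hz; apply (cderiv_eq _ _ (0 + / z)%C); [ring|].
    apply cderiv_plus; [apply cderiv_const|].
    apply (primitive_on_disc (fun w => / w)%C z0 (Cmod z0)); [|exact Hz].
    intros q Hq; eexists; apply cderiv_Cinv, NZ, Hq. }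
  assert (l0 : l z0 = w0) by (unfold l, seg; ring).
  exists l; split; [exact l0|]; intros z Hz; split; [apply Dl, Hz|].
  assert (K : (Cexp (l z) * / z)%C = (Cexp (l z0) * / z0)%C).
  { apply (cderiv0_const (fun z => Cexp (l z) * / z)%C z0 (Cmod z0)); [|exact Hz]; intros q Hq.
    assert (Nq := NZ q Hq).
    refine (cderiv_eq _ _ _ _ _ (cderiv_mult _ _ q _ _ (cderiv_comp Cexp l q _ _ (cderiv_Cexp (l q)) (Dl q Hq)) (cderiv_Cinv q Nq))).
    field; exact Nq. }
  rewrite l0, Hw0, Cinv_r in K by exact Hz0.
  assert (Nz := NZ z Hz).
  transitivity (Cexp (l z) * / z * z)%C; [field; exact Nz|rewrite K; ring].
Qed.

Section Descent.
Context (F : C -> M2C).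
Context (HN : holomorphic_null_immersion_SL2 left_half_plane F).
Context (Hper : forall w, left_half_plane w -> F (w + period) = F w).

Lemma periodic_nat (k : nat) (w : C) : left_half_plane w -> F (w + RtoC (INR k) * period) = F w.
Proof.
  intros Hw; induction k as [|k IH].
  - f_equal; simpl INR; ring.
  - rewrite S_INR; replace (w + RtoC (INR k + 1) * period)%C with (w + RtoC (INR k) * period + period)%C.
    + rewrite Hper, IH; [reflexivity|]; unfold left_half_plane, Re, period in *; simpl in *; lra.
    + rewrite RtoC_plus; ring.
Qed.

Lemma factors_through_Cexp (w v : C) : left_half_plane w -> left_half_plane v -> Cexp w = Cexp v -> F w = F v.
Proof.
  intros Hw Hv E; destruct (Cexp_fibre w v E) as (k & [K|K]); rewrite K, periodic_nat; auto.
Qed.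

Context (L : C -> C) (HL : forall z, punctured_disc z -> left_half_plane (L z) /\ Cexp (L z) = z).

(** [L] is an arbitrary choice of logarithms; periodicity makes the result independent of it, so that
    locally [L] may be replaced by a holomorphic branch. *)
Definition descended (z : C) : M2C := F (L z).

Lemma descended_Cexp (w : C) : left_half_plane w -> F w = descended (Cexp w).
Proof.
  intros Hw; destruct (HL _ (Cexp_punctured w Hw)) as [H1 H2].
  apply factors_through_Cexp; auto.
Qed.

Lemma descended_deriv (i j : nat) (z : C) : (i < 2)%nat -> (j < 2)%nat -> punctured_disc z ->
  cderiv (fun z => entry (descended z) i j) z (C_derive (fun w => entry (F w) i j) (L z) * / z)%C.
Proof.
  intros Hi Hj Hz; destruct (HL z Hz) as [H1 H2]; assert (Nz := Cneq0_of_pos z (proj1 Hz)).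
  destruct (local_log z (L z) Nz H2) as (l & l0 & Hl).
  apply (cderiv_ext_loc (fun q => entry (F (l q)) i j)).
  - destruct (copen_punctured 1 z Hz) as (d & Hd & HU).
    exists (Rmin d (Cmod z)); split; [apply Rmin_pos; [exact Hd|apply Hz]|]; intros q Hq.
    assert (Hq1 : Cmod (q - z) < d) by (eapply Rlt_le_trans; [exact Hq|apply Rmin_l]).
    assert (Hq2 : Cmod (q - z) < Cmod z) by (eapply Rlt_le_trans; [exact Hq|apply Rmin_r]).
    destruct (HL q (HU q Hq1)) as [H3 H4]; destruct (Hl q Hq2) as [_ H5].
    unfold descended; f_equal; apply factors_through_Cexp; [|exact H3|rewrite H4, H5; reflexivity].
    (* the branch stays in the half plane because its exponential stays in the disc *)
    unfold left_half_plane; apply exp_lt_inv; rewrite exp_0, <- Cmod_Cexp, H5; apply (HU q Hq1).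
  - rewrite <- l0; apply (cderiv_comp (fun w => entry (F w) i j) l).
    + rewrite l0; apply (proj1 (holomorphic_cderiv _ (fun w => entry (F w) i j)) (proj1 HN i j Hi Hj) _ H1).
    + apply Hl; replace (z - z)%C with (RtoC 0) by ring; rewrite Cmod_0; apply Hz.
Qed.

Lemma descended_null : holomorphic_null_immersion_SL2 punctured_disc descended.
Proof.
  assert (L2 : (0 < 2)%nat) by lia; assert (L3 : (1 < 2)%nat) by lia.
  assert (D := fun i j z Hi Hj Hz => cderiv_unique _ _ _ (descended_deriv i j z Hi Hj Hz)).
  assert (HN' := proj1 (null_immersion_entries _ _) HN); destruct HN' as (_ & Hdet & Hnull & Hne).
  apply null_immersion_entries; split; [|split; [|split]].
  - assert (HH : forall i j, (i < 2)%nat -> (j < 2)%nat -> holomorphic_on punctured_disc (fun z => entry (descended z) i j)).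
    { intros i j Hi Hj; eapply holomorphic_intro; intros z Hz; apply descended_deriv; assumption. }
    split; [exact (HH _ _ L2 L2)|split; [exact (HH _ _ L2 L3)|split; [exact (HH _ _ L3 L2)|exact (HH _ _ L3 L3)]]].
  - intros z Hz; apply (Hdet (L z)), HL, Hz.
  - intros z Hz; unfold e00, e01, e10, e11; rewrite !D by assumption.
    assert (K := Hnull (L z) (proj1 (HL z Hz))); unfold e00, e01, e10, e11 in K.
    transitivity (0 * (/ z * / z))%C; [rewrite <- K|]; ring.
  - intros z Hz (Z1 & Z2 & Z3 & Z4); unfold e00, e01, e10, e11 in Z1, Z2, Z3, Z4; rewrite D in Z1, Z2, Z3, Z4 by assumption.
    apply (Hne (L z) (proj1 (HL z Hz))).
    assert (Nz := Cneq0_of_pos z (proj1 Hz)).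
    assert (Q : forall q, (q * / z = 0)%C -> q = 0%C).
    { intros q E; transitivity (q * / z * z)%C; [field; exact Nz|rewrite E; ring]. }
    split; [exact (Q _ Z1)|split; [exact (Q _ Z2)|split; [exact (Q _ Z3)|exact (Q _ Z4)]]].
Qed.

End Descent.

(** * Removing the singularities of a matrix *)

Lemma matrix_removable (g : nat -> nat -> C -> C) (r M : R) : 0 < r ->
  (forall i j, (i < 2)%nat -> (j < 2)%nat -> holomorphic_on (fun z => 0 < Cmod z < r) (g i j)) ->
  (forall i j z, (i < 2)%nat -> (j < 2)%nat -> 0 < Cmod z < r -> Cmod (g i j z) <= M) ->
  exists r' H, 0 < r' <= r /\ forall i j, (i < 2)%nat -> (j < 2)%nat ->
    holomorphic_on (fun z => Cmod z < r') (H i j) /\ forall z, 0 < Cmod z < r' -> g i j z = H i j z.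
Proof.
  intros Hr Hg HM.
  assert (L2 : (0 < 2)%nat) by lia; assert (L3 : (1 < 2)%nat) by lia.
  assert (X := fun i j Hi Hj => removable (g i j) r M Hr (Hg i j Hi Hj) (fun z => HM i j z Hi Hj)).
  destruct (X 0 0 L2 L2)%nat as (r00 & h00 & P00 & Q00 & R00); destruct (X 0 1 L2 L3)%nat as (r01 & h01 & P01 & Q01 & R01).
  destruct (X 1 0 L3 L2)%nat as (r10 & h10 & P10 & Q10 & R10); destruct (X 1 1 L3 L3)%nat as (r11 & h11 & P11 & Q11 & R11).
  set (s := Rmin (Rmin r00 r01) (Rmin r10 r11)).
  assert (Hs : 0 < s) by (unfold s; repeat apply Rmin_pos; lra).
  assert (B2 : s <= Rmin r00 r01) by apply Rmin_l; assert (B3 : s <= Rmin r10 r11) by apply Rmin_r.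
  assert (C0 := Rle_trans _ _ _ B2 (Rmin_l _ _)); assert (C1 := Rle_trans _ _ _ B2 (Rmin_r _ _)).
  assert (C2 := Rle_trans _ _ _ B3 (Rmin_l _ _)); assert (C3 := Rle_trans _ _ _ B3 (Rmin_r _ _)).
  exists s, (fun i j => match i, j with 0%nat, 0%nat => h00 | 0%nat, _ => h01 | _, 0%nat => h10 | _, _ => h11 end).
  split; [lra|].
  apply index_cases;
    (split; [eapply holomorphic_restrict; [|eassumption]; intros z Hz; cbv beta in *; lra
            |intros z Hz; first [apply R00|apply R01|apply R10|apply R11]; lra]).
Qed.

(** * The Bryant representation of a smooth end *)

Section EndPole.
Context (f : C -> R3) (F G : C -> M2C) (n : nat) (c K d : R) (L : C -> C).
Context (HN : holomorphic_null_immersion_SL2 left_half_plane F).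
Context (Hf : forall w, left_half_plane w -> f (Cexp w) = bryant_point (F w)).
Context (Hn : (0 < n)%nat) (Hc : 0 < c) (HK : 0 <= K) (Hd : 0 < d <= 1).
Context (Hcontact : forall z, 0 < Cmod z < d ->
  Rabs (1 - dot (f z) (f z) - c * Cmod z ^ (2 * n)) <= K * Cmod z ^ S (2 * n)).
Context (HL : forall z, punctured_disc z -> left_half_plane (L z) /\ Cexp (L z) = z).
Context (HG : holomorphic_null_immersion_SL2 punctured_disc G) (EG : forall z, G z = F (L z)).

Lemma end_surface (z : C) : punctured_disc z -> surface G z = f z.
Proof.
  intros Hz; destruct (HL z Hz) as [H1 H2].
  rewrite <- bryant_point_surface, EG, <- Hf, H2 by exact H1; reflexivity.
Qed.

Lemma end_limit (eps : R) : 0 < eps -> exists s, 0 < s <= 1 /\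
  forall z, 0 < Cmod z < s -> Rabs (Cmod z ^ (2 * n) * norm_sq G z - 4 / c) <= eps.
Proof.
  intros He; destruct (lifted_limit f F n c K d HN Hf Hn Hc HK Hd Hcontact eps He) as (S0 & HS & HL0).
  exists (exp S0); split; [split; [apply exp_pos|rewrite <- exp_0; apply Rlt_le, exp_increasing, HS]|]; intros z Hz.
  assert (Hs1 : exp S0 < 1) by (rewrite <- exp_0; apply exp_increasing, HS).
  destruct (HL z ltac:(unfold punctured_disc; lra)) as [H1 H2].
  assert (Q := HL0 (L z)); rewrite lifted_entries_sq, H2 in Q.
  unfold norm_sq, e00, e01, e10, e11 in *; rewrite EG; apply Q, exp_lt_inv; rewrite <- Cmod_Cexp, H2; apply Hz.
Qed.

(** [z ^ n G] is bounded, hence extends holomorphically, and its norm has the limit [2 / sqrt c], which is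
    not [0]. *)
Lemma end_pole_factor : exists r H, 0 < r <= 1 /\ pole_factor G n r H /\ 0 < entries_sq H 0%C.
Proof.
  destruct (end_limit 1 Rlt_0_1) as (s & Hs & HB).
  assert (Ic : 0 < 4 / c) by (apply Rdiv_lt_0_compat; lra).
  assert (Hol : forall i j, (i < 2)%nat -> (j < 2)%nat -> holomorphic_on (fun z => 0 < Cmod z < s) (fun z => z ^ n * entry (G z) i j)%C).
  { intros i j Hi Hj; apply (holomorphic_intro _ _ (fun z => RtoC (INR n) * z ^ pred n * entry (G z) i j
      + z ^ n * C_derive (fun z => entry (G z) i j) z)%C); intros z Hz.
    apply (cderiv_mult (fun z => z ^ n)%C (fun z => entry (G z) i j)); [apply cderiv_pow|].
    apply (proj1 (holomorphic_cderiv punctured_disc (fun z => entry (G z) i j)) (proj1 HG i j Hi Hj)); unfold punctured_disc; lra. }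
  assert (Bd : forall z, 0 < Cmod z < s -> entries_sq (fun i j z => z ^ n * entry (G z) i j)%C z = Cmod z ^ (2 * n) * norm_sq G z).
  { intros z _; unfold entries_sq; rewrite !sqn_mult, sqn_pow; unfold norm_sq, e00, e01, e10, e11; ring. }
  destruct (matrix_removable (fun i j z => z ^ n * entry (G z) i j)%C s (4 / c + 2) (proj1 Hs) Hol) as (r & H & Hr & HH).
  - assert (X : forall z, 0 < Cmod z < s -> forall i j, (i < 2)%nat -> (j < 2)%nat -> Cmod (z ^ n * entry (G z) i j) ^ 2 <= 4 / c + 1).
    { intros z Hz; assert (Q := HB z Hz); apply Rabs_le_between in Q; rewrite <- Bd in Q by exact Hz; unfold entries_sq in Q.
      assert (P := fun i j => sqn_nonneg (z ^ n * entry (G z) i j)).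
      assert (P00 := P 0%nat 0%nat); assert (P01 := P 0%nat 1%nat); assert (P10 := P 1%nat 0%nat); assert (P11 := P 1%nat 1%nat).
      apply index_cases; rewrite <- sqn_Cmod; lra. }
    intros i j z Hi Hj Hz; specialize (X z Hz i j Hi Hj); assert (Y := Cmod_ge_0 (z ^ n * entry (G z) i j)); nra.
  - assert (HF : pole_factor G n r H).
    { intros i j Hi Hj; destruct (HH i j Hi Hj) as [H1 H2]; split; [exact H1|]; intros z Hz.
      rewrite <- H2 by exact Hz; assert (Nz := Cneq0_of_pos z (proj1 Hz)); field; apply Cpow_nz, Nz. }
    exists r, H; split; [lra|split; [exact HF|]].
    destruct (end_limit (/ c) ltac:(apply Rinv_0_lt_compat, Hc)) as (s' & Hs' & HB').
    apply Rnot_le_lt; intros Neg.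
    assert (C0 : @continuous C_UniformSpace R_UniformSpace (entries_sq H) (RtoC 0)).
    { apply (continuous_entries_sq G n r H HF); rewrite Cmod_0; lra. }
    assert (Pc : 0 < / c) by (apply Rinv_0_lt_compat, Hc).
    destruct (continuous_eps_C _ _ C0 (/ c) Pc) as (e & Hep & HE).
    set (m := Rmin (Rmin (e / 2) (r / 2)) (s' / 2)).
    assert (Hm : 0 < m) by (unfold m; repeat apply Rmin_pos; lra).
    assert (m1 : m <= Rmin (e / 2) (r / 2)) by apply Rmin_l; assert (m2 : m <= s' / 2) by apply Rmin_r.
    assert (m3 := Rle_trans _ _ _ m1 (Rmin_l _ _)); assert (m4 := Rle_trans _ _ _ m1 (Rmin_r _ _)).
    assert (Cm : Cmod (RtoC m) = m) by (rewrite Cmod_R, Rabs_pos_eq; lra).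
    specialize (HE (RtoC m)); replace (RtoC m - 0)%C with (RtoC m) in HE by ring; specialize (HE ltac:(lra)).
    specialize (HB' (RtoC m) ltac:(lra)); rewrite <- Bd in HB' by lra.
    replace (entries_sq (fun i j z => z ^ n * entry (G z) i j)%C (RtoC m)) with (entries_sq H (RtoC m)) in HB'.
    + apply Rabs_le_between in HB'; apply Rabs_def2 in HE; unfold Rdiv in HB'; lra.
    + unfold entries_sq; rewrite <- !(fun i j Hi Hj => proj2 (HH i j Hi Hj)) by (lia || lra); reflexivity.
Qed.

(** The metric identity bounds [|z|^4 |G' G^{-1}|^2] near the puncture and gives it a positive limit, the surface being
    immersed there. *)
Lemma end_log_derivative_order (fbar : C -> R3) : conformal_immersion euclidean disc fbar ->
  (forall z, punctured_disc z -> fbar z = f z) -> mpole_order_at_0 (log_derivative G) 2.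
Proof.
  intros (Hs & Hconf) Ef.
  destruct end_pole_factor as (r & H & Hr & HF & H0).
  assert (Hd0 : disc (RtoC 0)) by (unfold disc; rewrite Cmod_0; lra).
  destruct (smooth_on_continuous_dot disc (copen_disc 1) fbar (RtoC 0) Hs Hd0) as (_ & Cx & _).
  assert (Hpos : forall z, disc z -> 0 < dot (dx fbar z) (dx fbar z)).
  { intros z Hz; destruct (Hconf z Hz) as (I & _); exact (independent_norm_pos _ _ I). }
  set (Q := fun z => (cleared_deriv_sq H n z * cleared_deriv_sq H n z) * / (dot (dx fbar z) (dx fbar z) * (cleared_x0_succ H n z * cleared_x0_succ H n z))).
  assert (r0 : Cmod (RtoC 0) < r) by (rewrite Cmod_0; lra).
  assert (PT := fun z => cleared_x0_succ_pos n H z H0).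
  assert (CQ : @continuous C_UniformSpace R_UniformSpace Q (RtoC 0)).
  { assert (CN := continuous_cleared_deriv_sq G n r H HF _ r0); assert (CT := continuous_cleared_x0_succ G n r H HF _ r0).
    apply continuous_Rmult; [apply continuous_Rmult; exact CN|].
    apply continuous_Rinv; [apply continuous_Rmult; [exact Cx|apply continuous_Rmult; exact CT]|].
    apply Rgt_not_eq, Rmult_lt_0_compat; [apply Hpos, Hd0|apply Rmult_lt_0_compat; apply PT]. }
  assert (Q0 : 0 < Q (RtoC 0)).
  { unfold Q; rewrite cleared_deriv_sq_0; apply Rmult_lt_0_compat.
    - assert (0 < INR n ^ 2 * entries_sq H 0%C) by (apply Rmult_lt_0_compat; [apply pow_lt, lt_0_INR, Hn|exact H0]).
      apply Rmult_lt_0_compat; assumption.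
    - apply Rinv_0_lt_compat, Rmult_lt_0_compat; [apply Hpos, Hd0|apply Rmult_lt_0_compat; apply PT]. }
  assert (Hdet : forall z, punctured_disc z -> (e00 G z * e11 G z - e01 G z * e10 G z = 1)%C).
  { intros z Hz; apply null_immersion_entries in HG; apply HG, Hz. }
  assert (EQ : forall z, 0 < Cmod z < r -> Cmod z ^ 4 * surface_logderiv_sq G z = Q z).
  { intros z Hz; assert (P : punctured_disc z) by (unfold punctured_disc; lra).
    assert (I := pole_metric_identity G n r H z HG (proj2 Hr) HF Hz).
    rewrite <- (dx_ext punctured_disc (copen_punctured 1) fbar (surface G) z) in I;
      [|intros w Hw; rewrite Ef, end_surface by exact Hw; reflexivity|exact P].
    assert (A1 := Hpos z (proj2 P)); assert (A2 := PT z); unfold Q.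
    replace (cleared_deriv_sq H n z * cleared_deriv_sq H n z) with (cleared_deriv_sq H n z ^ 2) by ring; rewrite <- I; field; split; lra. }
  destruct (continuous_eps_C Q (RtoC 0) CQ 1 Rlt_0_1) as (e & He & HE).
  set (s := Rmin e r); assert (Hsp : 0 < s) by (apply Rmin_pos; lra).
  assert (s1 : s <= e) by apply Rmin_l; assert (s2 : s <= r) by apply Rmin_r.
  assert (EM : forall z, 0 < Cmod z < s -> entries_sq (fun i j z => z ^ 2 * entry (log_derivative G z) i j)%C z = Q z).
  { intros z Hz; rewrite <- EQ by lra; rewrite log_derivative_norm by (apply Hdet; unfold punctured_disc; lra).
    unfold entries_sq; rewrite !sqn_mult, sqn_pow; unfold e00, e01, e10, e11; simpl (2 * 2)%nat; ring. }
  destruct (matrix_removable (fun i j z => z ^ 2 * entry (log_derivative G z) i j)%C s (Q (RtoC 0) + 2) Hsp) as (r' & HA & Hr' & HH).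
  - assert (Hl : forall i j, (i < 2)%nat -> (j < 2)%nat -> holomorphic_on punctured_disc (fun z => entry (log_derivative G z) i j)).
    { assert (HG' := proj1 (null_immersion_entries _ _) HG); destruct HG' as ((Ha & Hb & Hc' & Hd') & _).
      assert (Prod : forall g h k l, holomorphic_on punctured_disc g -> holomorphic_on punctured_disc h ->
        holomorphic_on punctured_disc k -> holomorphic_on punctured_disc l ->
        holomorphic_on punctured_disc (fun z => C_derive g z * h z - C_derive k z * l z)%C).
      { intros g h k l Hg Hh Hk Hl; assert (D := fun g => proj1 (holomorphic_cderiv punctured_disc g)).
        assert (Hg' := holomorphic_deriv _ _ (copen_punctured 1) Hg); assert (Hk' := holomorphic_deriv _ _ (copen_punctured 1) Hk).
        apply (holomorphic_intro _ _ (fun z => (C_derive (C_derive g) z * h z + C_derive g z * C_derive h z)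
          - (C_derive (C_derive k) z * l z + C_derive k z * C_derive l z))%C).
        intros z Hz; apply cderiv_minus; apply cderiv_mult; apply D; assumption. }
      apply index_cases; (eapply holomorphic_ext; [exact (copen_punctured 1)|intros z Hz; symmetry; apply (log_derivative_entries G z (Hdet z Hz))|]);
        apply Prod; assumption. }
    intros i j Hi Hj; apply (holomorphic_intro _ _ (fun z => RtoC (INR 2) * z ^ pred 2 * entry (log_derivative G z) i j
      + z ^ 2 * C_derive (fun z => entry (log_derivative G z) i j) z)%C); intros z Hz.
    apply (cderiv_mult (fun z => z ^ 2)%C (fun z => entry (log_derivative G z) i j)); [apply cderiv_pow|].
    apply (proj1 (holomorphic_cderiv punctured_disc (fun z => entry (log_derivative G z) i j)) (Hl i j Hi Hj)); unfold punctured_disc; lra.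
  - assert (X : forall z, 0 < Cmod z < s -> forall i j, (i < 2)%nat -> (j < 2)%nat -> Cmod (z ^ 2 * entry (log_derivative G z) i j) ^ 2 <= Q (RtoC 0) + 1).
    { intros z Hz; assert (B := HE z); replace (z - RtoC 0)%C with z in B by ring; specialize (B ltac:(lra)).
      apply Rabs_def2 in B; assert (I := EM z Hz); unfold entries_sq in I.
      assert (P := fun i j => sqn_nonneg (z ^ 2 * entry (log_derivative G z) i j)).
      assert (P00 := P 0%nat 0%nat); assert (P01 := P 0%nat 1%nat); assert (P10 := P 1%nat 0%nat); assert (P11 := P 1%nat 1%nat).
      apply index_cases; rewrite <- sqn_Cmod; lra. }
    intros i j z Hi Hj Hz; specialize (X z Hz i j Hi Hj); assert (Y := Cmod_ge_0 (z ^ 2 * entry (log_derivative G z) i j)); nra.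
  - assert (HAf : pole_factor (log_derivative G) 2 r' HA).
    { intros i j Hi Hj; destruct (HH i j Hi Hj) as [H1 H2]; split; [exact H1|]; intros z Hz.
      rewrite <- H2 by exact Hz; assert (Nz := Cneq0_of_pos z (proj1 Hz)); field; exact Nz. }
    apply (mpole_of_factor (log_derivative G) 2 r' HA (proj1 Hr') HAf).
    replace (entries_sq HA 0%C) with (Q (RtoC 0)); [exact Q0|].
    apply (limit_eq Q (entries_sq HA) r' (proj1 Hr') CQ).
    + apply (continuous_entries_sq (log_derivative G) 2 r' HA HAf); rewrite Cmod_0; lra.
    + intros z Hz; rewrite <- EM by lra.
      unfold entries_sq; rewrite <- !(fun i j Hi Hj => proj2 (HH i j Hi Hj)) by (lia || lra); reflexivity.
Qed.

End EndPole.

Theorem theorem1 :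
  (forall (f : C -> R3) (F : C -> M2C),
     smooth_bryant_end f ->
     holomorphic_null_immersion_SL2 left_half_plane F ->
     (forall w : C, left_half_plane w -> f (Cexp w) = bryant_point (F w)) ->
     exists G : C -> M2C,
       (forall w : C, left_half_plane w -> F w = G (Cexp w)) /\
       holomorphic_null_immersion_SL2 punctured_disc G /\
       has_pole_at_0 G /\
       mpole_order_at_0 (fun z => mul2 (mderive G z) (inv2 (G z))) 2)
  /\
  (forall F : C -> M2C,
     holomorphic_null_immersion_SL2 punctured_disc F ->
     has_pole_at_0 F ->
     mpole_order_at_0 (fun z => mul2 (mderive F z) (inv2 (F z))) 2 ->
     smooth_bryant_end (fun z => bryant_point (F z))).
Proof.
  split; [|exact pole_smooth_end].
  intros f F (HB & p & fbar & Hp & Hconf & E0 & Ef) HN Hf.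
  destruct (end_contact f fbar HB Hconf) as (n & c & K & d & Hn & Hc & HK & Hd & Hcontact);
    [rewrite E0; exact Hp|exact Ef|].
  assert (Hper : forall w, left_half_plane w -> F (w + period)%C = F w).
  { intros w Hw; destruct (monodromy_trivial f F n c K d HN Hf Hn Hc HK Hd Hcontact w Hw) as (M1 & M2 & M3 & M4).
    apply matrix_eq, index_cases; assumption. }
  destruct (function_choice (A := C) (B := C) (R := fun z w => punctured_disc z -> left_half_plane w /\ Cexp w = z)) as (L & HL).
  { intros z; destruct (classic (punctured_disc z)) as [Hz|Hz].
    - destruct (Cexp_surjective z Hz) as (w & Hw); exists w; intros _; exact Hw.
    - exists z; intros X; contradiction. }
  assert (HG := descended_null F HN Hper L HL).
  exists (descended F L); split; [|split; [exact HG|split]].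
  - intros w Hw; exact (descended_Cexp F Hper L HL w Hw).
  - destruct (end_pole_factor f F (descended F L) n c K d L HN Hf Hn Hc HK Hd Hcontact HL HG (fun z => eq_refl))
      as (r & H & Hr & HF & H0).
    exists n; split; [exact Hn|exact (mpole_of_factor _ n r H (proj1 Hr) HF H0)].
  - exact (end_log_derivative_order f F (descended F L) n c K d L HN Hf Hn Hc HK Hd Hcontact HL HG (fun z => eq_refl) fbar Hconf Ef).
Qed.
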